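(* (1)(a) Let $(V,m)$ be an $L_\infty$-algebra. Then the maps $f_r:(\Pi V)^{\otimes r}\to \Pi\,\overline{\mathrm{CE}}(V,V)$, $r\ge 1$, given by $$f_r(w_1,\ldots,w_r)(x_1,\ldots,x_n)=m_{r+n}(w_1,\ldots,w_r,x_1,\ldots,x_n),\qquad w_i,x_i\in\Pi V,\ n\ge 1,\qquad ( * )$$ define an $L_\infty$-map $\mathbf f=(f_1,f_2,\ldots):V\to\overline{\mathrm{CE}}(V,V)$. The map $\mathbf f$ is characterized by the property that for any formal cdga $A$, an MC-element $\xi\in\mathrm{MC}(V,A)$ is mapped to the MC-element in $\mathrm{MC}(\overline{\mathrm{CE}}(V,V),A)$ corresponding to the twisting of $A\otimes V$ by $\xi$, i.e. to $m^\xi-m^A$. (1)(b) Let $(V,m)$ be a cyclic $L_\infty$-algebra. Then the formulas $( * )$ define maps $f_r:(\Pi V)^{\otimes r}\to\Pi\,\overline{\mathrm{CE}}(V)$ which give an $L_\infty$-map $\mathbf f:V\to\overline{\mathrm{CE}}(V)$, characterized by the property that for any formal cdga $A$, $\xi\in\mathrm{MC}(V,A)$ is mapped to the MC-element in $\mathrm{MC}(\overline{\mathrm{CE}}(V),A)$ corresponding to the twisting of $A\otimes V$ by $\xi$, i.e. to $m^\xi-m^A$. (2)(a) Let $(V,m)$ be an $A_\infty$-algebra, also regarded as an $L_\infty$-algebra via the associated (commutator) $L_\infty$-structure $\overline m$. Then the maps $f_r:(\Pi V)^{\otimes r}\to\Pi\,\overline{\mathrm{Hoch}}(V,V)$, $r\ge1$,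 given by $$f_r(w_1,\ldots,w_r)(x_1,\ldots,x_n)=\sum_{\sigma\in S_r}m_{r+n}(\sigma(w_1\otimes\cdots\otimes w_r)\,|\,x_1,\ldots,x_n),\qquad n\ge1,\qquad ( ** )$$ define an $L_\infty$-map $\mathbf f:V\to\overline{\mathrm{Hoch}}(V,V)$. Here $m_{r+n}(w_{i_1},\ldots,w_{i_r}|x_1,\ldots,x_n):=\sum\pm m_{r+n}(z_1,\ldots,z_{r+n})$, the sum ranging over all $\binom{r+n}{r}$ shuffles $z_1,\dots,z_{r+n}$ of the sequences $w_{i_1},\ldots,w_{i_r}$ and $x_1,\ldots,x_n$, with signs given by the Koszul rule. The map $\mathbf f$ is characterized by the property that for any formal cdga $A$, $\xi\in\mathrm{MC}(V,A)$ is mapped to the MC-element in $\mathrm{MC}(\overline{\mathrm{Hoch}}(V,V),A)$ corresponding to the twisting of $A\otimes V$ by $\xi$, i.e. to $m^\xi-m^A$. (2)(b) Let $(V,m)$ be a cyclic $A_\infty$-algebra. Then the formulas $( ** )$ define maps $f_r:(\Pi V)^{\otimes r}\to\Pi\,\overline{\mathrm{CHoch}}(V,V)$ which give an $L_\infty$-map $\mathbf f:V\to\overline{\mathrm{CHoch}}(V,V)$, characterized by the property that for any formal cdga $A$, $\xi\in\mathrm{MC}(V,A)$ is mapped to the MC-element in $\mathrm{MC}(\overline{\mathrm{CHoch}}(V,V),A)$ corresponding to the twisting of $A\otimes V$ by $\xi$, i.e. to $m^\xi-m^A$.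
   Context: Conventions. All vector spaces are $\mathbb Z/2$-graded over a field $\mathbf k$ of characteristic $0$; $\Pi$ is parity reversion; unmarked $\otimes$ is over $\mathbf k$; the Koszul sign rule is used throughout (in particular the dual of a homogeneous map $f$ is $f^*(\phi)=(-1)^{|f||\phi|}\phi\circ f$). A formal space is an inverse limit of finite-dimensional spaces, and maps from/into formal spaces are continuous; $V^*$ is formal for $V$ discrete and $V^{**}=V$. If $V$ is discrete and $W=\varprojlim W_i$ formal then $W\otimes V:=\varprojlim W_i\otimes V$. dga, cdga, dgla mean $\mathbb Z/2$-graded differential graded (commutative, Lie) algebras. A formal (c)dga is $A=\mathbf k\oplus A_+$, obtained by adjoining a unit to an inverse limit $A_+$ of finite-dimensional nilpotent non-unital (c)dgas. $\hat T$, $\hat S$ denote completed tensor and symmetric algebras. $S_n$ acts on $n$-th tensor powers by permuting factors. $L_\infty$/$A_\infty$-algebras. An $L_\infty$-structure on $V$ is a continuous odd derivation $m$ of $\hat S\Pi V^*$ with $m^2=0$ and no constant term (i.e. the component of $m|_{\Pi V^*}$ in $S^0$ vanishes); an $A_\infty$-structure is the same with $\hat T\Pi V^*$. The duals of the components of $m|_{\Pi V^*}$ are the structure maps $m_i:S^i\Pi V\to\Pi V$ (resp. $m_i:T^i\Pi V\to\Pi V$), $i\ge1$; in the $L_\infty$ case $(S^n\Pi V)^*=((\Pi V^* )^{\hat\otimes n})^{S_n}$ is identified with the coinvariants $S^n\Pi V^*$ by $x_1\otimes\cdots\otimes x_n\mapsto\frac1{n!}x_1\otimes\cdots\otimes x_n$.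 An $A_\infty$-structure $m$ induces the $L_\infty$-structure $\overline m$ obtained by composing $m:\Pi V^*\to\hat T\Pi V^*$ with the projection $\hat T\Pi V^*\to\hat S\Pi V^*$. If $V$ has a graded symmetric non-degenerate inner product $\langle,\rangle$, the structure is cyclic if all $\langle m_i(x_1,\ldots,x_i),x_{i+1}\rangle$ are invariant under cyclic permutations of $x_1,\ldots,x_{i+1}\in\Pi V$ (with Koszul signs), equivalently $m$ is a symplectic derivation. Complexes. $\mathrm{CE}(V,V)=\mathrm{Der}(\hat S\Pi V^* )$ and $\mathrm{Hoch}(V,V)=\mathrm{Der}(\hat T\Pi V^* )$ (continuous derivations), dglas with commutator bracket and differential $[m,-]$. $\overline{\mathrm{CE}}(V,V)$, $\overline{\mathrm{Hoch}}(V,V)$ are the sub-dglas of derivations with no constant term. By dualization their elements are identified with (possibly infinite) families of graded-symmetric (resp. arbitrary) multilinear maps $(\Pi V)^{\otimes n}\to\Pi V$, $n\ge1$. For cyclic $V$, $\overline{\mathrm{CE}}(V)\subset\overline{\mathrm{CE}}(V,V)$ and $\overline{\mathrm{CHoch}}(V,V)\subset\overline{\mathrm{Hoch}}(V,V)$ are the sub-dglas of cyclically invariant cochains $c$ (i.e. $\langle c(x_1,\ldots,x_n),x_{n+1}\rangle$ cyclically invariant), i.e. symplectic derivations. MC-elements. For a formal cdga $A$ put $m_i^A(a_1\otimes v_1,\ldots,a_i\otimes v_i)=\pm a_1\cdots a_i\otimes m_i(v_1,\ldots,v_i)$. $\mathrm{MC}(V,A)$ is the set of even $\xi\in A_+\otimes\Pi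 V$ with $(d_A\otimes\mathrm{id})(\xi)+\sum_{i\ge1}\frac1{i!}m_i^A(\xi^{\otimes i})=0$ for an $L_\infty$-algebra, and with $(d_A\otimes\mathrm{id})(\xi)+\sum_{i\ge1}m_i^A(\xi^{\otimes i})=0$ for an $A_\infty$-algebra (for $A$ commutative this agrees with the equation for $\overline m$). For a dgla $W$, $\mathrm{MC}(W,A)$ is the set of odd $x\in A_+\otimes W$ (equivalently even elements of $A_+\otimes\Pi W$) with $(d_A+d_W)x+\frac12[x,x]=0$; for $W$ one of the Lie algebras of derivations $\overline{\mathrm{CE}}(V,V)$, $\overline{\mathrm{CE}}(V)$, $\overline{\mathrm{Hoch}}(V,V)$, $\overline{\mathrm{CHoch}}(V,V)$, $A_+\otimes W$ means the completed tensor product, i.e. the $A$-linear derivations (of $A\otimes\hat S\Pi V^*$, resp. $A\otimes\hat T\Pi V^*$) with coefficients in $A_+$. Twisting. For $\xi\in\mathrm{MC}(V,A)$, $m^\xi$ is the $A$-linear structure on $V$ (derivation of $A\otimes\hat S\Pi V^*$, resp. $A\otimes\hat T\Pi V^*$) with structure maps $m^\xi_n(x_1,\ldots,x_n)=\sum_{i\ge0}\frac1{i!}m^A_{n+i}(\xi,\ldots,\xi,x_1,\ldots,x_n)$ in the $L_\infty$-case, and $m_n^\xi(x_1,\ldots,x_n)=\sum_{i\ge0}\sum m^A_{n+i}(z_1,\ldots,z_{n+i})$ in the $A_\infty$-case, the inner sum over all $\binom{n+i}{n}$ sequences containing $x_1,\ldots,x_n$ in order together with $i$ copies of $\xi$.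 $m^A=\mathrm{id}_A\otimes m$. $L_\infty$-maps. An $L_\infty$-map $V\to W$ is a continuous cdga map $(\hat S\Pi W^*,m_W)\to(\hat S\Pi V^*,m_V)$. For $W$ a dgla this amounts to a family of even graded-symmetric maps $f_r:(\Pi V)^{\otimes r}\to\Pi W$, $r\ge1$, such that the corresponding element of $(\hat S\Pi V^* )_+\otimes\Pi W\cong\mathrm{Hom}(\bigoplus_{r\ge1}S^r\Pi V,\Pi W)$ lies in $\mathrm{MC}(W,(\hat S\Pi V^*,m_V))$. It induces maps, natural in $A$, $\mathrm{MC}(V,A)\to\mathrm{MC}(W,A)$, $\xi\mapsto\sum_{r\ge1}\frac1{r!}f_r^A(\xi,\ldots,\xi)$. *)

(* Defs.v *)
From HB Require Import structures.
From mathcomp Require Import all_boot all_order all_algebra perm.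

Set Implicit Arguments.
Unset Strict Implicit.
Unset Printing Implicit Defensive.

Import GRing.Theory.
Local Open Scope ring_scope.

Record superspace (k : fieldType) := Superspace {
  ssort :> lmodType k;
  hcomp : bool -> {linear ssort -> ssort};
  hcompK : forall a b x, hcomp a (hcomp b x) = if a == b then hcomp b x else 0;
  hcomp_sum : forall x, hcomp false x + hcomp true x = x }.

Section Parity.
Variables (k : fieldType) (V : superspace k).

Definition homog (p : bool) (x : V) : Prop := hcomp V p x = x.

(* [homogs ps xs]: the entries of [xs] are homogeneous, of parities [ps]. *)
Fixpoint homogs (ps : seq bool) (xs : seq V) : Prop :=
  match ps, xs with
  | [::], [::] => True
  | p :: ps', x :: xs' => homog p x /\ homogs ps' xs'
  | _, _ => False
  end.

Fact Pi_hcompK a b x : hcomp V (~~ a) (hcomp V (~~ b) x) =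
  if a == b then hcomp V (~~ b) x else 0.
Proof. by rewrite hcompK; case: a; case: b. Qed.

Fact Pi_hcomp_sum x : hcomp V (~~ false) x + hcomp V (~~ true) x = x.
Proof. by rewrite addrC hcomp_sum. Qed.

(* Parity reversion: the same vectors, with the opposite parity. *)
Definition Pi : superspace k :=
  @Superspace k V (fun a => hcomp V (~~ a)) Pi_hcompK Pi_hcomp_sum.

End Parity.

Definition tpar (ps : seq bool) : bool := foldr addb false ps.

(* Sign of the rearrangement x_0 ... x_{n-1} |-> x_{is_0} ... x_{is_{n-1}}
   of homogeneous elements of parities [ps]: one sign for each inversion
   between two odd elements. *)
Fixpoint ksign (ps : seq bool) (is_ : seq nat) : bool :=
  if is_ is i :: js then
    tpar [seq [&& (j < i)%N, nth false ps i & nth false ps j] | j <- js]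
      (+) ksign ps js
  else false.

(* Sign of a_1 v_1 a_2 v_2 ... a_n v_n |-> a_1 ... a_n v_1 ... v_n. *)
Fixpoint isign (aps vps : seq bool) : bool :=
  match aps, vps with
  | _ :: aps', v :: vps' => (v && tpar aps') (+) isign aps' vps'
  | _, _ => false
  end.

(* The words of indices used for rearranging: the word of a permutation, the
   unshuffle which puts first the positions where [b] holds, and the shuffle
   of [s] and [t] in which [s] occupies the positions where [b] holds. *)
Definition pword n (s : 'S_n) : seq nat := [seq nat_of_ord (s i) | i <- enum 'I_n].

Definition unshuffle (b : seq bool) : seq nat :=
  mask b (iota 0 (size b)) ++ mask (map negb b) (iota 0 (size b)).

Fixpoint interleave T (b : seq bool) (s t : seq T) : seq T :=
  match b, s, t with
  | true :: b', x :: s', _ => x :: interleave b' s' t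
  | false :: b', _, y :: t' => y :: interleave b' s t'
  | _, _, _ => [::]
  end.

(* A family (c_n) of n-ary maps on U is a function on sequences, c_n being
    its restriction to sequences of size n. *)

Section Families.
Variables (k : fieldType) (U : superspace k).

Definition multilinear (R : lmodType k) (c : seq U -> R) : Prop :=
  forall s1 s2 (a : k) x y,
    c (s1 ++ (a *: x + y) :: s2) = a *: c (s1 ++ x :: s2) + c (s1 ++ y :: s2).

Definition gsymmetric (R : lmodType k) (c : seq U -> R) : Prop :=
  forall s1 s2 p q x y, homog p x -> homog q y ->
    c (s1 ++ x :: y :: s2) = (-1) ^+ (p && q) *: c (s1 ++ y :: x :: s2).

(* Multilinear extension of a map [F] given on homogeneous elements, each
   paired with its parity. *)
Fixpoint hsum (R : lmodType k) (F : seq (bool * U) -> R) (xs : seq U) : R :=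
  if xs is x :: xs' then
    \sum_(p : bool) hsum (fun hs => F ((p, hcomp U p x) :: hs)) xs'
  else F [::].

(* [kact is_ c] : x_0, ..., x_{n-1} |-> +/- c (x_{is_0}, ..., x_{is_{n-1}}). *)
Definition kact (R : lmodType k) (is_ : seq nat) (c : seq U -> R) (xs : seq U) : R :=
  hsum (fun hs => (-1) ^+ ksign (map fst hs) is_
                    *: c [seq (nth (false, 0) hs i).2 | i <- is_]) xs.

(* The n-th completed tensor power of U^* is the space of all n-linear
    functionals on U. The n-th symmetric power of U^* is represented by the
    S_n-invariants, i.e. by the graded-symmetric functionals, through
    [phi] / n! <-> phi. *)

Definition That (phi : seq U -> k^o) : Prop := multilinear phi.
Definition Shat (phi : seq U -> k^o) : Prop := multilinear phi /\ gsymmetric phi.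

(* The tensor product of the p-ary part of [phi] and of [psi]; a value
   psi(y) is nonzero only if |psi| = |y|. *)
Definition tensor (p : nat) (phi psi : seq U -> k^o) (xs : seq U) : k^o :=
  hsum (R := k^o) (fun hs =>
    (-1) ^+ (tpar (map fst (take p hs)) && tpar (map fst (drop p hs)))
      * (phi (map snd (take p hs)) * psi (map snd (drop p hs)))) xs.

Definition tmul (phi psi : seq U -> k^o) (xs : seq U) : k^o :=
  \sum_(p < (size xs).+1) tensor p phi psi xs.

(* ([phi]/p!) ([psi]/q!) = [phi (x) psi]/(p! q!) corresponds to the invariant
   functional \sum_(s in S_n) s.(phi (x) psi) / (p! q!), which is the sum over
   the (p,q)-unshuffles. *)
Definition smul (phi psi : seq U -> k^o) (xs : seq U) : k^o :=
  \sum_(b : (size xs).-tuple bool)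
    kact (unshuffle b) (tensor (count id b) phi psi) xs.

(* T^ U^* -> S^ U^*; the class of phi is ([\sum_s s.phi]) / n!. *)
Definition projTS (phi : seq U -> k^o) (xs : seq U) : k^o :=
  \sum_(s : 'S_(size xs)) kact (pword s) phi xs.

(* The inclusion of U^* as the component of degree 1. *)
Definition gen (psi : {linear U -> k^o}) (xs : seq U) : k^o :=
  if xs is [:: x] then psi x else 0.

Definition fparity (q : bool) (phi : seq U -> k^o) : Prop :=
  forall ps xs, homogs ps xs -> tpar ps != q -> phi xs = 0.

Definition operator := (seq U -> k^o) -> (seq U -> k^o).

Variant ftype := Sym | Tens.

Definition Fhat (t : ftype) := if t is Sym then Shat else That.
Definition fmul (t : ftype) := if t is Sym then smul else tmul.

(* The elements of parity [b] of Der(S^ U^* ) resp. Der(T^ U^* ). The topology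
   is that of a dual space: a basis of neighbourhoods of 0 is given by the
   annihilators of finite sets. *)
Record derivation (t : ftype) (b : bool) (D : operator) : Prop := Derivation {
  der_stable : forall phi, Fhat t phi -> Fhat t (D phi);
  der_linear : forall (a : k) phi psi, Fhat t phi -> Fhat t psi ->
    forall xs, D (fun ys => a * phi ys + psi ys) xs = a * D phi xs + D psi xs;
  der_parity : forall q phi, Fhat t phi -> fparity q phi ->
    fparity (b (+) q) (D phi);
  der_mul : forall q phi psi, Fhat t phi -> Fhat t psi -> fparity q phi ->
    forall xs, D (fmul t phi psi) xs =
      fmul t (D phi) psi xs + (-1) ^+ (b && q) * fmul t phi (D psi) xs;
  der_continuous : forall xs, exists L : seq (seq U), forall phi, Fhat t phi ->
    (forall ys, ys \in L -> phi ys = 0) -> D phi xs = 0 }.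

Definition no_constant_term (D : operator) : Prop :=
  forall psi : {linear U -> k^o}, D (gen psi) [::] = 0.

(* The elements of parity [b] of \overline{CE} resp. \overline{Hoch}. *)
Definition Der0 (t : ftype) (b : bool) (D : operator) : Prop :=
  derivation t b D /\ no_constant_term D.

Definition scomm (p q : bool) (D E : operator) (phi : seq U -> k^o) (xs : seq U) : k^o :=
  D (E phi) xs - (-1) ^+ (p && q) * E (D phi) xs.

(* [c] is the family of maps (U)^n -> U, n >= 1, dual to the restriction of
   the derivation [D] (of parity [b]) to U^*. *)
Record structure_maps (b : bool) (D : operator) (c : seq U -> U) : Prop := StructureMaps {
  sm_multilinear : multilinear c;
  sm_no_constant : c [::] = 0;
  sm_dual : forall q (psi : {linear U -> k^o}),
    (forall x, homog (~~ q) x -> psi x = 0) ->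
    forall xs, D (gen psi) xs = (-1) ^+ (b && q) * psi (c xs) }.

End Families.

Section Structures.
Variables (k : fieldType) (V : superspace k).
Notation U := (Pi V).

(* The derivation [D] is an L-infinity ([t = Sym]) resp. A-infinity
   ([t = Tens]) structure on [V], with structure maps [m]. *)
Record infinity_structure (t : ftype) (D : operator U) (m : seq U -> U) : Prop :=
  InfinityStructure {
  inf_der : Der0 t true D;
  inf_square : forall phi, Fhat t phi -> forall xs, D (D phi) xs = 0;
  inf_maps : structure_maps true D m }.

(* [Dbar] is the derivation of S^ with the restriction to U^* of
   the composite of [D] with T^ -> S^. *)
Definition associated_Linfty (D Dbar : operator U) : Prop :=
  Der0 Sym true Dbar /\
  forall (psi : {linear U -> k^o}) xs, Dbar (gen psi) xs = projTS (D (gen psi)) xs.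

Record inner_product (e : bool) (B : V -> V -> k^o) : Prop := InnerProduct {
  ip_linearl : forall y (a : k) x z, B (a *: x + z) y = a * B x y + B z y;
  ip_linearr : forall x (a : k) y z, B x (a *: y + z) = a * B x y + B x z;
  ip_parity : forall p q x y, homog p x -> homog q y -> p (+) q != e -> B x y = 0;
  ip_symmetric : forall p q x y, homog p x -> homog q y ->
    B x y = (-1) ^+ (p && q) * B y x;
  ip_nondegenerate : forall x, (forall y, B x y = 0) -> x = 0 }.

(* The form induced on \Pi V, <\Pi x, \Pi y> = (-1)^|x| <x, y> with |x| the
   parity in V; it is graded skew-symmetric. *)
Definition Pi_form (B : V -> V -> k^o) (x y : U) : k^o :=
  \sum_(p : bool) (-1) ^+ p * B (hcomp V p x) y.

Definition cyclic_maps (B : V -> V -> k^o) (c : seq U -> U) : Prop :=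
  forall p q ps (x y : U) (xs : seq U), homog p x -> homogs ps xs -> homog q y ->
    Pi_form B (c (x :: xs)) y =
      (-1) ^+ (p && (tpar ps (+) q)) * Pi_form B (c (rcons xs y)) x.

(* The elements of parity [b] of \overline{CE}(V) resp. \overline{CHoch}(V,V). *)
Definition cyclic_Der0 (t : ftype) (B : V -> V -> k^o) (b : bool) (D : operator U) : Prop :=
  Der0 t b D /\ exists2 c, structure_maps b D c & cyclic_maps B c.

End Structures.

Section UnitalProducts.
Variables (k : fieldType) (K : finType) (mu : K -> K -> K -> k).

(* The unital algebra k + A_+ has basis [option K], [None] being the unit;
   [prodc s l] is the coefficient at [l] of the product of the basis
   elements in [s]. *)
Definition umul (i j l : option K) : k :=
  match i, j with
  | None, _ => (j == l)%:R
  | _, None => (i == l)%:R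
  | Some i', Some j' => if l is Some l' then mu i' j' l' else 0
  end.

Fixpoint prodc (s : seq (option K)) (l : option K) : k :=
  if s is i :: s' then \sum_(j : option K) prodc s' j * umul i j l
  else (l == None)%:R.

End UnitalProducts.

(* A finite-dimensional nilpotent non-unital cdga, in a homogeneous basis:
   e_i e_j = \sum_l (bmul i j l) e_l and d e_i = \sum_l (bdiff i l) e_l. *)
Record nilcdga (k : fieldType) := NilCdga {
  bas : finType;
  bpar : bas -> bool;
  bmul : bas -> bas -> bas -> k;
  bdiff : bas -> bas -> k;
  nilbound : nat;
  bmul_parity : forall i j l, bmul i j l != 0 -> bpar l = bpar i (+) bpar j;
  bmulA : forall i j h l,
    \sum_s bmul i j s * bmul s h l = \sum_s bmul j h s * bmul i s l;
  bmulC : forall i j l, bmul i j l = (-1) ^+ (bpar i && bpar j) * bmul j i l;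
  bdiff_parity : forall i l, bdiff i l != 0 -> bpar l = ~~ bpar i;
  bdiffK : forall i l, \sum_s bdiff i s * bdiff s l = 0;
  bdiffM : forall i j l, \sum_s bmul i j s * bdiff s l =
    \sum_s bdiff i s * bmul s j l
      + (-1) ^+ bpar i * \sum_s bdiff j s * bmul i s l;
  bnilpotent : forall s : seq bas, (nilbound < size s)%N ->
    forall l, prodc bmul (map Some s) l = 0 }.

(* The inverse limit of a directed system; the transition map A_j -> A_i, for
   i <= j, is e_a |-> \sum_l (ftr i j a l) e_l. *)
Record formal_cdga (k : fieldType) := FormalCdga {
  fidx : Type;
  fle : fidx -> fidx -> Prop;
  flev : fidx -> nilcdga k;
  ftr : forall i j, bas (flev j) -> bas (flev i) -> k;
  fle_refl : forall i, fle i i;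
  fle_trans : forall i j h, fle i j -> fle j h -> fle i h;
  fle_inhabited : inhabited fidx;
  fle_directed : forall i j, exists2 h, fle i h & fle j h;
  ftr_id : forall i a l, ftr (i := i) (j := i) a l = (a == l)%:R;
  ftr_comp : forall i j h, fle i j -> fle j h -> forall a l,
    ftr (i := i) (j := h) a l = \sum_s ftr (i := j) (j := h) a s * ftr s l;
  ftr_parity : forall i j, fle i j -> forall a (l : bas (flev i)),
    ftr (j := j) a l != 0 -> bpar l = bpar a;
  ftr_mul : forall i j, fle i j -> forall (a b : bas (flev j)) (l : bas (flev i)),
    \sum_s bmul a b s * ftr s l = \sum_s \sum_t ftr a s * ftr b t * bmul s t l;
  ftr_diff : forall i j, fle i j -> forall (a : bas (flev j)) (l : bas (flev i)),
    \sum_s bdiff a s * ftr s l = \sum_s ftr a s * bdiff s l }.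

Arguments flev {k} f i.

(* An element of A (x) U, with A = k + A_+ finite-dimensional, is the function
    [option (bas A) -> U] of its coefficients. *)

Section Scalars.
Variables (k : fieldType) (A : nilcdga k).

Definition opar (i : option (bas A)) : bool := if i is Some i' then bpar i' else false.

Definition oplus (W : lmodType k) (x : bas A -> W) (i : option (bas A)) : W :=
  if i is Some i' then x i' else 0.

Definition oconst (W : lmodType k) (v : W) (i : option (bas A)) : W :=
  if i is None then v else 0.

Variable U : superspace k.

(* The A-multilinear extension of a family of maps [c] of parity [b]:
   c^A(a_1 v_1, ..., a_n v_n)
     = (-1)^(b (|a_1| + ... + |a_n|)) +/- a_1 ... a_n c(v_1, ..., v_n). *)
Definition extA (R : lmodType k) (b : bool) (c : seq U -> R)
    (ys : seq (option (bas A) -> U)) (l : option (bas A)) : R :=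
  \sum_(s : (size ys).-tuple (option (bas A)))
    prodc (@bmul k A) s l *:
      hsum (fun hs =>
          (-1) ^+ ((b && tpar (map opar s)) (+) isign (map opar s) (map fst hs))
            *: c (map snd hs))
        [seq yi.1 yi.2 | yi <- zip ys s].

Definition MC_left (t : ftype) (m : seq U -> U) (xi : bas A -> U) (l : bas A) : U :=
  \sum_i bdiff i l *: xi i
    + \sum_(1 <= n < (nilbound A).+1)
        (if t is Sym then (n`!%:R)^-1 else 1 : k)
          *: extA true m (nseq n (oplus xi)) (Some l).

(* The twisted structure maps m^xi_n, n >= 1, and the structure maps of m^A. *)
Definition twistA (t : ftype) (m : seq U -> U) (xi : bas A -> U)
    (xs : seq U) (l : option (bas A)) : U :=
  match t with
  | Sym => \sum_(0 <= i < (nilbound A).+1) (i`!%:R)^-1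
             *: extA true m (nseq i (oplus xi) ++ map (@oconst U) xs) l
  | Tens => \sum_(0 <= i < (nilbound A).+1)
              \sum_(b : (i + size xs).-tuple bool | count id b == i)
                extA true m (interleave b (nseq i (oplus xi)) (map (@oconst U) xs)) l
  end.

Definition constA (m : seq U -> U) (xs : seq U) (l : option (bas A)) : U :=
  extA true m (map (@oconst U) xs) l.

(* The component at this level of \sum_(r >= 1) f_r^A(xi, ..., xi) / r!, for
   an even family [f] of operators; a (x) \Pi D is identified with a (x) D. *)
Definition pushA (f : seq U -> operator U) (xi : bas A -> U) (l : bas A) : operator U :=
  fun phi xs =>
    \sum_(1 <= r < (nilbound A).+1) (r`!%:R)^-1
      * extA (R := k^o) false (fun ws => f ws phi xs) (nseq r (oplus xi)) (Some l).

(* Left-hand side of (d_A + [D, -])x + [x, x]/2 = 0 for an odd element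
   x = \sum_i e_i (x) x_i of A_+ (x) Der. *)
Definition MC_der_left (D : operator U) (x : bas A -> operator U) (l : bas A) : operator U :=
  fun phi xs =>
    \sum_i bdiff i l * x i phi xs
    + (-1) ^+ bpar l * scomm true (~~ bpar l) D (x l) phi xs
    + 2%:R^-1 * \sum_i \sum_j (-1) ^+ (~~ bpar i && bpar j) * bmul i j l
                  * scomm (~~ bpar i) (~~ bpar j) (x i) (x j) phi xs.

(* The A-linear derivation \sum_i e_i (x) x_i (odd, with coefficients in A_+)
   has the structure maps [M], with values in A (x) U: the coefficients of M are
   (-1)^|e_i| times the structure maps of the x_i. This is the A-linear
   extension of the duality c |-> c^* for which the equations
   (d_A + M)^2 = 0 on A (x) S(U) and (d_A + x)^2 = 0 on A (x) S^(U^* )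
   correspond to each other (c |-> c^* reverses the sign of commutators, so
   without (-1)^|e_i| the terms d_A would have the wrong sign). *)
Definition has_structure_maps (x : bas A -> operator U)
    (M : seq U -> option (bas A) -> U) : Prop :=
  forall l, structure_maps (~~ bpar l) (x l)
    (fun xs => if xs is [::] then 0 else (-1) ^+ bpar l *: M xs (Some l))
  /\ forall xs, xs != [::] -> M xs None = 0.

End Scalars.

Section MaurerCartan.
Variables (k : fieldType) (V : superspace k).
Notation U := (Pi V).

(* MC(V, A): an element of the completed tensor product A_+ (x) U is a
   compatible family of elements of the A_i (x) U. *)
Record MC (t : ftype) (m : seq U -> U) (A : formal_cdga k)
    (xi : forall i, bas (flev A i) -> U) : Prop := MCElement {
  MC_compat : forall i j, fle i j -> forall l, xi i l = \sum_a ftr a l *: xi j a;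
  MC_even : forall i l, homog (bpar l) (xi i l);
  MC_eq : forall i l, MC_left t m (xi i) l = 0 }.

(* MC(W, A) for a sub-dgla W of Der, W b being its part of parity b. *)
Record MC_der (t : ftype) (D : operator U) (W : bool -> operator U -> Prop)
    (A : formal_cdga k) (x : forall i, bas (flev A i) -> operator U) : Prop :=
  MCDerElement {
  MC_der_compat : forall i j, fle i j -> forall l phi xs, Fhat t phi ->
    x i l phi xs = \sum_a ftr a l * x j a phi xs;
  MC_der_odd : forall i l, W (~~ bpar l) (x i l);
  MC_der_eq : forall i l phi xs, Fhat t phi -> MC_der_left D (x i) l phi xs = 0 }.

(* [f] is an even element of (S^ U^* )_+ (x) \Pi W = Hom(S U, \Pi W) lying in
   MC(W, (S^ U^*, DV)), where phi (x) w is identified with x |-> phi(x) w: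
   - d_A acts on the functionals ws |-> f ws phi xs;
   - [phi (x) D, psi (x) E] = (-1)^(|D| |psi|) phi psi (x) [D, E], where
     |D| = |phi| + 1, and phi psi is the product [smul]. *)
Record Linfty_map (DV : operator U) (t : ftype) (D : operator U)
    (W : bool -> operator U -> Prop) (f : seq U -> operator U) : Prop := LinftyMap {
  Lm_multilinear : forall phi xs, Fhat t phi ->
    multilinear (R := k^o) (fun ws => f ws phi xs);
  Lm_symmetric : forall phi xs, Fhat t phi ->
    gsymmetric (R := k^o) (fun ws => f ws phi xs);
  Lm_positive : forall phi xs, Fhat t phi -> f [::] phi xs = 0;
  Lm_even : forall ps ws, homogs ps ws -> W (~~ tpar ps) (f ws);
  Lm_eq : forall ps ws phi xs, homogs ps ws -> Fhat t phi ->
    DV (fun vs => f vs phi xs) ws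
    + (-1) ^+ tpar ps * scomm true (~~ tpar ps) D (f ws) phi xs
    + 2%:R^-1 * \sum_(b : (size ws).-tuple bool)
       (let ps1 := mask b ps in let ps2 := mask (map negb b) ps in
        (-1) ^+ (ksign ps (unshuffle b) (+) tpar ps2)
          * scomm (~~ tpar ps1) (~~ tpar ps2)
              (f (mask b ws)) (f (mask (map negb b) ws)) phi xs)
    = 0 }.

Definition push (f : seq U -> operator U) (A : formal_cdga k)
    (xi : forall i, bas (flev A i) -> U) : forall i, bas (flev A i) -> operator U :=
  fun i => pushA f (xi i).

(* For every A, [f] maps xi in MC(V, A) to an element of MC(W, A), which is
   m^xi - m^A. *)
Definition twists (t : ftype) (D : operator U) (m : seq U -> U)
    (W : bool -> operator U -> Prop) (f : seq U -> operator U) : Prop :=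
  forall (A : formal_cdga k) (xi : forall i, bas (flev A i) -> U),
    MC t m xi ->
    MC_der t D W (push f xi) /\
    forall i, has_structure_maps (push f xi (i := i))
                (fun xs l => twistA t m (xi i) xs l - constA m xs l).

(* [f] is an L-infinity map (V, DV) -> W, and the only one with the
   property [twists]. *)
Definition twisting_map (DV : operator U) (t : ftype) (D : operator U) (m : seq U -> U)
    (W : bool -> operator U -> Prop) (f : seq U -> operator U) : Prop :=
  [/\ Linfty_map DV t D W f, twists t D m W f &
      forall g, Linfty_map DV t D W g -> twists t D m W g ->
        forall ws phi xs, Fhat t phi -> g ws phi xs = f ws phi xs].

(* The components f_r, r >= 1, of [f] are given by
   f_r(w_1, ..., w_r)(x_1, ..., x_n) = F (w_1, ..., w_r) (x_1, ..., x_n), n >= 1. *)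
Definition given_by (F : seq U -> seq U -> U) (f : seq U -> operator U) : Prop :=
  forall ps ws, homogs ps ws -> ws != [::] ->
    structure_maps (~~ tpar ps) (f ws) (fun xs => if xs is [::] then 0 else F ws xs).

Definition CE_formula (m : seq U -> U) (ws xs : seq U) : U := m (ws ++ xs).

Definition Hoch_formula (m : seq U -> U) (ws xs : seq U) : U :=
  \sum_(s : 'S_(size ws))
    \sum_(b : (size ws + size xs).-tuple bool | count id b == size ws)
      kact (interleave b (pword s) (iota (size ws) (size xs))) m (ws ++ xs).

End MaurerCartan.

(* Main.v *)
From HB Require Import structures.
From mathcomp Require Import all_boot all_order all_algebra perm.
From mathcomp Require Import boolp functions.
From mathcomp Require Import ring zify.
Require Import Defs.


Set Implicit Arguments.
Unset Strict Implicit.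
Unset Printing Implicit Defensive.

Import GRing.Theory.
Local Open Scope ring_scope.

(** Write iota_w for the derivation [ins] dual to the vector w: it inserts w into a functional and
    is the constant vector field w. Bracketing the structure m repeatedly with constant fields gives
    derivations [iota_{w_1}, [..., [iota_{w_r}, m]]] ([adins]). On a generator such a bracket
    inserts w_1, ..., w_r into m in all possible ways ([adins_gen]): in the symmetric algebra this
    is m(w_1, ..., w_r, x_1, ..., x_n), in the tensor algebra it is the sum over all orders of the
    w's and all their shuffles with the x's. So, up to Koszul signs, f_r is this derived bracket
    with its constant part removed ([tder], [twf]). The constant part is iota_nu, where nu is up to
    sign the L-infinity operation on w_1, ..., w_r. This description treats the symmetric and the
    tensor case together.

    The L-infinity equation. Since [m, m] = 0, so is its iterated bracket with the iota_{w_i}. The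
    Jacobi identity expands it as a sum over unshuffles of brackets of two derived brackets
    ([adins_square0]). Each factor is a derivation without constant term plus a constant field.
    Constant fields commute with each other, and a constant field iota_nu bracketed with a derived
    bracket is again a derived bracket, with nu as a new entry. These mixed terms form the
    Chevalley-Eilenberg differential of f, and the remaining terms are the quadratic part and the
    brackets with m ([twf_eq]).

    Maurer-Cartan elements. For xi in MC(V, A) the operator exp(ad iota_xi)(d_A + m) equals d_A -
    iota_{d xi} + sum_n (ad iota_xi)^n m / n!. The Maurer-Cartan equation says that iota_{d xi} is
    exactly the constant part of the last series. Hence the operator is d_A + m plus the image of
    xi, and it squares to zero because it is conjugate to d_A + m ([conj_square], [Wtot_square],
    [Wtot_Some]). Its values on generators are the twisted structure maps ([twistA_Sym],
    [twistA_Tens], [pushA_maps]).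

    Uniqueness. If g has the twisting property too, then h = g - f, evaluated on a fixed functional
    and word, satisfies sum_r h(xi, ..., xi) / r! = 0 on every Maurer-Cartan element. There are
    enough of these: adjoin to A two elements eps_true and eps_false with vanishing products and d
    eps_false = eps_true. Then xi + eps_true w, corrected by a multiple of eps_false, is again
    Maurer-Cartan for every w ([sxi_MC]). The coefficient of eps_true shows that h(w, ...) has the
    same vanishing property ([MCzero_cons]), and starting from A = k all values of h vanish
    ([MCzero_eq0]).

    Two facts are used throughout. A continuous derivation is determined by its values on
    generators, because polynomials are dense ([galg_dense], [derivation_ext]); in the symmetric
    case this rests on Euler's identity, hence on characteristic 0. For cyclic structures, inserting
    a vector preserves cyclic invariance up to a sign given by its parity ([cyc_ins]), so the
    derivations f_r(w_1, ..., w_r) are again cyclic ([twf_cyclic]). *)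

Local Notation sg b := ((-1) ^+ nat_of_bool b).

(** * Homogeneous vectors and the sign twist *)

Section Homogeneous.
Variables (k : fieldType) (U : superspace k).
Implicit Types (x y : U) (p q : bool).

Lemma homog_hcomp p x : homog p (hcomp U p x).
Proof. by rewrite /homog hcompK eqxx. Qed.

Lemma hcomp_homog p q x : homog p x -> hcomp U q x = if q == p then x else 0.
Proof. by move=> hx; rewrite -{1}hx hcompK; case: eqP => // ->. Qed.

Lemma homog0 p : homog p (0 : U).
Proof. by rewrite /homog linear0. Qed.

Lemma homogD p x y : homog p x -> homog p y -> homog p (x + y).
Proof. by rewrite /homog linearD => -> ->. Qed.

Lemma homogZ p (a : k) x : homog p x -> homog p (a *: x).
Proof. by rewrite /homog linearZ => ->. Qed.

Lemma homog_sum p I (r : seq I) (P : pred I) (F : I -> U) :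
  (forall i, P i -> homog p (F i)) -> homog p (\sum_(i <- r | P i) F i).
Proof. by move=> h; elim/big_ind: _ => //; [exact: homog0 | move=> *; exact: homogD]. Qed.

Lemma sum_hcomp x : \sum_(p : bool) hcomp U p x = x.
Proof. by rewrite big_bool /= addrC hcomp_sum. Qed.

(** The map x |-> (-1)^(p |x|) x. Composing arguments with [tau p] expresses the Koszul sign of
    moving an element of parity p across them without splitting them into homogeneous parts. *)
Definition tau p x : U := hcomp U false x + sg p *: hcomp U true x.

Fact tau_linear p : linear (tau p).
Proof.
by move=> a x y; rewrite /tau !linearP /= !scalerDr !scalerA (mulrC a) addrACA.
Qed.
HB.instance Definition _ p := GRing.isLinear.Build k U U _ (tau p) (tau_linear p).

Lemma tau_homog p q x : homog q x -> tau p x = sg (p && q) *: x.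
Proof.
move=> hx; rewrite /tau !(hcomp_homog _ hx).
by case: q {hx} p => [] []; rewrite /= ?scale1r ?addr0 ?add0r ?scaler0 ?addr0.
Qed.

Lemma homog_tau p q x : homog q x -> homog q (tau p x).
Proof. by move=> hx; rewrite (tau_homog _ hx); exact: homogZ. Qed.

Lemma tau_hcomp p q x : tau p (hcomp U q x) = hcomp U q (tau p x).
Proof.
rewrite /tau linearD linearZ /= !hcompK.
by case: q => /=; rewrite ?scaler0 ?addr0 ?add0r.
Qed.

End Homogeneous.

(** * Multilinear maps and their values on homogeneous words *)

Section Multilinear.
Variables (k : fieldType) (U : superspace k).
Implicit Types (x y : U) (p q : bool) (xs : seq U) (hs : seq (bool * U)).

(** A homogeneous word is stored together with its parities, so that one induction runs over the
    letters and their parities at once. *)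
Definition hh hs := homogs (map fst hs) (map snd hs).

Lemma hh_cons p x hs : hh ((p, x) :: hs) <-> homog p x /\ hh hs.
Proof. by []. Qed.

Lemma hh_cat hs1 hs2 : hh (hs1 ++ hs2) <-> hh hs1 /\ hh hs2.
Proof.
elim: hs1 => [|[p x] hs1 IH] /=; first by split => // -[].
by rewrite !hh_cons IH; tauto.
Qed.

Lemma homogsP ps xs : homogs ps xs ->
  exists hs, [/\ hh hs, ps = map fst hs & xs = map snd hs].
Proof.
elim: ps xs => [|p ps IH] [|x xs] //=; first by exists [::].
case=> hx /IH [hs [h1 -> ->]]; exists ((p, x) :: hs); split=> //.
Qed.

Lemma hh_mask b hs : hh hs -> hh (mask b hs).
Proof.
elim: hs b => [|[p x] hs IH] [|[] b] //=; rewrite hh_cons => -[hx hhs] //.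
  by split => //; exact: IH.
exact: IH.
Qed.

Section Target.
Variable (R : lmodType k).
Implicit Types (c : seq U -> R) (F : seq (bool * U) -> R).

Lemma ml0 c s1 s2 : multilinear c -> c (s1 ++ 0 :: s2) = 0.
Proof.
move=> mc; have := mc s1 s2 1 0 0; rewrite scale1r addr0 scale1r => /eqP.
by rewrite -subr_eq0 opprD addrA subrr sub0r oppr_eq0 => /eqP.
Qed.

Lemma mlZ c s1 s2 a x : multilinear c -> c (s1 ++ (a *: x) :: s2) = a *: c (s1 ++ x :: s2).
Proof. by move=> mc; have := mc s1 s2 a x 0; rewrite addr0 (ml0 _ _ mc) addr0. Qed.

Lemma mlD c s1 s2 x y : multilinear c ->
  c (s1 ++ (x + y) :: s2) = c (s1 ++ x :: s2) + c (s1 ++ y :: s2).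
Proof. by move=> mc; have := mc s1 s2 1 x y; rewrite !scale1r. Qed.

Lemma ml_sum c s1 s2 I (r : seq I) (P : pred I) (f : I -> U) : multilinear c ->
  c (s1 ++ (\sum_(i <- r | P i) f i) :: s2) = \sum_(i <- r | P i) c (s1 ++ f i :: s2).
Proof.
move=> mc; apply: (big_morph (fun x => c (s1 ++ x :: s2))).
  by move=> x y; exact: mlD.
exact: ml0.
Qed.

Lemma ml_context c s1 s2 : multilinear c -> multilinear (fun xs => c (s1 ++ xs ++ s2)).
Proof. by move=> mc t1 t2 a x y; rewrite -!catA !cat_cons !(catA s1) mc. Qed.

Lemma ml_cons c x : multilinear c -> multilinear (fun xs => c (x :: xs)).
Proof. by move=> mc t1 t2 a y z; rewrite -!cat_cons mc. Qed.

Lemma ml_map c (f : {linear U -> U}) : multilinear c -> multilinear (fun xs => c (map f xs)).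
Proof. by move=> mc t1 t2 a y z; rewrite !map_cat /= linearP mc. Qed.

Lemma ml_zero : multilinear (fun _ : seq U => 0 : R).
Proof. by move=> t1 t2 a y z; rewrite scaler0 addr0. Qed.

Lemma ml_linear (b : k) c d : multilinear c -> multilinear d ->
  multilinear (fun xs => b *: c xs + d xs).
Proof.
move=> mc md t1 t2 a y z; rewrite mc md !scalerDr !scalerA -!addrA; congr (_ + _).
  by rewrite mulrC.
by rewrite addrCA.
Qed.

Lemma ml_scale (b : k) c : multilinear c -> multilinear (fun xs => b *: c xs).
Proof. by move=> mc t1 t2 a y z; rewrite mc scalerDr !scalerA mulrC. Qed.

Lemma ml_add c d : multilinear c -> multilinear d -> multilinear (fun xs => c xs + d xs).
Proof. by move=> mc md t1 t2 a y z; rewrite mc md scalerDr addrACA. Qed.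

Lemma ml_bigsum I (r : seq I) (P : pred I) (c : I -> seq U -> R) :
  (forall i, P i -> multilinear (c i)) ->
  multilinear (fun xs => \sum_(i <- r | P i) c i xs).
Proof.
move=> mc t1 t2 a y z; rewrite scaler_sumr -big_split /=.
by apply: eq_bigr => i Pi; rewrite mc.
Qed.

Lemma hsumD F G xs : hsum (fun hs => F hs + G hs) xs = hsum F xs + hsum G xs.
Proof.
elim: xs F G => [//|x xs IH] F G /=.
rewrite -big_split /=; apply: eq_bigr => p _.
exact: (IH (fun hs => F (_ :: hs)) (fun hs => G (_ :: hs))).
Qed.

Lemma hsumZ (a : k) F xs : hsum (fun hs => a *: F hs) xs = a *: hsum F xs.
Proof.
elim: xs F => [//|x xs IH] F /=; rewrite scaler_sumr.
by apply: eq_bigr => p _; exact: (IH (fun hs => F (_ :: hs))).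
Qed.

Lemma hsum0 xs : hsum (fun _ => 0 : R) xs = 0.
Proof. by elim: xs => [//|x xs IH] /=; rewrite big1. Qed.

Lemma hsum_sum I (r : seq I) (P : pred I) (F : I -> seq (bool * U) -> R) xs :
  hsum (fun hs => \sum_(i <- r | P i) F i hs) xs = \sum_(i <- r | P i) hsum (F i) xs.
Proof.
elim: xs F => [//|x xs IH] F /=; rewrite exchange_big /=.
by apply: eq_bigr => p _; exact: (IH (fun i hs => F i (_ :: hs))).
Qed.

Lemma eq_hsum F G xs :
  (forall hs, hh hs -> size hs = size xs -> F hs = G hs) -> hsum F xs = hsum G xs.
Proof.
elim: xs F G => [|x xs IH] F G FG /=; first by apply: FG.
apply: eq_bigr => p _; apply: IH => hs hhs shs; apply: FG => /=; last by rewrite shs.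
by rewrite hh_cons; split => //; exact: homog_hcomp.
Qed.

Lemma ml_hsum c xs : multilinear c -> c xs = hsum (fun hs => c (map snd hs)) xs.
Proof.
elim: xs c => [//|x xs IH] c mc /=.
rewrite -{1}(sum_hcomp x) (ml_sum [::]) //; apply: eq_bigr => p _ /=.
by rewrite (IH (fun xs => c (_ :: xs))) //; exact: ml_cons.
Qed.

(** Each argument is the sum of its homogeneous parts. This reduces the sign computations below to
    words with explicit parities. *)
Lemma ml_ext c d : multilinear c -> multilinear d ->
  (forall hs, hh hs -> c (map snd hs) = d (map snd hs)) -> forall xs, c xs = d xs.
Proof.
move=> mc md cd xs; rewrite (ml_hsum _ mc) (ml_hsum _ md).
by apply: eq_hsum => hs hhs _; exact: cd.
Qed.

(** Linearity in each vector with its recorded parity kept fixed. This makes [hsum F] multilinear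
    ([hsum_ml]) and equal to [F] on homogeneous words ([hsum_homog]). *)
Definition slotlinear F := forall hs1 hs2 p (a : k) x y,
  F (hs1 ++ (p, a *: x + y) :: hs2) = a *: F (hs1 ++ (p, x) :: hs2) + F (hs1 ++ (p, y) :: hs2).

Lemma slotlinear_cons F h : slotlinear F -> slotlinear (fun hs => F (h :: hs)).
Proof. by move=> mF t1 t2 p a y z; rewrite -!cat_cons mF. Qed.

Lemma slotlinear0 F hs1 hs2 p : slotlinear F -> F (hs1 ++ (p, 0) :: hs2) = 0.
Proof.
move=> mc; have := mc hs1 hs2 p 1 0 0; rewrite scale1r addr0 scale1r => /eqP.
by rewrite -subr_eq0 opprD addrA subrr sub0r oppr_eq0 => /eqP.
Qed.

Lemma hsum_ml F : slotlinear F -> multilinear (hsum F).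
Proof.
move=> mF s1 s2 a x y; elim: s1 F mF => [|z s1 IH] F mF /=; last first.
  rewrite scaler_sumr -big_split /=; apply: eq_bigr => p _.
  by apply: IH; exact: slotlinear_cons.
rewrite scaler_sumr -big_split /=; apply: eq_bigr => p _.
rewrite -hsumZ -hsumD; apply: eq_hsum => hs _ _.
by rewrite linearP /= (mF [::]).
Qed.

Lemma hsum_homog F hs : slotlinear F -> hh hs -> hsum F (map snd hs) = F hs.
Proof.
elim: hs F => [//|[p x] hs IH] F mF; rewrite hh_cons => -[hx hhs] /=.
rewrite big_bool (IH (fun hs => F (_ :: hs))) //; last exact: slotlinear_cons.
rewrite (IH (fun hs => F (_ :: hs))) //; last exact: slotlinear_cons.
rewrite !(hcomp_homog _ hx).
by case: p hx => hx /=; rewrite (slotlinear0 [::]) // ?addr0 ?add0r.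
Qed.

End Target.

Lemma ml_comp (R S : lmodType k) (f : {linear R -> S}) (c : seq U -> R) :
  multilinear c -> multilinear (fun xs => f (c xs)).
Proof. by move=> mc t1 t2 a y z; rewrite mc linearP. Qed.

Lemma hh_taus p hs : hh hs -> hh [seq (h.1, tau p h.2) | h <- hs].
Proof.
elim: hs => [//|[q x] hs IH]; rewrite hh_cons => -[hx /IH hhs] /=.
by rewrite hh_cons; split => //; exact: homog_tau.
Qed.

Lemma ml_taus (R : lmodType k) (c : seq U -> R) p hs s1 : multilinear c -> hh hs ->
  c (s1 ++ map (tau p) (map snd hs)) =
    sg (p && tpar (map fst hs)) *: c (s1 ++ map snd hs).
Proof.
move=> mc; elim: hs s1 => [|[q x] hs IH] s1.
  by rewrite /= andbF scale1r.
rewrite hh_cons => -[hx /IH hhs] /=; rewrite (tau_homog _ hx) mlZ //.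
by have := hhs (rcons s1 x); rewrite !cat_rcons => ->; rewrite scalerA -signr_addb -andb_addr.
Qed.

Lemma tpar_cat ps qs : tpar (ps ++ qs) = tpar ps (+) tpar qs.
Proof. by elim: ps => //= p ps ->; rewrite addbA. Qed.

End Multilinear.

(** * Sums over subsets and signs of unshuffles *)

Section Bits.

Lemma big_bits0 (R : nmodType) (G : seq bool -> R) :
  \sum_(b : 0.-tuple bool) G b = G [::].
Proof.
rewrite (eq_bigr (fun=> G [::])) => [|b _]; last by rewrite (tuple0 b).
by rewrite sumr_const card_tuple expn0.
Qed.

Lemma big_bitsS (R : nmodType) n (G : seq bool -> R) :
  \sum_(b : n.+1.-tuple bool) G b =
    \sum_(b : n.-tuple bool) (G (true :: b) + G (false :: b)).
Proof.
rewrite (reindex (fun u : n.-tuple bool * bool => [tuple of u.2 :: u.1])) /=; last first.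
  exists (fun b : n.+1.-tuple bool => (behead_tuple b, thead b)) => [[b c] _|b _] /=.
    by congr pair; apply/val_inj.
  by rewrite [RHS]tuple_eta; apply/val_inj.
rewrite -(pair_bigA _ (fun (b : n.-tuple bool) (c : bool) => G (c :: b))) /=.
by apply: eq_bigr => b _; rewrite big_bool.
Qed.

Lemma unshuffle_true b :
  unshuffle (true :: b) = 0%N :: map S (unshuffle b).
Proof. by rewrite /unshuffle /= map_cat !map_mask -(iotaDl 1). Qed.

Lemma unshuffle_false b : unshuffle (false :: b) =
  map S (mask b (iota 0 (size b))) ++ 0%N :: map S (mask (map negb b) (iota 0 (size b))).
Proof. by rewrite /unshuffle /= !map_mask -(iotaDl 1). Qed.

Lemma tpar_map_false T (f : T -> bool) s : (forall x, f x = false) -> tpar (map f s) = false.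
Proof. by move=> f0; elim: s => //= x s ->; rewrite f0. Qed.

Lemma ksign_shift p ps s : ksign (p :: ps) (map S s) = ksign ps s.
Proof.
by elim: s => //= i s ->; congr (_ (+) _); rewrite -map_comp.
Qed.

Lemma tpar_nth_mask ps b : size b = size ps ->
  tpar [seq nth false ps j | j <- mask b (iota 0 (size b))] = tpar (mask b ps).
Proof. by move=> sb; rewrite map_mask sb -/(mkseq _ _) mkseq_nth. Qed.

Lemma ksign_true p ps b : ksign (p :: ps) (unshuffle (true :: b)) = ksign ps (unshuffle b).
Proof. by rewrite unshuffle_true /= ksign_shift -map_comp tpar_map_false. Qed.

(** The letter 0 has the smallest index, so it is inverted exactly with the letters standing before
    it. *)
Lemma ksign_insert0 p ps s t : ksign (p :: ps) (map S s ++ 0%N :: map S t) =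
  (p && tpar [seq nth false ps j | j <- s]) (+) ksign ps (s ++ t).
Proof.
elim: s => [|i s IH] /=.
  by rewrite andbF ksign_shift -map_comp tpar_map_false.
rewrite IH !map_cat /= !tpar_cat /= -!map_comp /= !addbA.
set u := tpar [seq _ | _ <- s]; set v := tpar [seq _ | _ <- t].
by move: u v {IH} => [] []; case: p; case: (nth _ _ i); case: (tpar _); case: (ksign _ _).
Qed.

Lemma ksign_false p ps b : size b = size ps ->
  ksign (p :: ps) (unshuffle (false :: b)) =
    (p && tpar (mask b ps)) (+) ksign ps (unshuffle b).
Proof. by move=> sb; rewrite unshuffle_false ksign_insert0 tpar_nth_mask. Qed.

(** A pair of odd letters taken from the two blocks is inverted in exactly one of the two
    unshuffles; pairs inside a block are never inverted. *)
Lemma ksign_compl ps b : size b = size ps ->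
  ksign ps (unshuffle (map negb b)) =
   ksign ps (unshuffle b) (+) (tpar (mask b ps) && tpar (mask (map negb b) ps)).
Proof.
elim: b ps => [|c b IH] [|p ps] //= [sb].
have snb : size (map negb b) = size ps by rewrite size_map.
have IHb := IH _ sb.
case: c; [rewrite (ksign_true p ps b) (ksign_false p snb) | rewrite (ksign_false p sb) (ksign_true p ps (map negb b))]; rewrite IHb /=.
  by case: p; case: (tpar _); case: (tpar _); case: (ksign _ _).
by case: p; case: (tpar _); case: (tpar _); case: (ksign _ _).
Qed.

End Bits.

(** * Recursive form of the products *)

Section Products.
Variables (k : fieldType) (U : superspace k).
Implicit Types (x y w : U) (p q e : bool) (xs : seq U) (hs : seq (bool * U)).
Implicit Types (phi psi : seq U -> k^o).

(** Each letter is given to [phi] or to [psi]. The parity [e] is that of what [phi] has received so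
    far, which a letter given to [psi] has to cross. Starting from [e = true] amounts to one more
    odd element to be crossed. *)
Fixpoint hsmul e phi psi hs : k^o :=
  if hs is (p, x) :: hs' then
    hsmul (e (+) p) (fun ys => phi (x :: ys)) psi hs'
      + sg (e && p) * hsmul e phi (fun ys => psi (x :: ys)) hs'
  else phi [::] * psi [::].

Fixpoint htmul e phi psi hs : k^o :=
  if hs is (p, x) :: hs' then
    sg (e && tpar (map fst hs)) * (phi [::] * psi (map snd hs))
      + htmul (e (+) p) (fun ys => phi (x :: ys)) psi hs'
  else phi [::] * psi [::].

Definition hmul t := if t is Sym then hsmul else htmul.

Lemma hmul_linl t e (a : k) phi1 phi2 psi hs :
  hmul t e (fun ys => a * phi1 ys + phi2 ys) psi hs =
    a * hmul t e phi1 psi hs + hmul t e phi2 psi hs.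
Proof.
case: t; rewrite /hmul; elim: hs e phi1 phi2 psi => [|[p x] hs IH] e phi1 phi2 psi /=; try ring.
- by rewrite (IH _ (fun ys => phi1 (x :: ys)) (fun ys => phi2 (x :: ys))) IH; ring.
- by rewrite (IH _ (fun ys => phi1 (x :: ys)) (fun ys => phi2 (x :: ys))); ring.
Qed.

Lemma hmul_linr t e (a : k) phi psi1 psi2 hs :
  hmul t e phi (fun ys => a * psi1 ys + psi2 ys) hs =
    a * hmul t e phi psi1 hs + hmul t e phi psi2 hs.
Proof.
case: t; rewrite /hmul; elim: hs e phi psi1 psi2 => [|[p x] hs IH] e phi psi1 psi2 /=; try ring.
- by rewrite (IH _ _ (fun ys => psi1 (x :: ys)) (fun ys => psi2 (x :: ys))) IH; ring.
- by rewrite IH; ring.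
Qed.

Lemma hmul0r t e phi hs : hmul t e phi (fun=> 0) hs = 0.
Proof.
case: t; rewrite /hmul; elim: hs e phi => [|[p x] hs IH] e phi /=; rewrite ?IH ?mulr0 ?addr0 //.
Qed.

Lemma hmul0l t e psi hs : hmul t e (fun=> 0) psi hs = 0.
Proof.
case: t; rewrite /hmul; elim: hs e psi => [|[p x] hs IH] e psi /=; rewrite ?IH ?mul0r ?mulr0 ?addr0 //.
Qed.

Lemma eq_hmul t e phi1 phi2 psi1 psi2 hs : phi1 =1 phi2 -> psi1 =1 psi2 ->
  hmul t e phi1 psi1 hs = hmul t e phi2 psi2 hs.
Proof. by move=> /funext -> /funext ->. Qed.

Lemma hmul_slot t e phi psi : multilinear phi -> multilinear psi ->
  slotlinear (R := k^o) (hmul t e phi psi).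
Proof.
move=> mp ms hs1 hs2 p a x y.
elim: hs1 e phi psi mp ms => [|[q z] hs1 IH] e phi psi mp ms /=.
  case: t => /=.
  - have -> : (fun ys => phi (a *: x + y :: ys)) =
        (fun ys => a * phi (x :: ys) + phi (y :: ys)).
      by apply/funext => ys; rewrite (mp [::]).
    have -> : (fun ys => psi (a *: x + y :: ys)) =
        (fun ys => a * psi (x :: ys) + psi (y :: ys)).
      by apply/funext => ys; rewrite (ms [::]).
    have Ll := @hmul_linl Sym; have Lr := @hmul_linr Sym; rewrite /hmul in Ll Lr.
    by rewrite Ll Lr /GRing.scale /=; ring.
  - have -> : (fun ys => phi (a *: x + y :: ys)) =
        (fun ys => a * phi (x :: ys) + phi (y :: ys)).
      by apply/funext => ys; rewrite (mp [::]).
    have Ll := @hmul_linl Tens; rewrite /hmul in Ll.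
    by rewrite (ms [::]) Ll /GRing.scale /=; ring.
case: t IH => /= IH.
- rewrite !IH //; try exact: ml_cons.
  by rewrite /GRing.scale /=; ring.
- rewrite !IH //; try exact: ml_cons.
  rewrite !map_cat /= -!cat_cons ms.
  by rewrite /GRing.scale /=; ring.
Qed.

Lemma tensor_slot n phi psi : multilinear phi -> multilinear psi ->
  slotlinear (R := k^o) (fun hs =>
    sg (tpar (map fst (take n hs)) && tpar (map fst (drop n hs)))
      * (phi (map snd (take n hs)) * psi (map snd (drop n hs)))).
Proof.
move=> mp ms hs1 hs2 p a x y.
rewrite !take_cat !drop_cat; case: ltnP => _.
  rewrite !map_cat /= ms /GRing.scale /=; ring.
case: (n - _)%N => [|m] /=.
  rewrite (ms [::]) /= /GRing.scale /=; ring.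
rewrite !map_cat /= mp /GRing.scale /=; ring.
Qed.

Lemma tensor_homog n phi psi hs : multilinear phi -> multilinear psi -> hh hs ->
  tensor n phi psi (map snd hs) =
    sg (tpar (map fst (take n hs)) && tpar (map fst (drop n hs)))
      * (phi (map snd (take n hs)) * psi (map snd (drop n hs))).
Proof.
move=> mp ms hhs; rewrite /tensor hsum_homog //; exact: tensor_slot.
Qed.

Lemma tmulE phi psi xs : multilinear phi -> multilinear psi ->
  tmul phi psi xs = hsum (R := k^o) (htmul false phi psi) xs.
Proof.
move=> mp ms; rewrite /tmul /tensor -hsum_sum; apply: eq_hsum => hs hhs shs.
rewrite -{}shs.
rewrite (eq_bigr (fun i : 'I__ => sg ((tpar (map fst (take i hs)) && tpar (map fst (drop i hs)))
   (+) (false && tpar (map fst (drop i hs))))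
      * (phi (map snd (take i hs)) * psi (map snd (drop i hs))))); last first.
  by move=> i _; rewrite addbF.
elim: hs phi false {mp hhs} => [|[p x] hs IH] phi e.
  by rewrite big_ord_recl big_ord0 /= andbF mul1r addr0.
rewrite big_ord_recl /= ; congr (_ + _).
rewrite -(IH (fun ys => phi (x :: ys))); apply: eq_bigr => i _ /=.
congr (sg _ * _).
by case: e; case: p; case: (tpar _); case: (tpar _).
Qed.

Lemma smul_kact b phi psi hs : multilinear phi -> multilinear psi -> hh hs ->
  size b = size hs ->
  tensor (count id b) phi psi [seq (nth (false, 0) hs i).2 | i <- unshuffle b] =
  sg (tpar (mask b (map fst hs)) && tpar (mask (map negb b) (map fst hs)))
   * (phi (mask b (map snd hs)) * psi (mask (map negb b) (map snd hs))).
Proof.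
move=> mp ms hhs sb.
have -> : [seq (nth (false, 0) hs i).2 | i <- unshuffle b] =
    map snd (mask b hs ++ mask (map negb b) hs).
  rewrite /unshuffle (map_comp snd (nth (false, 0) hs)) [in LHS]map_cat !map_mask.
  by rewrite sb -/(mkseq _ _) mkseq_nth !map_cat !map_mask.
have st : size (mask b hs) = count id b by rewrite size_mask.
rewrite tensor_homog //; last by rewrite hh_cat; split; exact: hh_mask.
by rewrite -{1 2 3 4}st !take_size_cat // !drop_size_cat // !map_mask.
Qed.

(** The unshuffle sign counts the odd pairs with the [psi] letter first, the tensor sign counts all
    mixed odd pairs. Their product counts those with the [phi] letter first, which is the sign
    accumulated by [e]. *)
Lemma smulE phi psi xs : multilinear phi -> multilinear psi ->
  smul phi psi xs = hsum (R := k^o) (hsmul false phi psi) xs.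
Proof.
move=> mp ms; rewrite /smul /kact -hsum_sum; apply: eq_hsum => hs hhs shs.
rewrite -{}shs.
(* The induction needs an arbitrary initial parity [e], whose sign is taken against the whole block
   of [psi]. *)
pose G e (phi psi : seq U -> k^o) ps xs (b : seq bool) : k^o :=
  sg (ksign ps (unshuffle b)
      (+) (tpar (mask b ps) && tpar (mask (map negb b) ps))
      (+) (e && tpar (mask (map negb b) ps)))
  * (phi (mask b xs) * psi (mask (map negb b) xs)).
rewrite (eq_bigr (fun b : (size hs).-tuple bool =>
    G false phi psi (map fst hs) (map snd hs) b)); last first.
  move=> b _; rewrite smul_kact ?size_tuple // /GRing.scale /= mulrA -signr_addb.
  by rewrite /G /= addbF.
elim: hs phi psi false {mp ms hhs} => [|[p x] hs IH] phi psi e.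
  by rewrite (big_bits0 (G e phi psi _ _)) /G /= andbF mul1r.
rewrite /= -(IH (fun ys => phi (x :: ys))) -(IH phi (fun ys => psi (x :: ys))).
rewrite (big_bitsS _ (G e phi psi _ _)) big_split /= mulr_sumr.
congr (_ + _); apply: eq_bigr => b _; rewrite /G.
  rewrite ksign_true /=; congr (sg _ * _).
  by case: e; case: p; case: (tpar _); case: (tpar _); case: (ksign _ _).
rewrite mulrA -signr_addb ksign_false ?size_tuple ?size_map //=; congr (sg _ * _).
by case: e; case: p; case: (tpar _); case: (tpar _); case: (ksign _ _).
Qed.

Lemma fmulE t phi psi xs : multilinear phi -> multilinear psi ->
  fmul t phi psi xs = hsum (R := k^o) (hmul t false phi psi) xs.
Proof. by case: t; [exact: smulE | exact: tmulE]. Qed.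

Lemma fmul_ml t phi psi : multilinear phi -> multilinear psi -> multilinear (fmul t phi psi).
Proof.
move=> mp ms s1 s2 a x y; rewrite !fmulE //; apply: hsum_ml; exact: hmul_slot.
Qed.

Lemma fmul_homog t phi psi hs : multilinear phi -> multilinear psi -> hh hs ->
  fmul t phi psi (map snd hs) = hmul t false phi psi hs.
Proof. by move=> mp ms hhs; rewrite fmulE // hsum_homog //; exact: hmul_slot. Qed.

(** A twist of [psi] by [tau d] gives every letter of [psi] the sign of crossing one more element of
    parity [d]. The tails of the recursion become products again in this way. *)
Lemma hmul_tau t e d phi psi hs : multilinear phi -> multilinear psi -> hh hs ->
  hmul t e phi (fun ys => psi (map (tau d) ys)) hs = hmul t (e (+) d) phi psi hs.
Proof.
move=> + ms hhs.
elim: hs e phi psi ms hhs => [|[p x] hs IH] e phi psi ms hhs mp; first by case: t.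
have [hx hhs'] := hhs.
case: t IH; rewrite /hmul => IH /=.
- rewrite (IH _ (fun ys => phi (x :: ys))) //; last exact: ml_cons.
  rewrite addbAC; congr (_ + _).
  have -> : (fun ys => psi (tau d x :: map (tau d) ys)) =
      (fun ys => sg (d && p) * psi (x :: map (tau d) ys) + (fun => 0) ys).
    by apply/funext => ys; rewrite (tau_homog _ hx) (mlZ [::]) //= addr0.
  have Lr := @hmul_linr Sym; rewrite /hmul in Lr.
  rewrite Lr (IH _ phi (fun ys => psi (x :: ys))) //; last exact: ml_cons.
  have -> : hsmul e phi (fun=> 0) hs = 0.
    exact: (hmul0r Sym).
  by rewrite addr0 mulrA -signr_addb andb_addl.
- rewrite (IH _ (fun ys => phi (x :: ys))) //; last exact: ml_cons.
  rewrite addbAC; congr (_ + _).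
  have := ml_taus d [::] ms hhs; rewrite /= => ->.
  by rewrite /GRing.scale /= andb_addl signr_addb; ring.
Qed.

End Products.

(** * Symmetric functionals, bilinearity and unit of the products *)

Section Symmetry.
Variables (k : fieldType) (U : superspace k).
Implicit Types (x y w : U) (p q e : bool) (xs : seq U) (hs : seq (bool * U)).
Implicit Types (phi psi : seq U -> k^o).

Lemma tauC p q x : tau p (tau q x) = tau q (tau p x).
Proof. by rewrite {2 3}/tau linearD linearZ /= !tau_hcomp. Qed.

Lemma taus_taus p q xs : map (tau p) (map (tau q) xs) = map (tau q) (map (tau p) xs).
Proof. by rewrite -!map_comp; apply: eq_map => x /=; rewrite tauC. Qed.

Lemma gsym_homog (R : lmodType k) (c : seq U -> R) : multilinear c ->
  (forall hs1 hs2 p q x y, hh hs1 -> hh hs2 -> homog p x -> homog q y ->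
    c (map snd hs1 ++ x :: y :: map snd hs2) =
      sg (p && q) *: c (map snd hs1 ++ y :: x :: map snd hs2)) ->
  gsymmetric c.
Proof.
move=> mc sc s1 s2 p q x y hx hy.
pose L s := fun s1 => c (s1 ++ [:: x, y & s]).
pose M s := fun s1 => sg (p && q) *: c (s1 ++ [:: y, x & s]).
apply: (@ml_ext _ _ _ (L s2) (M s2)) => [||hs1 hh1].
- exact: (ml_context [::] _ mc).
- apply: ml_scale; exact: (ml_context [::] _ mc).
apply: (@ml_ext _ _ _ (fun s2 => L s2 (map snd hs1)) (fun s2 => M s2 (map snd hs1))) => [||hs2 hh2].
- have := ml_context (map snd hs1 ++ [:: x; y]) [::] mc.
  by move=> m t1 t2 a u v; have := m t1 t2 a u v; rewrite /= !cats0 -!catA.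
- apply: ml_scale; have := ml_context (map snd hs1 ++ [:: y; x]) [::] mc.
  by move=> m t1 t2 a u v; have := m t1 t2 a u v; rewrite /= !cats0 -!catA.
exact: sc.
Qed.

Lemma gsym_cons (R : lmodType k) (c : seq U -> R) x :
  gsymmetric c -> gsymmetric (fun ys => c (x :: ys)).
Proof. by move=> sc s1 s2 p q y z hy hz; rewrite -!cat_cons (sc _ _ _ _ _ _ hy hz). Qed.

(* Moving a homogeneous argument across homogeneous ones. *)
Lemma gsym_move (R : lmodType k) (c : seq U -> R) s1 hs s2 p w : gsymmetric c ->
  homog p w -> hh hs ->
  c (s1 ++ map snd hs ++ w :: s2) =
    sg (p && tpar (map fst hs)) *: c (s1 ++ w :: map snd hs ++ s2).
Proof.
move=> sc hw; elim: hs s1 => [|[q x] hs IH] s1; first by rewrite /= andbF scale1r.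
rewrite hh_cons => -[hx hhs] /=.
have := IH (rcons s1 x) hhs; rewrite !cat_rcons => ->.
rewrite (sc _ _ _ _ _ _ hx hw) scalerA -signr_addb; congr (sg _ *: _).
by rewrite andb_addr addbC (andbC q).
Qed.

Lemma hmulZl t e (a : k) phi psi hs :
  hmul t e (fun ys => a * phi ys) psi hs = a * hmul t e phi psi hs.
Proof.
have := hmul_linl t e a phi (fun=> 0) psi hs; rewrite hmul0l addr0 => <-.
by apply: eq_hmul => // ys; rewrite addr0.
Qed.

Lemma hmulZr t e (a : k) phi psi hs :
  hmul t e phi (fun ys => a * psi ys) hs = a * hmul t e phi psi hs.
Proof.
have := hmul_linr t e a phi psi (fun=> 0) hs; rewrite hmul0r addr0 => <-.
by apply: eq_hmul => // ys; rewrite addr0.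
Qed.

Lemma hsmul_sym e phi psi hs1 hs2 p q x y : gsymmetric phi -> gsymmetric psi ->
  homog p x -> homog q y ->
  hsmul e phi psi (hs1 ++ (p, x) :: (q, y) :: hs2) =
   sg (p && q) * hsmul e phi psi (hs1 ++ (q, y) :: (p, x) :: hs2).
Proof.
move=> + + hx hy.
elim: hs1 e phi psi => [|[r z] hs1 IH] e phi psi sp ss /=; last first.
  rewrite !IH //; try exact: gsym_cons.
  by ring.
have -> : (fun ys => phi [:: x, y & ys]) = (fun ys => sg (p && q) * phi [:: y, x & ys]).
  by apply/funext => ys; rewrite (sp [::] _ _ _ _ _ hx hy).
have -> : (fun ys => psi [:: x, y & ys]) = (fun ys => sg (p && q) * psi [:: y, x & ys]).
  by apply/funext => ys; rewrite (ss [::] _ _ _ _ _ hx hy).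
have Zl := @hmulZl Sym; have Zr := @hmulZr Sym; rewrite /hmul in Zl Zr.
rewrite Zl Zr addbAC.
by case: p {hx}; case: q {hy}; case: e => /=; ring.
Qed.

Lemma fmul_Fhat t phi psi : Fhat t phi -> Fhat t psi -> Fhat t (fmul t phi psi).
Proof.
case: t => [[mp sp] [ms ss]|mp ms]; last exact: (@fmul_ml _ _ Tens).
have mm := @fmul_ml _ _ Sym _ _ mp ms; split => //.
apply: gsym_homog => // hs1 hs2 p q x y h1 h2 hx hy.
have E p1 x1 q1 y1 : homog p1 x1 -> homog q1 y1 ->
    fmul Sym phi psi ([seq h.2 | h <- hs1] ++ [:: x1, y1 & [seq h.2 | h <- hs2]]) =
    hsmul false phi psi (hs1 ++ (p1, x1) :: (q1, y1) :: hs2).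
  move=> hx1 hy1.
  rewrite -[in RHS]/(hmul Sym _ _ _ _) -fmul_homog ?map_cat //.
  by rewrite hh_cat !hh_cons.
by rewrite /fmul -/(fmul Sym) (E p x q y) // (E q y p x) // (hsmul_sym _ _ _ sp ss hx hy).
Qed.

Lemma Fhat_ml t phi : Fhat t phi -> multilinear phi.
Proof. by case: t => [[]|]. Qed.

Lemma Fhat_lin t (a : k) phi psi : Fhat t phi -> Fhat t psi ->
  Fhat t (fun ys => a * phi ys + psi ys).
Proof.
case: t => [[mp sp] [ms ss]|mp ms]; last exact: ml_linear.
split; first exact: ml_linear.
move=> s1 s2 p q x y hx hy.
by rewrite (sp _ _ _ _ _ _ hx hy) (ss _ _ _ _ _ _ hx hy) /GRing.scale /=; ring.
Qed.

Lemma Fhat0 t : Fhat t (fun _ : seq U => 0 : k^o).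
Proof.
have := @ml_zero k U k^o; case: t => // m; split => // s1 s2 p q x y _ _.
by rewrite scaler0.
Qed.

Lemma FhatZ t (a : k) phi : Fhat t phi -> Fhat t (fun ys => a * phi ys).
Proof.
move=> h; have := Fhat_lin a h (Fhat0 t).
by have -> : (fun ys => a * phi ys + (fun=> 0) ys) = (fun ys => a * phi ys)
  by apply/funext => ys; rewrite addr0.
Qed.

Lemma FhatD t phi psi : Fhat t phi -> Fhat t psi -> Fhat t (fun ys => phi ys + psi ys).
Proof.
move=> h1 h2; have := Fhat_lin 1 h1 h2.
by have -> : (fun ys => 1 * phi ys + psi ys) = (fun ys => phi ys + psi ys)
  by apply/funext => ys; rewrite mul1r.
Qed.

Lemma FhatB t (a : k) phi psi : Fhat t phi -> Fhat t psi ->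
  Fhat t (fun ys => phi ys - a * psi ys).
Proof.
move=> h1 h2; have := Fhat_lin (- a) h2 h1.
by have -> : (fun ys => - a * psi ys + phi ys) = (fun ys => phi ys - a * psi ys)
  by apply/funext => ys; rewrite mulNr addrC.
Qed.

Lemma Fhat_sum t I (r : seq I) (P : pred I) (F : I -> seq U -> k^o) :
  (forall i, P i -> Fhat t (F i)) -> Fhat t (fun ys => \sum_(i <- r | P i) F i ys).
Proof.
move=> hF; elim: r => [|i r IH].
  have -> : (fun ys => \sum_(i <- [::] | P i) F i ys) = (fun=> 0).
    by apply/funext => ys; exact: big_nil.
  exact: Fhat0.
have -> : (fun ys => \sum_(j <- i :: r | P j) F j ys) =
  (fun ys => if P i then F i ys + \sum_(j <- r | P j) F j ys else \sum_(j <- r | P j) F j ys).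
  by apply/funext => ys; exact: big_cons.
case Pi: (P i) => //; apply: FhatD => //; exact: hF.
Qed.

Lemma fmul_linl t (a : k) phi1 phi2 psi xs : Fhat t phi1 -> Fhat t phi2 -> Fhat t psi ->
  fmul t (fun ys => a * phi1 ys + phi2 ys) psi xs =
    a * fmul t phi1 psi xs + fmul t phi2 psi xs.
Proof.
move=> h1 h2 h; rewrite !fmulE; try exact: (Fhat_ml (t := t)).
  have -> : hsum (R := k^o) (hmul t false (fun ys => a * phi1 ys + phi2 ys) psi) xs =
      hsum (R := k^o) (fun hs => a *: (hmul t false phi1 psi hs : k^o) + hmul t false phi2 psi hs) xs.
    by apply: eq_hsum => hs _ _; exact: hmul_linl.
  by rewrite hsumD hsumZ.
exact/(@Fhat_ml t)/Fhat_lin.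
Qed.

Lemma fmul_linr t (a : k) phi psi1 psi2 xs : Fhat t phi -> Fhat t psi1 -> Fhat t psi2 ->
  fmul t phi (fun ys => a * psi1 ys + psi2 ys) xs =
    a * fmul t phi psi1 xs + fmul t phi psi2 xs.
Proof.
move=> h h1 h2; rewrite !fmulE; try exact: (Fhat_ml (t := t)).
  have -> : hsum (R := k^o) (hmul t false phi (fun ys => a * psi1 ys + psi2 ys)) xs =
      hsum (R := k^o) (fun hs => a *: (hmul t false phi psi1 hs : k^o) + hmul t false phi psi2 hs) xs.
    by apply: eq_hsum => hs _ _; exact: hmul_linr.
  by rewrite hsumD hsumZ.
exact/(@Fhat_ml t)/Fhat_lin.
Qed.

Definition unitf (xs : seq U) : k^o := if xs is [::] then 1 else 0.

Lemma unitf_ml : multilinear unitf.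
Proof. by move=> s1 s2 a x y; case: s1 => [|? ?] /=; rewrite scaler0 addr0. Qed.

Lemma unitf_Fhat t : Fhat t unitf.
Proof.
have m := unitf_ml; case: t => //; split => // s1 s2 p q x y _ _.
by case: s1 => [|? ?] /=; rewrite scaler0.
Qed.

Lemma unitf_fparity : fparity false unitf.
Proof. by case=> [|p ps] [|x xs]. Qed.

Lemma hmul1l t e psi hs : hmul t e unitf psi hs = sg (e && tpar (map fst hs)) * psi (map snd hs).
Proof.
case: t; rewrite /hmul; elim: hs e psi => [|[p x] hs IH] e psi /=; rewrite ?andbF ?mul1r //.
  by rewrite (@hmul0l _ _ Sym : forall e psi hs, hsmul e _ psi hs = 0) IH add0r mulrA -signr_addb -andb_addr.
by rewrite (@hmul0l _ _ Tens : forall e psi hs, htmul e _ psi hs = 0) addr0.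
Qed.

Lemma hmul1r t e phi hs : hmul t e phi unitf hs = phi (map snd hs).
Proof.
case: t; rewrite /hmul; elim: hs e phi => [|[p x] hs IH] e phi /=; rewrite ?mulr1 //.
  by rewrite (@hmul0r _ _ Sym : forall e psi hs, hsmul e psi _ hs = 0) IH mulr0 addr0.
by rewrite !mulr0 add0r IH.
Qed.

Lemma fmul1l t psi : multilinear psi -> fmul t unitf psi = psi.
Proof.
move=> m; apply/funext; apply: (@ml_ext _ _ k^o) => //; first exact: fmul_ml unitf_ml m.
by move=> hs hhs; rewrite fmul_homog ?hmul1l ?mul1r //; exact: unitf_ml.
Qed.

Lemma fmul1r t psi : multilinear psi -> fmul t psi unitf = psi.
Proof.
move=> m; apply/funext; apply: (@ml_ext _ _ k^o) => //; first exact: fmul_ml m unitf_ml.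
by move=> hs hhs; rewrite fmul_homog ?hmul1r //; exact: unitf_ml.
Qed.

Lemma fmul_nil t phi psi : multilinear phi -> multilinear psi ->
  fmul t phi psi [::] = phi [::] * psi [::].
Proof. by move=> mp ms; rewrite fmulE //; case: t. Qed.

(** On words where [phi] does not vanish the total parity is [q], so the twist reduces to one global
    sign. *)
Lemma eq_fparity_taus p q phi : multilinear phi -> fparity q phi ->
  (fun xs => phi (map (tau p) xs)) = (fun xs => sg (p && q) * phi xs).
Proof.
move=> m fp; apply/funext; apply: (@ml_ext _ _ k^o).
- exact: ml_map.
- exact: ml_scale.
move=> hs hhs; have := ml_taus p [::] m hhs; rewrite /= => ->.
have [->//|ne] := eqVneq (tpar (map fst hs)) q.
by rewrite (fp _ _ hhs ne) scaler0 mulr0.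
Qed.

End Symmetry.

(** * Constant vector fields: insertion of a vector *)

Section Insertion.
Variables (k : fieldType) (U : superspace k).
Implicit Types (x y w : U) (p q e b : bool) (xs : seq U) (hs : seq (bool * U)).
Implicit Types (phi psi : seq U -> k^o).

(* The derivation dual to the constant vector [w] of parity [p]. *)
Definition ins t p w (R : lmodType k) (c : seq U -> R) xs : R :=
  if t is Sym then c (w :: map (tau p) xs)
  else \sum_(i < (size xs).+1) c (take i xs ++ w :: map (tau p) (drop i xs)).

Arguments ins : simpl never.

Section Target.
Variable R : lmodType k.
Implicit Type c : seq U -> R.

Lemma ins_nil t p w c : ins t p w c [::] = c [:: w].
Proof. by case: t => //; rewrite /ins big_ord_recl big_ord0 addr0. Qed.

Lemma ins_Tens_cons p w c x xs : ins Tens p w c (x :: xs) =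
  c (w :: map (tau p) (x :: xs)) + ins Tens p w (fun ys => c (x :: ys)) xs.
Proof. by rewrite /ins big_ord_recl. Qed.

Lemma ins_lin t p w (a : k) c d xs :
  ins t p w (fun ys => a *: c ys + d ys) xs = a *: ins t p w c xs + ins t p w d xs.
Proof. by case: t => //; rewrite /ins big_split /= scaler_sumr. Qed.

Lemma ins_sum t p w I (r : seq I) (P : pred I) (c : I -> seq U -> R) xs :
  ins t p w (fun ys => \sum_(i <- r | P i) c i ys) xs = \sum_(i <- r | P i) ins t p w (c i) xs.
Proof. by case: t => //; rewrite /ins exchange_big. Qed.

Lemma insZ t p w (a : k) c xs : ins t p w (fun ys => a *: c ys) xs = a *: ins t p w c xs.
Proof. by case: t => //; rewrite /ins scaler_sumr. Qed.

Lemma ins_linw t p (a : k) x y c xs : multilinear c ->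
  ins t p (a *: x + y) c xs = a *: ins t p x c xs + ins t p y c xs.
Proof.
case: t => m; rewrite /ins; first by rewrite (m [::]).
by rewrite scaler_sumr -big_split; apply: eq_bigr => i _; rewrite m.
Qed.

Lemma ins_ml t p w c : multilinear c -> multilinear (ins t p w c).
Proof.
case: t => m.
  exact: (ml_map (tau p) (ml_cons w m)).
move=> s1 s2 a x y; elim: s1 c m => [|z s1 IH] c m.
  rewrite !cat0s !ins_Tens_cons /= linearP (m [:: w]).
  have -> : (fun ys => c (a *: x + y :: ys)) = (fun ys => a *: c (x :: ys) + c (y :: ys)).
    by apply/funext => ys; rewrite (m [::]).
  by rewrite (ins_lin Tens) scalerDr addrACA.
rewrite !cat_cons !ins_Tens_cons (IH (fun ys => c (z :: ys))); last exact: ml_cons.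
rewrite scalerDr addrACA; congr (_ + _).
exact: (ml_map (tau p) (ml_cons w m) (z :: s1)).
Qed.

Lemma ins_taus t p w d c : multilinear c -> homog p w -> 
  ins t p w (fun ys => c (map (tau d) ys)) = fun xs => sg (d && p) *: ins t p w c (map (tau d) xs).
Proof.
move=> m hw; apply/funext => xs; case: t; rewrite /ins /=.
  by rewrite (tau_homog _ hw) (mlZ [::]) // taus_taus.
rewrite size_map scaler_sumr; apply: eq_bigr => i _.
by rewrite map_cat /= (tau_homog _ hw) mlZ // taus_taus map_take map_drop.
Qed.

End Target.

Lemma ins_comp (R S : lmodType k) (f : {linear R -> S}) t p w (c : seq U -> R) xs :
  ins t p w (fun ys => f (c ys)) xs = f (ins t p w c xs).
Proof. by case: t => //; rewrite /ins linear_sum. Qed.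

Lemma ins_gsym (R : lmodType k) p w (c : seq U -> R) :
  multilinear c -> gsymmetric c -> gsymmetric (ins Sym p w c).
Proof.
move=> m s s1 s2 q r x y hx hy; rewrite /ins !map_cat /= -!cat_cons.
by apply: s; exact: homog_tau.
Qed.

Lemma ins_Fhat t p w phi : Fhat t phi -> Fhat t (ins t p w phi).
Proof.
case: t => [[m s]|m]; last exact: ins_ml.
by split; [exact: ins_ml | exact: ins_gsym].
Qed.

Lemma ins_fparity t p q w phi : homog p w -> fparity q phi ->
  fparity (p (+) q) (ins t p w phi).
Proof.
move=> hw fp ps xs /homogsP [hs [hhs -> ->]] ne {ps xs}.
have D h1 h2 : hs = h1 ++ h2 -> phi (map snd h1 ++ w :: map (tau p) (map snd h2)) = 0.
  move=> E; rewrite {}E in hhs ne; move: hhs; rewrite hh_cat => -[hh1 hh2].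
  have := hh_taus p hh2; set h3 := map _ h2 => hh3.
  have -> : map snd h1 ++ w :: map (tau p) (map snd h2) = map snd (h1 ++ (p, w) :: h3).
    by rewrite map_cat /= /h3 -!map_comp.
  apply: (fp (map fst (h1 ++ (p, w) :: h3))).
    by apply/hh_cat; split => //; apply/hh_cons.
  rewrite map_cat tpar_cat /= /h3 -map_comp.
  apply: contra_neq ne => <-; rewrite map_cat tpar_cat.
  rewrite (eq_map (_ : _ =1 fst)) //.
  by case: (tpar _); case: (tpar _); case: (p).
case: t; first exact: (D [::]).
rewrite /ins big1 // => i _; rewrite -map_take -map_drop.
by apply: D; rewrite cat_take_drop.
Qed.

Lemma gen_size (psi : {linear U -> k^o}) xs : size xs != 1%N -> gen psi xs = 0.
Proof. by case: xs => [|x [|y xs]]. Qed.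

(** A generator becomes a scalar. Every derivation kills scalars, and for this reason only one half
    of a commutator with [ins] is visible on generators. *)
Lemma ins_gen t p w (psi : {linear U -> k^o}) :
  ins t p w (gen psi) = fun xs => psi w * unitf xs.
Proof.
apply/funext => -[|x xs]; first by rewrite ins_nil /= mulr1.
rewrite /= mulr0; case: t; first by rewrite /ins gen_size.
rewrite /ins big1 // => i _; rewrite gen_size // size_cat /= size_map.
by rewrite addnS -size_cat cat_take_drop.
Qed.

Lemma gen_ml (psi : {linear U -> k^o}) : multilinear (gen psi).
Proof.
move=> [|z [|z' s1]] [|z'' s2] a x y /=; rewrite ?linearP //= ?scaler0 ?addr0 //.
Qed.

Lemma gen_Fhat t (psi : {linear U -> k^o}) : Fhat t (gen psi).
Proof.
have m := @gen_ml psi; case: t => //; split => // -[|z s1] s2 p q x y _ _ /=.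
  by rewrite scaler0.
by case: s1 => [|? ?] /=; rewrite scaler0.
Qed.

Definition hfun q (psi : {linear U -> k^o}) := forall x, homog (~~ q) x -> psi x = 0.

Lemma gen_fparity q (psi : {linear U -> k^o}) : hfun q psi -> fparity q (gen psi).
Proof.
move=> h [|p [|? ?]] [|x [|? ?]] //= [hx //] _ ne; apply: h.
by case: q p ne hx => [] [].
Qed.

Lemma hmul_taus t e d phi psi hs :
  hmul t e (fun ys => phi (map (tau d) ys)) (fun ys => psi (map (tau d) ys)) hs =
    hmul t e phi psi [seq (h.1, tau d h.2) | h <- hs].
Proof.
elim: hs e phi psi => [|[p x] hs IH] e phi psi; first by case: t.
case: t IH; rewrite /hmul => IH /=.
  by rewrite (IH _ (fun ys => phi (_ :: ys))) (IH _ _ (fun ys => psi (_ :: ys))).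
rewrite (IH _ (fun ys => phi (_ :: ys))); congr (sg _ * (_ * _) + _).
  by rewrite -map_comp.
by rewrite -!map_comp.
Qed.

(** The inserted [w] is the first letter of the word, so [hsmul] splits there into the two terms of
    the Leibniz rule. The twist on the other letters is distributed over the two factors by
    [hmul_taus] and then absorbed by the parity of [phi] and by [hmul_tau]. *)
Lemma smul_ins p q w phi psi xs : Fhat Sym phi -> Fhat Sym psi -> homog p w -> fparity q phi ->
  ins Sym p w (smul phi psi) xs =
    smul (ins Sym p w phi) psi xs + sg (p && q) * smul phi (ins Sym p w psi) xs.
Proof.
move=> hp hs hw fp.
have mp := Fhat_ml hp; have ms := Fhat_ml hs.
have i1 := Fhat_ml (ins_Fhat p w hp); have i2 := Fhat_ml (ins_Fhat p w hs).
move: xs; apply: (@ml_ext _ _ k^o) => [||hs0 hh0].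
- by apply: ins_ml; exact: (@fmul_ml _ _ Sym).
- apply: ml_add; first exact: (@fmul_ml _ _ Sym).
  by apply: ml_scale; exact: (@fmul_ml _ _ Sym).
have hh' := hh_taus p hh0; rewrite /ins.
have -> : w :: map (tau p) (map snd hs0) =
    map snd ((p, w) :: [seq (h.1, tau p h.2) | h <- hs0]) by rewrite /= -!map_comp.
have FH := @fmul_homog _ _ Sym; rewrite /fmul /hmul in FH.
have hh2 : hh ((p, w) :: [seq (h.1, tau p h.2) | h <- hs0]) by split.
rewrite FH // !FH //=.
have T := @hmul_taus Sym; rewrite /hmul in T.
have T2 := @hmul_tau _ _ Sym; rewrite /hmul in T2.
have Zl := @hmulZl _ _ Sym; rewrite /hmul in Zl.
rewrite -!T (eq_fparity_taus p mp fp) Zl; congr (_ + _).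
  by rewrite T2 ?addbb // ; exact: (ml_map (tau p) (ml_cons w mp)).
by rewrite mul1r.
Qed.

Lemma fmul0l t psi xs : Fhat t psi -> fmul t (fun=> 0) psi xs = 0.
Proof.
move=> h; rewrite fmulE; [|exact: (Fhat_ml (Fhat0 U t))|exact: Fhat_ml h].
rewrite -[RHS](hsum0 k^o xs); apply: eq_hsum => hs _ _; exact: hmul0l.
Qed.

Lemma fmul0r t phi xs : Fhat t phi -> fmul t phi (fun=> 0) xs = 0.
Proof.
move=> h; rewrite fmulE; [|exact: Fhat_ml h|exact: (Fhat_ml (Fhat0 U t))].
rewrite -[RHS](hsum0 k^o xs); apply: eq_hsum => hs _ _; exact: hmul0r.
Qed.

Lemma fmulZl t (a : k) phi psi xs : Fhat t phi -> Fhat t psi ->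
  fmul t (fun ys => a * phi ys) psi xs = a * fmul t phi psi xs.
Proof.
move=> h1 h2; have := fmul_linl a xs h1 (Fhat0 U t) h2; rewrite fmul0l // addr0 => <-.
by congr fmul; apply/funext => ys; rewrite addr0.
Qed.

Lemma fmulZr t (a : k) phi psi xs : Fhat t phi -> Fhat t psi ->
  fmul t phi (fun ys => a * psi ys) xs = a * fmul t phi psi xs.
Proof.
move=> h1 h2; have := fmul_linr a xs h1 h2 (Fhat0 U t); rewrite fmul0r // addr0 => <-.
by congr fmul; apply/funext => ys; rewrite addr0.
Qed.

Lemma fmulDl t phi1 phi2 psi xs : Fhat t phi1 -> Fhat t phi2 -> Fhat t psi ->
  fmul t (fun ys => phi1 ys + phi2 ys) psi xs = fmul t phi1 psi xs + fmul t phi2 psi xs.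
Proof.
move=> h1 h2 h; have := fmul_linl 1 xs h1 h2 h; rewrite mul1r => <-.
by congr fmul; apply/funext => ys; rewrite mul1r.
Qed.

Lemma tmul_cons phi psi p x xs : multilinear phi -> multilinear psi -> homog p x ->
  tmul phi psi (x :: xs) = phi [::] * psi (x :: xs)
    + tmul (fun ys => phi (x :: ys)) (fun ys => psi (map (tau p) ys)) xs.
Proof.
move=> mp ms hx; have mt := ml_map (tau p) ms; have mc := ml_cons x mp.
move: xs; apply: (@ml_ext _ _ k^o) => [||hs hhs].
- by apply: ml_cons; exact: (@fmul_ml _ _ Tens).
- apply: ml_add; first exact/ml_scale/ml_cons.
  exact: (@fmul_ml _ _ Tens).
have := @fmul_homog _ _ Tens phi psi ((p, x) :: hs) mp ms.
rewrite /fmul /= => -> //; rewrite mul1r; congr (_ + _).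
have := @fmul_homog _ _ Tens _ _ hs mc mt; rewrite /fmul => -> //.
by rewrite hmul_tau.
Qed.

Lemma tmul_nil phi psi : multilinear phi -> multilinear psi ->
  tmul phi psi [::] = phi [::] * psi [::].
Proof. exact: (@fmul_nil _ _ Tens). Qed.

Lemma fparity_cons p q x phi : homog p x -> fparity q phi ->
  fparity (p (+) q) (fun ys => phi (x :: ys)).
Proof.
move=> hx fp ps xs hps ne; apply: (fp (p :: ps)) => //=.
by apply: contra_neq ne => <-; rewrite addbA addbb.
Qed.

(** Induction on the word with [phi] and [psi] varying: removing a first letter [x] replaces [phi]
    by [phi (x :: _)], whose parity is shifted by that of [x], and twists [psi]. Insertions in front
    of [x] are treated separately, by [E]. *)
Lemma tmul_ins p q w phi psi xs : multilinear phi -> multilinear psi -> homog p w ->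
  fparity q phi ->
  ins Tens p w (tmul phi psi) xs =
    tmul (ins Tens p w phi) psi xs + sg (p && q) * tmul phi (ins Tens p w psi) xs.
Proof.
move=> + + hw fp; move: xs phi psi q fp.
suff H hs phi psi q : fparity q phi -> multilinear phi -> multilinear psi -> hh hs ->
    ins Tens p w (tmul phi psi) (map snd hs) = tmul (ins Tens p w phi) psi (map snd hs)
      + sg (p && q) * tmul phi (ins Tens p w psi) (map snd hs).
  move=> xs phi psi q fp mp ms; move: xs; apply: (@ml_ext _ _ k^o).
  - by apply: ins_ml; exact: (@fmul_ml _ _ Tens).
  - apply: ml_add; first exact: (@fmul_ml _ _ Tens _ _ (ins_ml Tens p w mp) ms).
    by apply: ml_scale; exact: (@fmul_ml _ _ Tens _ _ mp (ins_ml Tens p w ms)).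
  by move=> hs; exact: H.
elim: hs phi psi q => [|[r x] hs IH] phi psi q fp mp ms hhs.
  have mi := ins_ml Tens p w mp; have mj := ins_ml Tens p w ms.
  have mcw := ml_cons w mp; have mtp := ml_map (tau p) ms.
  rewrite /= ins_nil (@tmul_cons _ _ p) // !tmul_nil // !ins_nil addrC; congr (_ + _).
  have [->|ne] := eqVneq q false; first by rewrite andbF mul1r.
  by rewrite (fp [::] [::]) 1?eq_sym // !mul0r mulr0.
have [hx hhs'] : homog r x /\ hh hs by [].
rewrite [map _ _]/= ins_Tens_cons.
have mi := ins_ml Tens p w mp; have mj := ins_ml Tens p w ms.
have mt := ml_map (tau r) ms; have mc := ml_cons x mp.
have mcw := ml_cons w mp; have mtp := ml_map (tau p) ms.
have mcwt := ml_map (tau p) mcw.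
have htx : homog r (tau p x) by exact: homog_tau.
have E xs : tmul phi psi (w :: map (tau p) xs) =
    phi [::] * psi (w :: map (tau p) xs) +
    tmul (fun ys => phi (w :: map (tau p) ys)) psi xs.
  rewrite (@tmul_cons _ _ p) //; congr (_ + _); move: xs; apply: (@ml_ext _ _ k^o).
  - exact: (ml_map (tau p) (@fmul_ml _ _ Tens _ _ mcw mtp)).
  - exact: (@fmul_ml _ _ Tens).
  move=> h hhh; have hht := hh_taus p hhh.
  have -> : map (tau p) (map snd h) = map snd [seq (h.1, tau p h.2) | h <- h] by rewrite -!map_comp.
  have FH := @fmul_homog _ _ Tens; rewrite /fmul /hmul in FH.
  have T := @hmul_taus Tens; rewrite /hmul in T.
  have T2 := @hmul_tau _ _ Tens; rewrite /hmul in T2.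
  by rewrite !FH // -T (T2 _ _ _ _ _ (fun ys => psi (map (tau p) ys))) // T2 // addbb.
rewrite E (@tmul_cons _ psi r) //.
have -> : (fun ys => tmul phi psi (x :: ys)) = (fun ys => phi [::] *: (psi (x :: ys) : k^o)
    + tmul (fun ys => phi (x :: ys)) (fun ys => psi (map (tau r) ys)) ys).
  by apply/funext => ys; rewrite (@tmul_cons _ _ r).
rewrite ins_lin (IH _ _ (r (+) q)) //; last exact: fparity_cons.
rewrite (@tmul_cons _ _ r) // (@tmul_cons phi _ r) // !ins_Tens_cons ins_nil.
rewrite (ins_taus _ r ms hw).
have -> : (fun ys => ins Tens p w phi (x :: ys)) = (fun ys => phi (w :: map (tau p) (x :: ys))
   + ins Tens p w (fun ys => phi (x :: ys)) ys).
  by apply/funext => ys; rewrite ins_Tens_cons.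
have Dl := @fmulDl Tens; have Zr := @fmulZr Tens; rewrite /fmul in Dl Zr.
rewrite Dl //; [|exact: (ml_cons x mcwt)|exact: (ins_ml Tens p w mc)].
rewrite Zr //; last exact: (ml_map (tau r) mj).
(* Only an even functional has a value on the empty word, so the sign has no effect there. *)
have Q : sg (p && q) * phi [::] = phi [::].
  have [->|ne] := eqVneq q false; first by rewrite andbF mul1r.
  by rewrite (fp [::] [::]) 1?eq_sym // mulr0.
have -> (z : k) : sg (p && (r (+) q)) * (sg (r && p) * z) = sg (p && q) * z.
  by rewrite mulrA -signr_addb andb_addr (andbC r) addbAC addbb.
rewrite [in RHS]mulrDr [sg (p && q) * (phi [::] * _)]mulrA Q /= /GRing.scale /=.
ring.
Qed.

Lemma fmul_ins t p q w phi psi xs : Fhat t phi -> Fhat t psi -> homog p w -> fparity q phi ->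
  ins t p w (fmul t phi psi) xs =
    fmul t (ins t p w phi) psi xs + sg (p && q) * fmul t phi (ins t p w psi) xs.
Proof. by case: t => hp hs hw fp; [exact: smul_ins | exact: tmul_ins]. Qed.


End Insertion.

(** * The Lie superalgebra of derivations *)

Section Derivations.
Variables (k : fieldType) (U : superspace k).
Implicit Types (x y w : U) (p q e b : bool) (xs : seq U) (hs : seq (bool * U)).
Implicit Types (phi psi : seq U -> k^o) (D E : operator U).

(** The part of being a derivation that survives composition; products of derivations are only
    operators of this kind. *)
Record linop (t : ftype) D : Prop := Linop {
  lin_stable : forall phi, Fhat t phi -> Fhat t (D phi);
  lin_linear : forall (a : k) phi psi, Fhat t phi -> Fhat t psi ->
    D (fun ys => a * phi ys + psi ys) = fun xs => a * D phi xs + D psi xs }.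

Lemma der_linop t b D : derivation t b D -> linop t D.
Proof.
case=> h1 h2 _ _ _; split=> // a phi psi hp hs; apply/funext => xs; exact: h2.
Qed.

Section Linop.
Variables (t : ftype) (D : operator U).
Hypothesis hD : linop t D.

Lemma lin0 : D (fun=> 0) = fun=> 0.
Proof.
have := lin_linear hD (-1) (Fhat0 U t) (Fhat0 U t).
have -> : (fun ys : seq U => -1 * (fun=> 0 : k^o) ys + (fun=> 0) ys) = (fun=> 0).
  by apply/funext => ys; rewrite mulr0 addr0.
by move=> ->; apply/funext => xs; rewrite mulN1r addNr.
Qed.

Lemma linZ (a : k) phi : Fhat t phi -> D (fun ys => a * phi ys) = fun xs => a * D phi xs.
Proof.
move=> h; have := lin_linear hD a h (Fhat0 U t); rewrite lin0.
have -> : (fun ys => a * phi ys + (fun=> 0 : k^o) ys) = (fun ys => a * phi ys).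
  by apply/funext => ys; rewrite addr0.
by move=> ->; apply/funext => xs; rewrite addr0.
Qed.

Lemma linD phi psi : Fhat t phi -> Fhat t psi ->
  D (fun ys => phi ys + psi ys) = fun xs => D phi xs + D psi xs.
Proof.
move=> h1 h2; have := lin_linear hD 1 h1 h2.
have -> : (fun ys => 1 * phi ys + psi ys) = (fun ys => phi ys + psi ys).
  by apply/funext => ys; rewrite mul1r.
by move=> ->; apply/funext => xs; rewrite mul1r.
Qed.

Lemma linB (a : k) phi psi : Fhat t phi -> Fhat t psi ->
  D (fun ys => phi ys - a * psi ys) = fun xs => D phi xs - a * D psi xs.
Proof.
move=> h1 h2; have := lin_linear hD (- a) h2 h1.
have -> : (fun ys => - a * psi ys + phi ys) = (fun ys => phi ys - a * psi ys).
  by apply/funext => ys; rewrite mulNr addrC.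
by move=> ->; apply/funext => xs; rewrite mulNr addrC.
Qed.

Lemma lin_sum I (r : seq I) (P : pred I) (F : I -> seq U -> k^o) :
  (forall i, P i -> Fhat t (F i)) ->
  D (fun ys => \sum_(i <- r | P i) F i ys) = fun xs => \sum_(i <- r | P i) D (F i) xs.
Proof.
move=> hF; elim: r => [|i r IH].
  have -> : (fun ys => \sum_(i <- [::] | P i) F i ys) = (fun=> 0).
    by apply/funext => ys; exact: big_nil.
  by rewrite lin0; apply/funext => xs; rewrite big_nil.
have -> : (fun ys => \sum_(j <- i :: r | P j) F j ys) =
  (fun ys => if P i then F i ys + \sum_(j <- r | P j) F j ys else \sum_(j <- r | P j) F j ys).
  by apply/funext => ys; exact: big_cons.
case Pi: (P i); last by rewrite IH; apply/funext => xs; rewrite big_cons Pi.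
rewrite linD ?IH; [|exact: hF|exact: Fhat_sum].
by apply/funext => xs; rewrite big_cons Pi.
Qed.

End Linop.

Lemma linop_ins t p w : linop t (@ins k U t p w k^o).
Proof.
split=> [phi|a phi psi _ _]; first exact: ins_Fhat.
by apply/funext => xs; exact: (ins_lin (R := k^o)).
Qed.

Lemma derivation_ins t p w : homog p w -> derivation t p (@ins k U t p w k^o).
Proof.
move=> hw; split.
- by move=> phi; exact: ins_Fhat.
- by move=> a phi psi _ _ xs; exact: (ins_lin (R := k^o)).
- by move=> q phi _; exact: ins_fparity.
- by move=> q phi psi hp hs fp xs; exact: fmul_ins.
move=> xs; case: t.
  by exists [:: w :: map (tau p) xs] => phi _ H; apply: H; rewrite inE.
exists [seq take i xs ++ w :: map (tau p) (drop i xs) | i <- iota 0 (size xs).+1] => phi _ H.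
rewrite /ins big1 // => i _; apply: H; apply/mapP; exists (val i) => //.
by rewrite mem_iota /= ltn_ord.
Qed.

Lemma linop_scomm t p q D E : linop t D -> linop t E -> linop t (scomm p q D E).
Proof.
move=> hD hE; split=> [phi h|a phi psi hp hs].
  by apply: FhatB; [apply: lin_stable => //; apply: lin_stable | apply: lin_stable => //; apply: lin_stable].
have a1 := lin_stable hD hp; have a2 := lin_stable hD hs.
have b1 := lin_stable hE hp; have b2 := lin_stable hE hs.
apply/funext => xs; rewrite /scomm (lin_linear hE) // (lin_linear hD) //.
by rewrite (lin_linear hD) // (lin_linear hE) //; ring.
Qed.

Lemma derivation_scomm t p q D E : derivation t p D -> derivation t q E ->
  derivation t (p (+) q) (scomm p q D E).
Proof.
move=> dD dE; have lD := der_linop dD; have lE := der_linop dE.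
have lc := linop_scomm p q lD lE.
have sD := lin_stable lD; have sE := lin_stable lE.
split.
- exact: lin_stable.
- by move=> a phi psi hp hs xs; rewrite (lin_linear lc).
- move=> r phi hp fp ps xs hps ne; rewrite /scomm.
  rewrite (der_parity dD (sE _ hp) (der_parity dE hp fp) hps); last by rewrite addbA.
  rewrite (der_parity dE (sD _ hp) (der_parity dD hp fp) hps); last by rewrite addbA (addbC q).
  by rewrite mulr0 subrr.
- move=> r phi psi hp hs fp xs; rewrite /scomm.
  have fE := der_parity dE hp fp; have fD := der_parity dD hp fp.
  have -> : E (fmul t phi psi) = fun ys => fmul t (E phi) psi ys + sg (q && r) * fmul t phi (E psi) ys.
    by apply/funext => ys; rewrite (der_mul dE hp hs fp).
  have -> : D (fmul t phi psi) = fun ys => fmul t (D phi) psi ys + sg (p && r) * fmul t phi (D psi) ys.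
    by apply/funext => ys; rewrite (der_mul dD hp hs fp).
  have F1 := fmul_Fhat (sE _ hp) hs; have F2 := fmul_Fhat hp (sE _ hs).
  have F3 := fmul_Fhat (sD _ hp) hs; have F4 := fmul_Fhat hp (sD _ hs).
  rewrite (linD lD) ?(linZ lD) //; last exact: FhatZ.
  rewrite (linD lE) ?(linZ lE) //; last exact: FhatZ.
  rewrite (der_mul dD _ _ fE) // ?(der_mul dD _ _ fp) //; try exact: sE.
  rewrite (der_mul dE _ _ fD) // ?(der_mul dE _ _ fp) //; try exact: sD.
  have := fmul_linl (- sg (p && q)) xs (sE _ (sD _ hp)) (sD _ (sE _ hp)) hs.
  have -> : (fun ys => - sg (p && q) * E (D phi) ys + D (E phi) ys) =
     (fun ys => D (E phi) ys - sg (p && q) * E (D phi) ys).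
    by apply/funext => ys; rewrite mulNr addrC.
  move=> ->.
  have := fmul_linr (- sg (p && q)) xs hp (sE _ (sD _ hs)) (sD _ (sE _ hs)).
  have -> : (fun ys => - sg (p && q) * E (D psi) ys + D (E psi) ys) =
     (fun ys => D (E psi) ys - sg (p && q) * E (D psi) ys).
    by apply/funext => ys; rewrite mulNr addrC.
  move=> ->.
  rewrite !andb_addr !andb_addl !signr_addb.
  by case: p {dD fD lD lc sD F3 F4}; case: q {dE fE lE sE F1 F2}; case: r {fp}; rewrite /= ?expr0 ?expr1; ring.
move=> xs.
(* For every word choose a finite set of words that controls the value there. The value of a
   composite is controlled by the union of the sets of the inner operator over the set of the outer
   one. *)
have [f Hf] := choice (der_continuous dD).
have [g Hg] := choice (der_continuous dE).
exists (flatten (map g (f xs)) ++ flatten (map f (g xs))) => phi hp H.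
have z1 : D (E phi) xs = 0.
  apply: Hf; first exact: sE.
  move=> ys hys; apply: Hg => // zs hzs; apply: H; rewrite mem_cat; apply/orP; left.
  by apply/flattenP; exists (g ys) => //; exact: map_f.
have z2 : E (D phi) xs = 0.
  apply: Hg; first exact: sD.
  move=> ys hys; apply: Hf => // zs hzs; apply: H; rewrite mem_cat; apply/orP; right.
  by apply/flattenP; exists (f ys) => //; exact: map_f.
by rewrite /scomm z1 z2 mulr0 subrr.
Qed.

Lemma linop_lin t (a : k) D E : linop t D -> linop t E ->
  linop t (fun phi xs => a * D phi xs + E phi xs).
Proof.
move=> hD hE; split=> [phi h|c phi psi hp hs].
  by apply: Fhat_lin; exact: lin_stable.
by apply/funext => xs; rewrite (lin_linear hD) // (lin_linear hE) //; ring.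
Qed.

Lemma derivation_lin t b (a : k) D E : derivation t b D -> derivation t b E ->
  derivation t b (fun phi xs => a * D phi xs + E phi xs).
Proof.
move=> dD dE; have lD := der_linop dD; have lE := der_linop dE.
have lc := linop_lin a lD lE; have sD := lin_stable lD; have sE := lin_stable lE.
split.
- exact: (lin_stable lc).
- by move=> c phi psi hp hs xs; have /(congr1 (@^~ xs)) := lin_linear lc c hp hs.
- move=> r phi hp fp ps xs hps ne.
  by rewrite (der_parity dD hp fp hps) // (der_parity dE hp fp hps) // mulr0 addr0.
- move=> r phi psi hp hs fp xs; rewrite (der_mul dD _ _ fp) // (der_mul dE _ _ fp) //.
  rewrite (fmul_linl a xs (sD _ hp) (sE _ hp) hs) (fmul_linr a xs hp (sD _ hs) (sE _ hs)).
  by ring.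
move=> xs; case: (der_continuous dD xs) => L1 H1; case: (der_continuous dE xs) => L2 H2.
exists (L1 ++ L2) => phi hp H.
rewrite H1 ?H2 ?mulr0 ?addr0 // => ys hys; apply: H; rewrite mem_cat hys ?orbT //.
Qed.


Lemma der_unit t b D : derivation t b D -> D (@unitf k U) = fun=> 0.
Proof.
move=> dD; have hu := @unitf_Fhat k U t; have mu := @unitf_ml k U.
apply/funext => xs; have := der_mul dD hu hu (@unitf_fparity k U) xs.
have hD := der_stable dD hu.
rewrite fmul1r // (fmul1r _ (Fhat_ml hD)) (fmul1l _ (Fhat_ml hD)) andbF mul1r.
by move/eqP; rewrite -subr_eq0 opprD addrA subrr sub0r oppr_eq0 => /eqP.
Qed.

End Derivations.

(** * Linear functionals separate vectors *)

Section Functionals.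
Variables (k : fieldType) (W : lmodType k).

Section Build.
Variables (R : lmodType k) (f : W -> R) (Hf : linear f).
Definition mklin : {linear W -> R} := HB.pack f (GRing.isLinear.Build k W R *:%R f Hf).
End Build.

(* A maximal subspace avoiding [v] is a hyperplane complementary to [v]. *)
Lemma separating_functional (v : W) : v != 0 -> exists psi : {linear W -> k^o}, psi v = 1.
Proof.
move=> v0.
pose P (A : W -> Prop) := (forall a x y, A x -> A y -> A (a *: x + y)) /\ ~ A v.
have [|M [[Mlin Mv] Mmax]] := @classical_sets.Zorn_bigcup W P.
  move=> F FP Ftot; split.
    move=> a x y [A FA Ax] [B FB By]; case: (Ftot _ _ FA FB) => AB.
      by exists B => //; have [BP _] := FP _ FB; apply: BP => //; exact: AB.
    by exists A => //; have [AP _] := FP _ FA; apply: AP => //; exact: AB.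
  by case=> A FA Av; have [_] := FP _ FA; apply.
have M0 : M 0.
  (* The empty set also satisfies [P]. If 0 is not in [M] then [M] is empty, and the zero subspace
     is larger. *)
  apply: contrapT => nM0; apply: (Mmax (fun x => x = 0)).
    split; last by move=> h; apply: nM0; exact: h.
    move=> x Mx; exfalso; apply: nM0.
    by have := Mlin (-1) _ _ Mx Mx; rewrite scaleN1r addNr.
  split=> [a x y -> ->|]; first by rewrite scaler0 addr0.
  exact/eqP.
have MZ a x : M x -> M (a *: x) by move=> Mx; have := Mlin a _ _ Mx M0; rewrite addr0.
have MD x y : M x -> M y -> M (x + y) by move=> Mx My; have := Mlin 1 _ _ Mx My; rewrite scale1r.
(* If [x] is not in [M], the span of [M] and [x] is strictly larger, so by maximality it contains
   [v]; solving for [x] gives its class modulo [M] as a multiple of [v]. *)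
have ex x : exists a : k^o, M (x - a *: v).
  have [Mx|nMx] := pselect (M x); first by exists 0; rewrite scale0r subr0.
  pose M' y := exists m c, M m /\ y = m + c *: x.
  have : ~ P M'.
    apply: Mmax; split.
      by move=> y My; exists y, 0; rewrite scale0r addr0.
    move=> h; apply: nMx; apply: h.
    by exists 0, 1; rewrite add0r scale1r.
  move/not_andP; case.
    move=> nl; exfalso; apply: nl => a y z [m [c [Mm ->]]] [m' [c' [Mm' ->]]].
    exists (a *: m + m'), (a * c + c'); split; first exact: Mlin.
    by rewrite scalerDr scalerA scalerDl addrACA.
  move/contrapT => [m [c [Mm Ev]]].
  have c0 : c != 0.
    by apply: contra_notN Mv => /eqP c0; rewrite Ev c0 scale0r addr0.
  exists c^-1; have -> : x - c^-1 *: v = (- c^-1) *: m.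
    by rewrite Ev scalerDr scalerA mulVf // scale1r opprD addrCA subrr addr0 scaleNr.
  exact: MZ.
have [f Hf] := choice ex.
have uniq x a : M (x - a *: v) -> a = f x.
  move=> Ma; apply/eqP; rewrite -subr_eq0; apply: contra_notT Mv => ne.
  have := MD _ _ (Hf x) (MZ (-1) _ Ma).
  rewrite scaleN1r opprB addrC addrA subrK -scalerBl => /(MZ (a - f x)^-1).
  by rewrite scalerA mulVf // scale1r.
have fl : linear f.
  move=> a x y; apply/esym/uniq.
  have := Mlin a _ _ (Hf x) (Hf y).
  rewrite scalerBr scalerA addrACA -opprD -scalerDl; exact.
exists (mklin fl) => /=; apply/esym/uniq.
by rewrite scale1r subrr.
Qed.

End Functionals.

(** * Density of polynomials and extension of derivations from generators *)

Section Density.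
Variables (k : fieldType) (char0 : [pchar k] =i pred0) (U : superspace k).
Implicit Types (x y w : U) (p q e b : bool) (xs : seq U) (hs : seq (bool * U)).
Implicit Types (phi psi : seq U -> k^o).

Lemma natr_neq0 n : n.+1%:R != 0 :> k.
Proof. by have /pcharf0P -> := char0. Qed.

Lemma hfun_sep q x : homog q x -> x != 0 ->
  exists2 psi : {linear U -> k^o}, hfun q psi & psi x = 1.
Proof.
move=> hx /separating_functional [psi psix].
exists (psi \o hcomp U q)%FUN => [y hy|] /=.
  by rewrite (hcomp_homog _ hy); case: q {hx hy} => /=; rewrite linear0.
by rewrite hx.
Qed.

Lemma eq_by_functionals x y :
  (forall q (psi : {linear U -> k^o}), hfun q psi -> psi x = psi y) -> x = y.
Proof.
move=> H; apply/eqP; rewrite -subr_eq0 -(sum_hcomp (x - y)) big_bool /=.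
suff Z q : hcomp U q (x - y) = 0 by rewrite !Z addr0.
apply/eqP; apply: contrapT => /negP /(hfun_sep (homog_hcomp q _)) [psi hpsi].
have z := hpsi _ (homog_hcomp (~~ q) (x - y)).
have : psi (hcomp U q (x - y)) = psi (x - y).
  rewrite -[LHS]addr0 -z -linearD; congr (psi _).
  by case: (q); rewrite ?hcomp_sum // addrC hcomp_sum.
move=> ->; rewrite linearB (H _ _ hpsi) subrr => /eqP.
by rewrite eq_sym oner_eq0.
Qed.

Lemma tauK p x : tau p (tau p x) = x.
Proof.
rewrite {2}/tau linearD linearZ /= !(tau_homog _ (homog_hcomp _ _)) andbF andbT.
rewrite scalerA -signr_addb addbb !scale1r.
exact: hcomp_sum.
Qed.

(** A finite-rank operator with an explicit factorisation into homogeneous vectors and functionals: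
    composed with it, a functional of fixed degree becomes a polynomial in these functionals. *)
Definition fproj (s : seq (bool * (U * {linear U -> k^o}))) x : U :=
  \sum_(t <- s) t.2.2 x *: t.2.1.

Fact fproj_linear s : linear (fproj s).
Proof.
move=> a x y; rewrite /fproj scaler_sumr -big_split; apply: eq_bigr => t _ /=.
by rewrite linearP scalerDl scalerA.
Qed.
HB.instance Definition _ s := GRing.isLinear.Build k U U _ (fproj s) (fproj_linear s).

Definition hproj (s : seq (bool * (U * {linear U -> k^o}))) := 
  forall t, List.In t s -> homog t.1 t.2.1 /\ hfun t.1 t.2.2.

Lemma fproj_cons t s x : fproj (t :: s) x = t.2.2 x *: t.2.1 + fproj s x.
Proof. by rewrite /fproj big_cons. Qed.

Lemma fproj_homog s p x : hproj s -> homog p x -> homog p (fproj s x).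
Proof.
elim: s => [|t s IH] hs hx; first by rewrite /fproj big_nil; exact: homog0.
rewrite fproj_cons; apply: homogD; last by apply: IH => // u hu; apply: hs; right.
have [ht hf] := hs t (or_introl erefl).
have [<-|ne] := eqVneq t.1 p; first exact: homogZ.
rewrite hf ?scale0r; first exact: homog0.
by case: (t.1) (p) ne hx => [] [].
Qed.

Lemma fproj_hcomp s q x : hproj s -> hcomp U q (fproj s x) = fproj s (hcomp U q x).
Proof.
move=> hs; rewrite -{1}(hcomp_sum x) !linearD /=.
rewrite !(hcomp_homog q (fproj_homog hs (homog_hcomp _ x))).
by case: q; rewrite /= ?addr0 ?add0r.
Qed.

Lemma fproj_tau s p x : hproj s -> tau p (fproj s x) = fproj s (tau p x).
Proof. by move=> hs; rewrite /tau linearD linearZ /= !fproj_hcomp. Qed.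

Definition fproj_idem s := forall t, List.In t s -> fproj s t.2.1 = t.2.1.

Lemma fproj_fix s r x : (forall t, List.In t r -> fproj s t.2.1 = t.2.1) ->
  fproj s (fproj r x) = fproj r x.
Proof.
elim: r => [|t r IH] h; first by rewrite (_ : fproj [::] x = 0) ?linear0 //; exact: big_nil.
rewrite !(fproj_cons _ r) linearD linearZ /= h ?IH //; last by left.
by move=> u hu; apply: h; right.
Qed.

(** If the projection does not fix [v], a rank-one projection onto the remainder [v - fproj s v] is
    added. *)
Lemma fproj_extend s p v : hproj s -> fproj_idem s -> homog p v ->
  exists s', [/\ hproj s', fproj_idem s', fproj s' v = v &
    forall y, fproj s y = y -> fproj s' y = y].
Proof.
move=> hs idm hv; have PP x := fproj_fix x idm.
have [v0|v0] := eqVneq (v - fproj s v) 0.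
  exists s; split=> //; apply/esym/eqP; by rewrite -subr_eq0 v0.
pose v' := v - fproj s v.
have Pv' : fproj s v' = 0 by rewrite /v' linearB /= PP subrr.
have hv' : homog p v'.
  by apply: homogD => //; rewrite -scaleN1r; apply/homogZ/fproj_homog.
have [psi hpsi psi1] := hfun_sep hv' v0.
(* Precomposing [psi] with the complementary projection makes it vanish on all vectors already
   fixed, so that these stay fixed. *)
have fl : linear (fun x => psi (x - fproj s x)).
  by move=> a x y; rewrite linearP opprD addrACA -scalerBr linearP.
pose psi' := mklin fl.
have psi'E x : psi' x = psi (x - fproj s x) by [].
have psi'0 y : fproj s y = y -> psi' y = 0 by move=> Py; rewrite psi'E Py subrr linear0.
exists ((p, (v', psi')) :: s).
have C y : fproj ((p, (v', psi')) :: s) y = psi' y *: v' + fproj s y := fproj_cons _ _ _.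
have fix1 y : fproj s y = y -> fproj ((p, (v', psi')) :: s) y = y.
  by move=> Py; rewrite C psi'0 // scale0r add0r.
split => //.
- move=> t [<-|/hs //]; split => // x hx; rewrite [LHS]psi'E hpsi //.
  by apply: homogD => //; rewrite -scaleN1r; apply/homogZ/fproj_homog.
- move=> t [<-|ht]; last by apply: fix1; exact: idm.
  by rewrite C psi'E /= Pv' addr0 subr0 psi1 scale1r.
by rewrite C psi'E -/v' psi1 scale1r subrK.
Qed.

Lemma fproj_exists (L : seq U) : exists s,
  [/\ hproj s, fproj_idem s & forall x, x \in L -> fproj s x = x].
Proof.
elim: L => [|x L [s [h1 h2 h3]]]; first by exists [::]; split=> // t [] .
have [s1 [h11 h12 h13 h14]] := fproj_extend h1 h2 (homog_hcomp false x).
have [s2 [h21 h22 h23 h24]] := fproj_extend h11 h12 (homog_hcomp true x).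
exists s2; split=> // y; rewrite inE => /orP [/eqP ->|yL]; last first.
  by apply: h24; apply: h14; exact: h3.
by rewrite -{1 2}(hcomp_sum x) linearD /= h23 (h24 _ h13).
Qed.

(** The polynomials, built by left multiplication with homogeneous generators, so that a statement
    about derivations is proved by induction with one application of the Leibniz rule per step. *)
Inductive galg t : (seq U -> k^o) -> Prop :=
| galg_unit : galg t (@unitf k U)
| galg_zero : galg t (fun=> 0)
| galg_lin (a : k) phi psi : galg t phi -> galg t psi ->
    galg t (fun ys => a * phi ys + psi ys)
| galg_mul q (psi : {linear U -> k^o}) phi : hfun q psi -> galg t phi ->
    galg t (fmul t (gen psi) phi).

Lemma galg_Fhat t phi : galg t phi -> Fhat t phi.
Proof.
elim=> [||a phi1 phi2 _ h1 _ h2|q psi phi1 _ _ h].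
- exact: unitf_Fhat.
- exact: Fhat0.
- exact: Fhat_lin.
- apply: fmul_Fhat => //; exact: gen_Fhat.
Qed.

Lemma smul_nil phi psi : multilinear phi -> multilinear psi ->
  smul phi psi [::] = phi [::] * psi [::].
Proof. exact: (@fmul_nil _ _ Sym). Qed.

Lemma smul_cons phi psi p x xs : multilinear phi -> multilinear psi -> homog p x ->
  smul phi psi (x :: xs) =
    smul (fun ys => phi (x :: ys)) (fun ys => psi (map (tau p) ys)) xs
    + smul phi (fun ys => psi (x :: ys)) xs.
Proof.
move=> mp ms hx; have mt := ml_map (tau p) ms; have mc := ml_cons x mp.
have md := ml_cons x ms.
have FH := @fmul_homog _ _ Sym; rewrite /fmul /hmul in FH.
have T2 := @hmul_tau _ _ Sym; rewrite /hmul in T2.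
move: xs; apply: (@ml_ext _ _ k^o) => [||hs hhs].
- by apply: ml_cons; exact: (@fmul_ml _ _ Sym).
- by apply: ml_add; exact: (@fmul_ml _ _ Sym).
have hh2 : hh ((p, x) :: hs) by split.
by have := FH _ _ _ _ _ mp ms hh2; rewrite /= => ->; rewrite !FH // T2 // mul1r.
Qed.

Lemma galg_sum t I (r : seq I) (F : I -> seq U -> k^o) :
  (forall i, List.In i r -> galg t (F i)) -> galg t (fun ys => \sum_(i <- r) F i ys).
Proof.
elim: r => [|i r IH] hF.
  have -> : (fun ys => \sum_(i <- [::]) F i ys) = (fun=> 0).
    by apply/funext => ys; exact: big_nil.
  exact: galg_zero.
have -> : (fun ys => \sum_(j <- i :: r) F j ys) = (fun ys => 1 * F i ys + \sum_(j <- r) F j ys).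
  by apply/funext => ys; rewrite big_cons mul1r.
apply: galg_lin; first by apply: hF; left.
by apply: IH => j hj; apply: hF; right.
Qed.

Lemma eq_big_In (R : nmodType) I (r : seq I) (F G : I -> R) :
  (forall i, List.In i r -> F i = G i) -> \sum_(i <- r) F i = \sum_(i <- r) G i.
Proof.
elim: r => [|i r IH] h; first by rewrite !big_nil.
by rewrite !big_cons (h i) ?IH //; [move=> j hj; apply: h; right | left].
Qed.

(** The partial derivative of [phi] in the direction of the vector of [t] (its left quotient in the
    tensor case), restricted to the range of the projection. *)
Definition cofactor phi s (t : bool * (U * {linear U -> k^o})) (ys : seq U) : k^o :=
  phi (t.2.1 :: map (tau t.1) (map (fproj s) ys)).

Lemma cofactor_Fhat t phi s u : hproj s -> Fhat t phi -> Fhat t (cofactor phi s u).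
Proof.
move=> hs h; have m := Fhat_ml h.
have mc : multilinear (cofactor phi s u) := ml_map (fproj s) (ml_map (tau u.1) (ml_cons u.2.1 m)).
case: t h => // -[_ sp]; split => // s1 s2 p q x y hx hy.
rewrite /cofactor !map_cat /= -!cat_cons; apply: sp; exact/homog_tau/fproj_homog.
Qed.

Lemma cofactor_term phi s u p x xs : multilinear phi -> hproj s -> List.In u s -> homog p x ->
  u.2.2 x * cofactor phi s u (map (tau p) xs) = phi (u.2.2 x *: u.2.1 :: map (fproj s) xs).
Proof.
move=> m hs /hs [_ hf] hx; rewrite (mlZ [::]) // /GRing.scale /=.
have [<-|ne] := eqVneq u.1 p; last first.
  have -> : u.2.2 x = 0 by apply: hf; case: (u.1) (p) ne hx => [] [].
  by rewrite !mul0r.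
congr (_ * phi (_ :: _)); rewrite -!map_comp; apply: eq_map => y /=.
by rewrite (fproj_tau _ _ hs) tauK.
Qed.

Lemma gen_nil (psi : {linear U -> k^o}) : gen psi [::] = 0. Proof. by []. Qed.

Lemma gen_cons (psi : {linear U -> k^o}) x : (fun ys => gen psi (x :: ys)) = (fun ys => psi x * unitf ys).
Proof. by apply/funext => -[|y ys] /=; rewrite ?mulr1 ?mulr0. Qed.

(** The first argument is expanded in the vectors of [s]; the empty word is lost because every term
    has a generator on the left. *)
Lemma tmul_cofactors phi s xs : multilinear phi -> hproj s ->
  \sum_(u <- s) tmul (gen u.2.2) (cofactor phi s u) xs =
    if xs is [::] then 0 else phi (map (fproj s) xs).
Proof.
move=> m hs; have cF u : multilinear (cofactor phi s u) := @cofactor_Fhat Tens phi s u hs m.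
move: xs; apply: (@ml_ext _ _ k^o) => [||hs0 hh0].
- by apply: ml_bigsum => u _; exact: (@fmul_ml _ _ Tens _ _ (@gen_ml _ _ u.2.2) (cF u)).
- have mf := ml_map (fproj s) m.
  move=> [|z s1] s2 a x y; [exact: (mf [::])|exact: (mf (z :: s1))].
case: hs0 hh0 => [|[p x] hs0] hh0 /=.
  rewrite big1 // => u _; have mg := @gen_ml _ _ u.2.2.
  by rewrite tmul_nil // gen_nil mul0r.
have [hx hh1] : homog p x /\ hh hs0 by [].
rewrite /fproj (ml_sum [::]) //=; apply: eq_big_In => u hu.
have mg := @gen_ml _ _ u.2.2.
rewrite (tmul_cons _ mg (cF u) hx) gen_cons gen_nil mul0r add0r.
have mt : multilinear (fun ys => cofactor phi s u (map (tau p) ys)) := ml_map (tau p) (cF u).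
rewrite -[tmul _ _ _]/(fmul Tens _ _ _) (@fmulZl _ _ Tens) ?fmul1l //.
  exact: cofactor_term.
exact: unitf_ml.
Qed.

(** Euler's identity: the sum of the coordinate functions times the partial derivatives multiplies
    by the degree. In the induction the first letter is either taken by the generator, which gives
    one copy of the value, or goes to the cofactor. *)
Lemma smul_cofactors phi s xs : Fhat Sym phi -> hproj s ->
  \sum_(u <- s) smul (gen u.2.2) (cofactor phi s u) xs =
    (size xs)%:R * phi (map (fproj s) xs).
Proof.
move=> + hs; suff H hs0 : hh hs0 -> forall phi, Fhat Sym phi ->
    \sum_(u <- s) smul (gen u.2.2) (cofactor phi s u) (map snd hs0) =
    (size hs0)%:R * phi (map (fproj s) (map snd hs0)).
  move=> hp; have [m _] := hp; have cF u := Fhat_ml (cofactor_Fhat u hs hp).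
  rewrite (ml_hsum (c := fun xs => \sum_(u <- s) smul (gen u.2.2) (cofactor phi s u) xs)); last first.
    by apply: ml_bigsum => u _; exact: (@fmul_ml _ _ Sym _ _ (@gen_ml _ _ u.2.2) (cF u)).
  rewrite (ml_hsum _ (ml_map (fproj s) m)) -[_ * _]/(_ *: (_ : k^o)) -hsumZ.
  by apply: eq_hsum => hs0 hh0 <-; rewrite H.
elim: hs0 => [|[p x] hs0 IH] hh0 {}phi hp; have cF u := Fhat_ml (cofactor_Fhat u hs hp).
  rewrite big1 ?mul0r // => u _; have mg := @gen_ml _ _ u.2.2.
  by rewrite smul_nil // gen_nil mul0r.
have [hx hh1] : homog p x /\ hh hs0 by [].
have [m sp] := hp.
have mt u : Fhat Sym (fun ys => cofactor phi s u (map (tau p) ys)).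
  by split; [exact: (ml_map (tau p) (cF u))|]; have [_ su] := cofactor_Fhat u hs hp;
   move=> s1 s2 q r y z hy hz; rewrite !map_cat /=; apply: su; exact: homog_tau.
rewrite [map snd _]/= (eq_bigr _ (fun u _ => smul_cons _ (@gen_ml _ _ u.2.2) (cF u) hx)) big_split /=.
have -> : (size hs0).+1%:R = 1 + (size hs0)%:R :> k by rewrite mulrS.
rewrite mulrDl mul1r; congr (_ + _).
  rewrite {2}/fproj (ml_sum [::]) //=; apply: eq_big_In => u hu.
  rewrite gen_cons -[smul _ _ _]/(fmul Sym _ _ _) (@fmulZl _ _ Sym) ?fmul1l //.
  - exact: cofactor_term.
  - by case: (mt u).
  - exact: unitf_Fhat.
have hP := fproj_homog hs hx.
have hp' : Fhat Sym (fun ys => phi (fproj s x :: ys)).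
  by split; [exact: ml_cons|exact: gsym_cons].
rewrite -(IH hh1 _ hp'); apply: eq_big_In => u hu; congr smul; apply/funext => ys.
rewrite /cofactor /= (tau_homog _ hP) (mlZ [:: _]) //= (sp [::] _ _ _ _ _ (hs _ hu).1 hP).
by rewrite scalerA -signr_addb addbb scale1r.
Qed.

(** Induction on the degree, since cofactors have degree one less. In the symmetric case Euler's
    identity is divided by the degree n + 1, which is invertible in characteristic 0. *)
Lemma galg_proj t n phi s : Fhat t phi -> hproj s ->
  (forall xs, size xs != n -> phi xs = 0) -> galg t (fun xs => phi (map (fproj s) xs)).
Proof.
move=> + hs; elim: n phi => [|n IH] phi hp supp.
  have -> : (fun xs => phi (map (fproj s) xs)) = (fun xs => phi [::] * unitf xs + (fun=> 0) xs).
    apply/funext => -[|x xs] /=; first by rewrite mulr1 addr0.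
    by rewrite supp // mulr0 addr0.
  by apply: galg_lin; [exact: galg_unit|exact: galg_zero].
have m := Fhat_ml hp.
have gc u : galg t (cofactor phi s u).
  have := IH (fun ys => phi (u.2.1 :: map (tau u.1) ys)).
  have -> : (fun xs => phi (u.2.1 :: map (tau u.1) (map (fproj s) xs))) = cofactor phi s u by [].
  apply; last by move=> xs ne; rewrite supp //= size_map.
  case: t hp {IH} => hp; first exact: (ins_Fhat u.1 u.2.1 hp).
  exact: (ml_map (tau u.1) (ml_cons u.2.1 m)).
have gs : galg t (fun xs => \sum_(u <- s) fmul t (gen u.2.2) (cofactor phi s u) xs).
  by apply: galg_sum => u /hs [_ hu]; apply: (galg_mul hu).
case: t hp IH gc gs => hp IH gc gs.
- have -> : (fun xs => phi (map (fproj s) xs)) = (fun xs => n.+1%:R^-1 *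
      (\sum_(u <- s) fmul Sym (gen u.2.2) (cofactor phi s u) xs) + (fun=> 0) xs).
    apply/funext => xs; rewrite addr0 smul_cofactors //.
    have [sx|ne] := eqVneq (size xs) n.+1.
      by rewrite sx mulrA mulVf ?mul1r // natr_neq0.
    by rewrite supp ?size_map // !mulr0.
  by apply: galg_lin => //; exact: galg_zero.
- have -> : (fun xs => phi (map (fproj s) xs)) =
      (fun xs => (\sum_(u <- s) fmul Tens (gen u.2.2) (cofactor phi s u) xs)) => //.
  by apply/funext => xs; rewrite tmul_cofactors //; case: xs => //=; rewrite supp.
Qed.

(** Project onto a finite-dimensional space containing all letters of the words in [L], and keep the
    degrees up to the length of the longest word. *)
Lemma galg_dense t phi (L : seq (seq U)) : Fhat t phi ->
  exists2 phi', galg t phi' & forall xs, xs \in L -> phi' xs = phi xs.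
Proof.
move=> hp; have [s [hs _ fix_s]] := fproj_exists (flatten L).
pose N := \max_(xs <- L) size xs.
pose phin n xs : k^o := if size xs == n then phi xs else 0.
have hn n : Fhat t (phin n).
  have m : multilinear (phin n).
    move=> s1 s2 a x y; rewrite /phin !size_cat /=.
    by case: ifP => _; [exact: (Fhat_ml hp) | rewrite scaler0 addr0].
  case: t hp => // -[_ sp]; split => // s1 s2 p q x y hx hy.
  rewrite /phin !size_cat /=; case: ifP => _; last by rewrite scaler0.
  exact: sp.
exists (fun xs => \sum_(n <- iota 0 N.+1) phin n (map (fproj s) xs)).
  apply: galg_sum => n _; apply: (galg_proj (n := n)) => // xs ne.
  by rewrite /phin (negbTE ne).
move=> xs xsL.
have -> : map (fproj s) xs = xs.
  apply: map_id_in => x hx; apply: fix_s; apply/flattenP; by exists xs.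
rewrite (bigD1_seq (size xs)) ?iota_uniq //; last first.
  by rewrite mem_iota add0n ltnS /= /N; exact: (leq_bigmax_seq (F := size)).
rewrite /= /phin eqxx big1 ?addr0 // => n ne; by rewrite eq_sym (negbTE ne).
Qed.

(** The Leibniz rule kills all polynomials, and continuity passes to any functional: at a given word
    only finitely many of its values matter, and there a polynomial has the same values. *)
Lemma derivation_eq0 t b (D : operator U) : derivation t b D ->
  (forall q (psi : {linear U -> k^o}), hfun q psi -> D (gen psi) = fun=> 0) ->
  forall phi, Fhat t phi -> D phi = fun=> 0.
Proof.
move=> dD Dgen phi hp; have lD := der_linop dD.
have Dalg phi' : galg t phi' -> D phi' = fun=> 0.
  elim=> [||a phi1 phi2 g1 h1 g2 h2|q psi phi1 hq g h].
  - exact: der_unit dD.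
  - exact: lin0 lD.
  - rewrite (lin_linear lD) ?h1 ?h2; try exact: galg_Fhat.
    by apply/funext => xs; rewrite mulr0 addr0.
  have F1 := galg_Fhat g; have F2 := @gen_Fhat _ _ t psi.
  apply/funext => xs; rewrite (der_mul dD F2 F1 (gen_fparity hq)) h (Dgen _ _ hq).
  by rewrite fmul0l // fmul0r // mulr0 addr0.
apply/funext => xs; have [L HL] := der_continuous dD xs.
have [phi' g E] := galg_dense L hp.
have F1 := galg_Fhat g.
have := HL (fun ys => phi ys - 1 * phi' ys) (FhatB 1 hp F1).
rewrite (linB lD) // (Dalg _ g) mulr0 subr0; apply.
by move=> ys hys; rewrite E // mul1r subrr.
Qed.

Lemma derivation_ext t b (D E : operator U) : derivation t b D -> derivation t b E ->
  (forall q (psi : {linear U -> k^o}), hfun q psi -> D (gen psi) = E (gen psi)) ->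
  forall phi, Fhat t phi -> D phi = E phi.
Proof.
move=> dD dE H phi hp.
have := derivation_eq0 (derivation_lin (-1) dE dD) _ hp.
have h q (psi : {linear U -> k^o}) : hfun q psi ->
  (fun xs => -1 * E (gen psi) xs + D (gen psi) xs) = fun=> 0.
  by move=> hq; rewrite (H _ _ hq); apply/funext => xs; rewrite mulN1r addNr.
move=> /(_ h) /funeqP e; apply/funext => xs; have := e xs.
by rewrite mulN1r addrC => /eqP; rewrite subr_eq0 => /eqP.
Qed.

(* The constant part of a derivation is its constant component on generators. *)
Lemma derivation_nil t b (D : operator U) v : derivation t b D -> homog b v ->
  (forall q (psi : {linear U -> k^o}), hfun q psi -> D (gen psi) [::] = psi v) ->
  forall phi, Fhat t phi -> D phi [::] = phi [:: v].
Proof.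
move=> dD hv Dgen phi hp; have lD := der_linop dD.
have Dalg phi' : galg t phi' -> D phi' [::] = phi' [:: v].
  elim=> [||a phi1 phi2 g1 h1 g2 h2|q psi phi1 hq g h].
  - by rewrite (der_unit dD).
  - by rewrite (lin0 lD).
  - by rewrite (lin_linear lD) ?h1 ?h2; try exact: galg_Fhat.
  have F1 := galg_Fhat g; have F2 := @gen_Fhat _ _ t psi.
  rewrite (der_mul dD F2 F1 (gen_fparity hq)).
  have m1 := Fhat_ml F1; have m2 := @gen_ml _ _ psi.
  have F3 := Fhat_ml (der_stable dD F2); have F4 := Fhat_ml (der_stable dD F1).
  rewrite !fmul_nil // (Dgen _ _ hq) /= mul0r mulr0 addr0.
  have i1 := fmul_ml t m2 m1.
  rewrite -[RHS](ins_nil t b v (fmul t (gen psi) phi1)) (fmul_ins _ F2 F1 hv (gen_fparity hq)).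
  have F5 := ins_Fhat b v F1; have m5 := Fhat_ml F5.
  rewrite (fmul_nil _ m2 m5) /= mul0r mulr0 addr0 ins_gen.
  by rewrite (fmulZl _ _ (unitf_Fhat U t) F1) fmul1l.
have [L HL] := der_continuous dD [::].
have [phi' g E] := galg_dense ([:: v] :: L) hp.
have F1 := galg_Fhat g.
have := HL (fun ys => phi ys - 1 * phi' ys) (FhatB 1 hp F1).
rewrite (linB lD) // (Dalg _ g) mul1r => h; apply/eqP; rewrite -subr_eq0.
rewrite -(E [:: v]) ?inE ?eqxx // h //.
by move=> ys hys; rewrite E ?mul1r ?subrr // inE hys orbT.
Qed.

End Density.

(** * Derived brackets with constant vector fields *)

Section Iterated.
Variables (k : fieldType) (char0 : [pchar k] =i pred0) (U : superspace k).
Implicit Types (x y w v : U) (p q e b : bool) (xs : seq U) (hs : seq (bool * U)).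
Implicit Types (phi psi : seq U -> k^o) (A B D E : operator U) (t : ftype).

Definition inss t hs (R : lmodType k) (c : seq U -> R) : seq U -> R :=
  foldr (fun h c => ins t h.1 h.2 c) c hs.

(* The iterated bracket [w_1, [w_2, ... [w_r, D]]] with the constant
   derivations [ins t p_i w_i]; [D] is odd. *)
Fixpoint adins t D hs : operator U :=
  if hs is h :: hs' then
    scomm h.1 (~~ tpar (map fst hs')) (@ins k U t h.1 h.2 k^o) (adins t D hs')
  else D.

Lemma adins_linop t D hs : linop t D -> linop t (adins t D hs).
Proof.
move=> lD; elim: hs => //= h hs IH; apply: linop_scomm => //; exact: linop_ins.
Qed.

Lemma adins_derivation t D hs : derivation t true D -> hh hs ->
  derivation t (~~ tpar (map fst hs)) (adins t D hs).
Proof.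
move=> dD; elim: hs => //= -[p x] hs IH [hx /IH hhs] /=.
rewrite -addbN; apply: derivation_scomm hhs; exact: derivation_ins.
Qed.

(** In each commutator the term that first applies [ins] to the generator gives a derivation of a
    scalar, which is 0; what is left is iterated insertion into the value of [D]. *)
Lemma adins_gen t D hs (psi : {linear U -> k^o}) : derivation t true D -> hh hs ->
  adins t D hs (gen psi) = inss t hs (D (gen psi)).
Proof.
move=> dD; elim: hs => //= -[p x] hs IH [hx hhs] /=.
have dF := adins_derivation dD hhs.
have lF := der_linop dF.
apply/funext => xs; rewrite /scomm IH //= ins_gen.
by rewrite (linZ lF) ?(der_unit dF) ?mulr0 ?subr0 //; exact: unitf_Fhat.
Qed.

Lemma adins_slot t D phi xs : linop t D -> Fhat t phi ->
  slotlinear (R := k^o) (fun hs => adins t D hs phi xs).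
Proof.
move=> lD hp hs1 hs2 p a x y; elim: hs1 phi hp xs => [|[q z] hs1 IH] phi hp xs /=.
  have lF := adins_linop hs2 lD.
  have m := Fhat_ml (lin_stable lF hp).
  rewrite /scomm ins_linw //.
  have -> : ins t p (a *: x + y) phi = (fun ys => a * ins t p x phi ys + ins t p y phi ys).
    by apply/funext => ys; rewrite ins_linw //; exact: Fhat_ml hp.
  rewrite (lin_linear lF); [|exact: ins_Fhat..].
  by rewrite /GRing.scale /=; ring.
have -> : map fst (hs1 ++ (p, a *: x + y) :: hs2) = map fst (hs1 ++ (p, x) :: hs2).
  by rewrite !map_cat.
have -> : map fst (hs1 ++ (p, y) :: hs2) = map fst (hs1 ++ (p, x) :: hs2).
  by rewrite !map_cat.
rewrite /scomm (IH _ (ins_Fhat q z hp)).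
have -> : adins t D (hs1 ++ (p, a *: x + y) :: hs2) phi =
  (fun ys => a *: (adins t D (hs1 ++ (p, x) :: hs2) phi ys : k^o) + adins t D (hs1 ++ (p, y) :: hs2) phi ys).
  by apply/funext => ys; exact: IH.
rewrite ins_lin /GRing.scale /=; ring.
Qed.

(** The bracket of two constant fields is a derivation that kills the generators, so it vanishes by
    [derivation_eq0]. *)
Lemma ins_anticomm t p q x y phi : homog p x -> homog q y -> Fhat t phi ->
  ins t p x (ins t q y phi) = fun xs => sg (p && q) * ins t q y (ins t p x phi) xs.
Proof.
move=> hx hy hp; have d := derivation_scomm (derivation_ins t hx) (derivation_ins t hy).
have := derivation_eq0 char0 d _ hp => H.
have /funeqP e : scomm p q (@ins k U t p x k^o) (@ins k U t q y k^o) phi = fun=> 0.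
  apply: H => r psi hr; apply/funext => xs; rewrite /scomm !ins_gen.
  have -> : @ins k U t p x k^o (fun xs => psi y * unitf xs) = fun=> 0.
    rewrite (linZ (linop_ins t p x)) ?(der_unit (derivation_ins t hx)) //; last exact: unitf_Fhat.
    by apply/funext => ys; rewrite mulr0.
  have -> : @ins k U t q y k^o (fun xs => psi x * unitf xs) = fun=> 0.
    rewrite (linZ (linop_ins t q y)) ?(der_unit (derivation_ins t hy)) //; last exact: unitf_Fhat.
    by apply/funext => ys; rewrite mulr0.
  by rewrite mulr0 subr0.
apply/funext => xs; apply/eqP; rewrite -subr_eq0; apply/eqP; exact: e.
Qed.

(** The Jacobi identity for two neighbouring constant fields, whose own bracket is 0. This is the
    graded symmetry of the maps f_r. *)
Lemma adins_swap t D hs1 hs2 p q x y phi xs : linop t D -> hh hs1 -> homog p x -> homog q y ->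
  Fhat t phi ->
  adins t D (hs1 ++ (p, x) :: (q, y) :: hs2) phi xs =
    sg (p && q) * adins t D (hs1 ++ (q, y) :: (p, x) :: hs2) phi xs.
Proof.
move=> lD hh1 hx hy; elim: hs1 hh1 phi xs => [_|[r z] hs1 IH] => [|[hz hh1]] phi xs hp /=.
  have lF := adins_linop hs2 lD; have sF := lin_stable lF; rewrite /scomm.
  have i1 := ins_Fhat p x hp; have i2 := ins_Fhat q y hp.
  rewrite !(linB (linop_ins t _ _)); try by [exact: sF | exact: ins_Fhat | apply/sF/ins_Fhat | exact/ins_Fhat/sF].
  rewrite (ins_anticomm hx hy (sF _ hp)) (ins_anticomm hy hx hp) (linZ lF); last exact/ins_Fhat/ins_Fhat.
  move: (tpar _) => T; rewrite (andbC q p).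
  by case: (p); case: (q); case: T; rewrite /= ?expr0 ?expr1; ring.
have E : map fst (hs1 ++ [:: (p, x), (q, y) & hs2]) = map fst hs1 ++ [:: p, q & map fst hs2].
  by rewrite map_cat.
have E' : map fst (hs1 ++ [:: (q, y), (p, x) & hs2]) = map fst hs1 ++ [:: q, p & map fst hs2].
  by rewrite map_cat.
have -> : tpar (map fst (hs1 ++ [:: (p, x), (q, y) & hs2])) =
          tpar (map fst (hs1 ++ [:: (q, y), (p, x) & hs2])).
  by rewrite E E' !tpar_cat /=; congr addb; rewrite addbCA.
rewrite /scomm (IH hh1 _ _ (ins_Fhat r z hp)).
have -> : adins t D (hs1 ++ [:: (p, x), (q, y) & hs2]) phi =
    fun xs => sg (p && q) * adins t D (hs1 ++ [:: (q, y), (p, x) & hs2]) phi xs.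
  by apply/funext => ys; exact: IH.
rewrite (linZ (linop_ins t _ _)); last by apply: lin_stable => //; exact: adins_linop.
ring.
Qed.

Lemma scomm_jacobi t p a b (I A B : operator U) phi xs : linop t I -> linop t A -> linop t B ->
  Fhat t phi ->
  scomm (p (+) a) b (scomm p a I A) B phi xs
    + sg (p && a) * scomm a (p (+) b) A (scomm p b I B) phi xs =
  scomm p (a (+) b) I (scomm a b A B) phi xs.
Proof.
move=> lI lA lB hp; rewrite /scomm.
have [[sI sA] sB] := (lin_stable lI, lin_stable lA, lin_stable lB).
have [[i1 a1] b1] := (sI _ hp, sA _ hp, sB _ hp).
have [[ia ib] ai] := (sI _ a1, sI _ b1, sA _ i1).
have [[bi ab] ba] := (sB _ i1, sA _ b1, sB _ a1).
rewrite (linB lA) // (linB lB) // (linB lI) //.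
rewrite !andb_addl !andb_addr !signr_addb.
by case: (p); case: (a); case: (b) => /=; rewrite ?expr0 ?expr1; ring.
Qed.

(** One term of the iterated bracket of [D, D]: the letters selected by [b] act on the first factor,
    the others on the second. *)
Definition adins_term t D hs (b : seq bool) : operator U := fun phi xs =>
  sg (ksign (map fst hs) (unshuffle b) (+) tpar (mask (map negb b) (map fst hs)))
   * scomm (~~ tpar (mask b (map fst hs))) (~~ tpar (mask (map negb b) (map fst hs)))
       (adins t D (mask b hs)) (adins t D (mask (map negb b) hs)) phi xs.

Definition adins_square t D hs phi xs : k^o :=
  \sum_(b : (size hs).-tuple bool) adins_term t D hs b phi xs.

Lemma adins_term_Fhat t D hs (bs : seq bool) phi : linop t D -> Fhat t phi -> Fhat t (adins_term t D hs bs phi).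
Proof.
move=> lD hp; apply: FhatZ.
by apply: (lin_stable (linop_scomm _ _ (adins_linop _ lD) (adins_linop _ lD))).
Qed.

Lemma tpar_mask (bs ps : seq bool) : size bs = size ps ->
  tpar ps = tpar (mask bs ps) (+) tpar (mask (map negb bs) ps).
Proof.
elim: bs ps => [|c bs IH] [|p ps] //= [/IH ->].
by case: c => /=; [rewrite addbA | rewrite addbCA].
Qed.

Lemma scomm_insZ t p q w (a : k) (C : operator U) phi xs :
  scomm p q (@ins k U t p w k^o) (fun phi xs => a * C phi xs) phi xs =
    a * scomm p q (@ins k U t p w k^o) C phi xs.
Proof. by rewrite /scomm (insZ (R := k^o) t p w a) /GRing.scale /=; ring. Qed.

(** A new letter acts on the first or on the second factor, by the Jacobi identity; the sign of
    acting on the second one is exactly the change of the unshuffle sign. *)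
Lemma adins_term_cons t D p w hs (bs : seq bool) phi xs : linop t D -> size bs = size hs -> Fhat t phi ->
  adins_term t D ((p, w) :: hs) (true :: bs) phi xs
  + adins_term t D ((p, w) :: hs) (false :: bs) phi xs =
  scomm p (tpar (map fst hs)) (@ins k U t p w k^o) (adins_term t D hs bs) phi xs.
Proof.
move=> lD sb hp; rewrite /adins_term.
have := scomm_jacobi p (~~ tpar (mask bs (map fst hs))) (~~ tpar (mask (map negb bs) (map fst hs)))
  xs (linop_ins t p w) (adins_linop (mask bs hs) lD) (adins_linop (mask (map negb bs) hs) lD) hp.
have Ep a b : ~~ a (+) ~~ b = a (+) b by case: a; case: b.
rewrite Ep => J; rewrite (tpar_mask (bs := bs) (ps := map fst hs)) ?size_map //.
transitivity (sg (ksign (map fst hs) (unshuffle bs) (+) tpar (mask (map negb bs) (map fst hs)))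
  * scomm p (tpar (mask bs (map fst hs)) (+) tpar (mask (map negb bs) (map fst hs)))
    (@ins k U t p w k^o) (scomm (~~ tpar (mask bs (map fst hs)))
         (~~ tpar (mask (map negb bs) (map fst hs)))
         (adins t D (mask bs hs)) (adins t D (mask (map negb bs) hs))) phi xs); last first.
  exact/esym/scomm_insZ.
rewrite -J [RHS]mulrDr; congr (_ + _).
  rewrite ksign_true; congr (_ * _).
  by rewrite /= -addbN -map_mask.
rewrite ksign_false ?size_map //= mulrA -signr_addb -addbN -!map_mask; congr (sg _ * _).
by case: (p); case: (tpar _); case: (tpar _); case: (ksign _ _).
Qed.

(** By [adins_term_cons] the whole sum is the iterated bracket of the constant fields with [D, D] =
    2 D^2 = 0. *)
Lemma adins_square0 t D hs phi xs : linop t D -> (forall phi, Fhat t phi -> D (D phi) = fun=> 0) ->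
  hh hs -> Fhat t phi -> adins_square t D hs phi xs = 0.
Proof.
move=> lD DD; elim: hs phi xs => [|[p w] hs IH] phi xs hhs hp.
  rewrite /adins_square (big_bits0 (fun bs : seq bool => adins_term t D [::] bs phi xs)) /adins_term /=.
  by rewrite mul1r /scomm DD // mulr0 subr0.
have [hw hh1] : homog p w /\ hh hs by [].
have li := linop_ins t p w.
rewrite /adins_square (big_bitsS _ (fun bs : seq bool => adins_term t D ((p, w) :: hs) bs phi xs)).
have S1 : adins_square t D hs phi = fun=> 0 by apply/funext => ys; exact: IH.
have S2 : adins_square t D hs (ins t p w phi) = fun=> 0.
  by apply/funext => ys; apply: IH => //; exact: ins_Fhat.
transitivity (ins t p w (adins_square t D hs phi) xs
    - sg (p && tpar (map fst hs)) * adins_square t D hs (ins t p w phi) xs); last first.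
  by rewrite S1 S2 mulr0 subr0; have := lin0 li => ->.
have -> : adins_square t D hs phi = fun xs => \sum_(b : (size hs).-tuple bool) adins_term t D hs b phi xs by [].
rewrite (lin_sum li); last by move=> b _; exact: adins_term_Fhat.
rewrite /adins_square mulr_sumr -sumrB; apply: eq_bigr => b _.
by rewrite adins_term_cons ?size_tuple.
Qed.

End Iterated.

(** * Values of a derivation of the symmetric algebra *)

Section SymExpand.
Variables (k : fieldType) (char0 : [pchar k] =i pred0) (U : superspace k).
Implicit Types (x y w v : U) (p q e b : bool) (xs : seq U) (hs : seq (bool * U)).
Implicit Types (phi psi : seq U -> k^o) (A B D E : operator U) (t : ftype).

(** The first letter [w] of the word is removed with iota_w E = [iota_w, E] + (sign) E iota_w. In
    the first term [w] has become an argument of the structure map, in the second an argument of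
    [phi]: these are the two choices for the first bit. On the empty word only the constant part of
    [E] acts ([derivation_nil]). *)
Lemma Sym_expand b E (c : seq U -> U) hs phi : derivation Sym b E ->
  (forall hs, hh hs -> homog (b (+) tpar (map fst hs)) (c (map snd hs))) ->
  (forall hs q (psi : {linear U -> k^o}), hh hs -> hfun q psi ->
    E (gen psi) (map snd hs) = sg (b && ~~ tpar (map fst hs)) * psi (c (map snd hs))) ->
  hh hs -> Fhat Sym phi ->
  E phi (map snd hs) = \sum_(bs : (size hs).-tuple bool)
    sg ((b && ~~ tpar (map fst hs)) (+) ksign (map fst hs) (unshuffle bs))
      * phi (c (mask bs (map snd hs)) :: mask (map negb bs) (map snd hs)).
Proof.
elim: hs b E c phi => [|[p w] hs IH] b E c phi dE hc gE hhs hp.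
  rewrite (big_bits0 (fun bs : seq bool => sg (_ (+) ksign _ (unshuffle bs)) *
     phi (c (mask bs [::]) :: mask (map negb bs) [::]))) /= andbT addbF.
  have h0 := hc [::] I; rewrite /= addbF in h0.
  rewrite (derivation_nil char0 dE (v := sg b *: c [::])) //.
  - by rewrite (mlZ [::]) //; exact: Fhat_ml hp.
  - exact: homogZ.
  - by move=> q psi hq; rewrite (gE [::] q) //= andbT linearZ.
have [hw hh1] : homog p w /\ hh hs by [].
have lE := der_linop dE; have mp := Fhat_ml hp.
set T := tpar (map fst hs).
have mE := Fhat_ml (lin_stable lE hp).
have gens (z : k) : E (fun xs => z * unitf xs) = fun=> 0.
  rewrite (linZ lE); last exact: unitf_Fhat.
  by rewrite (der_unit dE); apply/funext => ys; rewrite mulr0.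
(* These are the structure maps of the bracket [iota_w, E]. *)
pose c' ys := sg (p && ~~ b) *: c (w :: ys).
have dE' := derivation_scomm (derivation_ins Sym hw) dE.
have E1 ys psi : E psi (w :: map (tau p) ys) = scomm p b (@ins k U Sym p w k^o) E psi ys
    + sg (p && b) * E (ins Sym p w psi) ys.
  by rewrite /scomm subrK.
have IH1 := IH _ _ c' phi dE'.
have IH2 := IH _ _ c (ins Sym p w phi) dE.
have taum hs0 (f : seq U -> k^o) : multilinear f -> hh hs0 ->
    f (map snd hs0) = sg (p && tpar (map fst hs0)) * f (map (tau p) (map snd hs0)).
  move=> mf hh0; have := ml_taus p [::] mf hh0; rewrite /= => ->.
  by rewrite /GRing.scale /= mulrA -signr_addb addbb mul1r.
rewrite [map snd _]/= (taum _ (fun ys => E phi (w :: ys))) //; last exact: ml_cons.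
rewrite E1 IH1 // {IH1}; first last.
- move=> hs0 q psi hh0 hq.
  have := E1 (map snd hs0) (gen psi); rewrite ins_gen gens mulr0 addr0 => <-.
  have mg := Fhat_ml (lin_stable lE (gen_Fhat Sym psi)).
  have := taum hs0 (fun ys => E (gen psi) (w :: ys)) (ml_cons w mg) hh0.
  have hh2 : hh ((p, w) :: hs0) by split.
  rewrite (gE ((p, w) :: hs0) q) // => e.
  have -> : E (gen psi) (w :: map (tau p) (map snd hs0)) = sg (p && tpar (map fst hs0)) *
      (sg (b && ~~ tpar (map fst ((p, w) :: hs0))) * psi (c (w :: map snd hs0))).
    by rewrite e /= mulrA -signr_addb addbb mul1r.
  rewrite /c' linearZ /= /GRing.scale /= !mulrA -!signr_addb; congr (sg _ * _).
  by case: (p); case: (b); case: (tpar _).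
- move=> hs0 hh0; apply: homogZ; rewrite (addbC p) -addbA.
  by apply: (hc ((p, w) :: hs0)); split.
rewrite {}IH2 //; last exact: ins_Fhat.
rewrite (big_bitsS _ (fun bs => sg ((b && ~~ tpar (map fst ((p, w) :: hs)))
  (+) ksign (map fst ((p, w) :: hs)) (unshuffle bs)) * phi (c (mask bs (w :: map snd hs))
   :: mask (map negb bs) (w :: map snd hs)))).
rewrite !mulr_sumr -big_split mulr_sumr; apply: eq_bigr => bs _.
rewrite [in RHS]ksign_true [in RHS]ksign_false ?size_tuple ?size_map //=.
have hI := hh_mask bs hh1; have hJ := hh_mask (map negb bs) hh1.
rewrite mulrDr; congr (_ + _).
  rewrite /c' (mlZ [::]) //= /GRing.scale /= !mulrA -!signr_addb -/T; congr (sg _ * _).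
  by case: (p); case: (b); case: (T); case: (ksign _ _).
have hcI := hc _ hI; rewrite !map_mask in hcI.
rewrite /ins /= (tau_homog _ hcI) (mlZ [:: w]) //=.
have mpp : multilinear (fun ys => phi (w :: c (mask bs (map snd hs)) :: ys)).
  exact: (ml_cons (c _) (ml_cons w mp)).
have := ml_taus p [::] mpp hJ; rewrite /= !map_mask => ->.
have [_ sp] := hp; rewrite (sp [::] _ _ _ _ _ hw hcI) /=.
rewrite /GRing.scale /= !mulrA -!signr_addb; congr (sg _ * _).
rewrite -/T (_ : T = tpar (mask bs (map fst hs)) (+) tpar (mask (map negb bs) (map fst hs))).
  by case: (p); case: (b); case: (tpar _); case: (tpar _); case: (ksign _ _).
by apply: tpar_mask; rewrite size_map size_tuple.
Qed.

End SymExpand.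

Lemma scale_regE (k : fieldType) (a : k) (x : k^o) : a *: x = a * x.
Proof. by []. Qed.

Lemma big_bits_negb (R : nmodType) n (G : seq bool -> R) :
  \sum_(b : n.-tuple bool) G (map negb b) = \sum_(b : n.-tuple bool) G b.
Proof.
rewrite [RHS](reindex (fun b : n.-tuple bool => [tuple of map negb b])) //=.
by apply: onW_bij; exists (fun b : n.-tuple bool => [tuple of map negb b]) => b; apply/val_inj;
   rewrite /= -map_comp map_id_in // => c _ /=; rewrite negbK.
Qed.

Lemma mask_false_nseq T n (s : seq T) : mask (nseq n false) s = [::].
Proof. by elim: n s => [|n IH] [|x s] /=. Qed.

Lemma nilp_mask T (s : seq T) (bs : seq bool) : size bs = size s ->
  nilp (mask bs s) = (bs == nseq (size s) false).
Proof. by elim: s bs => [|x s IH] [|[] bs] //= [/IH ->]. Qed.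

Lemma ksign_unshuffle_false ps n : n = size ps -> ksign ps (unshuffle (nseq n false)) = false.
Proof.
elim: n ps => [|n IH] [|p ps] // [sn].
have := ksign_false p (etrans (size_nseq n false) sn).
by rewrite mask_false_nseq andbF (IH ps sn).
Qed.

Lemma ksign_unshuffle_true ps n : n = size ps -> ksign ps (unshuffle (nseq n true)) = false.
Proof.
elim: n ps => [|n IH] [|p ps] // [sn].
exact: etrans (ksign_true p ps (nseq n true)) (IH ps sn).
Qed.

Lemma scommC (k : fieldType) (U : superspace k) p q (A B : operator U) phi xs :
  scomm q p B A phi xs = - sg (p && q) * scomm p q A B phi xs.
Proof. by rewrite /scomm (andbC q); case: (p && q); rewrite /= ?expr0 ?expr1; ring. Qed.

(** * The L-infinity map as derived brackets without constant part *)

Section Twisting.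
Variables (k : fieldType) (char0 : [pchar k] =i pred0) (U : superspace k).
Implicit Types (x y w v : U) (p q e b : bool) (xs : seq U) (hs : seq (bool * U)).
Implicit Types (phi psi : seq U -> k^o).

Lemma ins0w t p (R : lmodType k) (c : seq U -> R) xs : multilinear c -> ins t p 0 c xs = 0.
Proof.
move=> m; have := ins_linw t p (-1) 0 0 xs m.
by rewrite scaleN1r oppr0 addr0 scaleN1r addNr.
Qed.

Lemma insZw t p (a : k) w (R : lmodType k) (c : seq U -> R) xs : multilinear c ->
  ins t p (a *: w) c xs = a *: ins t p w c xs.
Proof. by move=> m; have := ins_linw t p a w 0 xs m; rewrite addr0 ins0w // addr0. Qed.

Lemma derivation_eq t b (D E : operator U) : derivation t b D ->
  (forall phi, Fhat t phi -> D phi = E phi) -> derivation t b E.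
Proof.
move=> dD DE; have lD := der_linop dD; split.
- by move=> phi hp; rewrite -(DE _ hp); exact: (lin_stable lD hp).
- by move=> a phi psi hp hs xs; rewrite -(DE _ (Fhat_lin a hp hs)) -(DE _ hp) -(DE _ hs) (lin_linear lD).
- by move=> q phi hp fp; rewrite -(DE _ hp); exact: (der_parity dD hp fp).
- move=> q phi psi hp hs fp xs; rewrite -(DE _ (fmul_Fhat hp hs)) -(DE _ hp) -(DE _ hs).
  exact: (der_mul dD hp hs fp xs).
- move=> xs; have [L HL] := der_continuous dD xs; exists L => phi hp.
  by rewrite -(DE _ hp); exact: HL.
Qed.

Lemma Der0_eq t b (D E : operator U) : Der0 t b D ->
  (forall phi, Fhat t phi -> D phi = E phi) -> Der0 t b E.
Proof.
move=> [dD cD] DE; split; first exact: derivation_eq DE.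
by move=> psi; rewrite -(DE _ (gen_Fhat t psi)) cD.
Qed.

Lemma Der0_lin t b (a : k) (D E : operator U) : Der0 t b D -> Der0 t b E ->
  Der0 t b (fun phi xs => a * D phi xs + E phi xs).
Proof.
move=> [dD cD] [dE cE]; split; first exact: derivation_lin.
by move=> psi; rewrite cD cE mulr0 addr0.
Qed.

Lemma Der0_zero t b : Der0 t b (fun (_ : seq U -> k^o) (_ : seq U) => 0).
Proof.
have h0 := Fhat0 U t; split=> //; split.
- by move=> phi _; exact: h0.
- by move=> a phi psi _ _ xs; rewrite mulr0 addr0.
- by move=> q phi _ _ ps xs.
- by move=> q phi psi hp hs _ xs; rewrite fmul0l // fmul0r // mulr0 addr0.
- by move=> xs; exists [::].
Qed.

Lemma gen_split (psi : {linear U -> k^o}) : exists psi0 psi1 : {linear U -> k^o},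
  [/\ hfun false psi0, hfun true psi1, (forall x, psi x = psi0 x + psi1 x) &
  gen psi = fun xs => gen psi0 xs + gen psi1 xs].
Proof.
exists (psi \o hcomp U false)%FUN, (psi \o hcomp U true)%FUN.
have e x : psi x = psi (hcomp U false x) + psi (hcomp U true x) by rewrite -linearD hcomp_sum.
split=> //.
- by move=> x hx /=; rewrite (hcomp_homog _ hx) /= linear0.
- by move=> x hx /=; rewrite (hcomp_homog _ hx) /= linear0.
by apply/funext => -[|x [|y xs]] /=; rewrite ?addr0.
Qed.

Lemma no_constant_hfun t (D : operator U) : linop t D ->
  (forall q (psi : {linear U -> k^o}), hfun q psi -> D (gen psi) [::] = 0) ->
  no_constant_term D.
Proof.
move=> lD h psi; have [psi0 [psi1 [h0 h1 _ ->]]] := gen_split psi.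
by rewrite (linD lD) ?(h _ _ h0) ?(h _ _ h1) ?addr0 //; exact: gen_Fhat.
Qed.

Lemma Der0_nil t b (D : operator U) phi : Der0 t b D -> Fhat t phi -> D phi [::] = 0.
Proof.
move=> [dD cD] hp; rewrite (derivation_nil char0 dD (homog0 U b)) //.
  exact: (ml0 [::] [::] (Fhat_ml hp)).
by move=> q psi _; rewrite cD linear0.
Qed.

(** [D] is the given structure, on either algebra, and [DV] the L-infinity structure on the
    symmetric algebra, with structure maps [mu]. The link is [D_mu]: the constant part of a derived
    bracket of [D] is given by [mu]. In the tensor case this says that [mu] is the symmetrisation of
    the A-infinity maps. *)
Variables (t : ftype) (D DV : operator U) (mu : seq U -> U).
Hypotheses (dD : Der0 t true D) (DD : forall phi, Fhat t phi -> D (D phi) = fun=> 0).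
Hypotheses (dDV : derivation Sym true DV) (mu_ml : multilinear mu).
Hypothesis mu_homog : forall hs, hh hs -> homog (~~ tpar (map fst hs)) (mu (map snd hs)).
Hypothesis DV_mu : forall hs q (psi : {linear U -> k^o}), hh hs -> hfun q psi ->
  DV (gen psi) (map snd hs) = sg (~~ tpar (map fst hs)) * psi (mu (map snd hs)).
Hypothesis D_mu : forall hs q (psi : {linear U -> k^o}), hh hs -> hfun q psi ->
  inss t hs (D (gen psi)) [::] = sg (~~ tpar (map fst hs)) * psi (mu (map snd hs)).

Let lD : linop t D := der_linop (proj1 dD).

Lemma mu_nil : mu [::] = 0.
Proof.
apply: (@eq_by_functionals k U) => q psi hq.
have := @D_mu [::] q psi I hq; rewrite /= (proj2 dD) linear0 expr1 mulN1r => /eqP.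
by rewrite eq_sym oppr_eq0 => /eqP.
Qed.

(** [DV] maps generators to symmetric functionals, and functionals separate vectors. *)
Lemma mu_sym : gsymmetric mu.
Proof.
apply: gsym_homog => // hs1 hs2 p q x y hh1 hh2 hx hy.
apply: (@eq_by_functionals k U) => r psi hr.
have [_ s] := lin_stable (der_linop dDV) (gen_Fhat Sym psi).
have := s (map snd hs1) (map snd hs2) p q x y hx hy.
have E p1 x1 q1 y1 : map snd hs1 ++ [:: x1, y1 & map snd hs2] =
    map snd (hs1 ++ [:: (p1, x1), (q1, y1) & hs2]) by rewrite map_cat.
rewrite (E p x q y) (E q y p x) !(DV_mu _ hr) //; try by [apply/hh_cat].
rewrite -!E !map_cat !tpar_cat /= (addbCA q) /GRing.scale /= linearZ /= mulrCA.
by move/(can_inj (signrMK _)).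
Qed.

(** The sign is that of duality for an odd derivation, chosen so that the constant field [nu hs] has
    the same constant part as the derived bracket [adins t D hs]. *)
Definition nu hs : U := sg (~~ tpar (map fst hs)) *: mu (map snd hs).

Lemma nu_homog hs : hh hs -> homog (~~ tpar (map fst hs)) (nu hs).
Proof. by move=> hhs; apply/homogZ/mu_homog. Qed.

(* The iterated bracket without its constant part. *)
Definition tder hs : operator U := fun phi xs =>
  (-1 : k) * ins t (~~ tpar (map fst hs)) (nu hs) phi xs + adins t D hs phi xs.

Lemma tder_Der0 hs : hh hs -> Der0 t (~~ tpar (map fst hs)) (tder hs).
Proof.
move=> hhs.
have d1 := derivation_ins t (nu_homog hhs); have d2 := adins_derivation (proj1 dD) hhs.
have d := derivation_lin (-1) d1 d2; split => //.
apply: no_constant_hfun (der_linop d) _ => q psi hq; rewrite /tder.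
rewrite adins_gen ?(D_mu _ hq) //; last exact: (proj1 dD).
by rewrite ins_gen /= mulr1 /nu linearZ mulN1r addNr.
Qed.

Lemma tder_nil phi : Fhat t phi -> tder [::] phi = D phi.
Proof.
move=> hp; apply/funext => xs; rewrite /tder /nu /= mu_nil scaler0.
rewrite ins0w ?mulr0 ?add0r //; exact: Fhat_ml hp.
Qed.

Lemma tder_slot phi xs : Fhat t phi -> slotlinear (R := k^o) (fun hs => tder hs phi xs).
Proof.
move=> hp hs1 hs2 p a x y; rewrite /tder (adins_slot xs lD hp) /nu !map_cat /=.
rewrite mu_ml scalerDr scalerA (mulrC _ a) -scalerA ins_linw; last exact: Fhat_ml hp.
have R (z1 z2 z3 z4 : k) : (-1) * (a * z1 + z2) + (a * z3 + z4) = a * ((-1) * z1 + z3) + ((-1) * z2 + z4).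
  by ring.
exact: R.
Qed.

Lemma tder_swap hs1 hs2 p q x y phi xs : hh hs1 -> homog p x -> homog q y ->
  Fhat t phi ->
  tder (hs1 ++ (p, x) :: (q, y) :: hs2) phi xs =
    sg (p && q) * tder (hs1 ++ (q, y) :: (p, x) :: hs2) phi xs.
Proof.
move=> hh1 hx hy hp; rewrite /tder (adins_swap char0 _ _ lD) // mulrDr; congr (_ + _).
rewrite /nu !map_cat /= (mu_sym _ _ hx hy) !tpar_cat /= (addbCA p q).
have mp := Fhat_ml hp; rewrite !insZw // !scale_regE; ring.
Qed.


(** The multilinear extension of [tder]. The empty word has to be set to 0 by hand: [tder [::]] is
    [D] itself ([tder_nil]), whereas f has no component of degree 0. *)
Definition twf (ws : seq U) : operator U := fun phi xs =>
  if ws is [::] then 0 else hsum (R := k^o) (fun hs => tder hs phi xs) ws.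

Definition twh hs : operator U := fun phi xs => if hs is [::] then 0 else tder hs phi xs.

Lemma twfE hs phi : hh hs -> Fhat t phi -> twf (map snd hs) phi = twh hs phi.
Proof.
case: hs => [//|h hs] hhs hp; apply/funext => xs; rewrite /twf /twh [map _ _]/=.
exact: (hsum_homog (tder_slot xs hp) hhs).
Qed.

Lemma twf_ml phi xs : Fhat t phi -> multilinear (R := k^o) (fun ws => twf ws phi xs).
Proof.
move=> hp; have m := hsum_ml (tder_slot xs hp).
by move=> [|z s1] s2 a x y; exact: m.
Qed.

Lemma twf_sym phi xs : Fhat t phi -> gsymmetric (R := k^o) (fun ws => twf ws phi xs).
Proof.
move=> hp; apply: gsym_homog; first exact: twf_ml.
move=> hs1 hs2 p q x y hh1 hh2 hx hy.
have E p1 x1 q1 y1 : map snd hs1 ++ [:: x1, y1 & map snd hs2] =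
    map snd (hs1 ++ [:: (p1, x1), (q1, y1) & hs2]) by rewrite map_cat.
have N (h : bool * U) h' : twh (hs1 ++ [:: h, h' & hs2]) phi xs = tder (hs1 ++ [:: h, h' & hs2]) phi xs.
  by rewrite /twh; case: (hs1).
rewrite (E p x q y) (E q y p x) !twfE // ?N; try by apply/hh_cat.
exact: tder_swap.
Qed.

Lemma twf_Der0 hs : hh hs -> Der0 t (~~ tpar (map fst hs)) (twf (map snd hs)).
Proof.
move=> hhs; case: hs hhs => [_|h hs hhs]; first exact: Der0_zero.
apply: Der0_eq (tder_Der0 hhs) _ => phi hp.
by rewrite twfE.
Qed.

Lemma scomm_eq p q (A A' B B' : operator U) phi xs : 
  (forall phi, Fhat t phi -> A phi = A' phi) -> (forall phi, Fhat t phi -> B phi = B' phi) ->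
  linop t A' -> linop t B' -> Fhat t phi ->
  scomm p q A B phi xs = scomm p q A' B' phi xs.
Proof.
move=> eA eB lA lB hp; rewrite /scomm (eA _ hp) (eB _ hp).
by rewrite eA ?eB //; exact: lin_stable hp.
Qed.

Lemma adins_tder hs phi : adins t D hs phi =
  fun xs => tder hs phi xs + ins t (~~ tpar (map fst hs)) (nu hs) phi xs.
Proof. by apply/funext => xs; rewrite /tder mulN1r addrAC addNr add0r. Qed.

Let bsgn hs (bs : seq bool) :=
  ksign (map fst hs) (unshuffle bs) (+) tpar (mask (map negb bs) (map fst hs)).

(** The word in which the letters selected by [bs] are contracted to one letter by [nu]. On such
    words the Chevalley-Eilenberg differential evaluates f. *)
Let nuJ hs (bs : seq bool) :=
  (~~ tpar (mask bs (map fst hs)), nu (mask bs hs)) :: mask (map negb bs) hs.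

Lemma bsgn_compl hs (bs : seq bool) : size bs = size hs ->
  sg (bsgn hs (map negb bs)) * - sg (~~ tpar (mask (map negb bs) (map fst hs)) &&
     ~~ tpar (mask bs (map fst hs))) = sg (bsgn hs bs) :> k.
Proof.
move=> sb; rewrite /bsgn ksign_compl ?size_map //.
have -> : map negb (map negb bs) = bs.
  by rewrite -map_comp map_id_in // => c _ /=; rewrite negbK.
rewrite -signrN -signr_addb; congr (sg _).
by case: (tpar _); case: (tpar _); case: (ksign _ _).
Qed.

Lemma nuJ_hh hs bs : hh hs -> hh (nuJ hs bs).
Proof.
move=> hhs; apply/hh_cons; split; last exact: hh_mask.
by rewrite -map_mask; apply: nu_homog; exact: hh_mask.
Qed.

(** Both derived brackets are written as [tder] plus a constant field. The two constant fields
    commute, and the bracket of [nu I] with the rest of the second factor is the derived bracket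
    with [nu I] as a new first entry; likewise with the roles exchanged. *)
Lemma adins_commute_nu hs bs phi xs : hh hs -> Fhat t phi ->
  adins_term t D hs bs phi xs =
   sg (bsgn hs bs) * scomm (~~ tpar (mask bs (map fst hs))) (~~ tpar (mask (map negb bs) (map fst hs)))
         (tder (mask bs hs)) (tder (mask (map negb bs) hs)) phi xs
   + sg (bsgn hs bs) * adins t D (nuJ hs bs) phi xs
   + sg (bsgn hs bs) * (- sg (~~ tpar (mask bs (map fst hs)) && ~~ tpar (mask (map negb bs) (map fst hs))) *
     adins t D (nuJ hs (map negb bs)) phi xs).
Proof.
move=> hhs hp; rewrite /adins_term -/(bsgn hs bs) -!mulrDr; congr (_ * _).
have hI := hh_mask bs hhs; have hJ := hh_mask (map negb bs) hhs.
rewrite /nuJ /=.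
have -> : map negb (map negb bs) = bs.
  by rewrite -map_comp map_id_in // => c _ /=; rewrite negbK.
rewrite -!map_mask.
move: (mask bs hs) (mask (map negb bs) hs) hI hJ => I J hI hJ.
have [[dI _] [dJ _]] := (tder_Der0 hI, tder_Der0 hJ).
have [lI lJ] := (der_linop dI, der_linop dJ).
rewrite /scomm !adins_tder.
set a := ~~ tpar (map fst I); set b := ~~ tpar (map fst J).
have iI := linop_ins t a (nu I); have iJ := linop_ins t b (nu J).
have aI := lin_stable lI hp; have aJ := lin_stable lJ hp.
have bI := lin_stable iI hp; have bJ := lin_stable iJ hp.
rewrite (linD lI) // (linD lJ) // (linD iI) // (linD iJ) //.
rewrite (ins_anticomm char0 (nu_homog hI) (nu_homog hJ) hp) -/a -/b (andbC b a).
by case: (a && b); rewrite /= ?expr0 ?expr1; ring.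
Qed.

Definition tder_square hs : operator U := fun phi xs =>
  \sum_(bs : (size hs).-tuple bool) sg (bsgn hs bs) *
    scomm (~~ tpar (mask bs (map fst hs))) (~~ tpar (mask (map negb bs) (map fst hs)))
         (tder (mask bs hs)) (tder (mask (map negb bs) hs)) phi xs.

(** Complementing the subset exchanges the two kinds of mixed terms of [adins_commute_nu], hence the
    factor 2. *)
Lemma tder_square_adins hs phi xs : hh hs -> Fhat t phi ->
  tder_square hs phi xs +
    2%:R * \sum_(bs : (size hs).-tuple bool) sg (bsgn hs bs) * adins t D (nuJ hs bs) phi xs = 0.
Proof.
move=> hhs hp; rewrite -[RHS](adins_square0 xs lD DD hhs hp) /adins_square.
transitivity (\sum_(bs : (size hs).-tuple bool) (sg (bsgn hs bs) *
    scomm (~~ tpar (mask bs (map fst hs))) (~~ tpar (mask (map negb bs) (map fst hs)))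
         (tder (mask bs hs)) (tder (mask (map negb bs) hs)) phi xs
  + sg (bsgn hs bs) * adins t D (nuJ hs bs) phi xs
   + sg (bsgn hs bs) * (- sg (~~ tpar (mask bs (map fst hs)) && ~~ tpar (mask (map negb bs) (map fst hs))) *
     adins t D (nuJ hs (map negb bs)) phi xs))); last first.
  by apply: eq_bigr => bs _; rewrite -adins_commute_nu.
rewrite !big_split /= -addrA mulrDl mul1r; congr (_ + (_ + _)).
rewrite -[LHS](big_bits_negb (size hs) (fun bs => sg (bsgn hs bs) * adins t D (nuJ hs bs) phi xs)).
apply: eq_bigr => bs _; rewrite mulrA; congr (_ * _).
have nn : map negb (map negb bs) = bs by rewrite -map_comp map_id_in // => c _ /=; rewrite negbK.
rewrite -(bsgn_compl (bs := map negb bs)) ?size_map ?size_tuple // nn.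
by rewrite andbC.
Qed.

Lemma tpar_nuJ hs bs : size bs = size hs ->
  ~~ tpar (map fst (nuJ hs bs)) = tpar (map fst hs).
Proof.
move=> sb; rewrite /= map_mask [RHS](tpar_mask (bs := bs)) ?size_map //.
by case: (tpar _); case: (tpar _).
Qed.

(** The constant part of [tder_square_adins]: brackets of derivations without constant term have
    none, so only the L-infinity relation of [mu] is left, after division by 2. *)
Lemma nu_sum0 hs : hh hs ->
  \sum_(bs : (size hs).-tuple bool) sg (bsgn hs bs) *: nu (nuJ hs bs) = 0.
Proof.
move=> hhs; apply: (@eq_by_functionals k U) => q psi hq.
rewrite linear0 linear_sum /=.
have := tder_square_adins [::] hhs (gen_Fhat t psi).
have -> : tder_square hs (gen psi) [::] = 0.
  rewrite /tder_square big1 // => bs _; rewrite /scomm.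
  have [dI dJ] := (tder_Der0 (hh_mask bs hhs), tder_Der0 (hh_mask (map negb bs) hhs)).
  have [FI FJ] := (lin_stable (der_linop (proj1 dI)) (gen_Fhat t psi),
    lin_stable (der_linop (proj1 dJ)) (gen_Fhat t psi)).
  by rewrite (Der0_nil dI) // (Der0_nil dJ) // mulr0 subr0 mulr0.
rewrite add0r => /eqP; rewrite mulf_eq0 => /orP [/eqP h|/eqP h].
  by have := natr_neq0 char0 1; rewrite h eqxx.
rewrite -[RHS]h; apply: eq_bigr => bs _.
move: (nuJ hs bs) (nuJ_hh bs hhs) => N hn.
rewrite linearZ /= scale_regE; congr (_ * _).
by rewrite (adins_gen psi (proj1 dD) hn) (D_mu hn hq) /nu linearZ.
Qed.

(** Removing the constant parts of the derived brackets on the contracted words changes the sum by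
    an insertion of the vector of [nu_sum0], which is 0. *)
Lemma tder_square_eq hs phi xs : hh hs -> Fhat t phi ->
  tder_square hs phi xs +
    2%:R * \sum_(bs : (size hs).-tuple bool) sg (bsgn hs bs) * tder (nuJ hs bs) phi xs = 0.
Proof.
move=> hhs hp; rewrite -[RHS](tder_square_adins xs hhs hp); congr (_ + _ * _).
rewrite [RHS](eq_bigr (fun bs : (size hs).-tuple bool => sg (bsgn hs bs) * tder (nuJ hs bs) phi xs +
     ins t (tpar (map fst hs)) (sg (bsgn hs bs) *: nu (nuJ hs bs)) phi xs)); last first.
  have mp := Fhat_ml hp; move=> bs _; rewrite adins_tder mulrDr tpar_nuJ ?size_tuple //.
  congr (_ + _); symmetry; exact: insZw.
rewrite big_split /= -[LHS]addr0; congr (_ + _).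
have mp := Fhat_ml hp.
have sumw (r : seq ((size hs).-tuple bool)) (F : (size hs).-tuple bool -> U) :
    \sum_(bs <- r) ins t (tpar (map fst hs)) (F bs) phi xs =
    ins t (tpar (map fst hs)) (\sum_(bs <- r) F bs) phi xs.
  elim: r => [|bs r IH]; first by rewrite !big_nil ins0w.
  rewrite !big_cons IH; have := ins_linw t (tpar (map fst hs)) 1 (F bs) (\sum_(b <- r) F b) xs mp.
  by rewrite !scale1r.
by rewrite sumw nu_sum0 // ins0w.
Qed.

(** [Sym_expand] contracts a block of letters by [mu]; the sign of duality turns [mu] into [nu]. *)
Lemma DV_twf hs phi xs : hh hs -> Fhat t phi ->
  DV (fun vs => twf vs phi xs) (map snd hs) =
  \sum_(bs : (size hs).-tuple bool) sg (bsgn hs bs) * tder (nuJ hs bs) phi xs.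
Proof.
move=> hhs hp.
have FS : Fhat Sym (fun vs => twf vs phi xs) by split; [exact: twf_ml | exact: twf_sym].
rewrite (Sym_expand char0 dDV mu_homog DV_mu hhs FS).
apply: eq_bigr => bs _.
have hI := hh_mask bs hhs; have hJ := hh_mask (map negb bs) hhs.
have hm := mu_homog hI; rewrite !map_mask in hm.
have E : mu (mask bs (map snd hs)) :: mask (map negb bs) (map snd hs) =
    map snd ((~~ tpar (mask bs (map fst hs)), mu (mask bs (map snd hs))) :: mask (map negb bs) hs).
  by rewrite /= map_mask.
have hhE : hh ((~~ tpar (mask bs (map fst hs)), mu (mask bs (map snd hs))) :: mask (map negb bs) hs).
  by split.
rewrite E (twfE hhE hp).
rewrite /twh /nuJ /nu !map_mask.
have := tder_slot xs hp [::] (mask (map negb bs) hs) (~~ tpar (mask bs (map fst hs)))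
  (sg (~~ tpar (mask bs (map fst hs)))) (mu (mask bs (map snd hs))) 0.
rewrite (slotlinear0 [::] _ _ (tder_slot xs hp)) !addr0 /= => ->.
rewrite scale_regE mulrA -signr_addb; congr (sg _ * _).
rewrite /bsgn [tpar (map fst hs)](tpar_mask (bs := bs)) ?size_map ?size_tuple //.
by case: (tpar _); case: (tpar _); case: (ksign _ _).
Qed.

Lemma twf_linop hs : hh hs -> linop t (twh hs).
Proof.
case: hs => [_|h hs hhs]; first exact: der_linop (proj1 (Der0_zero t true)).
exact: der_linop (proj1 (tder_Der0 hhs)).
Qed.

Lemma tder_linop hs : hh hs -> linop t (tder hs).
Proof. by move=> hhs; exact: der_linop (proj1 (tder_Der0 hhs)). Qed.

(** Half of [tder_square_eq]. In [tder_square] the empty and the full subset have [D] as one factor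
    and give the brackets of f with [D]; these two terms are absent from the quadratic part of f,
    where f vanishes on the empty word. *)
Lemma twf_eq hs phi xs : hh hs -> Fhat t phi ->
  DV (fun vs => twf vs phi xs) (map snd hs)
    + sg (tpar (map fst hs)) * scomm true (~~ tpar (map fst hs)) D (twf (map snd hs)) phi xs
    + 2%:R^-1 * \sum_(bs : (size hs).-tuple bool) sg (bsgn hs bs)
          * scomm (~~ tpar (mask bs (map fst hs))) (~~ tpar (mask (map negb bs) (map fst hs)))
              (twf (mask bs (map snd hs))) (twf (mask (map negb bs) (map snd hs))) phi xs = 0.
Proof.
move=> hhs hp; rewrite DV_twf //.
have two := natr_neq0 char0 1.
have := tder_square_eq xs hhs hp; set S1 := \sum_(bs : _) _ => e1.
have {e1} -> : S1 = - (2%:R^-1 * tder_square hs phi xs).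
  apply: (mulfI two); rewrite mulrN mulrA divff // mul1r; apply/eqP.
  by rewrite -addr_eq0 addrC; apply/eqP.
set S2 := \sum_(bs : _) _.
suff -> : tder_square hs phi xs = 2%:R * (sg (tpar (map fst hs)) *
    scomm true (~~ tpar (map fst hs)) D (twf (map snd hs)) phi xs) + S2.
  by rewrite mulrDr (mulKf two) -addrA addNr.
have z0 : (fun _ : seq U => 0 : k^o) = fun=> 0 by [].
have sc0l p q (A : operator U) : linop t A -> scomm p q (twh [::]) A phi xs = 0.
  by move=> lA; rewrite /scomm (lin0 lA) mulr0 subr0.
have sc0r p q (A : operator U) : linop t A -> scomm p q A (twh [::]) phi xs = 0.
  by move=> lA; rewrite /scomm (lin0 lA) mulr0 subr0.
have lt0 := @twf_linop [::] I.
have tw p q I J : hh I -> hh J -> scomm p q (twf (map snd I)) (twf (map snd J)) phi xs =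
    scomm p q (twh I) (twh J) phi xs.
  move=> hI hJ; apply: scomm_eq => //; try exact: twf_linop.
    by move=> psi; exact: twfE.
  by move=> psi; exact: twfE.
have td0 p q I J : hh I -> hh J -> scomm p q (tder I) (tder J) phi xs =
    scomm p q (if nilp I then D else tder I) (if nilp J then D else tder J) phi xs.
  move=> hI hJ; apply: scomm_eq => //.
  - by case: I {hI} => [|h K] psi hpsi //=; rewrite tder_nil.
  - by case: J {hJ} => [|h K] psi hpsi //=; rewrite tder_nil.
  - by case: I hI => [|h K] hK //=; exact: tder_linop.
  - by case: J hJ => [|h K] hK //=; exact: tder_linop.
have [hs0|hsn] := eqVneq hs [::].
  rewrite /S2 /tder_square hs0 !big1 ?addr0.
  - by rewrite (sc0r _ _ _ lD) !mulr0.
  - by move=> bs _; rewrite !mask0 (sc0l _ _ _ lt0) mulr0.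
  - move=> bs _; rewrite !mask0 td0 //= /scomm DD // mulr0 subr0 mulr0 //.
set T := tpar (map fst hs); pose X := sg T * scomm true (~~ T) D (tder hs) phi xs.
have -> : sg T * scomm true (~~ T) D (twf (map snd hs)) phi xs = X.
  rewrite /X; congr (_ * _); apply: scomm_eq => //; last exact: tder_linop.
  by move=> psi hpsi; rewrite twfE //; case: (hs) hsn.
have n0 : (0 < size hs)%N by case: (hs) hsn.
(* The two extreme subsets, all bits [false] and all bits [true], are to contribute one copy of [X]
   each. *)
have sumX c : \sum_(bs : (size hs).-tuple bool) (if bs == nseq (size hs) c :> seq bool then X else 0) = X.
  by rewrite -big_mkcond /= (big_pred1 (nseq_tuple (size hs) c)).
have -> : 2%:R * X = X + X by rewrite mulr_natl.
rewrite -[Y in Y + _ + _](sumX true) -[Y in _ + Y + _](sumX false) /S2 /tder_square -!big_split.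
apply: eq_bigr => bs _ /=.
have sbs : size bs = size hs by rewrite size_tuple.
case: bs sbs => bs /= _ sbs.
have hI := hh_mask bs hhs; have hJ := hh_mask (map negb bs) hhs.
rewrite -!map_mask tw // td0 //.
have nI := nilp_mask sbs; have nJ := nilp_mask (bs := map negb bs) (s := hs).
rewrite size_map in nJ; have {nJ} nJ := nJ sbs.
have e1 : (map negb bs == nseq (size hs) false) = (bs == nseq (size hs) true).
  have inj : injective negb by exact: inv_inj negbK.
  by rewrite -(inj_eq (inj_map inj)) -map_comp map_nseq /= map_id_in // => c _ /=; rewrite negbK.
have mt : mask (nseq (size hs) true) hs = hs by rewrite mask_true.
have [bf|bnf] := eqVneq bs (nseq (size hs) false).
  have -> : (bs == nseq (size hs) true) = false.
    by rewrite bf; case: (size hs) n0.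
  rewrite bf map_nseq /= mt mask_false_nseq /= (sc0l _ _ _ (twf_linop hhs)) mulr0 addr0 add0r.
  have -> : nilp hs = false by case: (hs) hsn.
  rewrite /X /bsgn ksign_unshuffle_false ?size_map //.
  by rewrite map_nseq /= -(size_map fst) mask_true.
have [bt|bnt] := eqVneq bs (nseq (size hs) true).
  rewrite bt map_nseq /= mt mask_false_nseq /= (sc0r _ _ _ (twf_linop hhs)) mulr0 !addr0.
  have -> : nilp hs = false by case: (hs) hsn.
  rewrite /X /bsgn ksign_unshuffle_true ?size_map // map_nseq /= mask_false_nseq /= mul1r.
  by rewrite scommC -signrN -/T negbK.
rewrite !add0r; congr (_ * scomm _ _ _ _ _ _).
  by rewrite nI (negbTE bnf) /twh; case: (mask bs hs) nI => //; rewrite (negbTE bnf).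
by rewrite nJ e1 (negbTE bnt) /twh; case: (mask _ hs) nJ => //; rewrite e1 (negbTE bnt).
Qed.

End Twisting.

(** * The unital algebra k + A_+ in coordinates *)

Lemma big_option (R : nmodType) (T : finType) (F : option T -> R) :
  \sum_(i : option T) F i = F None + \sum_(i : T) F (Some i).
Proof.
rewrite (bigD1 None) //=; congr (_ + _).
rewrite (reindex_omap Some id) => [|[i|] //].
by apply: eq_bigl => i; rewrite eqxx.
Qed.

Lemma big_tupleS (R : nmodType) (T : finType) n (G : seq T -> R) :
  \sum_(s : n.+1.-tuple T) G s = \sum_(i : T) \sum_(s : n.-tuple T) G (i :: s).
Proof.
rewrite (reindex (fun u : T * n.-tuple T => [tuple of u.1 :: u.2])) /=; last first.
  exists (fun b : n.+1.-tuple T => (thead b, behead_tuple b)) => [[c b] _|b _] /=.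
    by congr pair; apply/val_inj.
  by rewrite [RHS]tuple_eta; apply/val_inj.
by rewrite -(pair_bigA _ (fun c (b : n.-tuple T) => G (c :: b))).
Qed.

Lemma big_tuple0 (R : nmodType) (T : finType) (G : seq T -> R) :
  \sum_(s : 0.-tuple T) G s = G [::].
Proof.
rewrite (eq_bigr (fun=> G [::])) => [|b _]; last by rewrite (tuple0 b).
by rewrite sumr_const card_tuple expn0.
Qed.

Lemma sum_delta (R : pzRingType) (T : finType) (j : T) (F : T -> R) :
  \sum_i (i == j)%:R * F i = F j.
Proof.
rewrite (bigD1 j) //= eqxx mul1r big1 ?addr0 // => i /negbTE ->.
by rewrite mul0r.
Qed.

Section Unital.
Variables (k : fieldType) (A : nilcdga k).
Implicit Types (i j l : option (bas A)).

Local Notation um := (umul (@bmul k A)).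

Definition obdiff i l : k := if i is Some i' then if l is Some l' then bdiff i' l' else 0 else 0.

Lemma um1l j l : um None j l = (j == l)%:R. Proof. by []. Qed.
Lemma um1r i l : um i None l = (i == l)%:R. Proof. by case: i. Qed.
Lemma um_None (i : bas A) j : um (Some i) j None = 0. Proof. by case: j. Qed.
Lemma um_NoneR i (j : bas A) : um i (Some j) None = 0. Proof. by case: i. Qed.

Lemma um_parity i j l : um i j l != 0 -> opar l = opar i (+) opar j.
Proof.
case: i => [i|]; last by rewrite um1l; have [->|_] := eqVneq j l; rewrite ?eqxx.
case: j => [j|]; last by rewrite um1r; have [<-|_] := eqVneq (Some i) l; rewrite ?eqxx ?addbF.
by case: l => [l|] /=; [exact: bmul_parity | rewrite eqxx].
Qed.

Lemma umC i j l : um i j l = sg (opar i && opar j) * um j i l.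
Proof.
case: i j l => [i|] [j|] [l|] //=; rewrite ?andbF ?mul1r ?mulr0 //; exact: bmulC.
Qed.

Lemma umA i j h l : \sum_s um i j s * um s h l = \sum_s um j h s * um i s l.
Proof.
case: i => [i|]; last first.
  rewrite (eq_bigr (fun s => (s == j)%:R * um s h l)) ?sum_delta; last by move=> s _; rewrite um1l eq_sym.
  rewrite [RHS](eq_bigr (fun s => (s == l)%:R * um j h s)) ?sum_delta // => s _.
  by rewrite um1l mulrC.
case: h => [h|]; last first.
  rewrite [LHS](eq_bigr (fun s => (s == l)%:R * um (Some i) j s)) ?sum_delta; last by move=> s _; rewrite um1r mulrC.
  rewrite [RHS](eq_bigr (fun s => (s == j)%:R * um (Some i) s l)) ?sum_delta // => s _.
  by rewrite um1r eq_sym.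
case: j => [j|]; last first.
  rewrite (eq_bigr (fun s => (s == Some i)%:R * um s (Some h) l)) ?sum_delta; last by move=> s _; rewrite um1r eq_sym.
  rewrite [RHS](eq_bigr (fun s => (s == Some h)%:R * um (Some i) s l)) ?sum_delta // => s _.
  by rewrite um1l eq_sym.
rewrite !big_option !um_None !mul0r !add0r.
case: l => [l|]; last by rewrite !big1 // => s _; rewrite ?um_None ?um_NoneR mulr0.
exact: bmulA.
Qed.

Lemma obdiff_parity i l : obdiff i l != 0 -> opar l = ~~ opar i.
Proof. by case: i l => [i|] [l|] //=; rewrite ?eqxx //; exact: bdiff_parity. Qed.

Lemma obdiffK i l : \sum_s obdiff i s * obdiff s l = 0.
Proof.
case: i => [i|]; last by rewrite big1 // => s _; rewrite mul0r.
case: l => [l|]; last by rewrite big1 // => -[s|] _; rewrite /= mulr0.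
by rewrite big_option /= mul0r add0r bdiffK.
Qed.

Lemma obdiffM i j l : \sum_s um i j s * obdiff s l =
  \sum_s obdiff i s * um s j l + sg (opar i) * \sum_s obdiff j s * um i s l.
Proof.
case: i => [i|]; last first.
  rewrite (eq_bigr (fun s => (s == j)%:R * obdiff s l)) ?sum_delta; last by move=> s _; rewrite um1l eq_sym.
  rewrite big1 ?add0r => [|s _]; last by rewrite mul0r.
  rewrite /= mul1r (eq_bigr (fun s => (s == l)%:R * obdiff j s)) ?sum_delta // => s _.
  by rewrite mulrC.
case: j => [j|]; last first.
  rewrite (eq_bigr (fun s => (s == Some i)%:R * obdiff s l)) ?sum_delta; last by move=> s _; rewrite um1r eq_sym.
  rewrite [X in _ = _ + _ * X]big1 ?mulr0 ?addr0 => [|s _]; last by rewrite mul0r.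
  rewrite (eq_bigr (fun s => (s == l)%:R * obdiff (Some i) s)) ?sum_delta // => s _.
  by rewrite um1r mulrC.
case: l => [l|]; last first.
  rewrite [LHS]big1; last by case=> [s|] _; rewrite /= mulr0.
  rewrite [X in _ = X + _]big1; last by move=> s _; rewrite um_NoneR mulr0.
  by rewrite big1 ?mulr0 ?addr0 // => s _; rewrite um_None mulr0.
by rewrite !big_option /= !mul0r !add0r bdiffM.
Qed.

Lemma prodc_parity (s : seq (option (bas A))) l :
  prodc (@bmul k A) s l != 0 -> opar l = tpar (map (@opar k A) s).
Proof.
elim: s l => [|i s IH] l /=; first by case: l => //=; rewrite eqxx.
move=> ne; have [j] : exists j, prodc (@bmul k A) s j * um i j l != 0.
  apply: contrapT => /forallNP h; case/negP: ne; rewrite big1 // => j _.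
  by apply/eqP; rewrite -[_ == _]negbK; apply/negP/h.
by rewrite mulf_eq0 negb_or => /andP [/IH <- /um_parity].
Qed.

End Unital.

Arguments umul : simpl never.

(** * Evaluation of multilinear maps on elements with coefficients in A *)

Section Extension.
Variables (k : fieldType) (A : nilcdga k) (U : superspace k) (R : lmodType k).
Implicit Types (c : seq U -> R) (l i j : option (bas A)) (ys : seq (option (bas A) -> U)).

Local Notation um := (umul (@bmul k A)).
Local Notation op := (@opar k A).

Lemma extA_nil b c l : @extA k A U R b c [::] l = (l == None)%:R *: c [::].
Proof.
rewrite /extA (big_tuple0 (fun s => prodc (@bmul k A) s l *: hsum (fun hs =>
  sg ((b && tpar (map op s)) (+) isign (map op s) (map fst hs)) *: c (map snd hs))
  [seq yi.1 yi.2 | yi <- zip [::] s])) /=.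
by rewrite andbF scale1r.
Qed.

(** The first coefficient is multiplied onto the product of the others. A nonzero coefficient of
    that product at [j] forces its parity to be that of [j], so the sign depends on [i] and [j]
    only. *)
Lemma extA_cons b c y ys l : extA b c (y :: ys) l =
  \sum_i \sum_j um i j l *: \sum_(p : bool) sg ((b && op i) (+) (p && op j)) *:
    extA b (fun vs => c (hcomp U p (y i) :: vs)) ys j.
Proof.
rewrite /extA (big_tupleS _ (fun s => prodc (@bmul k A) s l *: hsum (fun hs =>
  sg ((b && tpar (map op s)) (+) isign (map op s) (map fst hs)) *: c (map snd hs))
  [seq yi.1 yi.2 | yi <- zip (y :: ys) s])) /=.
apply: eq_bigr => i _.
under eq_bigr => s _ do rewrite scaler_suml.
rewrite exchange_big /=; apply: eq_bigr => j _.
pose h p (s : seq (option (bas A))) := hsum (fun hs => sg ((b && tpar (map op s)) (+)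
    isign (map op s) (map fst hs)) *: c (hcomp U p (y i) :: map snd hs)) [seq yi.1 yi.2 | yi <- zip ys s].
transitivity (um i j l *: \sum_(s : (size ys).-tuple (option (bas A))) \sum_(p : bool)
    sg ((b && op i) (+) (p && op j)) *: (prodc (@bmul k A) s j *: h p s)); last first.
  by rewrite exchange_big; congr (_ *: _); apply: eq_bigr => p _; rewrite scaler_sumr.
rewrite scaler_sumr; apply: eq_bigr => s _.
rewrite mulrC -scalerA; congr (_ *: _).
have [z|nz] := eqVneq (prodc (@bmul k A) s j) 0.
  by rewrite z scale0r big1 // => p _; rewrite scale0r scaler0.
rewrite scaler_sumr; apply: eq_bigr => p _.
rewrite [RHS]scalerA mulrC -scalerA; congr (_ *: _).
rewrite /h -hsumZ; apply: eq_hsum => hs _ _.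
rewrite scalerA -signr_addb; congr (sg _ *: _).
rewrite /= (prodc_parity nz).
by case: (b); case: (op i); case: (p); case: (tpar _); case: (isign _ _).
Qed.

Lemma eq_extA b c d ys l : c =1 d -> @extA k A U R b c ys l = extA b d ys l.
Proof. by move=> /funext ->. Qed.

Lemma extA0 b ys l : @extA k A U R b (fun=> 0) ys l = 0.
Proof.
rewrite /extA big1 // => s _; rewrite (_ : hsum _ _ = 0) ?scaler0 //.
rewrite -[RHS](hsum0 R [seq yi.1 yi.2 | yi <- zip ys s]).
by apply: eq_hsum => hs _ _; rewrite scaler0.
Qed.

Definition evenA (y : option (bas A) -> U) := forall i, homog (op i) (y i).

Lemma extA_even b c y ys l : multilinear c -> evenA y -> extA b c (y :: ys) l =
  \sum_i \sum_j (um i j l * sg ((b && op i) (+) (op i && op j))) *: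
    extA b (fun vs => c (y i :: vs)) ys j.
Proof.
move=> m ey; rewrite extA_cons; apply: eq_bigr => i _; apply: eq_bigr => j _.
rewrite -scalerA; congr (_ *: _).
have Z p : p != op i -> extA b (fun vs => c (hcomp U p (y i) :: vs)) ys j = 0.
  move=> ne; rewrite (hcomp_homog _ (ey i)) (negbTE ne).
  by rewrite (@eq_extA _ _ (fun=> 0)) ?extA0 // => vs; exact: (ml0 [::]).
rewrite (bigD1 (op i)) //= [X in _ + X]big1 => [|p ne]; last by rewrite Z ?scaler0.
by rewrite addr0 (hcomp_homog _ (ey i)) eqxx.
Qed.

(** The coefficient at [l] of C(xi, ..., xi), with n copies of an even xi = sum of e_i (x) xi_i and
    the Koszul sign of collecting the e_i on the left. Letters are passed with the parities of their
    coefficients, since [C] may depend on parities. *)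
Fixpoint evA (xi : bas A -> U) n (C : seq (bool * U) -> R) l : R :=
  if n is n'.+1 then
    \sum_(i : bas A) \sum_j (um (Some i) j l * sg (bpar i && op j)) *:
      evA xi n' (fun hs => C ((bpar i, xi i) :: hs)) j
  else (l == None)%:R *: C [::].

Definition even (xi : bas A -> U) := forall i : bas A, homog (bpar i) (xi i).

Lemma evenA_oplus xi : even xi -> evenA (oplus xi).
Proof. by move=> h [i|] /=; [exact: h | exact: homog0]. Qed.

Lemma evA_lin xi n (a : k) C1 C2 l :
  evA xi n (fun hs => a *: C1 hs + C2 hs) l = a *: evA xi n C1 l + evA xi n C2 l.
Proof.
elim: n C1 C2 l => [|n IH] C1 C2 l /=; first by rewrite scalerDr !scalerA mulrC.
rewrite scaler_sumr -big_split; apply: eq_bigr => i _ /=.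
rewrite scaler_sumr -big_split; apply: eq_bigr => j _ /=.
rewrite (IH (fun hs => C1 (_ :: hs)) (fun hs => C2 (_ :: hs))) scalerDr !scalerA.
by rewrite (mulrC a).
Qed.

Lemma eq_evA xi n C1 C2 l : even xi ->
  (forall hs, hh hs -> size hs = n -> C1 hs = C2 hs) -> evA xi n C1 l = evA xi n C2 l.
Proof.
move=> ev; elim: n C1 C2 l => [|n IH] C1 C2 l h /=; first by rewrite h.
apply: eq_bigr => i _; apply: eq_bigr => j _; congr (_ *: _); apply: IH => hs hhs shs.
by apply: h; rewrite /= ?shs //; split => //; exact: ev.
Qed.

Lemma evA0 xi n l : evA xi n (fun=> 0) l = 0.
Proof.
by elim: n l => [|n IH] l /=; rewrite ?scaler0 // big1 // => i _; rewrite big1 // => j _; rewrite IH scaler0.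
Qed.

Lemma evAZ xi n (a : k) C l : evA xi n (fun hs => a *: C hs) l = a *: evA xi n C l.
Proof.
have := evA_lin xi n a C (fun=> 0) l; rewrite evA0 addr0 => <-.
by congr evA; apply/funext => hs; rewrite addr0.
Qed.

(** Each xi_i is labelled with the parity of e_i, so the word labelled by a product contributing to
    e_l has total parity [opar l], and the sign is constant. *)
Lemma evA_sign xi n b C l : evA xi n (fun hs => sg (b && tpar (map fst hs)) *: C hs) l =
  sg (b && op l) *: evA xi n C l.
Proof.
elim: n C l => [|n IH] C l /=.
  by case: l => [l|] /=; rewrite ?scale0r ?scaler0 // andbF !scale1r.
rewrite scaler_sumr; apply: eq_bigr => i _; rewrite scaler_sumr; apply: eq_bigr => j _ /=.
have [z|nz] := eqVneq (um (Some i) j l) 0; first by rewrite z mul0r !scale0r scaler0.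
rewrite (um_parity nz).
have -> : (fun hs => sg (b && (bpar i (+) tpar (map fst hs))) *: C ((bpar i, xi i) :: hs)) =
   (fun hs => sg (b && bpar i) *: (sg (b && tpar (map fst hs)) *: C ((bpar i, xi i) :: hs))).
  by apply/funext => hs; rewrite scalerA -signr_addb -andb_addr.
rewrite evAZ (IH (fun hs => C (_ :: hs))) !scalerA; congr (_ *: _).
by rewrite -!mulrA -!signr_addb mulrCA -!signr_addb; congr (_ * sg _); rewrite /= ?andb_addr;
  case: (b); case: (bpar i); case: (op j).
Qed.

Lemma extA_evA b xi n c l : multilinear c -> even xi ->
  extA b c (nseq n (oplus xi)) l = sg (b && op l) *: evA xi n (fun hs => c (map snd hs)) l.
Proof.
move=> + ev; elim: n c l => [|n IH] c l m.
  by rewrite extA_nil /=; case: l => [l|] /=; rewrite ?scale0r ?scaler0 // andbF !scale1r.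
rewrite [nseq _ _]/= extA_even //; last exact: evenA_oplus.
rewrite big_option /= [X in X + _]big1 ?add0r => [|j _]; last first.
  rewrite (@eq_extA _ _ (fun=> 0)) ?extA0 ?scaler0 // => vs; exact: (ml0 [::]).
rewrite scaler_sumr; apply: eq_bigr => i _; rewrite scaler_sumr; apply: eq_bigr => j _.
rewrite IH; last exact: ml_cons.
have [z|nz] := eqVneq (um (Some i) j l) 0; first by rewrite z !mul0r !scale0r scaler0.
rewrite (um_parity nz) !scalerA; congr (_ *: _).
rewrite -!mulrA -!signr_addb mulrCA -!signr_addb; congr (_ * sg _).
by rewrite /=; case: (b); case: (bpar i); case: (op j).
Qed.

Lemma evA_prodc xi n C l : evA xi n C l = \sum_(s : n.-tuple (bas A))
  (prodc (@bmul k A) (map Some s) l * sg (isign (map (@bpar k A) s) (map (@bpar k A) s))) *: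
    C [seq (bpar (n := A) a, xi a) | a <- s].
Proof.
elim: n C l => [|n IH] C l.
  rewrite (big_tuple0 (fun s : seq (bas A) => (prodc (@bmul k A) (map Some s) l * sg (isign (map (@bpar k A) s) (map (@bpar k A) s))) *:
    C [seq (bpar (n := A) a, xi a) | a <- s])) /= mulr1 //.
rewrite (big_tupleS _ (fun s : seq (bas A) => (prodc (@bmul k A) (map Some s) l * sg (isign (map (@bpar k A) s) (map (@bpar k A) s))) *:
    C [seq (bpar (n := A) a, xi a) | a <- s])) /=.
apply: eq_bigr => i _.
under [RHS]eq_bigr => s _ do rewrite mulr_suml scaler_suml.
rewrite exchange_big /=; apply: eq_bigr => j _; rewrite IH scaler_sumr; apply: eq_bigr => s _.
rewrite scalerA; congr (_ *: _).
have [z|nz] := eqVneq (prodc (@bmul k A) (map Some s) j) 0; first by rewrite z !mul0r mulr0.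
have := prodc_parity nz; rewrite -map_comp => -> /=.
rewrite (eq_map (_ : op \o Some =1 @bpar k A)) // signr_addb.
by rewrite mulrCA !mulrA.
Qed.

Lemma evA_nil xi n C l : (nilbound A < n)%N -> evA xi n C l = 0.
Proof.
move=> h; rewrite evA_prodc big1 // => s _.
by rewrite bnilpotent ?size_tuple // mul0r scale0r.
Qed.

Lemma evA_None xi n C : evA xi n.+1 C None = 0.
Proof. by rewrite /= big1 // => i _; rewrite big1 // => j _; rewrite um_None mul0r scale0r. Qed.

End Extension.

Lemma evA_morph (k : fieldType) (A : nilcdga k) (U : superspace k) (R S : lmodType k)
   (f : {linear R -> S}) (xi : bas A -> U) n C l :
  f (evA xi n C l) = evA xi n (fun hs => f (C hs)) l.
Proof.
elim: n C l => [|n IH] C l /=; first by rewrite linearZ.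
rewrite linear_sum; apply: eq_bigr => i _; rewrite linear_sum; apply: eq_bigr => j _.
by rewrite linearZ /= (IH (fun hs => C (_ :: hs))).
Qed.

(** * Conjugation by an exponential *)

Section Leibniz.
Variables (k : fieldType) (char0 : [pchar k] =i pred0) (V : lmodType k) (G : V -> Prop).
Hypotheses (G0 : G 0) (Glin : forall (c : k) u v, G u -> G v -> G (c *: u + v)).

(** Linearity on the subspace [G] only, as the operators on functionals are controlled only on the
    elements of the completed algebra. *)
Definition glin (F : V -> V) := (forall u, G u -> G (F u)) /\
  forall (c : k) u v, G u -> G v -> F (c *: u + v) = c *: F u + F v.

Lemma glinD F u v : glin F -> G u -> G v -> F (u + v) = F u + F v.
Proof. by case=> _ h gu gv; have := h 1 u v gu gv; rewrite !scale1r. Qed.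

Lemma glin0 F : glin F -> F 0 = 0.
Proof.
move=> gF; have := glinD gF G0 G0; rewrite addr0 => /eqP.
by rewrite -subr_eq0 opprD addrA subrr sub0r oppr_eq0 => /eqP.
Qed.

Lemma glinZ F c u : glin F -> G u -> F (c *: u) = c *: F u.
Proof.
move=> gF gu; have [_ h] := gF; have := h c u 0 gu G0.
by rewrite (glin0 gF) !addr0.
Qed.

Lemma glinB F u v : glin F -> G u -> G v -> F (u - v) = F u - F v.
Proof. by case=> _ h gu gv; have := h (-1) v u gv gu; rewrite !scaleN1r !(addrC (- _)). Qed.

Lemma GD u v : G u -> G v -> G (u + v).
Proof. by move=> gu gv; have := Glin 1 gu gv; rewrite scale1r. Qed.

Lemma G_sum I (r : seq I) (P : pred I) (u : I -> V) :
  (forall i, P i -> G (u i)) -> G (\sum_(i <- r | P i) u i).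
Proof. by move=> h; apply: big_ind => //; exact: GD. Qed.

Lemma glin_sum F I (r : seq I) (u : I -> V) : glin F -> (forall i, G (u i)) ->
  F (\sum_(i <- r) u i) = \sum_(i <- r) F (u i).
Proof.
move=> gF h; elim: r => [|i r IH]; first by rewrite !big_nil; exact: glin0.
by rewrite !big_cons glinD ?IH //; exact: G_sum.
Qed.

Variables (X : V -> V) (a : nat -> V -> V).
Hypotheses (gX : glin X) (ga : forall n, glin (a n)).
Hypothesis a_rec : forall n u, G u -> n.+1%:R *: a n.+1 u = X (a n u) - a n (X u).
Hypothesis a_sq : forall u, G u -> a 0 (a 0 u) = 0.

(* If [a n] is the n-th term of exp(ad X) a_0, then the square of a_0 is
   transported to each homogeneous part of the square of the sum. *)
Lemma conj_square n u : G u -> \sum_(p < n.+1) a p (a (n - p)%N u) = 0.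
Proof.
elim: n u => [|n IH] u gu; first by rewrite big_ord_recl big_ord0 addr0 subnn a_sq.
have n0 := natr_neq0 char0 n; apply: (scalerI n0); rewrite scaler0.
transitivity (X (\sum_(p < n.+1) a p (a (n - p)%N u)) - \sum_(p < n.+1) a p (a (n - p)%N (X u))); last first.
  by rewrite !IH ?(glin0 gX) ?subr0 //; exact: (proj1 gX).
have sa m v : G v -> G (a m v) := proj1 (ga m) v.
rewrite (glin_sum _ gX) => [|p]; last exact/sa/sa.
rewrite scaler_sumr -sumrB.
(* Splitting n + 1 as p + (n + 1 - p) gives each of the two factors the coefficient that [a_rec]
   needs. *)
rewrite (eq_bigr (fun p : 'I_n.+2 => p%:R *: a p (a (n.+1 - p)%N u) +
   (n.+1 - p)%:R *: a p (a (n.+1 - p)%N u))); last first.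
  by move=> p _; rewrite -scalerDl -natrD subnKC // -ltnS.
rewrite big_split /= big_ord_recl /= scale0r add0r.
rewrite [X in _ + X]big_ord_recr /= subnn scale0r addr0 -big_split /=.
apply: eq_bigr => p _; rewrite /bump /= add1n subSS a_rec ?sa //.
have le : (p <= n)%N by rewrite -ltnS.
rewrite subSn // -(glinZ _ (ga p)); last exact: sa.
rewrite a_rec // (glinB (ga p)); [|exact/(proj1 gX)/sa|exact/sa/(proj1 gX)].
  by rewrite addrA subrK.
exact: sa.
Qed.

Lemma triangle_sum (F : nat -> nat -> V) K :
  \sum_(0 <= n < K) \sum_(p < n.+1) F p (n - p)%N =
  \sum_(0 <= p < K) \sum_(0 <= q < K - p) F p q.
Proof.
elim: K => [|K IH]; first by rewrite !big_geq.
rewrite big_nat_recr //= IH [RHS]big_nat_recr //= subSnn big_nat1.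
rewrite [in LHS]big_ord_recr /= addrA; congr (_ + _); last by rewrite subnn.
rewrite -(big_mkord xpredT (fun p => F p (K - p)%N)) -big_split /=.
rewrite big_nat [RHS]big_nat; apply: eq_bigr => p /andP [_ pK].
by rewrite subSn 1?ltnW // big_nat_recr.
Qed.

(** If p + q is at least M + M, then p or q is at least M and the term vanishes. So the square of
    the sum equals the sum of its homogeneous parts of degree below M + M, which vanish by
    [conj_square]. *)
Lemma conj_sum_square M u : G u -> (forall n v, (M <= n)%N -> G v -> a n v = 0) ->
  \sum_(0 <= p < M + M) a p (\sum_(0 <= q < M + M) a q u) = 0.
Proof.
move=> gu aM; have sa m v : G v -> G (a m v) := proj1 (ga m) v.
transitivity (\sum_(0 <= n < M + M) \sum_(p < n.+1) a p (a (n - p)%N u)); last first.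
  by rewrite big1 // => n _; exact: conj_square.
rewrite (triangle_sum (fun p q => a p (a q u))); apply: eq_big_nat => p /andP [_ pM].
rewrite (glin_sum _ (ga p)) => [|q]; last exact: sa.
rewrite (big_cat_nat (n := (M + M - p)%N)) ?leq_subr //=.
rewrite [X in _ + X]big_nat [X in _ + X]big1 ?addr0 // => q /andP [qM _].
have [Mp|pM'] := leqP M p; first by rewrite aM //; exact: sa.
rewrite (aM q) ?(glin0 (ga p)) //.
by apply: leq_trans qM; rewrite -addnBA ?leq_addr // ltnW.
Qed.

End Leibniz.

(** * Operators with coefficients in A *)

Section Action.
Variables (k : fieldType) (char0 : [pchar k] =i pred0) (A : nilcdga k) (U : superspace k).
Variable t : ftype.
Implicit Types (l i j : option (bas A)) (phi psi : seq U -> k^o) (e b : bool).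
Local Notation um := (umul (@bmul k A)).
Local Notation op := (@opar k A).

Definition coefs := option (bas A) -> seq U -> k^o.
Implicit Types (u v : coefs) (W : option (bas A) -> operator U).

Definition goodc u := forall j, Fhat t (u j).

Lemma goodc0 : goodc (0 : option (bas A) -> seq U -> k^o).
Proof. by move=> j; exact: Fhat0. Qed.

Lemma goodc_lin (c : k) u v : goodc u -> goodc v ->
  goodc ((c *: (u : option (bas A) -> seq U -> k^o) + (v : option (bas A) -> seq U -> k^o))).
Proof. by move=> gu gv j; exact: (Fhat_lin c (gu j) (gv j)). Qed.

(* Left multiplication by the element [\sum_c e_c W_c] of A (x) Op, of parity
   [e], on A (x) functions. *)
Definition act e W u : coefs := fun l xs =>
  \sum_c \sum_j (um c j l * sg ((e (+) op c) && op j)) * W c (u j) xs.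

Definition opd u : coefs := fun l xs => \sum_i obdiff i l * u i xs.

Lemma act_glin e W : (forall c, linop t (W c)) ->
  glin (V := option (bas A) -> seq U -> k^o) goodc (act e W).
Proof.
move=> lW; split=> [u gu l|c u v gu gv].
  apply: Fhat_sum => i _; apply: Fhat_sum => j _; apply: FhatZ.
  exact: (lin_stable (lW _) (gu _)).
apply/funext => l; apply/funext => xs.
rewrite -[RHS]/(c * act e W u l xs + act e W v l xs) /act mulr_sumr -big_split; apply: eq_bigr => i _ /=.
rewrite mulr_sumr -big_split; apply: eq_bigr => j _ /=.
have -> : W i ((c *: (u : option (bas A) -> seq U -> k^o) + (v : option (bas A) -> seq U -> k^o)) j) =
    fun xs => c * W i (u j) xs + W i (v j) xs by exact: (lin_linear (lW i) c (gu j) (gv j)).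
by ring.
Qed.

Lemma opd_glin : glin (V := option (bas A) -> seq U -> k^o) goodc opd.
Proof.
split=> [u gu l|c u v gu gv].
  by apply: Fhat_sum => i _; apply: FhatZ.
apply/funext => l; apply/funext => xs.
rewrite -[RHS]/(c * opd u l xs + opd v l xs) /opd mulr_sumr -big_split; apply: eq_bigr => i _ /=.
rewrite -[X in _ * X = _]/(c * u i xs + v i xs); ring.
Qed.

Definition mulop e W W' : option (bas A) -> operator U := fun l phi xs =>
  \sum_i \sum_j (um i j l * sg ((e (+) op i) && op j)) * W i (W' j phi) xs.

(** Associativity of A; the parities of its structure constants allow the two Koszul signs to be
    rewritten as those of the product in A (x) Op. *)
Lemma act_comp e e' W W' u : (forall c, linop t (W c)) -> (forall c, linop t (W' c)) ->
  goodc u -> act e W (act e' W' u) = act (e (+) e') (mulop e W W') u.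
Proof.
move=> lW lW' gu; apply/funext => l; apply/funext => xs.
have F c j : Fhat t (W' c (u j)) by exact: (lin_stable (lW' c) (gu j)).
rewrite /act /mulop.
transitivity (\sum_c \sum_c' \sum_j' \sum_j (um c' j' j * um c j l) *
   sg (((e (+) op c) && (op c' (+) op j')) (+) ((e' (+) op c') && op j')) * W c (W' c' (u j')) xs).
  apply: eq_bigr => c _.
  under eq_bigr => j _.
    rewrite (lin_sum (lW c)); last first.
      by move=> c' _; apply: Fhat_sum => j' _; apply: FhatZ.
    rewrite mulr_sumr.
    under eq_bigr => c' _.
      rewrite (lin_sum (lW c)); last by move=> j' _; apply: FhatZ.
      rewrite mulr_sumr.
      under eq_bigr => j' _ do rewrite (linZ (lW c)) //.
      over.
    over.
  rewrite exchange_big /=; apply: eq_bigr => c' _; rewrite exchange_big /=.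
  apply: eq_bigr => j' _; apply: eq_bigr => j _.
  have [z|nz] := eqVneq (um c' j' j) 0; first by rewrite z !(mul0r, mulr0).
  by rewrite (um_parity nz) signr_addb; ring.
transitivity (\sum_s \sum_j \sum_c \sum_c' (um c c' s * um s j l) *
   sg (((e (+) op c) && (op c' (+) op j)) (+) ((e' (+) op c') && op j)) * W c (W' c' (u j)) xs); last first.
  apply: eq_bigr => s _; apply: eq_bigr => j _; rewrite mulr_sumr; apply: eq_bigr => c _.
  rewrite mulr_sumr; apply: eq_bigr => c' _.
  have [z|nz] := eqVneq (um c c' s) 0; first by rewrite z !(mul0r, mulr0).
  rewrite (um_parity nz).
  have -> : sg (((e (+) op c) && (op c' (+) op j)) (+) ((e' (+) op c') && op j)) =
    sg ((e (+) e' (+) (op c (+) op c')) && op j) * sg ((e (+) op c) && op c') :> k.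
    rewrite -signr_addb; congr (sg _).
    by case: (e); case: (e'); case: (op c); case: (op c'); case: (op j).
  by ring.
rewrite [RHS](eq_bigr (fun s => \sum_c \sum_j \sum_c' (um c c' s * um s j l) *
   sg (((e (+) op c) && (op c' (+) op j)) (+) ((e' (+) op c') && op j)) * W c (W' c' (u j)) xs));
  last by move=> s _; exact: exchange_big.
rewrite [RHS]exchange_big /=; apply: eq_bigr => c _.
rewrite [RHS]exchange_big /= [LHS]exchange_big /=; apply: eq_bigr => j _.
rewrite [RHS]exchange_big /=; apply: eq_bigr => c' _.
by rewrite -!mulr_suml umA.
Qed.

(** The Leibniz rule in A: the commutator of d_A with left multiplication by W is left
    multiplication by d_A W. *)
Lemma opd_act e W u : (forall c, linop t (W c)) -> goodc u ->
  opd (act e W u) = (act (~~ e) (fun s phi xs => \sum_c obdiff c s * W c phi xs) u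
     : option (bas A) -> seq U -> k^o) + sg e *: (act e W (opd u) : option (bas A) -> seq U -> k^o).
Proof.
move=> lW gu; apply/funext => l; apply/funext => xs.
rewrite -[RHS]/(act (~~ e) (fun s phi xs => \sum_c obdiff c s * W c phi xs) u l xs
  + sg e * act e W (opd u) l xs).
transitivity (\sum_c \sum_j (\sum_s um c j s * obdiff s l) * (sg ((e (+) op c) && op j) * W c (u j) xs)).
  rewrite /opd /act.
  under eq_bigr => i _ do rewrite mulr_sumr.
  rewrite exchange_big /=; apply: eq_bigr => c _.
  under eq_bigr => i _ do rewrite mulr_sumr.
  rewrite exchange_big /=; apply: eq_bigr => j _.
  by rewrite mulr_suml; apply: eq_bigr => s _; ring.
under eq_bigr => c _ do under eq_bigr => j _ do rewrite obdiffM mulrDl.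
under eq_bigr => c _ do rewrite big_split /=.
rewrite big_split /=; congr (_ + _).
  rewrite /act.
  under eq_bigr => c _ do under eq_bigr => j _ do rewrite mulr_suml.
  under eq_bigr => c _ do rewrite exchange_big /=.
  rewrite exchange_big /=; apply: eq_bigr => s _.
  rewrite exchange_big /=; apply: eq_bigr => j _.
  rewrite mulr_sumr; apply: eq_bigr => c _.
  have [z|nz] := eqVneq (obdiff c s) 0; first by rewrite z !(mul0r, mulr0).
  rewrite (obdiff_parity nz) (_ : ~~ e (+) ~~ op c = e (+) op c); last by case: (e); case: (op c).
  by ring.
rewrite /act mulr_sumr; apply: eq_bigr => c _.
rewrite mulr_sumr.
transitivity (\sum_j \sum_i (sg (op c) * (obdiff i j * um c j l)) *
    (sg ((e (+) op c) && op i) * W c (u i) xs)).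
  rewrite exchange_big; apply: eq_bigr => i _.
  by rewrite mulr_sumr mulr_suml.
apply: eq_bigr => j _; rewrite /opd (lin_sum (lW c)); last by move=> i _; exact: FhatZ.
rewrite !mulr_sumr; apply: eq_bigr => i _; rewrite (linZ (lW c)) //.
have [z|nz] := eqVneq (obdiff i j) 0; first by rewrite z !(mul0r, mulr0).
rewrite (obdiff_parity nz).
have E : sg (op c) * sg ((e (+) op c) && op i) = sg e * sg ((e (+) op c) && ~~ op i) :> k.
  by rewrite -!signr_addb; congr (sg _); case: (e); case: (op c); case: (op i).
transitivity (obdiff i j * um c j l * (sg (op c) * sg ((e (+) op c) && op i)) * W c (u i) xs); first by ring.
by rewrite E; ring.
Qed.

End Action.

(** * The conjugate of d_A + D by exp(iota_xi) *)

Section PushMC.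
Variables (k : fieldType) (char0 : [pchar k] =i pred0) (U : superspace k).
Variables (t : ftype) (D : operator U) (A : nilcdga k) (xi : bas A -> U).
Hypotheses (lD : linop t D) (DD : forall phi, Fhat t phi -> D (D phi) = fun=> 0) (exi : even xi).
Implicit Types (l i j c : option (bas A)) (phi psi : seq U -> k^o).
Implicit Types (W : option (bas A) -> operator U) (u : coefs A U).
Local Notation um := (umul (@bmul k A)).
Local Notation op := (@opar k A).

Lemma ev_sum n l (C : seq (bool * U) -> k^o) : evA xi n C l = \sum_(s : n.-tuple (bas A))
  (prodc (@bmul k A) (map Some s) l * sg (isign (map (@bpar k A) s) (map (@bpar k A) s))) *
    C [seq (bpar (n := A) a, xi a) | a <- s].
Proof. exact: evA_prodc. Qed.

Lemma linop_sum (J : Type) (r : seq J) (a : J -> k) (F : J -> operator U) :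
  (forall j0 : J, linop t (F j0)) -> linop t (fun phi xs => \sum_(j0 <- r) a j0 * F j0 phi xs).
Proof.
move=> lF; split=> [phi hp|c phi psi hp hs].
  by apply: Fhat_sum => j0 _; apply/FhatZ/(lin_stable (lF j0) hp).
apply/funext => xs; rewrite mulr_sumr -big_split; apply: eq_bigr => j0 _ /=.
by rewrite (lin_linear (lF j0)) //; ring.
Qed.

Lemma linop_ev n l (F : seq (bool * U) -> operator U) : (forall hs, linop t (F hs)) ->
  linop t (fun phi xs => evA xi n (fun hs => F hs phi xs : k^o) l).
Proof.
move=> lF.
have -> : (fun phi xs => evA xi n (fun hs => F hs phi xs : k^o) l) =
    (fun phi xs => \sum_(s : n.-tuple (bas A))
  (prodc (@bmul k A) (map Some s) l * sg (isign (map (@bpar k A) s) (map (@bpar k A) s))) *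
    F [seq (bpar (n := A) a, xi a) | a <- s] phi xs).
  by apply/funext => phi; apply/funext => xs; exact: ev_sum.
exact: linop_sum.
Qed.

Lemma ins_ev p w n l (C : seq (bool * U) -> seq U -> k^o) xs :
  evA xi n (fun hs => ins t p w (C hs) xs) l = ins t p w (fun ys => evA xi n (fun hs => C hs ys) l) xs.
Proof.
have -> : (fun ys => evA xi n (fun hs => C hs ys) l) = (fun ys => \sum_(s : n.-tuple (bas A))
  (prodc (@bmul k A) (map Some s) l * sg (isign (map (@bpar k A) s) (map (@bpar k A) s))) *:
    C [seq (bpar (n := A) a, xi a) | a <- s] ys).
  by apply/funext => ys; exact: ev_sum.
rewrite ins_sum ev_sum; apply: eq_bigr => s _; by rewrite insZ.
Qed.

(** The even element iota_xi of A (x) Op, which has no component at the unit; [insdx] below is in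
    the same way the odd element iota_{d xi}. *)
Definition insx c : operator U := if c is Some i then @ins k U t (bpar i) (xi i) k^o else fun _ _ => 0.
Definition dxi (s : bas A) : U := \sum_i bdiff i s *: xi i.
Definition insdx c : operator U :=
  if c is Some i then @ins k U t (~~ bpar i) (dxi i) k^o else fun _ _ => 0.
(** The n-fold commutator of iota_xi with [D], as [adX_Qn] shows: the derived bracket of [D]
    evaluated on n copies of xi. *)
Definition Qn n c : operator U := fun phi xs => evA xi n (fun hs => adins t D hs phi xs : k^o) c.

Lemma linop0 : linop t (fun (_ : seq U -> k^o) (_ : seq U) => 0).
Proof. exact: der_linop (proj1 (Der0_zero U t true)). Qed.

Lemma linop_insx c : linop t (insx c).
Proof. by case: c => [i|] /=; [exact: linop_ins | exact: linop0]. Qed.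

Lemma linop_insdx c : linop t (insdx c).
Proof. by case: c => [i|] /=; [exact: linop_ins | exact: linop0]. Qed.

Lemma linop_Qn n c : linop t (Qn n c).
Proof. by apply: linop_ev => hs; exact: adins_linop. Qed.

Lemma dxi_homog s : homog (~~ bpar s) (dxi s).
Proof.
apply: homog_sum => i _; have [->|nz] := eqVneq (bdiff i s) 0; first by rewrite scale0r; exact: homog0.
by apply: homogZ; rewrite (bdiff_parity nz) negbK; exact: exi.
Qed.

Definition adX W l : operator U := fun phi xs =>
  mulop false insx W l phi xs - mulop true W insx l phi xs.

Lemma adX_Qn n l phi xs : Fhat t phi -> adX (Qn n) l phi xs = Qn n.+1 l phi xs.
Proof.
move=> hp; rewrite /adX /mulop /Qn [RHS]/= big_option /=.
rewrite [X in X + _ - _]big1 ?add0r => [|j _]; last by rewrite mulr0.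
rewrite [X in _ - X]exchange_big big_option /=.
rewrite [X in _ - (X + _)]big1 ?add0r => [|j _]; last first.
  have := lin0 (linop_Qn n j); rewrite /Qn => /funeqP ->; exact: mulr0.
rewrite -sumrB; apply: eq_bigr => i _; rewrite -sumrB; apply: eq_bigr => j _.
rewrite /scomm.
have -> : (fun hs => ins t (bpar i) (xi i) (adins t D hs phi) xs -
     sg (bpar i && ~~ tpar (map fst hs)) * adins t D hs (ins t (bpar i) (xi i) phi) xs : k^o) =
   (fun hs => - sg (bpar i) *: (sg (bpar i && tpar (map fst hs)) *: 
      (adins t D hs (ins t (bpar i) (xi i) phi) xs : k^o)) + ins t (bpar i) (xi i) (adins t D hs phi) xs).
  apply/funext => hs; rewrite addrC; congr (_ + _).
  by rewrite !scale_regE mulNr mulrA -signr_addb; congr (- (sg _ * _)); case: (bpar i); case: (tpar _).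
rewrite evA_lin evA_sign ins_ev umC.
rewrite !scale_regE /=.
have E : sg (bpar i && op j) * sg (~~ op j && bpar i) = sg (bpar i && op j) * sg (bpar i) * sg (bpar i && op j) :> k.
  by rewrite -!signr_addb; congr (sg _); case: (bpar i); case: (op j).
rewrite [um j (Some i) l]umC /= (andbC (op j)).
have S b : sg b * sg b = 1 :> k by rewrite -signr_addb addbb.
set z1 := ins _ _ _ _ _; set z2 := evA _ _ _ _; set m := um (Some i) j l.
case: (bpar i); case: (op j); rewrite /= ?expr0 ?expr1; ring.
Qed.


(** Constant fields supercommute ([ins_anticomm]), and A is graded commutative. *)
Lemma adX_insdx l phi xs : Fhat t phi -> adX insdx l phi xs = 0.
Proof.
move=> hp; rewrite /adX /mulop [X in _ - X]exchange_big -sumrB big1 // => i _.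
rewrite -sumrB big1 // => j _.
case: i => [i|] /=; last first.
  by case: j => [j|] /=; rewrite ?(mulr0, subrr) // (lin0 (linop_ins _ _ _)) !mulr0 subrr.
case: j => [j|] /=; last by rewrite (lin0 (linop_ins _ _ _)) !mulr0 subrr.
rewrite (ins_anticomm char0 (exi i) (dxi_homog j) hp).
case: l => [l|]; last by rewrite !mul0r subrr.
rewrite [um (Some j) _ _]umC [op _]/= [op (Some i)]/=.
set z := ins _ _ _ _ _; set m := um _ _ _.
case: (bpar i); case: (bpar j); rewrite /= ?expr0 ?expr1; ring.
Qed.

Lemma adX_lin (a b : k) W W' l phi xs : (forall c, linop t (W c)) -> (forall c, linop t (W' c)) ->
  Fhat t phi ->
  adX (fun c phi xs => a * W c phi xs + b * W' c phi xs) l phi xs =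
    a * adX W l phi xs + b * adX W' l phi xs.
Proof.
move=> lW lW' hp; rewrite /adX /mulop !mulrBr addrACA -opprD; congr (_ - _);
  rewrite !mulr_sumr -big_split; apply: eq_bigr => i _ /=;
  rewrite !mulr_sumr -big_split; apply: eq_bigr => j _ /=; last by ring.
have FW := lin_stable (lW j) hp; have FW' := lin_stable (lW' j) hp.
rewrite (linD (linop_insx i) (FhatZ a FW) (FhatZ b FW')).
by rewrite (linZ (linop_insx i) a FW) (linZ (linop_insx i) b FW'); ring.
Qed.

Lemma eq_act e W W' u : goodc t u -> (forall c phi xs, Fhat t phi -> W c phi xs = W' c phi xs) ->
  act e W u = act e W' u.
Proof.
move=> gu h; apply/funext => l; apply/funext => xs.
by apply: eq_bigr => c _; apply: eq_bigr => j _; rewrite h.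
Qed.

Local Notation V := (option (bas A) -> seq U -> k^o).

Lemma act_lin e (a b : k) W W' u :
  act e (fun c phi xs => a * W c phi xs + b * W' c phi xs) u = 
    (a *: (act e W u : V) + b *: (act e W' u : V) : V).
Proof.
apply/funext => l; apply/funext => xs.
rewrite -[RHS]/(a * act e W u l xs + b * act e W' u l xs) /act !mulr_sumr -big_split.
apply: eq_bigr => c _ /=; rewrite !mulr_sumr -big_split; apply: eq_bigr => j _ /=.
by ring.
Qed.

Lemma act0 e W u : (forall c phi xs, Fhat t phi -> W c phi xs = 0) -> goodc t u -> act e W u = 0 :> V.
Proof.
move=> h gu; apply/funext => l; apply/funext => xs.
by apply: big1 => c _; apply: big1 => j _; rewrite h ?mulr0.
Qed.

(** The degree n term of exp(ad iota_xi)(d_A + D), without d_A itself, which [aop] adds for n = 0.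
    Since [iota_xi, d_A] = - iota_{d xi} commutes with iota_xi, the differential d_A contributes to
    degrees 0 and 1 only. *)
Definition Wn n c : operator U := fun phi xs =>
  (n`!%:R)^-1 * Qn n c phi xs + (- (n == 1%N)%:R) * insdx c phi xs.

Lemma linop_Wn n c : linop t (Wn n c).
Proof.
have l1 := linop_Qn n c; have l2 := linop_insdx c.
have F := linop_lin ((n`!%:R)^-1) l1 (linop_lin (- (n == 1%N)%:R) l2 linop0).
have -> // : Wn n c = fun phi xs => (n`!%:R)^-1 * Qn n c phi xs + 
  ((- (n == 1%N)%:R) * insdx c phi xs + 0).
by apply/funext => phi; apply/funext => xs; rewrite addr0.
Qed.

Definition aop n (u : V) : V := (if n is 0 then opd u : V else 0) + (act true (Wn n) u : V).

Lemma aop_glin n : glin (V := V) (goodc t) (aop n).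
Proof.
have [s1 l1] := act_glin true (linop_Wn n); have [s2 l2] := @opd_glin k A U t.
case: n s1 l1 => [|n] s1 l1; rewrite /aop; split=> [u gu|a u v gu gv].
- by move=> l; apply: FhatD; [exact: s2 | exact: s1].
- by rewrite l1 // l2 // scalerDr addrACA.
- by rewrite add0r; exact: s1.
- by rewrite !add0r; exact: l1.
Qed.

Lemma opd_insx u : goodc t u ->
  (act false insx (opd u) : V) - opd (act false insx u) = - (act true insdx u : V).
Proof.
move=> gu; rewrite (opd_act false linop_insx gu) /= expr0 scale1r opprD addrCA subrr addr0.
congr (- _); apply: eq_act => // -[s|] phi xs hp; last first.
  by rewrite big1 // => -[c|] _; rewrite mul0r.
rewrite big_option /= mul0r add0r.
transitivity (\sum_(i : bas A) ins t (~~ bpar s) (bdiff i s *: xi i) phi xs); last first.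
  have m := Fhat_ml hp; rewrite /dxi.
  elim: (index_enum _) => [|i r IH]; first by rewrite !big_nil (ins0w _ _ xs m).
  by rewrite !big_cons (ins_linw _ _ _ _ _ xs m) IH insZw.
apply: eq_bigr => i _; rewrite (insZw _ _ _ _ xs (Fhat_ml hp)) scale_regE.
have [->|nz] := eqVneq (bdiff i s) 0; first by rewrite !mul0r.
by rewrite (bdiff_parity nz) negbK.
Qed.

(** The recursion for the terms of an exponential series: [adX_Qn] for the part from [D], [opd_insx]
    for the part from d_A, and [adX_insdx] to stop the latter after degree 1. *)
Lemma aop_rec n u : goodc t u ->
  n.+1%:R *: aop n.+1 u = (act false insx (aop n u) : V) - aop n (act false insx u).
Proof.
move=> gu; have [s1 l1] := act_glin false linop_insx.
have gX : goodc t (act false insx u) := s1 u gu.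
have gW : goodc t (act true (Wn n) u) := proj1 (act_glin true (linop_Wn n)) u gu.
have gd := proj1 (@opd_glin k A U t) u gu.
have Hn := natr_neq0 char0 n.
have C : (act false insx (act true (Wn n) u) : V) - (act true (Wn n) (act false insx u)) =
   n`!%:R^-1 *: (act true (Qn n.+1) u : V).
  rewrite (act_comp false true linop_insx (linop_Wn n) gu) (act_comp true false (linop_Wn n) linop_insx gu) /=.
  transitivity (act true (adX (Wn n)) u : V).
    have := act_lin true 1 (-1) (mulop false insx (Wn n)) (mulop true (Wn n) insx) u.
    rewrite scale1r scaleN1r => <-; apply: eq_act => // c phi xs hp.
    by rewrite mul1r mulN1r.
  have -> : act true (adX (Wn n)) u = act true (fun c phi xs => n`!%:R^-1 * Qn n.+1 c phi xs + 0 * adX insdx c phi xs) u.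
    apply: eq_act => // c phi xs hp.
    by rewrite adX_lin //; [rewrite adX_Qn // adX_insdx // !mulr0|exact: linop_Qn|exact: linop_insdx].
  by rewrite act_lin scale0r addr0.
have -> : act false insx (aop n u) = (act false insx (if n is 0 then opd u : V else 0) : V)
   + (act false insx (act true (Wn n) u) : V).
  have l11 := l1 1; rewrite /aop; have := l11 (if n is 0 then opd u : V else 0) (act true (Wn n) u).
  by rewrite !scale1r; apply=> //; case: (n) => [|?] //; exact: goodc0.
rewrite /aop opprD addrACA C {C} add0r.
have fE : n.+1%:R * (n.+1)`!%:R^-1 = n`!%:R^-1 :> k.
  by rewrite factS natrM invfM mulrA mulfV // mul1r.
have -> : n.+1%:R *: (act true (Wn n.+1) u : V) =
    n`!%:R^-1 *: (act true (Qn n.+1) u : V) - (if n is 0 then act true insdx u : V else 0).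
  rewrite act_lin scalerDr scalerA fE scalerA; congr (_ + _).
  by case: (n) => [|?] /=; [rewrite mul1r scaleN1r | rewrite mulr0n !oppr0 mulr0 scale0r].
rewrite addrC; congr (_ + _); case: (n) => [|?]; first by rewrite opd_insx.
by rewrite oppr0 addr0 (glin0 (@goodc0 k A U t) (act_glin false linop_insx)).
Qed.

(** Both d_A and [D] square to zero. The operator [D] acts on the coefficient at e_l with the sign
    (-1)^|e_l|, so it anticommutes with d_A. *)
Lemma aop_sq u : goodc t u -> aop 0 (aop 0 u) = 0.
Proof.
move=> gu.
have W0 c phi xs : Wn 0 c phi xs = (c == None)%:R * D phi xs.
  by rewrite /Wn fact0 invr1 mul1r oppr0 mul0r addr0.
have aE v : goodc t v -> act true (Wn 0) v = (fun l xs => sg (op l) * D (v l) xs).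
  move=> gv; apply/funext => l; apply/funext => xs.
  rewrite /act big_option /= [X in _ + X]big1 ?addr0 => [|i _]; last first.
    by rewrite big1 // => j _; rewrite W0 mul0r mulr0.
  rewrite -[RHS](@sum_delta _ _ l (fun j => sg (op j) * D (v j) xs)).
  by apply: eq_bigr => j _; rewrite W0 eqxx !mul1r mulrA.
have g0 := proj1 (aop_glin 0) u gu; have gd := proj1 (@opd_glin k A U t) u gu.
have ga := proj1 (act_glin true (linop_Wn 0)) u gu.
have [sd ld] := @opd_glin k A U t.
apply/funext => l; apply/funext => xs.
rewrite -[RHS]/(0 : k) {1}/aop.
rewrite -[LHS]/(opd (aop 0 u) l xs + act true (Wn 0) (aop 0 u) l xs) aE //.
have -> : aop 0 u = (1 *: (opd u : V) + (act true (Wn 0) u : V) : V) by rewrite scale1r.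
rewrite (ld 1 _ _ gd ga) -[X in X + _]/(1 * opd (opd u) l xs + opd (act true (Wn 0) u) l xs).
have -> : opd (opd u) l xs = 0.
  rewrite /opd.
  under eq_bigr => i _ do rewrite mulr_sumr.
  rewrite exchange_big big1 // => j _.
  transitivity ((\sum_i obdiff j i * obdiff i l) * u j xs); last by rewrite obdiffK mul0r.
  by rewrite mulr_suml; apply: eq_bigr => i _; ring.
have -> : D ((1 *: (opd u : V) + (act true (Wn 0) u : V) : V) l) xs =
   1 * D (opd u l) xs + D (act true (Wn 0) u l) xs.
  by have /funeqP := lin_linear lD 1 (gd l) (ga l); exact.
rewrite aE //; cbn beta; rewrite (linZ lD (sg (op l)) (lin_stable lD (gu l))) DD // /opd (lin_sum lD) => [|i _]; last exact: FhatZ.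
rewrite mulr0 mulr0 add0r addr0 mul1r mulr_sumr -big_split big1 // => i _ /=.
rewrite (linZ lD) //.
have [->|nz] := eqVneq (obdiff i l) 0; first by rewrite !(mul0r, mulr0) addr0.
by rewrite (obdiff_parity nz); case: (op i); rewrite /= ?expr0 ?expr1; ring.
Qed.

Lemma Qn_nil n c phi xs : (nilbound A < n)%N -> Qn n c phi xs = 0.
Proof. by move=> h; exact: evA_nil. Qed.

(** From degree [(nilbound A).+2] on all terms vanish: the derived brackets by nilpotency, and
    iota_{d xi} because it sits in degree 1. Twice this bound is the range that [conj_sum_square]
    uses. *)
Definition Wtot c : operator U := fun phi xs => \sum_(0 <= n < (nilbound A).+2 + (nilbound A).+2) Wn n c phi xs.

Lemma linop_Wtot c : linop t (Wtot c).
Proof.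
have := linop_sum (index_iota 0 ((nilbound A).+2 + (nilbound A).+2)) (fun=> 1) (fun n => linop_Wn n c).
suff -> : (fun phi xs => \sum_(j0 <- index_iota 0 ((nilbound A).+2 + (nilbound A).+2)) 1 * Wn j0 c phi xs)
  = Wtot c by [].
apply/funext => phi; apply/funext => xs.
by apply: eq_bigr => n _; rewrite mul1r.
Qed.

(** The square-zero operator d_A + Wtot is applied to the element 1 (x) phi. *)
Lemma Wtot_square l phi xs : Fhat t phi ->
  \sum_i obdiff i l * Wtot i phi xs
  + \sum_i \sum_j um i j l * sg (~~ op i && op j) * Wtot i (Wtot j phi) xs = 0.
Proof.
move=> hp; pose u : V := fun l => if l is None then phi else fun=> 0.
have gu : goodc t u by case=> [?|]; [exact: Fhat0|].
have S v : goodc t v -> \sum_(0 <= n < (nilbound A).+2 + (nilbound A).+2) aop n v =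
    (opd v : V) + (act true Wtot v : V).
  move=> gv; rewrite /aop big_split big_nat_recl //= [X in _ + X + _]big1 // addr0; congr (_ + _).
  apply/funext => l'; apply/funext => xs'; rewrite !fct_sumE /act /Wtot exchange_big.
  apply: eq_bigr => c _; rewrite exchange_big; apply: eq_bigr => j _ /=.
  by rewrite -mulr_sumr.
have := @conj_sum_square k char0 V (goodc t) (@goodc0 k A U t) (@goodc_lin k A U t)
   (act false insx) aop (act_glin false linop_insx) aop_glin aop_rec aop_sq (nilbound A).+2 u gu.
have gs v : goodc t v -> goodc t ((opd v : V) + (act true Wtot v : V) : V).
  move=> gv l'; apply: FhatD; first exact: (proj1 (@opd_glin k A U t) v gv).
  exact: (proj1 (act_glin true linop_Wtot) v gv).
rewrite (S u gu) (S _ (gs u gu)).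
have gd := proj1 (@opd_glin k A U t) u gu.
have ga := proj1 (act_glin true linop_Wtot) u gu.
have [sd ld] := @opd_glin k A U t.
have -> : opd ((opd u : V) + (act true Wtot u : V) : V) = ((opd (opd u) : V) + opd (act true Wtot u) : V).
  by have := ld 1 _ _ gd ga; rewrite !scale1r.
have -> : act true Wtot ((opd u : V) + (act true Wtot u : V) : V) =
  ((act true Wtot (opd u) : V) + act true Wtot (act true Wtot u) : V).
  by have := proj2 (act_glin true linop_Wtot) 1 _ _ gd ga; rewrite !scale1r.
have ou0 : opd u = 0 :> V.
  apply/funext => l'; apply/funext => xs'; rewrite -[RHS]/(0 : k) /opd big_option /= mul0r add0r.
  by rewrite big1 // => i _; rewrite mulr0.
have aW : act true Wtot u = fun l xs => Wtot l phi xs.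
  apply/funext => l'; apply/funext => xs'; rewrite /act.
  rewrite -[RHS](@sum_delta _ _ l' (fun c => Wtot c phi xs')); apply: eq_bigr => c _.
  rewrite big_option (_ : um c None l' = (c == l')%:R) /=; last by case: (c).
  rewrite andbF expr0 mulr1 big1 ?addr0 // => i _.
  have /funeqP -> := lin0 (linop_Wtot c).
  by rewrite mulr0.
rewrite ou0 !(glin0 (@goodc0 k A U t) (@opd_glin k A U t)) (glin0 (@goodc0 k A U t) (act_glin true linop_Wtot)).
rewrite !add0r aW => H.
have {}H : (opd (fun l xs => Wtot l phi xs) : V) + (act true Wtot (fun l xs => Wtot l phi xs) : V) = 0.
  apply: H => n v Mn gv; case: n Mn => // -[//|n] Mn; rewrite /aop add0r act0 // => c phi' xs' hp'.
  by rewrite /Wn Qn_nil ?(ltnW Mn) // mulr0 add0r oppr0 mul0r.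
by have /(congr1 (fun F : V => F l xs)) := H.
Qed.

(** The component of [Wtot] at the unit is [D], and separating it from the others turns
    [Wtot_square] into the Maurer-Cartan equation. By graded commutativity of A both halves of the
    commutators [x_i, x_j] have the same sum, which cancels the factor 1/2. *)
Lemma MC_der_left0 (x : bas A -> operator U) (l : bas A) phi xs : Fhat t phi ->
  (forall phi (xs : seq U), Fhat t phi -> Wtot None phi xs = D phi xs) ->
  (forall (i : bas A) phi (xs : seq U), Fhat t phi -> Wtot (Some i) phi xs = x i phi xs) ->
  MC_der_left D x l phi xs = 0.
Proof.
move=> hp WN WS.
have SD := lin_stable lD hp.
have Sx (i : bas A) : Fhat t (x i phi).
  have -> : x i phi = Wtot (Some i) phi by apply/funext => ys; rewrite WS.
  exact: (lin_stable (linop_Wtot _) hp).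
have ES (i : bas A) : Wtot (Some i) phi = x i phi by apply/funext => ys; rewrite WS.
have EN : Wtot None phi = D phi by apply/funext => ys; rewrite WN.
have := Wtot_square (Some l) xs hp.
rewrite !big_option /= mul0r add0r.
under eq_bigr => i _ do rewrite ES.
pose S2 := \sum_i \sum_j bmul i j l * sg (~~ bpar i && bpar j) * x i (x j phi) xs.
have -> : \sum_i um None (Some i) (Some l) * sg (bpar i) * Wtot None (Wtot (Some i) phi) xs =
    sg (bpar l) * D (x l phi) xs.
  rewrite -[RHS](@sum_delta _ _ l (fun i : bas A => sg (bpar i) * D (x i phi) xs)).
  by apply: eq_bigr => i _; rewrite ES WN // mulrA.
have -> : \sum_i \sum_j um (Some i) j (Some l) * sg (~~ bpar i && op j) * Wtot (Some i) (Wtot j phi) xs =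
    x l (D phi) xs + S2.
  rewrite /S2 -[X in X + _](@sum_delta _ _ l (fun i : bas A => x i (D phi) xs)) -big_split.
  apply: eq_bigr => i _; rewrite big_option EN WS // andbF expr0 mulr1; congr (_ + _).
  by apply: eq_bigr => j _; rewrite ES WS.
rewrite mul0r mul0r add0r => H; rewrite /MC_der_left /scomm -[RHS]H !addrA; congr (_ + _).
- rewrite -[RHS]addrA; congr (_ + _); rewrite mulrBr mulrA -signr_addb.
  have -> : bpar l (+) (true && ~~ bpar l) = true by case: (bpar l).
  by rewrite expr1 mulN1r opprK.
- have [n2 e2] : (2%:R : k) != 0 /\ S2 + S2 = 2%:R * S2.
    by split; [exact: natr_neq0 | rewrite mulr_natl mulr2n].
  apply: (mulfI n2); rewrite mulrA mulfV // mul1r -e2.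
  under eq_bigr => i _ do under eq_bigr => j _ do rewrite mulrBr.
  under eq_bigr => i _ do rewrite sumrB.
  rewrite sumrB; congr (_ + _).
    by apply: eq_bigr => i _; apply: eq_bigr => j _; rewrite [in LHS](mulrC (sg _)).
  rewrite exchange_big -sumrN /=; apply: eq_bigr => j _; rewrite -sumrN; apply: eq_bigr => i _.
  rewrite bmulC; set m := bmul j i l; set z := x j _ _.
  by case: (bpar i); case: (bpar j); rewrite /= ?expr0 ?expr1; ring.
Qed.

End PushMC.

(** * The image of a Maurer-Cartan element *)

Section PushTwist.
Variables (k : fieldType) (char0 : [pchar k] =i pred0) (U : superspace k).
Variables (t : ftype) (D DV : operator U) (mu : seq U -> U).
Hypotheses (dD : Der0 t true D) (DD : forall phi, Fhat t phi -> D (D phi) = fun=> 0).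
Hypotheses (dDV : derivation Sym true DV) (mu_ml : multilinear mu).
Hypothesis mu_homog : forall hs, hh hs -> homog (~~ tpar (map fst hs)) (mu (map snd hs)).
Hypothesis DV_mu : forall hs q (psi : {linear U -> k^o}), hh hs -> hfun q psi ->
  DV (gen psi) (map snd hs) = sg (~~ tpar (map fst hs)) * psi (mu (map snd hs)).
Hypothesis D_mu : forall hs q (psi : {linear U -> k^o}), hh hs -> hfun q psi ->
  inss t hs (D (gen psi)) [::] = sg (~~ tpar (map fst hs)) * psi (mu (map snd hs)).
Variables (A : nilcdga k) (xi : bas A -> U).
Hypothesis exi : even xi.
Implicit Types (phi : seq U -> k^o).
Local Notation op := (@opar k A).
Let lD : linop t D := der_linop (proj1 dD).

(* [dxi] is the Maurer-Cartan equation *)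
Hypothesis MCxi : forall l : bas A, MC_left Sym mu xi l = 0.

Lemma pushA_ev (f : seq U -> operator U) (l : bas A) phi xs :
  (forall phi xs, Fhat t phi -> multilinear (R := k^o) (fun ws => f ws phi xs)) -> Fhat t phi ->
  pushA f xi l phi xs = \sum_(1 <= r < (nilbound A).+1) r`!%:R^-1 *
    evA xi r (fun hs => f (map snd hs) phi xs : k^o) (Some l).
Proof.
move=> mf hp; apply: eq_bigr => r _; congr (_ * _).
by have := extA_evA false r (Some l) (mf phi xs hp) exi; rewrite expr0 scale1r.
Qed.

(** The Maurer-Cartan equation of xi solved for d xi, with the signs written in terms of [nu]. *)
Lemma nu_sum : forall l : bas A,
  \sum_(1 <= n < (nilbound A).+1) n`!%:R^-1 *: evA xi n (nu mu) (Some l) = dxi xi l.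
Proof.
move=> l; apply/eqP; rewrite -subr_eq0 -oppr_eq0 opprB; apply/eqP; rewrite -[RHS](MCxi l).
rewrite /MC_left; congr (_ + _); rewrite -sumrN; apply: eq_bigr => n _.
rewrite -scalerN; congr (_ *: _); rewrite (extA_evA true n (Some l) mu_ml exi) /=.
have -> : nu mu = (fun hs => -1 *: (sg (true && tpar (map fst hs)) *: mu (map snd hs))).
  by apply/funext => hs; rewrite /nu scalerA; congr (_ *: _); case: (tpar _); rewrite /= ?expr0 ?expr1; ring.
by rewrite evAZ evA_sign scaleN1r opprK.
Qed.

Lemma ev_ins_nu n l phi xs : Fhat t phi ->
  evA xi n (fun hs => ins t (~~ tpar (map fst hs)) (nu mu hs) phi xs) l =
    ins t (~~ op l) (evA xi n (nu mu) l) phi xs.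
Proof.
move=> hp; have m := Fhat_ml hp; rewrite !ev_sum.
transitivity (\sum_(s : n.-tuple (bas A)) ins t (~~ op l) ((prodc (@bmul k A) (map Some s) l *
    sg (isign (map (@bpar k A) s) (map (@bpar k A) s))) *: nu mu [seq (bpar (n := A) a, xi a) | a <- s]) phi xs).
  apply: eq_bigr => s _; rewrite (insZw _ _ _ _ xs m) scale_regE.
  have [->|nz] := eqVneq (prodc (@bmul k A) (map Some s) l) 0; first by rewrite !mul0r.
  rewrite (prodc_parity nz) -!map_comp; congr (_ * ins t (~~ tpar _) _ _ _).
rewrite evA_prodc.
elim: (index_enum _) => [|s r IH]; first by rewrite !big_nil ins0w.
by rewrite !big_cons IH -[X in ins _ _ (X + _)]scale1r ins_linw // scale_regE mul1r.
Qed.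

Lemma Wtot_None phi xs : Wtot t D xi None phi xs = D phi xs.
Proof.
rewrite /Wtot big_nat_recl // big1 ?addr0 => [|n _].
  by rewrite /Wn /Qn /= fact0 invr1 mul1r oppr0 mul0r addr0 scale_regE mul1r.
by rewrite /Wn /Qn evA_None /= !mulr0 addr0.
Qed.

(** The constant parts of the derived brackets on xi, ..., xi add up to iota_{d xi} by [nu_sum].
    Hence the term - iota_{d xi} of [Wtot] removes precisely these constant parts and leaves the
    image of xi under f. *)
Lemma Wtot_Some (l : bas A) phi xs : Fhat t phi ->
  Wtot t D xi (Some l) phi xs = pushA (twf t D mu) xi l phi xs.
Proof.
move=> hp.
rewrite pushA_ev //; last by move=> *; exact: twf_ml.
rewrite /Wtot /Wn big_split /= addnS [X in _ + X]big_nat_recl // [X in _ + (_ + X)]big_nat_recl //.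
rewrite [X in _ + (_ + (_ + X))]big1 ?addr0 => [|n _]; last by rewrite /= oppr0 mul0r.
rewrite /= oppr0 mul0r add0r mulN1r big_nat_recl //.
rewrite (_ : Qn _ _ _ 0 _ _ _ = 0) ?mulr0 ?add0r; last exact: mul0r.
rewrite -[X in X - _](big_add1 _ _ 0 ((nilbound A).+2 + (nilbound A).+1).+1 xpredT
  (fun n => n`!%:R^-1 * Qn t D xi n (Some l) phi xs)).
rewrite (big_cat_nat (n := (nilbound A).+1)) //=; last by rewrite !addSnnS leq_addr.
rewrite [X in _ + X - _]big_nat [X in _ + X - _]big1 ?addr0 => [|n /andP [Nn _]]; last first.
  by rewrite Qn_nil // mulr0.
have -> : ins t (~~ bpar l) (dxi xi l) phi xs = \sum_(1 <= n < (nilbound A).+1)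
   n`!%:R^-1 * evA xi n (fun hs => ins t (~~ tpar (map fst hs)) (nu mu hs) phi xs : k^o) (Some l).
  have m := Fhat_ml hp; rewrite -nu_sum; elim: (index_iota _ _) => [|n r IH].
    by rewrite !big_nil ins0w.
  by rewrite !big_cons ins_linw // IH ev_ins_nu.
rewrite -sumrB; apply: eq_big_nat => n /andP [n0 _].
rewrite -mulrBr; congr (_ * _); apply/eqP; rewrite subr_eq; apply/eqP.
have := evA_lin xi n (1 : k) (fun hs => twf t D mu (map snd hs) phi xs : k^o)
  (fun hs => ins t (~~ tpar (map fst hs)) (nu mu hs) phi xs : k^o) (Some l).
rewrite scale1r => <-; apply: (eq_evA _ exi) => -[|h hs] hhs sn; first by rewrite -sn in n0.
by rewrite (twfE dD mu_ml) // scale1r /= /tder mulN1r addrAC addNr add0r.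
Qed.

Lemma pushA_MC phi xs (l : bas A) : Fhat t phi ->
  MC_der_left D (fun l => pushA (twf t D mu) xi l) l phi xs = 0.
Proof.
move=> hp; apply: (MC_der_left0 char0 lD DD exi) => // [{}phi {}xs {}hp|{}l {}phi {}xs {}hp].
  exact: Wtot_None.
exact: Wtot_Some.
Qed.

End PushTwist.

(** * Membership of the image in the target Lie algebra *)

Section PushClosed.
Variables (k : fieldType) (U : superspace k) (t : ftype) (W : bool -> operator U -> Prop).
Variables (A : nilcdga k) (xi : bas A -> U).
Hypothesis exi : even xi.

(** What the cyclic and the non-cyclic targets have in common and what is needed to form finite
    linear combinations of values of f inside them; operators matter only through their values on
    the completed algebra. *)
Record opclosed : Prop := Opclosed {
  opc_zero : forall b, W b (fun _ _ => 0);
  opc_lin : forall b (a : k) E F, W b E -> W b F -> W b (fun phi xs => a * E phi xs + F phi xs);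
  opc_eq : forall b E F, W b E -> (forall phi, Fhat t phi -> E phi = F phi) -> W b F }.

Lemma opc_sum (J : Type) (r : seq J) (a : J -> k) (F : J -> operator U) b : opclosed ->
  (forall j : J, a j != 0 -> W b (F j)) -> W b (fun phi xs => \sum_(j <- r) a j * F j phi xs).
Proof.
move=> cW h; elim: r => [|j r IH].
  by apply: (opc_eq cW (opc_zero cW b)) => phi _; apply/funext => xs; rewrite big_nil.
have [z|nz] := eqVneq (a j) 0.
  by apply: (opc_eq cW IH) => phi _; apply/funext => xs; rewrite big_cons z mul0r add0r.
by apply: (opc_eq cW (opc_lin cW (a j) (h j nz) IH)) => phi _; apply/funext => xs; rewrite big_cons.
Qed.

Lemma pushA_closed (f : seq U -> operator U) (l : bas A) : opclosed ->
  (forall phi xs, Fhat t phi -> multilinear (R := k^o) (fun ws => f ws phi xs)) ->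
  (forall hs, hh hs -> W (~~ tpar (map fst hs)) (f (map snd hs))) ->
  W (~~ bpar l) (pushA f xi l).
Proof.
move=> cW mf Wf.
pose w r : r.-tuple (bas A) -> k := fun s =>
  prodc (@bmul k A) (map Some s) (Some l) * sg (isign (map (@bpar k A) s) (map (@bpar k A) s)).
apply: (opc_eq cW (E := fun phi xs => \sum_(r <- index_iota 1 (nilbound A).+1) r`!%:R^-1 *
   (\sum_(s <- index_enum (r.-tuple (bas A))) w r s * f [seq xi a | a <- s] phi xs))).
  apply: opc_sum => // r _; apply: opc_sum => // s nz.
  have e : prodc (@bmul k A) (map Some s) (Some l) != 0.
    by apply: contraNneq nz; rewrite /w => ->; rewrite mul0r.
  have := prodc_parity e => /= ->; rewrite -map_comp.
  have := Wf [seq (bpar (n := A) a, xi a) | a <- s]; rewrite -!map_comp; apply.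
  by elim: (val s) => //= a s' IH; apply/hh_cons; split.
move=> phi hp; apply/funext => xs; rewrite (@pushA_ev k U t A xi exi f l phi xs mf hp).
apply: eq_bigr => r _; congr (_ * _); rewrite ev_sum.
by apply: eq_bigr => s _; rewrite -map_comp.
Qed.

End PushClosed.

(** * Adjoining a contractible pair of generators to A *)

Section ExtAlg.
Variables (k : fieldType) (A : nilcdga k) (p : bool).
Local Notation um := (umul (@bmul k A)).
Local Notation op := (@opar k A).
Local Notation K := (option (bas A)).

(** The nilpotent algebra A_+ + A eps_true + A eps_false, in which products of two eps vanish and d
    eps_false = eps_true; [inr (i, b)] is e_i eps_b. The parity of eps_true is p, so that eps_true
    (x) w is even for w of parity p. *)
Definition ext_bas : finType := (bas A + K * bool)%type.
Definition upar (b : bool) := p (+) ~~ b.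

Definition ext_par (x : ext_bas) : bool :=
  match x with inl i => bpar i | inr (i, b) => op i (+) upar b end.

Definition ext_mul (x y z : ext_bas) : k :=
  match x, y, z with
  | inl i, inl j, inl l => bmul i j l
  | inl i, inr (j, b), inr (l, c) => (b == c)%:R * um (Some i) j l
  | inr (i, b), inl j, inr (l, c) => (b == c)%:R * (sg (upar b && bpar j) * um i (Some j) l)
  | _, _, _ => 0
  end.

Definition ext_diff (x z : ext_bas) : k :=
  match x, z with
  | inl i, inl l => bdiff i l
  | inr (i, b), inr (l, c) => (b == c)%:R * obdiff i l + (~~ b && c)%:R * (sg (op i) * (i == l)%:R)
  | _, _ => 0
  end.

Lemma sum_ext (R : nmodType) (F : ext_bas -> R) :
  \sum_s F s = \sum_(i : bas A) F (inl i) + \sum_(i : K) \sum_(b : bool) F (inr (i, b)).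
Proof. by rewrite big_sumType pair_bigA; congr (_ + _); apply: eq_bigr => -[]. Qed.

Lemma sum_ext_bool (b : bool) (F : bool -> k) : \sum_(c : bool) (b == c)%:R * F c = F b.
Proof. by case: b; rewrite big_bool /= !(mul0r, mul1r, add0r, addr0). Qed.

Lemma sum_K_bas (i j : bas A) (F : K -> k) :
  \sum_s um (Some i) (Some j) s * F s = \sum_s bmul i j s * F (Some s).
Proof. by rewrite big_option /= mul0r add0r. Qed.

Lemma ext_mul_parity x y z : ext_mul x y z != 0 -> ext_par z = ext_par x (+) ext_par y.
Proof.
case: x => [i|[i b]]; case: y => [j|[j c]]; case: z => [l|[l e]]; rewrite /= ?eqxx //.
- exact: bmul_parity.
- case: (c =P e) => [<-|_]; last by rewrite mul0r eqxx.
  by rewrite mul1r => /um_parity ->; rewrite addbA.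
- case: (b =P e) => [<-|_]; last by rewrite mul0r eqxx.
  rewrite mul1r mulf_eq0 negb_or => /andP [_ /um_parity ->] /=.
  exact: addbAC.
Qed.

Lemma ext_mulC x y z : ext_mul x y z = sg (ext_par x && ext_par y) * ext_mul y x z.
Proof.
have S (b : bool) : sg b * sg b = 1 :> k by rewrite -signr_addb addbb.
case: x => [i|[i b]]; case: y => [j|[j c]]; case: z => [l|[l e]]; rewrite /= ?mulr0 //.
- exact: bmulC.
- rewrite umC; case: (c == e); rewrite ?mul0r ?mulr0 // !mul1r mulrA -signr_addb; congr (sg _ * _).
  by rewrite /=; case: (bpar i); case: (op j); case: (upar c).
- rewrite umC; case: (b == e); rewrite ?mul0r ?mulr0 // !mul1r mulrA -signr_addb; congr (sg _ * _).
  by rewrite /=; case: (op i); case: (bpar j); case: (upar b).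
Qed.

Lemma ext_mulA x y z w :
  \sum_s ext_mul x y s * ext_mul s z w = \sum_s ext_mul y z s * ext_mul x s w.
Proof.
have Z (F G : ext_bas -> k) : (forall s, F s * G s = 0) -> \sum_s F s * G s = 0.
  by move=> h; apply: big1 => s _; exact: h.
have ZK (F : ext_bas -> k) : (forall b, F (inr b) = 0) -> \sum_s F s = \sum_(i : bas A) F (inl i).
  move=> h; rewrite sum_ext [X in _ + X]big1 ?addr0 // => i _.
  by apply: big1 => b _; exact: h.
have ZT (F : ext_bas -> k) c : (forall i, F (inl i) = 0) -> (forall i b, F (inr (i, b)) = (c == b)%:R * F (inr (i, c))) ->
    \sum_s F s = \sum_(i : K) F (inr (i, c)).
  move=> h1 h2; rewrite sum_ext [X in X + _]big1 ?add0r //; apply: eq_bigr => i _.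
  rewrite -[RHS](sum_ext_bool c (fun=> F (inr (i, c)))); apply: eq_bigr => b _; exact: h2.
case: w => [l|[l e]]; case: x => [i|[i b]]; case: y => [j|[j c]]; case: z => [h|[h d]];
  try by rewrite !Z // => -[?|[? ?]]; rewrite /= ?(mul0r, mulr0).
- rewrite !ZK => [|[? ?]|[? ?]]; rewrite /= ?(mul0r, mulr0) //; exact: bmulA.
- rewrite ZK => [|[? ?]]; last by rewrite /= mul0r.
  rewrite (ZT _ d) => [|?|s b] /=; [|by rewrite ?(mul0r, mulr0)|by case: (d =P b) => [->|_]; rewrite ?eqxx ?mulr1n ?mulr0n ?mul1r ?mul0r].
  rewrite eqxx mulr1n.
  have H := umA (Some i) (Some j) h l; rewrite sum_K_bas in H.
  transitivity ((d == e)%:R * (\sum_s bmul i j s * um (Some s) h l)).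
    by rewrite mulr_sumr; apply: eq_bigr => s _; ring.
  by rewrite H mulr_sumr; apply: eq_bigr => s _; ring.
- rewrite (ZT _ c) => [|?|s b] /=; [|by rewrite ?(mul0r, mulr0)|by case: (c =P b) => [->|_]; rewrite ?eqxx ?mulr1n ?mulr0n ?mul1r ?mul0r].
  rewrite eqxx mulr1n.
  rewrite (ZT _ c) => [|?|s b] /=; [|by rewrite ?(mul0r, mulr0)|by case: (c =P b) => [->|_]; rewrite ?eqxx ?mulr1n ?mulr0n ?mul1r ?mul0r].
  rewrite eqxx mulr1n.
  have H := umA (Some i) j (Some h) l.
  transitivity ((c == e)%:R * sg (upar c && bpar h) * (\sum_s um (Some i) j s * um s (Some h) l)).
    by rewrite mulr_sumr; apply: eq_bigr => s _; ring.
  by rewrite H mulr_sumr; apply: eq_bigr => s _; ring.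
- rewrite (ZT _ b) => [|?|s d] /=; [|by rewrite ?(mul0r, mulr0)|by case: (b =P d) => [->|_]; rewrite ?eqxx ?mulr1n ?mulr0n ?mul1r ?mul0r].
  rewrite eqxx mulr1n.
  rewrite ZK => [|[? ?]]; last by rewrite /= mul0r.
  have H := umA i (Some j) (Some h) l; rewrite sum_K_bas in H.
  transitivity ((b == e)%:R * sg (upar b && (bpar j (+) bpar h)) * (\sum_s um i (Some j) s * um s (Some h) l)).
    rewrite mulr_sumr; apply: eq_bigr => s _.
    have -> : sg (upar b && (bpar j (+) bpar h)) = sg (upar b && bpar j) * sg (upar b && bpar h) :> k.
      by rewrite -signr_addb; congr (sg _); case: (upar b).
    by ring.
  rewrite H mulr_sumr; apply: eq_bigr => s _.
  have [->|nz] := eqVneq (bmul j h s) 0; first by rewrite !(mul0r, mulr0).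
  by rewrite (bmul_parity nz); ring.
Qed.

Lemma ext_diff_parity x z : ext_diff x z != 0 -> ext_par z = ~~ ext_par x.
Proof.
case: x => [i|[i b]]; case: z => [l|[l c]]; rewrite /= ?eqxx //; first exact: bdiff_parity.
have [<-|ne] := eqVneq b c.
  rewrite andNb mul0r addr0 mul1r => /obdiff_parity ->; by case: (op i); case: (upar b).
rewrite mul0r add0r; case: b c ne => [] [] //= _; rewrite ?mul0r ?eqxx // mul1r.
rewrite mulf_eq0 negb_or => /andP [_ nz].
have {nz} <- : i = l by apply/eqP; apply: contraNT nz => /negPf ->; rewrite eqxx.
by rewrite /upar; case: (op i); case: (p).
Qed.

Lemma ext_diffK x z : \sum_s ext_diff x s * ext_diff s z = 0.
Proof.
case: x => [i|[i b]]; case: z => [l|[l c]]; rewrite sum_ext.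
- rewrite [X in _ + X]big1 ?addr0 => [|s _]; first exact: bdiffK.
  by apply: big1 => d _; rewrite /= mul0r.
- rewrite !big1 ?addr0 // => s _; last by rewrite /= mulr0.
  by apply: big1 => d _; rewrite /= mul0r.
- rewrite !big1 ?addr0 // => s _; last by rewrite /= mul0r.
  by apply: big1 => d _; rewrite /= mulr0.
rewrite big1 ?add0r => [|s _]; last by rewrite /= mul0r.
transitivity ((b == c)%:R * (\sum_s obdiff i s * obdiff s l) + (~~ b && c)%:R *
  ((\sum_s (s == l)%:R * (sg (op s) * obdiff i s)) + sg (op i) * (\sum_s (s == i)%:R * obdiff s l))).
  rewrite mulrDr !mulr_sumr -!big_split; apply: eq_bigr => s _; rewrite /= (eq_sym s i).
  by case: b; case: c; rewrite big_bool /=; ring.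
rewrite obdiffK mulr0 add0r !sum_delta.
have [->|nz] := eqVneq (obdiff i l) 0; first by rewrite !mulr0 addr0 mulr0.
by rewrite (obdiff_parity nz); case: (op i); rewrite /= ?expr0 ?expr1; ring.
Qed.

Lemma ext_diffM x y z : \sum_s ext_mul x y s * ext_diff s z =
  \sum_s ext_diff x s * ext_mul s y z + sg (ext_par x) * \sum_s ext_diff y s * ext_mul x s z.
Proof.
have Z (F G : ext_bas -> k) : (forall s, F s * G s = 0) -> \sum_s F s * G s = 0.
  by move=> h; apply: big1 => s _; exact: h.
have ZK (F : ext_bas -> k) : (forall b, F (inr b) = 0) -> \sum_s F s = \sum_(i : bas A) F (inl i).
  move=> h; rewrite sum_ext [X in _ + X]big1 ?addr0 // => i _.
  by apply: big1 => b _; exact: h.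
have ZT (F : ext_bas -> k) : (forall i, F (inl i) = 0) ->
    \sum_s F s = \sum_(i : K) (F (inr (i, true)) + F (inr (i, false))).
  move=> h1; rewrite sum_ext [X in X + _]big1 ?add0r //; apply: eq_bigr => i _.
  by rewrite big_bool.
have ob (i : bas A) (F : K -> k) : \sum_s obdiff (Some i) s * F s = \sum_s bdiff i s * F (Some s).
  by rewrite big_option /= mul0r add0r.
case: x => [i|[i b]]; case: y => [j|[j d]]; case: z => [l|[l c]];
  try by rewrite !Z ?mulr0 ?addr0 // => -[?|[? ?]]; rewrite /= ?(mul0r, mulr0).
- rewrite !ZK => [|[? ?]|[? ?]|[? ?]]; rewrite /= ?(mul0r, mulr0) //; exact: bdiffM.
- rewrite ZT => [|?]; last by rewrite /= mul0r.
  rewrite ZK => [|[? ?]]; last by rewrite /= mul0r.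
  rewrite ZT => [|?]; last by rewrite /= mul0r.
  transitivity ((d == c)%:R * (\sum_s um (Some i) j s * obdiff s l) + (~~ d && c)%:R *
     \sum_s (s == l)%:R * (um (Some i) j s * sg (op s))).
    rewrite !mulr_sumr -!big_split; apply: eq_bigr => s _ /=.
    by case: d; case: c; rewrite /=; ring.
  rewrite obdiffM sum_delta ob.
  transitivity ((d == c)%:R * (\sum_s bdiff i s * um (Some s) j l) + sg (bpar i) * (
    (d == c)%:R * (\sum_s obdiff j s * um (Some i) s l) + (~~ d && c)%:R * (sg (op j) * 
       \sum_s (s == j)%:R * um (Some i) s l))); last first.
    rewrite /= !mulr_sumr; congr (_ + _); first by apply: eq_bigr => s _; ring.
    rewrite -!big_split /= mulr_sumr; apply: eq_bigr => s _; rewrite (eq_sym s j).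
    by case: d; case: c; rewrite /=; ring.
  rewrite sum_delta; have [->|nz] := eqVneq (um (Some i) j l) 0; first by ring.
  by rewrite (um_parity nz) signr_addb /=; ring.
- rewrite ZT => [|?]; last by rewrite /= mul0r.
  rewrite ZT => [|?]; last by rewrite /= mul0r.
  rewrite ZK => [|[? ?]]; last by rewrite /= mul0r.
  transitivity (sg (upar b && bpar j) * ((b == c)%:R * (\sum_s um i (Some j) s * obdiff s l) + (~~ b && c)%:R *
     \sum_s (s == l)%:R * (um i (Some j) s * sg (op s)))).
    rewrite !mulr_sumr -!big_split mulr_sumr; apply: eq_bigr => s _ /=.
    by case: b; case: c; rewrite /=; ring.
  rewrite obdiffM sum_delta ob.
  transitivity (sg (upar b && bpar j) * ((b == c)%:R * (\sum_s obdiff i s * um s (Some j) l)) + 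
    (~~ b && c)%:R * (sg (upar c && bpar j) * (sg (op i) * \sum_s (s == i)%:R * um s (Some j) l))
    + sg (upar b && bpar j) * ((b == c)%:R * (sg (op i) * \sum_s bdiff j s * um i (Some s) l))); last first.
    congr (_ + _).
      rewrite !mulr_sumr -!big_split; apply: eq_bigr => s _; rewrite /= (eq_sym s i).
      by case: b; case: c; rewrite /=; ring.
    rewrite !mulr_sumr; apply: eq_bigr => s _ /=.
    have [->|nz] := eqVneq (bdiff j s) 0; first by ring.
    rewrite (bdiff_parity nz).
    have -> : sg (op i (+) upar b) = sg (op i) * sg (upar b && bpar j) * sg (upar b && ~~ bpar j) :> k.
      by rewrite -!signr_addb; congr (sg _); case: (op i); case: (upar b); case: (bpar j).
    have S e : sg e * sg e = 1 :> k by rewrite -signr_addb addbb.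
    transitivity (sg (upar b && bpar j) * ((b == c)%:R * (sg (op i) * (bdiff j s * um i (Some s) l)))
       * (sg (upar b && ~~ bpar j) * sg (upar b && ~~ bpar j))); last by ring.
    by rewrite S; ring.
  rewrite sum_delta; have [->|nz] := eqVneq (um i (Some j) l) 0; first by ring.
  rewrite (um_parity nz) signr_addb /=.
  case: b; case: c; rewrite /upar /=; try ring.
  by case: (p); case: (bpar j); rewrite /= ?expr0 ?expr1; ring.
Qed.

(** The coefficient at [l] of the product of the e_i, for i in [u], with [v]. It keeps the letters
    in front of the factor eps in the proof of nilpotency. *)
Fixpoint lmuls (u : seq (bas A)) (v : K -> k) (l : K) : k :=
  if u is i :: u' then \sum_j lmuls u' v j * um (Some i) j l else v l.

Lemma eq_lmuls u v v' l : v =1 v' -> lmuls u v l = lmuls u v' l.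
Proof.
by move=> e; elim: u l => [|i u IH] l /=; [exact: e|apply: eq_bigr => j _; rewrite IH].
Qed.

Lemma lmulsZ u v (a : k) l : lmuls u (fun j => a * v j) l = a * lmuls u v l.
Proof. by elim: u l => //= i u IH l; rewrite mulr_sumr; apply: eq_bigr => j _; rewrite IH mulrA. Qed.

Lemma lmuls_rcons u i v l : lmuls (rcons u i) v l = lmuls u (fun l => \sum_j v j * um (Some i) j l) l.
Proof. by elim: u l => //= h u IH l; apply: eq_bigr => j _; rewrite IH. Qed.

Lemma lmuls_prodc u s l : lmuls u (prodc (@bmul k A) (map Some s)) l = prodc (@bmul k A) (map Some (u ++ s)) l.
Proof. by elim: u l => //= h u IH l; apply: eq_bigr => j _; rewrite IH. Qed.

Lemma lmuls_mulr u v i l :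
  lmuls u (fun j => \sum_j' v j' * um j' i j) l = \sum_j lmuls u v j * um j i l.
Proof.
elim: u l => //= h u IH l.
transitivity (\sum_j' \sum_j lmuls u v j' * (um j' i j * um (Some h) j l)).
  rewrite exchange_big; apply: eq_bigr => j _; rewrite IH mulr_suml.
  by apply: eq_bigr => j' _; rewrite mulrA.
transitivity (\sum_j' \sum_j lmuls u v j' * (um (Some h) j' j * um j i l)).
  by apply: eq_bigr => j' _; rewrite -!mulr_sumr umA.
rewrite exchange_big; apply: eq_bigr => j _; rewrite mulr_suml.
by apply: eq_bigr => j' _; rewrite mulrA.
Qed.

(** [J] embeds A, with its unit, into the extended algebra; [T l b] stands for e_l eps_b. *)
Definition J (i : K) : option ext_bas := if i is Some i' then Some (inl i') else None.
Definition T (l : K) (b : bool) : option ext_bas := Some (inr (l, b)).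

Lemma sum_oext (R : nmodType) (F : option ext_bas -> R) :
  \sum_s F s = \sum_i F (J i) + \sum_i \sum_(b : bool) F (T i b).
Proof. by rewrite big_option sum_ext [X in _ = X + _]big_option addrA. Qed.

Lemma umJJJ i j l : umul ext_mul (J i) (J j) (J l) = um i j l.
Proof. by case: i => [i|]; case: j => [j|]; case: l => [l|]. Qed.

Lemma umJJT i j l b : umul ext_mul (J i) (J j) (T l b) = 0.
Proof. by case: i => [i|]; case: j => [j|]. Qed.

Lemma umTJ i c j l : umul ext_mul (T i c) j (J l) = 0.
Proof. by case: l => [l|]; case: j => [[?|[? ?]]|]. Qed.

Lemma umJT i j c l : umul ext_mul i (T j c) (J l) = 0.
Proof. by case: l => [l|]; case: i => [[?|[? ?]]|]. Qed.

Lemma umTT i c j d l : umul ext_mul (T i c) (T j d) l = 0.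
Proof. by case: l => [[?|[? ?]]|]. Qed.

Lemma umJTT i j c l b : umul ext_mul (J i) (T j c) (T l b) = (c == b)%:R * um i j l.
Proof.
case: i => [i|] //.
rewrite -[LHS]/(((j == l) && (c == b))%:R) -[um _ _ _]/((j == l)%:R).
by rewrite -natrM mulnb andbC.
Qed.

Lemma umTJT i j c l b :
  umul ext_mul (T i c) (J j) (T l b) = (c == b)%:R * (sg (upar c && op j) * um i j l).
Proof.
case: j => [j|] //.
rewrite -[LHS]/(((i == l) && (c == b))%:R) andbF expr0 mul1r.
have -> : um i None l = (i == l)%:R by case: (i).
by rewrite -natrM mulnb andbC.
Qed.

Local Notation prodx s := (prodc ext_mul (map Some s)).

Lemma prodxJ x s l : prodx (x :: s) (J l) =
  if x is inl i then \sum_j prodx s (J j) * um (Some i) j l else 0.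
Proof.
rewrite -[LHS]/(\sum_j prodx s j * umul ext_mul (Some x) j (J l)) sum_oext.
rewrite [X in _ + X]big1 ?addr0 => [|j _]; last by apply: big1 => b _; rewrite umJT mulr0.
case: x => [i|[i b]]; last by apply: big1 => j _; rewrite (umTJ i b) mulr0.
by apply: eq_bigr => j _; rewrite (umJJJ (Some i)).
Qed.

Lemma prodxT x s l b : prodx (x :: s) (T l b) =
  match x with inl i => \sum_j prodx s (T j b) * um (Some i) j l
  | inr (i, c) => \sum_j prodx s (J j) * ((c == b)%:R * (sg (upar c && op j) * um i j l)) end.
Proof.
rewrite -[LHS]/(\sum_j prodx s j * umul ext_mul (Some x) j (T l b)) sum_oext.
case: x => [i|[i c]].
  rewrite [X in X + _]big1 ?add0r => [|j _]; last by rewrite (umJJT (Some i)) mulr0.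
  apply: eq_bigr => j _; rewrite -(sum_ext_bool b (fun=> prodx s (T j b) * um (Some i) j l)).
  apply: eq_bigr => c _; rewrite (umJTT (Some i)) eq_sym.
  by case: eqP => [->|_]; rewrite ?mul0r ?mulr0 // !mul1r.
rewrite [X in _ + X]big1 ?addr0 => [|j _]; last by apply: big1 => d _; rewrite (umTT i c) mulr0.
by apply: eq_bigr => j _; rewrite (umTJT i j c).
Qed.

Lemma prodx_inl u l : prodx (map inl u) (J l) = prodc (@bmul k A) (map Some u) l.
Proof.
elim: u l => [|i u IH] l; first by case: l.
by rewrite [map inl _]/= prodxJ; apply: eq_bigr => j _; rewrite IH.
Qed.

Lemma prodx_J s : (exists u, s = map inl u) \/ forall l, prodx s (J l) = 0.
Proof.
elim: s => [|x s [[u ->]|IH]]; first by left; exists [::].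
  by case: x => [i|x]; [left; exists (i :: u)|right=> l; rewrite prodxJ].
right=> l; rewrite prodxJ; case: x => // i.
by apply: big1 => j _; rewrite IH mul0r.
Qed.

Lemma lmuls0 u l : lmuls u (fun=> 0) l = 0.
Proof. by elim: u l => //= i u IH l; apply: big1 => j _; rewrite IH mul0r. Qed.

(** A nonzero product with value in A eps contains exactly one factor e_i eps_c. Its other letters
    lie in A_+ and multiply to zero in A when they are too many. As e_i may be the unit, one letter
    can be lost, hence the bound [(nilbound A).+1]. *)
Lemma prodx_nilT s u b l : ((nilbound A).+1 < size u + size s)%N ->
  lmuls u (fun j => prodx s (T j b)) l = 0.
Proof.
elim: s u l => [|x s IH] u l lt; first by rewrite -[RHS](lmuls0 u l).
rewrite (eq_lmuls _ (v' := _) _ (fun j => prodxT x s j b)).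
case: x lt => [i|[i c]] lt.
  by rewrite -lmuls_rcons IH // size_rcons addSnnS.
have [[v es]|z] := prodx_J s; last first.
  by rewrite -[RHS](lmuls0 u l); apply: eq_lmuls => j; apply: big1 => j' _; rewrite z mul0r.
(* The scalar [e] collects the signs of moving eps_c and e_i behind the letters of [v]; then [u] and
   [v] form one product in A. *)
pose e := sg (upar c && tpar (map op (map Some v))) * sg (op i && tpar (map op (map Some v))) * (c == b)%:R : k.
transitivity (lmuls u (fun j => e * \sum_j' prodc (@bmul k A) (map Some v) j' * um j' i j) l).
  apply: eq_lmuls => j; rewrite mulr_sumr; apply: eq_bigr => j' _; rewrite es prodx_inl umC.
  have [->|nz] := eqVneq (prodc (@bmul k A) (map Some v) j') 0; first by rewrite !(mul0r, mulr0).
  by rewrite (prodc_parity nz) /e; ring.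
rewrite lmulsZ lmuls_mulr big1 ?mulr0 // => j _; rewrite lmuls_prodc bnilpotent ?mul0r //.
by move: lt; rewrite es /= size_map addnS ltnS size_cat.
Qed.

Lemma ext_nilpotent s : ((nilbound A).+1 < size s)%N -> forall l, prodx s l = 0.
Proof.
move=> lt.
have ZJ l : prodx s (J l) = 0.
  have [[u es]|//] := prodx_J s; rewrite es prodx_inl bnilpotent //.
  by apply: ltnW; rewrite es size_map in lt.
case=> [[l|[l b]]|]; [exact: (ZJ (Some l)) | exact: (@prodx_nilT s [::] b l) | exact: (ZJ None)].
Qed.

Definition ext_alg : nilcdga k := @NilCdga k ext_bas ext_par ext_mul ext_diff (nilbound A).+1
  ext_mul_parity ext_mulA ext_mulC ext_diff_parity ext_diffK ext_diffM ext_nilpotent.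

End ExtAlg.

(** * Evaluation over the extended algebra *)

Section ExtEval.
Variables (k : fieldType) (A : nilcdga k) (p : bool) (U : superspace k) (R : lmodType k).
Variables (xi : bas A -> U) (zeta : bool -> option (bas A) -> U).
Local Notation um := (umul (@bmul k A)).
Local Notation op := (@opar k A).
Local Notation K := (option (bas A)).
Local Notation A' := (ext_alg A p).
Local Notation J := (@J k A).
Local Notation T := (@T k A).
Hypothesis exi : even xi.
Hypothesis hzeta : forall b i, homog (op i (+) upar p b) (zeta b i).
Implicit Types (C : seq (bool * U) -> R).

Definition ext_pt (x : bas A') : U := match x with inl i => xi i | inr (i, b) => zeta b i end.

Lemma ext_pt_even : even ext_pt.
Proof. by case=> [i|[i b]]; [exact: exi | exact: hzeta]. Qed.

Definition hsym C := forall hs1 hs2 h1 h2, hh (hs1 ++ h1 :: h2 :: hs2) ->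
  C (hs1 ++ h1 :: h2 :: hs2) = sg (h1.1 && h2.1) *: C (hs1 ++ h2 :: h1 :: hs2).

Lemma hsym_cons C h : hsym C -> homog h.1 h.2 -> hsym (fun hs => C (h :: hs)).
Proof.
by case: h => q x sC hx hs1 hs2 h1 h2 hhs; apply: (sC ((q, x) :: hs1)); apply/hh_cons.
Qed.

Lemma evA_J n C l : evA ext_pt n C (J l) = evA xi n C l.
Proof.
elim: n C l => [|n IH] C l /=; first by case: l.
rewrite sum_ext [X in _ + X]big1 ?addr0 => [|i _]; last first.
  by apply: big1 => b _; apply: big1 => j _; rewrite (umTJ _ i b) mul0r scale0r.
apply: eq_bigr => i _; rewrite sum_oext [X in _ + X]big1 ?addr0 => [|j _]; last first.
  by apply: big1 => b _; rewrite umJT mul0r scale0r.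
by apply: eq_bigr => j _; rewrite IH (umJJJ _ (Some i)); case: j.
Qed.

Lemma umACA i i' j l : \sum_s um i' j s * um i s l = sg (op i && op i') * \sum_s um i j s * um i' s l.
Proof.
rewrite -umA -[in RHS]umA mulr_sumr; apply: eq_bigr => s _.
by rewrite umC mulrA.
Qed.

(** The terms of the coefficient at e_l eps_b in which the letter carrying eps comes first: the
    derivative of C(xi, ..., xi) in the direction zeta_b. *)
Definition zsum n C l b := \sum_i \sum_j (um i j l * sg (op i && op j)) *:
  evA xi n (fun hs => C ((op i (+) upar p b, zeta b i) :: hs)) j.

(** A letter xi in front of the letter zeta_b can be moved behind it: the symmetry of [C] and the
    graded commutativity of A give cancelling signs. *)
Lemma zsum_step n C l b : hsym C ->
  \sum_(i : bas A) \sum_j (um (Some i) j l * sg (bpar i && (op j (+) upar p b))) *: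
    zsum n (fun hs => C ((bpar i, xi i) :: hs)) j b = zsum n.+1 C l b.
Proof.
move=> sC.
pose Z i i' j := evA xi n (fun hs => C ((op i' (+) upar p b, zeta b i') :: (bpar (n := A) i, xi i) :: hs)) j.
transitivity (\sum_(i : bas A) \sum_i' \sum_j' ((sg (bpar i && op j') * sg (op i' && op j')) *
    \sum_j um i' j' j * um (Some i) j l) *: Z i i' j').
  apply: eq_bigr => i _.
  under eq_bigr => j _ do rewrite scaler_sumr.
  rewrite exchange_big; apply: eq_bigr => i' _.
  under eq_bigr => j _ do rewrite scaler_sumr.
  rewrite exchange_big; apply: eq_bigr => j' _; rewrite mulr_sumr scaler_suml.
  apply: eq_bigr => j _; rewrite scalerA.
  have -> : evA xi n (fun hs => C [:: (bpar i, xi i), (op i' (+) upar p b, zeta b i') & hs]) j' =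
      sg (bpar i && (op i' (+) upar p b)) *: Z i i' j'.
    rewrite -evAZ; apply: eq_evA => // hs hhs _.
    apply: (sC [::] hs (bpar i, xi i) (op i' (+) upar p b, zeta b i')).
    by apply/hh_cons; split=> //; apply/hh_cons.
  rewrite scalerA; congr (_ *: _).
  have [->|nz] := eqVneq (um i' j' j) 0; first by rewrite !(mul0r, mulr0).
  rewrite (um_parity nz).
  have E : sg (bpar i && (op i' (+) op j' (+) upar p b)) * sg (bpar i && (op i' (+) upar p b)) = sg (bpar i && op j') :> k.
    by rewrite -signr_addb; congr (sg _); case: (bpar i); case: (op i'); case: (op j'); case: (upar p b).
  by rewrite -E; ring.
transitivity (\sum_i' \sum_(i : bas A) \sum_j' ((sg (op i' && (bpar i (+) op j')) * sg (bpar i && op j')) *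
    \sum_j um (Some i) j' j * um i' j l) *: Z i i' j').
  rewrite exchange_big; apply: eq_bigr => i' _; apply: eq_bigr => i _; apply: eq_bigr => j' _.
  congr (_ *: _); rewrite umACA mulrA; congr (_ * _).
  by rewrite -!signr_addb; congr (sg _); rewrite /=; case: (bpar i); case: (op i'); case: (op j').
apply: eq_bigr => i' _ /=.
under [RHS]eq_bigr => j _ do rewrite scaler_sumr.
rewrite [RHS]exchange_big; apply: eq_bigr => i _.
under [RHS]eq_bigr => j _ do rewrite scaler_sumr.
rewrite [RHS]exchange_big; apply: eq_bigr => j' _; rewrite mulr_sumr scaler_suml.
apply: eq_bigr => j _; rewrite scalerA; congr (_ *: _).
have [->|nz] := eqVneq (um (Some i) j' j) 0; first by rewrite !(mul0r, mulr0).
by rewrite (um_parity nz) /=; ring.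
Qed.

Lemma evA_TS n C l b : evA ext_pt n.+1 C (T l b) =
  \sum_(i : bas A) \sum_j (um (Some i) j l * sg (bpar i && (op j (+) upar p b))) *:
    evA ext_pt n (fun hs => C ((bpar i, xi i) :: hs)) (T j b) + zsum n C l b.
Proof.
have sb (F : bool -> R) : \sum_(c : bool) (c == b)%:R *: F c = F b.
  by case: b; rewrite big_bool /= ?mulr1n ?mulr0n ?scale1r ?scale0r ?addr0 ?add0r.
rewrite [LHS]/= sum_ext; congr (_ + _); apply: eq_bigr => i _.
  rewrite sum_oext [X in X + _]big1 ?add0r => [|j _]; last by rewrite (umJJT p (Some i)) mul0r scale0r.
  apply: eq_bigr => j _; rewrite -[RHS](sb (fun c => (um (Some i) j l * sg (bpar i && (op j (+) upar p c))) *: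
    evA ext_pt n (fun hs => C ((bpar i, xi i) :: hs)) (T j c))).
  by apply: eq_bigr => c _; rewrite (umJTT p (Some i)) -mulrA -scalerA.
rewrite -[RHS](sb (fun c => \sum_j (um i j l * sg (op i && op j)) *:
  evA xi n (fun hs => C ((op i (+) upar p c, zeta c i) :: hs)) j)).
apply: eq_bigr => c _; rewrite sum_oext [X in _ + X]big1 ?addr0 => [|j _]; last first.
  by apply: big1 => d _; rewrite umTT mul0r scale0r.
rewrite scaler_sumr; apply: eq_bigr => j _; rewrite umTJT evA_J scalerA; congr (_ *: _).
have -> : @opar k A' (J j) = op j by case: (j).
have E : sg (upar p c && op j) * sg ((op i (+) upar p c) && op j) = sg (op i && op j) :> k.
  by rewrite -signr_addb; congr (sg _); case: (op i); case: (op j); case: (upar p c).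
by rewrite -E /=; ring.
Qed.

(** Exactly one of the n + 1 letters carries eps_b, and by [zsum_step] its position does not
    matter. *)
Lemma evA_T n C l b : hsym C -> evA ext_pt n.+1 C (T l b) = n.+1%:R *: zsum n C l b.
Proof.
elim: n C l => [|n IH] C l sC; rewrite evA_TS.
  rewrite big1 ?add0r ?scale1r // => i _; apply: big1 => j _.
  by rewrite /= scale0r scaler0.
rewrite -[n.+2]addn1 natrD scalerDl scale1r; congr (_ + _).
rewrite -zsum_step // scaler_sumr; apply: eq_bigr => i _; rewrite scaler_sumr; apply: eq_bigr => j _.
rewrite IH; last by apply: hsym_cons => //; exact: exi.
by rewrite !scalerA mulrC.
Qed.

End ExtEval.

Lemma evA_closed_nu (k : fieldType) (U : superspace k) (mu : seq U -> U) (A : nilcdga k) (xi : bas A -> U) n p w c :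
  (forall hs, hh hs -> homog (~~ tpar (map fst hs)) (mu (map snd hs))) -> even xi -> homog p w ->
  homog (p (+) ~~ opar c) (evA xi n (fun hs => nu mu ((p, w) :: hs)) c).
Proof.
move=> mh exi hw; rewrite evA_prodc; apply: homog_sum => s _.
have [z|nz] := eqVneq (prodc (@bmul k A) (map Some s) c) 0.
  by rewrite z mul0r scale0r; exact: homog0.
apply: homogZ; have := nu_homog mh (hs := (p, w) :: [seq (bpar (n := A) a, xi a) | a <- s]).
rewrite (prodc_parity nz) /= -!map_comp -addbN; apply.
by apply/hh_cons; split => //; elim: (val s) => //= a s' IH; apply/hh_cons; split.
Qed.

(** Each insertion leaves its letter behind the letters that come later in the list; symmetry moves
    it to the front, with a Koszul sign. *)
Lemma inss_Sym (k : fieldType) (U : superspace k) (R : lmodType k) (c : seq U -> R) hs hs2 :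
  multilinear c -> gsymmetric c -> hh hs -> hh hs2 -> inss Sym hs c (map snd hs2) =
    sg (tpar (map fst hs) && tpar (map fst hs2)) *: c (map snd hs ++ map snd hs2).
Proof.
move=> m g; elim: hs hs2 => [|[p w] hs IH] hs2; first by rewrite scale1r.
move=> /hh_cons [hw hhs] hh2.
have hh3 : hh ((p, w) :: [seq (h.1, tau p h.2) | h <- hs2]).
  by apply/hh_cons; split=> //; exact: hh_taus.
have e1 : map fst [seq (h.1, tau p h.2) | h <- hs2] = map fst hs2 by rewrite -map_comp.
have e2 : map snd [seq (h.1, tau p h.2) | h <- hs2] = map (tau p) (map snd hs2) by rewrite -!map_comp.
have := IH _ hhs hh3; rewrite /= e1 e2 => H; rewrite -[LHS]/(inss Sym hs c (w :: map (tau p) (map snd hs2))) H.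
have := @ml_taus _ _ _ c p hs2 (map snd hs ++ [:: w]) m hh2; rewrite -!catA !cat1s => ->.
have := gsym_move [::] (map snd hs2) g hw hhs => /= ->.
rewrite !scalerA -!signr_addb; congr (sg _ *: _).
by case: (p); case: (tpar _); case: (tpar _).
Qed.

Lemma evA_0 (k : fieldType) (A : nilcdga k) (U : superspace k) (R : lmodType k) (xi : bas A -> U)
  (C : seq (bool * U) -> R) l : evA xi 0 C l = (l == None)%:R *: C [::].
Proof. by []. Qed.

Arguments evA : simpl never.

(** * Symmetric functionals vanishing on all Maurer-Cartan elements *)

Section Uniqueness.
Variables (k : fieldType) (char0 : [pchar k] =i pred0) (U : superspace k).
Variables (DV : operator U) (mu : seq U -> U).
Hypotheses (dDV : Der0 Sym true DV) (DDV : forall phi, Fhat Sym phi -> DV (DV phi) = fun=> 0).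
Hypothesis mu_ml : multilinear mu.
Hypothesis mu_homog : forall hs, hh hs -> homog (~~ tpar (map fst hs)) (mu (map snd hs)).
Hypothesis DV_mu : forall hs q (psi : {linear U -> k^o}), hh hs -> hfun q psi ->
  DV (gen psi) (map snd hs) = sg (~~ tpar (map fst hs)) * psi (mu (map snd hs)).

Let lDV : linop Sym DV := der_linop (proj1 dDV).
Let musym : gsymmetric mu := mu_sym (proj1 dDV) mu_ml DV_mu.

Lemma Sym_D_mu hs q (psi : {linear U -> k^o}) : hh hs -> hfun q psi ->
  inss Sym hs (DV (gen psi)) [::] = sg (~~ tpar (map fst hs)) * psi (mu (map snd hs)).
Proof.
move=> hhs hq; rewrite -(DV_mu hhs hq).
have [m g] := lin_stable lDV (gen_Fhat Sym psi).
by have := inss_Sym (hs2 := [::]) m g hhs I; rewrite andbF scale1r cats0.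
Qed.

Lemma nu_hsym : hsym (nu mu).
Proof.
move=> hs1 hs2 [p x] [q y] hhs.
have [hh1 /hh_cons [hx /hh_cons [hy hh2]]] : hh hs1 /\ hh ((p, x) :: (q, y) :: hs2) by apply/hh_cat.
rewrite /nu !map_cat /= (musym _ _ hx hy) !scalerA mulrC -!signr_addb; congr (sg _ *: _).
by rewrite !tpar_cat /=; case: (p); case: (q); case: (tpar _); case: (tpar _).
Qed.

Section Level.
Variables (A : nilcdga k) (xi : bas A -> U).
Hypothesis exi : even xi.
Local Notation um := (umul (@bmul k A)).
Local Notation op := (@opar k A).
Implicit Types (c i j l : option (bas A)).

(** Up to sign, the linear part of the structure twisted by xi, applied to w. *)
Definition Nw p w c : U := \sum_(0 <= n < (nilbound A).+1) n`!%:R^-1 *: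
  evA xi n (fun hs => nu mu ((p, w) :: hs)) c.

Lemma Nw_homog p w c : homog p w -> homog (p (+) ~~ op c) (Nw p w c).
Proof. by move=> hw; apply: homog_sum => n _; apply/homogZ/evA_closed_nu. Qed.

Lemma NwZ p (a : k) w c : Nw p (a *: w) c = a *: Nw p w c.
Proof.
rewrite /Nw scaler_sumr; apply: eq_bigr => n _; rewrite scalerA mulrC -scalerA -evAZ.
congr (_ *: _); apply: eq_evA => // hs _ _.
by rewrite /nu /= (mlZ [::]) // scalerA mulrC scalerA.
Qed.

Lemma MC_left_dxi (l : bas A) : MC_left Sym mu xi l =
  dxi xi l - \sum_(1 <= n < (nilbound A).+1) n`!%:R^-1 *: evA xi n (nu mu) (Some l).
Proof.
rewrite /MC_left; congr (_ + _); rewrite -sumrN; apply: eq_bigr => n _.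
rewrite -scalerN; congr (_ *: _); rewrite (extA_evA true n (Some l) mu_ml exi) /=.
have -> : nu mu = (fun hs => -1 *: (sg (true && tpar (map fst hs)) *: mu (map snd hs))).
  by apply/funext => hs; rewrite /nu scalerA; congr (_ *: _); case: (tpar _); rewrite /= ?expr0 ?expr1; ring.
by rewrite evAZ evA_sign scaleN1r opprK.
Qed.

Hypothesis MCxi : forall l : bas A, MC_left Sym mu xi l = 0.
Local Notation E := (Wtot Sym DV xi).

Lemma E_Der0 c : Der0 Sym (~~ op c) (E c).
Proof.
have cl : opclosed Sym (Der0 (U := U) Sym).
  by split=> [b|b a D1 D2|b D1 D2]; [exact: Der0_zero | exact: Der0_lin | exact: Der0_eq].
case: c => [l|].
  apply: (Der0_eq (D := pushA (twf Sym DV mu) xi l)) => [|phi hp].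
    apply: (pushA_closed exi l cl) => [phi xs hp|hs hhs]; first exact: twf_ml.
    exact: (twf_Der0 dDV mu_ml mu_homog Sym_D_mu).
  by apply/funext => xs; rewrite (Wtot_Some dDV mu_ml exi MCxi).
by apply: Der0_eq dDV _ => phi hp; apply/funext => xs; rewrite Wtot_None.
Qed.

Lemma E_gen p w c q (psi : {linear U -> k^o}) : homog p w -> hfun q psi ->
  E c (gen psi) [:: w] = psi (Nw p w c).
Proof.
move=> hw hq.
transitivity (\sum_(0 <= n < (nilbound A).+2 + (nilbound A).+2) n`!%:R^-1 *
   psi (evA xi n (fun hs => nu mu ((p, w) :: hs)) c)).
  apply: eq_bigr => n _; rewrite /Wn.
  have -> : insdx Sym xi c (gen psi) [:: w] = 0.
    by case: c => [i|] //=; rewrite ins_gen /= mulr0.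
  rewrite mulr0 addr0 (evA_morph (S := k^o) psi); congr (_ * _).
  apply: eq_evA => // hs hhs _.
  have hhc : hh ((p, w) :: hs) by apply/hh_cons.
  rewrite (adins_gen _ (proj1 dDV) hhs) -(ins_nil Sym p w).
  rewrite -[LHS]/(inss Sym ((p, w) :: hs) (DV (gen psi)) [::]) (Sym_D_mu hhc hq).
  by rewrite /nu linearZ.
rewrite (big_cat_nat (n := (nilbound A).+1)) //=; last by rewrite -[leqLHS]addn0 leq_add.
rewrite [X in _ + X]big_nat [X in _ + X]big1 ?addr0 => [|n /andP [Nn _]]; last first.
  by rewrite evA_nil // linear0 mulr0.
by rewrite /Nw linear_sum; apply: eq_bigr => n _; rewrite linearZ.
Qed.

(** The value at the one-letter word w is the constant part of the bracket with iota_w, because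
    [E c] itself has no constant part; [derivation_nil] then reduces the claim to generators. *)
Lemma E_slot p w c phi : homog p w -> Fhat Sym phi -> E c phi [:: w] = phi [:: Nw p w c].
Proof.
move=> hw hp; have dE := E_Der0 c.
pose E' := scomm p (~~ op c) (@ins k U Sym p w k^o) (E c).
have dE' : derivation Sym (p (+) ~~ op c) E' := derivation_scomm (derivation_ins Sym hw) (proj1 dE).
have e phi' : Fhat Sym phi' -> E' phi' [::] = E c phi' [:: w].
  by move=> hp'; rewrite /E' /scomm ins_nil (Der0_nil char0 dE (ins_Fhat _ _ hp')) mulr0 subr0.
rewrite -e //; apply: (derivation_nil char0 dE' (Nw_homog c hw)) => // q psi hq.
by rewrite e ?(E_gen _ hw hq) //; exact: gen_Fhat.
Qed.

(** [Wtot_square] read on one-letter words: the twisted differential squares to zero. *)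
Lemma Nw_eq p w l : homog p w -> \sum_i obdiff i l *: Nw p w i +
  \sum_i \sum_j (um i j l * sg (~~ op i && op j)) *: Nw (p (+) ~~ op i) (Nw p w i) j = 0.
Proof.
move=> hw; apply: (@eq_by_functionals k U) => q psi hq; rewrite linear0.
rewrite -(Wtot_square char0 lDV DDV exi l [:: w] (gen_Fhat Sym psi)) linearD !linear_sum.
congr (_ + _); apply: eq_bigr => i _; first by rewrite linearZ (E_slot _ hw) //; exact: gen_Fhat.
rewrite linear_sum; apply: eq_bigr => j _; rewrite linearZ; congr (_ * _).
have F := lin_stable (der_linop (proj1 (E_Der0 j))) (gen_Fhat Sym psi).
by rewrite (E_slot _ hw) // (E_slot _ (Nw_homog i hw)) //; exact: gen_Fhat.
Qed.

End Level.

Definition MCx (A : nilcdga k) (xi : bas A -> U) := forall l : bas A, MC_left Sym mu xi l = 0.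

Section Extend.
Variables (A : nilcdga k) (xi : bas A -> U) (p : bool) (w : U).
Hypotheses (exi : even xi) (MCxi : MCx xi) (hw : homog p w).
Local Notation um := (umul (@bmul k A)).
Local Notation op := (@opar k A).
Local Notation A' := (ext_alg A p).

(** The vector w is put at eps_true. The Maurer-Cartan equation at eps_true then forces the
    coefficient at eps_false to be the twisted differential of w, up to sign. *)
Definition szeta (b : bool) (i : option (bas A)) : U :=
  if b then (if i is None then w else 0) else sg (op i) *: Nw xi p w i.

Lemma szeta_homog b i : homog (op i (+) upar p b) (szeta b i).
Proof.
case: b => /=; first by rewrite /upar addbF; case: i => [i|] //=; exact: homog0.
by rewrite /upar addbC -addbA addTb; apply/homogZ/Nw_homog.
Qed.

Lemma zsum_w (R : lmodType k) n (C : seq (bool * U) -> R) l :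
  (forall q hs, C ((q, 0) :: hs) = 0) ->
  zsum p xi szeta n C l true = evA xi n (fun hs => C ((p, w) :: hs)) l.
Proof.
move=> C0; rewrite /zsum big_option [X in _ + X]big1 ?addr0 => [|i _]; last first.
  apply: big1 => j _; rewrite [evA _ _ _ _](_ : _ = 0) ?scaler0 //.
  by rewrite -[RHS](evA0 R xi n j); apply: eq_evA => // hs _ _; rewrite C0.
rewrite (bigD1 l) //= big1 ?addr0 => [|j jl].
  by rewrite -[um _ _ _]/((l == l)%:R) eqxx mulr1 scale1r /upar addbF.
by rewrite -[um _ _ _]/((j == l)%:R) (negPf jl) mul0r scale0r.
Qed.

Definition sxi : bas A' -> U := ext_pt xi szeta.

Lemma sxi_even : even sxi.
Proof. exact: ext_pt_even exi szeta_homog. Qed.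

(** The equation has three components: over A it is that of xi, at eps_true it holds by the choice
    of [szeta], and at eps_false it says that the twisted differential of w is closed ([Nw_eq]). *)
Lemma sxi_MC : MCx sxi.
Proof.
have nu0 q hs : nu mu ((q, 0) :: hs) = 0.
  by rewrite /nu /= (ml0 [::]) // scaler0.
move=> l; rewrite (MC_left_dxi sxi_even l); apply/eqP; rewrite subr_eq0; apply/eqP.
case: l => [l|[l b]].
  have EJ n : @evA k A' U _ sxi n (nu mu) (Some (inl l)) = evA xi n (nu mu) (Some l).
    exact: (@evA_J k A p U _ xi szeta n (nu mu) (Some l)).
  rewrite big_nat_recr //= [X in _ + X](_ : _ = 0) ?addr0; last first.
    by rewrite EJ evA_nil // scaler0.
  transitivity (dxi xi l).
    by rewrite /dxi sum_ext [X in _ + X]big1 ?addr0 // => i _; apply: big1 => b _; rewrite scale0r.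
  have := MCxi l; rewrite MC_left_dxi // => /eqP; rewrite subr_eq0 => /eqP ->.
  by apply: eq_bigr => n _; rewrite EJ.
rewrite big_add1 /=.
transitivity (\sum_(0 <= n < (nilbound A).+1) n`!%:R^-1 *: zsum p xi szeta n (nu mu) l b); last first.
  apply: eq_bigr => n _.
  rewrite (evA_T exi szeta_homog n l b nu_hsym) scalerA; congr (_ *: _).
  by rewrite factS natrM invfM mulrAC mulVf ?mul1r //; exact: natr_neq0.
transitivity (\sum_i (obdiff i l *: szeta b i) + (if b then Nw xi p w l else 0)).
  rewrite /dxi sum_ext big1 ?add0r => [|i _]; last by rewrite scale0r.
  have -> : (if b then Nw xi p w l else 0) = \sum_i (i == l)%:R *: (if b then Nw xi p w i else 0).
    rewrite (bigD1 l) //= eqxx scale1r big1 ?addr0 // => i /negPf ->; exact: scale0r.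
  rewrite -big_split; apply: eq_bigr => i _; rewrite big_bool /= /szeta.
  have S : sg (op i) * sg (op i) = 1 :> k by rewrite -signr_addb addbb.
  case: b; rewrite /= ?mulr1n ?mulr0n ?mul0r ?mul1r ?addr0 ?add0r ?scale0r ?scaler0 ?addr0 ?add0r //.
  by congr (_ + _); rewrite scalerA mulrAC S mul1r.
(* At eps_true the constant vector w has no differential, and d eps_false = eps_true supplies the
   required term; at eps_false the claim is [Nw_eq] up to the sign (-1)^|e_l|. *)
case: b.
  rewrite big1 ?add0r => [|[i|] _]; rewrite /= ?scaler0 ?scale0r //.
  by apply: eq_bigr => n _; rewrite zsum_w.
rewrite addr0 /szeta; have := Nw_eq exi MCxi l hw.
move/(congr1 (fun x => sg (op l) *: x)); rewrite scaler0 scalerDr => /eqP.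
rewrite addr_eq0 => /eqP H.
transitivity (- (sg (op l) *: (\sum_i obdiff i l *: Nw xi p w i))).
  rewrite -scaleNr scaler_sumr; apply: eq_bigr => i _; rewrite !scalerA; congr (_ *: _).
  have [->|nz] := eqVneq (obdiff i l) 0; first by rewrite mul0r mulr0.
  by rewrite (obdiff_parity nz); case: (op i); rewrite /= ?expr0 ?expr1; ring.
rewrite H opprK scaler_sumr /zsum.
under [RHS]eq_bigr => n _ do rewrite scaler_sumr.
rewrite exchange_big; apply: eq_bigr => i _ /=; rewrite scaler_sumr.
under [RHS]eq_bigr => n _ do rewrite scaler_sumr.
rewrite exchange_big; apply: eq_bigr => j _ /=.
transitivity ((um i j l * sg (op i && op j)) *: Nw xi (op i (+) upar p false) (sg (op i) *: Nw xi p w i) j).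
  rewrite NwZ // !scalerA.
  have -> : op i (+) upar p false = p (+) ~~ op i by rewrite /upar; case: (op i); case: (p).
  congr (_ *: _); have [->|nz] := eqVneq (um i j l) 0; first by rewrite !(mul0r, mulr0).
  by rewrite (um_parity nz); case: (op i); case: (op j); rewrite /= ?expr0 ?expr1; ring.
rewrite /Nw scaler_sumr; apply: eq_bigr => n _; rewrite !scalerA; congr (_ *: _); exact: mulrC.
Qed.

End Extend.

(* The families of functionals which vanish on all Maurer-Cartan elements. *)
Definition MCzero (h : seq U -> k^o) := forall (A : nilcdga k) (xi : bas A -> U),
  even xi -> MCx xi -> forall l, \sum_(0 <= r < (nilbound A).+1) r`!%:R^-1 *
    evA xi r (fun hs => h (map snd hs)) l = 0.

(** Take the coefficient at eps_true of the vanishing sum for the extended element [sxi]. The factor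
    n + 1 of [evA_T] turns 1/(n+1)! into 1/n!. *)
Lemma MCzero_cons h p w : multilinear h -> gsymmetric h -> MCzero h -> homog p w ->
  MCzero (fun ws => h (w :: ws)).
Proof.
move=> mh gh zh hw A xi exi MCxi l.
have sh : hsym (fun hs : seq (bool * U) => h (map snd hs)).
  move=> hs1 hs2 [q1 x] [q2 y] hhs.
  have [hh1 /hh_cons [hx /hh_cons [hy hh2]]] : hh hs1 /\ hh ((q1, x) :: (q2, y) :: hs2) by apply/hh_cat.
  by rewrite !map_cat; exact: (gh (map snd hs1)).
rewrite -[RHS](zh _ _ (sxi_even exi hw) (sxi_MC exi MCxi hw) (T l true)).
rewrite [RHS]big_nat_recl //= evA_0 scale_regE mul0r mulr0 add0r; apply: eq_bigr => n _.
rewrite (evA_T exi (szeta_homog exi hw) n l true sh) zsum_w //; last by move=> q hs; exact: (ml0 [::]).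
rewrite scale_regE mulrA; congr (_ * _).
by rewrite factS natrM invfM mulrAC mulVf ?mul1r //; exact: natr_neq0.
Qed.

Definition triv_alg : nilcdga k.
Proof.
by refine (@NilCdga k void (fun=> false) (fun _ _ _ => 0) (fun _ _ => 0) 0 _ _ _ _ _ _ _) => // [] [|[]].
Defined.

Lemma MCzero_nil h : MCzero h -> h [::] = 0.
Proof.
have e : even (fun x : bas triv_alg => match x return U with end) by case.
have m : MCx (fun x : bas triv_alg => match x return U with end) by case.
move/(_ triv_alg _ e m None); rewrite big_nat1 evA_0 eqxx scale_regE mul1r fact0 invr1 mul1r.
exact.
Qed.

(** The letters are stripped off one by one with [MCzero_cons]; the last value is read off over the
    algebra k, where xi is empty. *)
Lemma MCzero_eq0 h : multilinear h -> gsymmetric h -> MCzero h -> forall ws, h ws = 0.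
Proof.
move=> mh gh zh.
have H hs : hh hs -> h (map snd hs) = 0.
  elim: hs h mh gh zh => [|[p w] hs IH] h mh gh zh; first by move=> _; exact: MCzero_nil.
  case/hh_cons => hw hhs; apply: (IH (fun ws => h (w :: ws))) => //; first exact: ml_cons.
    by move=> s1 s2 q1 q2 x y hx hy; exact: (gh (w :: s1)).
  exact: MCzero_cons hw.
by apply: ml_ext => //; exact: ml_zero.
Qed.

End Uniqueness.

(** * Iterated insertion as a sum over orders and shuffles *)

Section Shuffles.
Variables (k : fieldType) (U : superspace k) (R : lmodType k).
Implicit Types (h : bool * U) (us ys hs : seq (bool * U)) (c : seq U -> R) (F : seq (bool * U) -> R).
Local Notation par us := (tpar (map fst us)).

(* The sum of [c] over the shuffles of [us] and [ys], with the signs of the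
   rearrangements of [us ++ ys]; [m] is the total length. *)
Fixpoint shfm m us ys c : R :=
  if m is m'.+1 then
    (if ys is y :: ys' then sg (y.1 && par us) *: shfm m' us ys' (fun vs => c (y.2 :: vs)) else 0)
    + (if us is h :: us' then shfm m' us' ys (fun vs => c (h.2 :: vs)) else 0)
  else c [::].

Definition shf us ys c := shfm (size us + size ys) us ys c.

Lemma shf_consE us ys c : (0 < size us + size ys)%N -> shf us ys c =
  (if ys is y :: ys' then sg (y.1 && par us) *: shf us ys' (fun vs => c (y.2 :: vs)) else 0)
    + (if us is h :: us' then shf us' ys (fun vs => c (h.2 :: vs)) else 0).
Proof. by case: us ys => [|h us] [|y ys] // _; rewrite /shf /= -?addSnnS. Qed.

Lemma shf0r us c : shf us [::] c = c (map snd us).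
Proof. by elim: us c => [//|h us IH] c; rewrite shf_consE // add0r IH. Qed.

Lemma shf0l ys c : shf [::] ys c = c (map snd ys).
Proof. by elim: ys c => [//|y ys IH] c; rewrite shf_consE // addr0 IH andbF scale1r. Qed.

(* The insertions of [h] at all places of [us]. *)
Fixpoint insL h us F : R :=
  F (h :: us) + (if us is u :: us' then sg (h.1 && u.1) *: insL h us' (fun vs => F (u :: vs)) else 0).

Lemma insL_lin h us (a : k) F G : insL h us (fun vs => a *: F vs + G vs) = a *: insL h us F + insL h us G.
Proof.
elim: us F G => [|u us IH] F G /=; first by rewrite !addr0.
by rewrite IH !scalerDr !scalerA (mulrC a) addrACA.
Qed.

Lemma insL0 h us : insL h us (fun=> 0) = 0.
Proof. by elim: us => [|u us IH] /=; rewrite ?IH ?scaler0 addr0. Qed.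

Lemma insLZ h us (a : k) F : insL h us (fun vs => a *: F vs) = a *: insL h us F.
Proof.
have := insL_lin h us a F (fun=> 0); rewrite insL0 addr0 => <-.
by congr insL; apply/funext => vs; rewrite addr0.
Qed.

Lemma insLD h us F G : insL h us (fun vs => F vs + G vs) = insL h us F + insL h us G.
Proof.
have := insL_lin h us 1 F G; rewrite scale1r => <-.
by congr insL; apply/funext => vs; rewrite scale1r.
Qed.

Lemma eq_insL h us F G : (hh (h :: us) -> forall vs, hh vs -> par vs = h.1 (+) par us -> size vs = (size us).+1 -> F vs = G vs) ->
  hh (h :: us) -> insL h us F = insL h us G.
Proof.
move=> + hhu => /(_ hhu); elim: us F G hhu => [|u us IH] F G hhu FG; first by rewrite /= !addr0; apply: FG.
case: h hhu FG IH => p w; case: u => q x hhu FG IH.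
have /hh_cons [hw /hh_cons [hx hus]] := hhu.
rewrite [LHS]/= [RHS]/= (FG ((p, w) :: (q, x) :: us)) //; congr (_ + _ *: _).
apply: IH => [|vs hv pv sv]; first exact/hh_cons.
apply: FG.
- exact/hh_cons.
- by rewrite /= pv addbCA.
- by rewrite /= sv.
Qed.

Lemma insL_sum h us F : insL h us F = \sum_(i < (size us).+1)
  sg (h.1 && par (take i us)) *: F (take i us ++ h :: drop i us).
Proof.
elim: us F => [|u us IH] F; first by rewrite big_ord_recl big_ord0 /= andbF scale1r.
rewrite big_ord_recl /= andbF scale1r; congr (_ + _).
rewrite IH scaler_sumr; apply: eq_bigr => i _; rewrite scalerA -signr_addb /=.
by congr (sg _ *: _); case: (h.1); case: (u.1).
Qed.

(** Both sides run once over the words that contain [us] and [ys] in order and [h] at an arbitrary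
    place; the sign in front is that of moving [h] across [us]. *)
Lemma insL_shf h us ys c : hh (h :: us) -> hh ys -> sg (h.1 && par us) *: insL h ys (fun vs => shf us vs c) =
  insL h us (fun vs => shf vs ys c).
Proof.
have [m] := ubnP (size us + size ys); elim: m us ys c => // m IH us ys c lt hhu hhy.
have hhh : homog h.1 h.2 by move: hhu; case: (h) => p w /hh_cons [].
(* [Y] and [X] split off the words beginning with [h], which agree on both sides. *)
have Y : sg (h.1 && par us) *: insL h ys (fun vs => if vs is y :: ys' then
      sg (y.1 && par us) *: shf us ys' (fun vs => c (y.2 :: vs)) else 0) =
    shf us ys (fun vs => c (h.2 :: vs)) + (if ys is y :: ys' then
      sg (y.1 && (h.1 (+) par us)) *: (sg (h.1 && par us) *: insL h ys' (fun vs => shf us vs (fun vs => c (y.2 :: vs)))) else 0).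
  have S b : sg b * sg b = 1 :> k by rewrite -signr_addb addbb.
  case: ys {lt hhy} => [|y ys] /=; rewrite scalerDr scalerA S scale1r ?scaler0 //; congr (_ + _).
  rewrite insLZ !scalerA -!signr_addb; congr (sg _ *: _).
  by case: (h.1); case: (y.1); case: (tpar _).
have X : insL h us (fun vs => if vs is u :: us' then shf us' ys (fun vs => c (u.2 :: vs)) else 0) =
    shf us ys (fun vs => c (h.2 :: vs)) + (if us is u :: us' then
      sg (h.1 && u.1) *: insL h us' (fun vs => shf vs ys (fun vs => c (u.2 :: vs))) else 0).
  by case: us {lt hhu Y} => [|u us].
have E1 : insL h ys (fun vs => shf us vs c) =
   insL h ys (fun vs => if vs is y :: ys' then sg (y.1 && par us) *: shf us ys' (fun vs => c (y.2 :: vs)) else 0)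
   + (if us is u :: us' then insL h ys (fun vs => shf us' vs (fun vs => c (u.2 :: vs))) else 0).
  transitivity (insL h ys (fun vs => (if vs is y :: ys' then sg (y.1 && par us) *: shf us ys' (fun vs => c (y.2 :: vs)) else 0)
     + (if us is u :: us' then shf us' vs (fun vs => c (u.2 :: vs)) else 0))).
    apply: eq_insL => [_ vs _ _ sv|]; first by rewrite shf_consE // sv addnS.
    by move: hhh hhy; case: (h) => p w; move=> *; apply/hh_cons.
  rewrite insLD; congr (_ + _); case: (us) => [|u us']; [exact: insL0 | by []].
have E2 : insL h us (fun vs => shf vs ys c) =
   (if ys is y :: ys' then sg (y.1 && (h.1 (+) par us)) *: insL h us (fun vs => shf vs ys' (fun vs => c (y.2 :: vs))) else 0)
   + insL h us (fun vs => if vs is u :: us' then shf us' ys (fun vs => c (u.2 :: vs)) else 0).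
  transitivity (insL h us (fun vs => (if ys is y :: ys' then sg (y.1 && (h.1 (+) par us)) *: shf vs ys' (fun vs => c (y.2 :: vs)) else 0)
     + (if vs is u :: us' then shf us' ys (fun vs => c (u.2 :: vs)) else 0))).
    by apply: eq_insL => // _ vs _ pv sv; rewrite shf_consE ?sv // pv.
  rewrite insLD; congr (_ + _); case: (ys) => [|y ys']; [exact: insL0 | exact: insLZ].
rewrite E1 E2 X scalerDr Y -addrA [RHS]addrCA; congr (_ + _).
congr (_ + _).
  case: ys lt hhy {Y X E1 E2} => [//|y ys] lt hhy; congr (_ *: _); apply: IH => //.
    by move: lt; rewrite /= addnS ltnS.
  by case: (y) hhy => q x /hh_cons [].
case: us lt hhu {Y X E1 E2} => [|u us] lt hhu; first exact: scaler0.
have hhu2 : hh (h :: us) by move: hhu; case: (h) => p w; case: (u) => q x /hh_cons [hw /hh_cons [_ hu]]; apply/hh_cons.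
rewrite -IH // scalerA -signr_addb; congr (sg _ *: _).
by rewrite /=; case: (h.1); case: (u.1); case: (tpar _).
Qed.

(* The sum of [F] over all rearrangements of [hs]. *)
Fixpoint psum hs F : R := if hs is h :: hs' then psum hs' (fun us => insL h us F) else F [::].

Lemma psum_lin hs (a : k) F G : psum hs (fun vs => a *: F vs + G vs) = a *: psum hs F + psum hs G.
Proof.
elim: hs F G => //= h hs IH F G; rewrite -IH.
by congr psum; apply/funext => us; exact: insL_lin.
Qed.

Lemma psum0 hs : psum hs (fun=> 0) = 0.
Proof.
elim: hs => //= h hs IH; rewrite -[RHS]IH.
by congr psum; apply/funext => us; exact: insL0.
Qed.

Lemma psumZ hs (a : k) F : psum hs (fun vs => a *: F vs) = a *: psum hs F.
Proof.
have := psum_lin hs a F (fun=> 0); rewrite psum0 addr0 => <-.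
by congr psum; apply/funext => vs; rewrite addr0.
Qed.

Lemma eq_psum hs F G : hh hs ->
  (forall vs, hh vs -> par vs = par hs -> size vs = size hs -> F vs = G vs) -> psum hs F = psum hs G.
Proof.
elim: hs F G => [|[p w] hs IH] F G hhs FG; first exact: FG.
have /hh_cons [hw hh2] := hhs; apply: IH => // vs hv pv sv; apply: eq_insL; last exact/hh_cons.
by move=> _ vs' hv' pv' sv'; apply: FG; rewrite ?pv' ?sv' /= ?pv ?sv.
Qed.

Lemma insL_psum h ys hs (F : seq (bool * U) -> seq (bool * U) -> R) :
  insL h ys (fun vs => psum hs (fun us => F us vs)) = psum hs (fun us => insL h ys (F us)).
Proof.
elim: ys F => [|y ys IH] F.
  by rewrite /= addr0; congr psum; apply/funext => us; rewrite /= addr0.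
rewrite /= (IH (fun us vs => F us (y :: vs))) addrC -psum_lin.
by congr psum; apply/funext => us; rewrite addrC.
Qed.

Lemma ins_insL p w c ys : multilinear c -> hh ys -> ins Tens p w c (map snd ys) =
  sg (p && par ys) *: insL (p, w) ys (fun vs => c (map snd vs)).
Proof.
elim: ys c => [|[q y] ys IH] c m hhy; first by rewrite ins_nil /= andbF scale1r addr0.
have /hh_cons [hy hys] := hhy.
have := @ml_taus _ _ _ c p ((q, y) :: ys) [:: w] m hhy => T1.
rewrite [map snd _]/= ins_Tens_cons (IH _ (ml_cons y m) hys) [RHS]scalerDr.
congr (_ + _); first exact: T1.
rewrite scalerA -signr_addb; congr (sg _ *: _).
by rewrite /=; case: (p); case: (q); case: (tpar _).
Qed.

Lemma inss_ml t hs c : multilinear c -> multilinear (inss t hs c).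
Proof. by move=> m; elim: hs => //= h hs IH; exact: ins_ml. Qed.

(** By [insL_shf] inserting a new letter among the x's and then shuffling is the same as inserting
    it among the other w's first, and this is how [psum] extends a rearrangement. *)
Lemma inss_psum hs c ys : multilinear c -> hh hs -> hh ys -> inss Tens hs c (map snd ys) =
  sg (par hs && par ys) *: psum hs (fun us => shf us ys c).
Proof.
move=> m; elim: hs ys => [|[p w] hs IH] ys; first by move=> _ _; rewrite scale1r /= shf0l.
move=> hhs hhy; have /hh_cons [hw hh2] := hhs.
rewrite -[LHS]/(ins Tens p w (inss Tens hs c) (map snd ys)) (ins_insL _ _ (inss_ml _ _ m) hhy).
rewrite (_ : insL _ _ _ = insL (p, w) ys (fun vs => sg (par hs && (p (+) par ys)) *: psum hs (fun us => shf us vs c))); last first.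
  apply: eq_insL; last exact/hh_cons.
  by move=> _ vs hv pv _; rewrite IH // pv.
rewrite insLZ insL_psum.
rewrite (eq_psum (G := fun us => sg (p && par hs) *: insL (p, w) us (fun vs => shf vs ys c)) hh2); last first.
  move=> us hus pus _; have hh3 : hh ((p, w) :: us) by apply/hh_cons.
  have := insL_shf c hh3 hhy; rewrite /= pus => <-.
  by rewrite scalerA -signr_addb addbb scale1r.
rewrite psumZ !scalerA -!signr_addb; congr (sg _ *: _).
by rewrite /=; case: (p); case: (tpar _); case: (tpar _).
Qed.

Lemma inss_psum_nil hs c : multilinear c -> hh hs ->
  inss Tens hs c [::] = psum hs (fun us => c (map snd us)).
Proof.
move=> m hhs; have := @inss_psum hs c [::] m hhs I; rewrite andbF scale1r => ->.
by congr psum; apply/funext => us; exact: shf0r.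
Qed.

End Shuffles.

(** * Shuffles and permutations as index words *)

Section BitSums.
Variable (R : nmodType).

Definition bsum m r (G : seq bool -> R) : R := \sum_(b : m.-tuple bool | count id b == r) G b.

Lemma bsumE m r G : bsum m r G = \sum_(b : m.-tuple bool) (if count id b == r then G b else 0).
Proof. by rewrite /bsum big_mkcond. Qed.

Lemma bsum0 r G : bsum 0 r G = if r is 0 then G [::] else 0.
Proof.
rewrite bsumE (big_bits0 (fun bs : seq bool => if count id bs == r then G bs else 0)) /=.
by case: r.
Qed.

Lemma bsumS m r G : bsum m.+1 r G = bsum m r (fun b => G (false :: b)) +
  (if r is r'.+1 then bsum m r' (fun b => G (true :: b)) else 0).
Proof.
rewrite bsumE (big_bitsS _ (fun bs : seq bool => if count id bs == r then G bs else 0)) big_split /= addrC.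
rewrite !bsumE; congr (_ + _).
case: r => [|r]; last by rewrite bsumE.
by rewrite big1.
Qed.

Lemma bsum_small m r G : (m < r)%N -> bsum m r G = 0.
Proof.
move=> lt; rewrite /bsum big_pred0 // => b; apply/negP => /eqP e.
by have := count_size id b; rewrite e size_tuple leqNgt lt.
Qed.

End BitSums.

Lemma tpar_interleave (T : Type) (f : T -> bool) (b : seq bool) u v :
  count id b = size u -> size b = (size u + size v)%N ->
  tpar (map f (interleave b u v)) = tpar (map f u) (+) tpar (map f v).
Proof.
elim: b u v => [|[] b IH] u v /= e1 e2.
- by case: u v e1 e2 => [|? ?] [|? ?].
- case: u e1 e2 => [|x u] /= e1 e2; first by lia.
  by rewrite IH ?addbA //; lia.
- case: v e1 e2 => [|y v] /= e1 e2; first by have := count_size id b; lia.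
  by rewrite IH 1?addbCA //; lia.
Qed.

Lemma perm_interleave (T : eqType) (b : seq bool) (u v : seq T) :
  count id b = size u -> size b = (size u + size v)%N -> perm_eq (interleave b u v) (u ++ v).
Proof.
elim: b u v => [|[] b IH] u v /= e1 e2.
- by case: u v e1 e2 => [|? ?] [|? ?].
- case: u e1 e2 => [|x u] /= e1 e2; first by lia.
  by rewrite perm_cons IH //; lia.
- case: v e1 e2 => [|y v] /= e1 e2; first by have := count_size id b; lia.
  by rewrite perm_sym perm_catC cat_cons perm_cons perm_catC perm_sym IH //; lia.
Qed.

Section Words.
Variables (k : fieldType) (U : superspace k) (R : lmodType k).
Variables (c0 : seq U -> R) (zs : seq (bool * U)).
Let entry i := nth (false, 0) zs i.
Let kterm is_ (c : seq U -> R) := sg (ksign (map fst zs) is_) *: c [seq (entry i).2 | i <- is_].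

Lemma nth_fst i : nth false (map fst zs) i = (entry i).1.
Proof.
rewrite /entry; elim: (zs) i => [|z s IH] [|i] //=.
Qed.

(** Recursion on the first letter. All indices in [u] are smaller than those of the second sequence,
    so a letter of the latter is inverted exactly with the letters of [u] still to come, and a
    letter of [u] with none of the second sequence. *)
Lemma bsum_words m u a n (c : seq U -> R) : all (fun i => (i < a)%N) u -> m = (size u + n)%N ->
  bsum m (size u) (fun b => kterm (interleave b u (iota a n)) c) =
  sg (ksign (map fst zs) u) *: shfm m (map entry u) (map entry (iota a n)) c.
Proof.
elim: m u a n c => [|m IH] u a n c au em.
  have [-> ->] : u = [::] /\ n = 0%N by case: (u) (n) em => [|? ?] [|?].
  by rewrite bsum0 /kterm.
rewrite bsumS [shfm _ _ _ _]/= scalerDr; congr (_ + _).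
  case: n em => [|n] em.
    by rewrite scaler0 bsum_small // -[size u]addn0 -em.
  have em' : m = (size u + n)%N by move: em; rewrite addnS => -[].
  rewrite [iota _ _]/= [map _ (_ :: _)]/=.
  have := IH u a.+1 n (fun vs => c ((entry a).2 :: vs)) _ em'.
  have au' : all (fun i => (i < a.+1)%N) u by apply: sub_all au => i /ltnW.
  move=> /(_ au') H.
  rewrite scalerA mulrC -scalerA -H /bsum scaler_sumr; apply: eq_bigr => b /eqP cb.
  have sb : size b = (size u + n)%N by rewrite size_tuple.
  rewrite /kterm [interleave _ _ _]/= [ksign _ (_ :: _)]/= [map _ (_ :: _)]/= scalerA -signr_addb.
  congr (sg (_ (+) _) *: _).
  rewrite tpar_interleave ?size_iota //.
  have -> : tpar [seq [&& (j < a)%N, nth false (map fst zs) a & nth false (map fst zs) j] | j <- iota a.+1 n] = false.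
    have : all (fun j => (a < j)%N) (iota a.+1 n) by apply/allP => j; rewrite mem_iota => /andP [].
    elim: (iota _ _) => //= j s IHs /andP [aj /IHs ->].
    by rewrite ltnNge (ltnW aj).
  rewrite addbF -!map_comp.
  elim: (u) au => [|j s IHs] /=; first by rewrite andbF.
  by case/andP => ja /IHs ->; rewrite ja !nth_fst /=; case: (entry a).1; case: (entry j).1.
case: u au em => [|i u]; first by move=> _ _; rewrite scaler0.
case/andP => ia au em.
have em' : m = (size u + n)%N by move: em; rewrite /= addSn => -[].
have H := IH u a n (fun vs => c ((entry i).2 :: vs)) au em'.
rewrite [ksign _ (_ :: _)]/= signr_addb -scalerA -H /bsum scaler_sumr; apply: eq_bigr => b /eqP cb.
have sb : size b = (size u + n)%N by rewrite size_tuple.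
rewrite /kterm [interleave _ _ _]/= [ksign _ (_ :: _)]/= [map _ (_ :: _)]/= scalerA -signr_addb.
congr (sg (_ (+) _) *: _); rewrite tpar_interleave ?size_iota //.
have -> : tpar [seq [&& (j < i)%N, nth false (map fst zs) i & nth false (map fst zs) j] | j <- iota a n] = false.
  have : all (fun j => (i < j)%N) (iota a n).
    by apply/allP => j; rewrite mem_iota => /andP [aj _]; exact: leq_trans aj.
  elim: (iota _ _) => //= j s IHs /andP [aj /IHs ->].
  by rewrite ltnNge (ltnW aj).
by rewrite addbF.
Qed.

End Words.

Section Permutations.
Variables (k : fieldType) (U : superspace k) (R : lmodType k).

Lemma size_pword n (s : 'S_n) : size (pword s) = n.
Proof. by rewrite size_map size_enum_ord. Qed.

Lemma nth_pword n (s : 'S_n) (j : 'I_n) : nth 0%N (pword s) j = s j.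
Proof. by rewrite (nth_map j) ?size_enum_ord // nth_ord_enum. Qed.

Lemma perm_pword n (s : 'S_n) : perm_eq (pword s) (iota 0 n).
Proof.
rewrite -val_enum_ord /pword (map_comp val s) perm_map //.
have us : uniq [seq s i | i <- enum 'I_n] by rewrite map_inj_uniq ?enum_uniq //; exact: perm_inj.
apply: uniq_perm => //; first exact: enum_uniq.
move=> i; rewrite mem_enum; apply/mapP; exists (s^-1%g i); rewrite ?mem_enum //.
by rewrite permKV.
Qed.

Lemma lift_perm_inj2 n (i i' : 'I_n.+1) (s s' : 'S_n) :
  lift_perm i ord0 s = lift_perm i' ord0 s' -> (i, s) = (i', s').
Proof.
move=> e; have ei : i = i'.
  have := congr1 (fun f : 'S_n.+1 => f i) e; rewrite lift_perm_id.
  by case: (unliftP i' i) => [j ->|//]; rewrite lift_perm_lift.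
rewrite {}ei in e *; congr pair; apply/permP => j; apply: (@lift_inj _ ord0).
by rewrite -!(lift_perm_lift i') e.
Qed.

(** A permutation of n + 1 letters is given by the position [i] of the letter 0 in its word and the
    order of the n remaining letters. *)
Lemma sum_lift_perm n (G : 'S_n.+1 -> R) :
  \sum_s G s = \sum_(s : 'S_n) \sum_(i < n.+1) G (lift_perm i ord0 s).
Proof.
rewrite (reindex (fun u : 'I_n.+1 * 'S_n => lift_perm u.1 ord0 u.2)) /=; last first.
  apply: onW_bij; apply: inj_card_bij => [[i s] [i' s'] /= /lift_perm_inj2 //|].
  by rewrite card_prod card_ord !card_Sn factS.
by rewrite exchange_big pair_bigA.
Qed.

Lemma pword_lift n (i : 'I_n.+1) (s : 'S_n) :
  pword (lift_perm i ord0 s) = map S (take i (pword s)) ++ 0%N :: map S (drop i (pword s)).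
Proof.
have st : size (take i (pword s)) = i by rewrite size_takel // size_pword -ltnS.
apply: (@eq_from_nth _ 0%N).
  rewrite [LHS]size_pword size_cat (size_map S (take i _)) st /= (size_map S (drop i _)) size_drop size_pword.
  by have := ltn_ord i; lia.
rewrite size_pword => j lj; rewrite -[j]/(nat_of_ord (Ordinal lj)) nth_pword.
case: (unliftP i (Ordinal lj)) => [h ->|->]; last first.
  by rewrite lift_perm_id nth_cat (size_map S (take i _)) st ltnn subnn.
rewrite lift_perm_lift /= /bump nth_cat (size_map S (take i _)) st.
have [ih|hi] := leqP i h.
  rewrite ltnNge leqW //= ?subSn //= (nth_map 0%N) ?size_drop ?size_pword; last by rewrite ltn_sub2r // (leq_ltn_trans ih).
  by rewrite nth_drop subnKC // nth_pword.
by rewrite add0n hi (nth_map 0%N) ?st // nth_take // nth_pword.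
Qed.

(** Inserting the first letter at all places corresponds to [sum_lift_perm], and the sign of the
    insertion is [ksign_insert0]. *)
Lemma psum_pword hs (F : seq (bool * U) -> R) :
  \sum_(s : 'S_(size hs)) sg (ksign (map fst hs) (pword s)) *: F [seq nth (false, 0) hs i | i <- pword s]
  = psum hs F.
Proof.
elim: hs F => [|[p w] hs IH] F.
  rewrite (eq_bigr (fun=> F [::])) => [|s _]; last first.
    by have -> : pword s = [::] by [apply/size0nil; rewrite size_pword]; rewrite scale1r.
  by rewrite sumr_const card_Sn mulr1n.
rewrite sum_lift_perm [psum _ _]/= -IH; apply: eq_bigr => s _.
rewrite insL_sum size_map size_pword scaler_sumr; apply: eq_bigr => i _.
rewrite pword_lift ksign_insert0 cat_take_drop signr_addb scalerA mulrC; congr (_ * sg (_ && _) *: F _).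
  rewrite -[take i [seq nth _ hs _ | _ <- _]]map_take; elim: (take i _) => //= j u ->; by rewrite nth_fst.
by rewrite map_cat /= -(map_comp _ S (take i _)) -(map_comp _ S (drop i _)) -[take i [seq nth _ hs _ | _ <- _]]map_take -[drop i [seq nth _ hs _ | _ <- _]]map_drop.
Qed.

End Permutations.

(** * Rearrangements of copies of an even element *)

Section EvalSums.
Variables (k : fieldType) (A : nilcdga k) (U : superspace k) (R : lmodType k).
Variable xi : bas A -> U.
Hypothesis exi : even xi.
Local Notation um := (umul (@bmul k A)).
Local Notation op := (@opar k A).
Implicit Types (C F : seq (bool * U) -> R) (c : seq U -> R) (l : option (bas A)).

Lemma evA_S n C l : evA xi n.+1 C l = \sum_(i : bas A) \sum_j (um (Some i) j l * sg (bpar i && op j)) *: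
  evA xi n (fun hs => C ((bpar i, xi i) :: hs)) j.
Proof. by []. Qed.

Lemma evA_sum n (J : Type) (r : seq J) (C : J -> seq (bool * U) -> R) l :
  evA xi n (fun hs => \sum_(j <- r) C j hs) l = \sum_(j <- r) evA xi n (C j) l.
Proof.
elim: r => [|j r IH].
  by rewrite big_nil -[RHS](evA0 R xi n l); apply: eq_evA => // hs _ _; rewrite big_nil.
rewrite big_cons -IH -[evA xi n (C j) l]scale1r -evA_lin; apply: eq_evA => // hs _ _.
by rewrite big_cons scale1r.
Qed.

(** Two copies of an even element may be exchanged: the sign from the vectors cancels the sign from
    graded commutativity of A. *)
Lemma evA_swap n C l : evA xi n.+2 (fun hs => if hs is h1 :: h2 :: us then
  sg (h1.1 && h2.1) *: C (h2 :: h1 :: us) else 0) l = evA xi n.+2 C l.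
Proof.
have X (G : bas A -> bas A -> option (bas A) -> R) :
  \sum_(i : bas A) \sum_j (um (Some i) j l * sg (bpar i && op j)) *:
    \sum_(i' : bas A) \sum_j' (um (Some i') j' j * sg (bpar i' && op j')) *: G i i' j' =
  \sum_(i : bas A) \sum_(i' : bas A) \sum_j' ((sg (bpar i && (bpar i' (+) op j')) * sg (bpar i' && op j')) *
     \sum_j um (Some i') j' j * um (Some i) j l) *: G i i' j'.
  apply: eq_bigr => i _.
  under eq_bigr => j _ do rewrite scaler_sumr.
  rewrite exchange_big; apply: eq_bigr => i' _.
  under eq_bigr => j _ do rewrite scaler_sumr.
  rewrite exchange_big; apply: eq_bigr => j' _; rewrite mulr_sumr scaler_suml.
  apply: eq_bigr => j _; rewrite scalerA; congr (_ *: _).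
  have [->|nz] := eqVneq (um (Some i') j' j) 0; first by rewrite !(mul0r, mulr0).
  by rewrite (um_parity nz) /=; ring.
rewrite evA_S [RHS]evA_S.
under eq_bigr => i _ do under eq_bigr => j _ do rewrite evA_S.
under [RHS]eq_bigr => i _ do under eq_bigr => j _ do rewrite evA_S.
rewrite !X [RHS]exchange_big; apply: eq_bigr => i _; apply: eq_bigr => i' _; apply: eq_bigr => j' _.
rewrite evAZ scalerA; congr (_ *: _); rewrite umACA mulrA [LHS]mulrAC; congr (_ * _).
by rewrite -!signr_addb; congr (sg _); rewrite /=; case: (bpar i); case: (bpar i'); case: (op j').
Qed.

Lemma evA_move n i F l : (i <= n)%N -> evA xi n.+1 (fun hs => if hs is h :: us then
  sg (h.1 && tpar (map fst (take i us))) *: F (take i us ++ h :: drop i us) else 0) l = evA xi n.+1 F l.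
Proof.
elim: i n F l => [|i IH] n F l le.
  rewrite !evA_S; apply: eq_bigr => i _; apply: eq_bigr => j _; congr (_ *: _).
  by apply: eq_evA => // hs _ _; rewrite take0 drop0 andbF scale1r.
case: n le => [//|n] le.
rewrite -[LHS]evA_swap.
transitivity (evA xi n.+2 (fun hs => if hs is u :: h :: us then
   sg (h.1 && tpar (map fst (take i us))) *: F (u :: take i us ++ h :: drop i us) else 0) l).
  apply: eq_evA => // -[|[q x] [|[p w] us]] _ //= _; rewrite scalerA -signr_addb.
  by congr (sg _ *: _); case: (p); case: (q); case: (tpar _).
rewrite evA_S [RHS]evA_S; apply: eq_bigr => j _; apply: eq_bigr => j' _; congr (_ *: _).
exact: (IH n (fun us => F ((bpar j, xi j) :: us))).
Qed.

(** The n! orders of n copies of an even element all contribute equally. *)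
Lemma evA_psum n F l : evA xi n (fun hs => psum hs F) l = n`!%:R *: evA xi n F l.
Proof.
elim: n F l => [|n IH] F l; first by rewrite /= scale1r.
transitivity (n`!%:R *: evA xi n.+1 (fun hs => if hs is h :: us then insL h us F else 0) l).
  rewrite !evA_S scaler_sumr; apply: eq_bigr => i _; rewrite scaler_sumr; apply: eq_bigr => j _.
  by rewrite (IH (fun us => insL (bpar i, xi i) us F)) !scalerA; congr (_ *: _); exact: mulrC.
transitivity (n`!%:R *: \sum_(i < n.+1) evA xi n.+1 F l); last first.
  by rewrite sumr_const card_ord -scaler_nat scalerA factS natrM mulrC.
congr (_ *: _).
transitivity (\sum_(i < n.+1) evA xi n.+1 (fun hs => if hs is h :: us then
  sg (h.1 && tpar (map fst (take i us))) *: F (take i us ++ h :: drop i us) else 0) l); last first.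
  by apply: eq_bigr => i _; apply: evA_move; rewrite -ltnS.
rewrite -evA_sum; apply: eq_evA => // -[//|h us] _ [<-].
exact: insL_sum.
Qed.

Lemma extA_const e c (x : U) zs l : multilinear c -> extA e c (@oconst k A U x :: zs) l =
  \sum_(p : bool) sg (p && op l) *: extA e (fun vs => c (hcomp U p x :: vs)) zs l.
Proof.
move=> m; rewrite extA_cons big_option [X in _ + X]big1 ?addr0 => [|i _]; last first.
  apply: big1 => j _; rewrite big1 ?scaler0 // => p _; rewrite /= linear0.
  rewrite [extA _ _ _ _](_ : _ = 0) ?scaler0 //.
  by rewrite -[RHS](extA0 R e zs j); apply: eq_extA => vs; exact: (ml0 [::]).
rewrite (bigD1 l) //= [X in _ + X]big1 ?addr0 => [|j jl]; last by rewrite um1l (negPf jl) scale0r.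
rewrite um1l eqxx scale1r; apply: eq_bigr => p _.
by rewrite andbF.
Qed.

Lemma extA_consts e c xs l : multilinear c -> extA e c (map (@oconst k A U) xs) l = (l == None)%:R *: c xs.
Proof.
elim: xs c => [|x xs IH] c m; first by rewrite extA_nil.
rewrite [map _ _]/= extA_const //.
rewrite (eq_bigr (fun p : bool => (l == None)%:R *: c (hcomp U p x :: xs))) => [|p _]; last first.
  rewrite IH; last exact: ml_cons.
  by case: (l) => [?|]; rewrite ?scale0r ?scaler0 // andbF scale1r.
by rewrite -scaler_sumr -(ml_sum [::]) //= sum_hcomp.
Qed.

Lemma extA_Sym e c n xs l : multilinear c ->
  extA e c (nseq n (oplus xi) ++ map (@oconst k A U) xs) l =
    sg (e && op l) *: evA xi n (fun us => c (map snd us ++ xs)) l.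
Proof.
elim: n c l => [|n IH] c l m.
  by rewrite [_ ++ _]/= extA_consts // /= scalerA; case: (l) => [?|]; rewrite ?mulr0 // andbF mul1r.
rewrite [_ ++ _]/= extA_even //; last exact: evenA_oplus.
rewrite big_option [X in X + _]big1 ?add0r => [|j _]; last first.
  by rewrite /= [extA _ _ _ _](_ : _ = 0) ?scaler0 // -[RHS](extA0 R e (nseq n (oplus xi) ++ map (@oconst k A U) xs) j);
     apply: eq_extA => vs; exact: (ml0 [::]).
rewrite evA_S scaler_sumr; apply: eq_bigr => i _; rewrite scaler_sumr; apply: eq_bigr => j _.
rewrite IH; last exact: ml_cons.
rewrite !scalerA; congr (_ *: _).
have [->|nz] := eqVneq (um (Some i) j l) 0; first by rewrite !(mul0r, mulr0).
have E : sg ((e && bpar i) (+) (bpar i && op j)) * sg (e && op j) = sg (e && (bpar i (+) op j)) * sg (bpar i && op j) :> k.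
  by rewrite -!signr_addb; congr (sg _); case: (e); case: (bpar i); case: (op j).
by rewrite (um_parity nz) -mulrA E /=; ring.
Qed.

(* The shuffles of copies of the even element [xi] with constants. *)
Lemma extA_Tens e c m n xs l : multilinear c -> m = (n + size xs)%N ->
  bsum m n (fun b => extA e c (interleave b (nseq n (oplus xi)) (map (@oconst k A U) xs)) l) =
  hsum (fun ys => sg (e && op l) *: evA xi n (fun us => shfm m us ys c) l) xs.
Proof.
elim: m n xs c l => [|m IH] n xs c l mc em.
  have [-> ->] : n = 0%N /\ xs = [::] by case: (n) (xs) em => [|?] [|? ?].
  by rewrite bsum0 /= extA_nil scalerA; case: l => [l|]; rewrite ?mulr0 // andbF mul1r.
rewrite bsumS.
have -> : hsum (fun ys => sg (e && op l) *: evA xi n (fun us => shfm m.+1 us ys c) l) xs =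
  (if xs is x :: xs' then \sum_(p : bool) sg (p && op l) *:
      hsum (fun ys => sg (e && op l) *: evA xi n (fun us => shfm m us ys (fun vs => c (hcomp U p x :: vs))) l) xs' else 0)
  + hsum (fun ys => sg (e && op l) *: evA xi n (fun us => if us is h :: us' then shfm m us' ys (fun vs => c (h.2 :: vs)) else 0) l) xs.
  transitivity (hsum (fun ys => sg (e && op l) *: evA xi n (fun us => 
     if ys is y :: ys' then sg (y.1 && tpar (map fst us)) *: shfm m us ys' (fun vs => c (y.2 :: vs)) else 0) l
     + sg (e && op l) *: evA xi n (fun us => if us is h :: us' then shfm m us' ys (fun vs => c (h.2 :: vs)) else 0) l) xs).
    apply: eq_hsum => ys _ _; rewrite -scalerDr; congr (_ *: _).
    by rewrite -[X in X + _]scale1r -evA_lin; apply: eq_evA => // us _ _; rewrite scale1r.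
  rewrite hsumD; congr (_ + _); case: (xs) => [|x xs']; first by rewrite /= evA0 scaler0.
  rewrite [LHS]/=; apply: eq_bigr => p _; rewrite -hsumZ; apply: eq_hsum => ys _ _.
  by rewrite evA_sign !scalerA; congr (_ *: _); exact: mulrC.
congr (_ + _).
  case: xs em => [|x xs] em; first by rewrite bsum_small // -[n]addn0 -em.
  have em' : m = (n + size xs)%N by move: em => /=; lia.
  rewrite /bsum.
  under eq_bigr => b _ do rewrite [interleave _ _ _]/= extA_const //.
  rewrite exchange_big; apply: eq_bigr => p _; rewrite -IH //; last exact: ml_cons.
  by rewrite /bsum scaler_sumr.
case: n em => [|n] em.
  by rewrite -[LHS](hsum0 R xs); apply: eq_hsum => ys _ _; rewrite /evA !scaler0.
have em' : m = (n + size xs)%N by move: em => /=; lia.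
transitivity (\sum_(i : bas A) \sum_j (um (Some i) j l * sg ((e && bpar i) (+) (bpar i && op j))) *:
   bsum m n (fun b => extA e (fun vs => c (xi i :: vs)) (interleave b (nseq n (oplus xi)) (map (@oconst k A U) xs)) j)).
  under [RHS]eq_bigr => i _ do under eq_bigr => j _ do rewrite scaler_sumr.
  under [RHS]eq_bigr => i _ do rewrite exchange_big.
  rewrite [RHS]exchange_big; apply: eq_bigr => b _.
  rewrite [interleave _ _ _]/= extA_even //; last exact: evenA_oplus.
  rewrite big_option [X in X + _]big1 ?add0r // => j _.
  rewrite /= [extA _ _ _ _](_ : _ = 0) ?scaler0 //.
  by rewrite -[RHS](extA0 R e (interleave b (nseq n (oplus xi)) (map (@oconst k A U) xs)) j);
     apply: eq_extA => vs; exact: (ml0 [::]).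
transitivity (hsum (fun ys => \sum_(i : bas A) \sum_j (um (Some i) j l * sg ((e && bpar i) (+) (bpar i && op j))) *: 
   (sg (e && op j) *: evA xi n (fun us => shfm m us ys (fun vs => c (xi i :: vs))) j)) xs).
  rewrite hsum_sum; apply: eq_bigr => i _; rewrite hsum_sum; apply: eq_bigr => j _.
  by rewrite IH ?hsumZ //; exact: ml_cons.
apply: eq_hsum => ys _ _; rewrite evA_S scaler_sumr; apply: eq_bigr => i _.
rewrite scaler_sumr; apply: eq_bigr => j _; rewrite !scalerA; congr (_ *: _).
have [->|nz] := eqVneq (um (Some i) j l) 0; first by rewrite !(mul0r, mulr0).
have E : sg ((e && bpar i) (+) (bpar i && op j)) * sg (e && op j) = sg (e && (bpar i (+) op j)) * sg (bpar i && op j) :> k.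
  by rewrite -!signr_addb; congr (sg _); case: (e); case: (bpar i); case: (op j).
by rewrite (um_parity nz) -mulrA E /=; ring.
Qed.

End EvalSums.

(** * The twisted structure maps as iterated insertions *)

Section Uniform.
Variables (k : fieldType) (char0 : [pchar k] =i pred0) (U : superspace k).
Implicit Types (hs ys us : seq (bool * U)) (xs ws : seq U).

Section Kact.
Variables (R : lmodType k) (c : seq U -> R) (is_ : seq nat) (N : nat).
Hypotheses (mc : multilinear c) (pis : perm_eq is_ (iota 0 N)).

(** Extended by zero to words whose length differs from N, where the positions named in [is_] would
    be read off default values. *)
Definition kactF (zs : seq (bool * U)) : R :=
  if size zs == N then sg (ksign (map fst zs) is_) *: c [seq (nth (false, 0) zs i).2 | i <- is_] else 0.

Lemma kactE xs : size xs = N -> kact is_ c xs = hsum kactF xs.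
Proof. by move=> sx; apply: eq_hsum => zs _ sz; rewrite /kactF sz sx eqxx. Qed.

Lemma kactF_slot : slotlinear kactF.
Proof.
move=> hs1 hs2 p a x y; rewrite /kactF !size_cat /= !map_cat /=.
have [eN|_] := eqVneq; last by rewrite scaler0 addr0.
have kin : size hs1 \in is_ by rewrite (perm_mem pis) mem_iota -eN; lia.
have uis : uniq is_ by rewrite (perm_uniq pis) iota_uniq.
case/splitPr: kin uis => i1 i2; rewrite cat_uniq /= negb_or => /and3P [_ /andP [n1 _] /andP [n2 _]].
have E (j : seq nat) z z' : size hs1 \notin j -> [seq (nth (false, 0) (hs1 ++ (p, z) :: hs2) i).2 | i <- j] =
    [seq (nth (false, 0) (hs1 ++ (p, z') :: hs2) i).2 | i <- j].
  move=> nj; apply/eq_in_map => i ij; rewrite !nth_cat.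
  case: (ltngtP i (size hs1)) => [//|gt|e]; last by rewrite e (negPf nj) in ij.
  by rewrite -[(i - size hs1)%N]prednK ?subn_gt0.
rewrite !map_cat /= !nth_cat !ltnn !subnn /= (E i1 (a *: x + y) 0 n1) (E i1 x 0 n1) (E i1 y 0 n1).
rewrite (E i2 (a *: x + y) 0 n2) (E i2 x 0 n2) (E i2 y 0 n2) mc scalerDr !scalerA; congr (_ + _).
by rewrite mulrC.
Qed.

Lemma kact_slot s1 s2 (a : k) x y : (size s1 + (size s2).+1 = N)%N ->
  kact is_ c (s1 ++ (a *: x + y) :: s2) = a *: kact is_ c (s1 ++ x :: s2) + kact is_ c (s1 ++ y :: s2).
Proof.
by move=> sN; rewrite !kactE ?size_cat //; exact: (hsum_ml kactF_slot).
Qed.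

Lemma kact_homog zs : hh zs -> size zs = N ->
  kact is_ c (map snd zs) = sg (ksign (map fst zs) is_) *: c [seq (nth (false, 0) zs i).2 | i <- is_].
Proof.
by move=> hz sz; rewrite kactE ?size_map // (hsum_homog kactF_slot hz) /kactF sz eqxx.
Qed.

End Kact.

Lemma ksign_cat ps qs is_ : all (fun i => (i < size ps)%N) is_ -> ksign (ps ++ qs) is_ = ksign ps is_.
Proof.
elim: is_ => //= i s IH /andP [ip sp]; rewrite IH //; congr (tpar _ (+) _).
apply/eq_in_map => j js; have jp := allP sp j js.
by rewrite !nth_cat ip jp.
Qed.

Lemma perm_hoch r n (s : 'S_r) (b : seq bool) : size b = (r + n)%N -> count id b = r ->
  perm_eq (interleave b (pword s) (iota r n)) (iota 0 (r + n)).
Proof.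
move=> sb cb; rewrite (perm_trans (perm_interleave _ _)) ?size_pword ?size_iota //.
by rewrite iotaD add0n perm_cat2r perm_pword.
Qed.

Lemma inss_taus t hs (R : lmodType k) (c : seq U -> R) b ys : multilinear c -> hh ys ->
  inss t hs c (map (tau b) (map snd ys)) = sg (b && tpar (map fst ys)) *: inss t hs c (map snd ys).
Proof. by move=> mc hy; exact: (ml_taus b [::] (inss_ml t hs mc) hy). Qed.

Lemma projTS_inss (phi : seq U -> k^o) hs : multilinear phi -> hh hs ->
  projTS phi (map snd hs) = inss Tens hs phi [::].
Proof.
move=> mp hhs; rewrite inss_psum_nil // -psum_pword /projTS.
move: (size (map snd hs)) (size_map snd hs) => r ->; apply: eq_bigr => s _.
rewrite (kact_homog mp (perm_pword s)) //; congr (_ *: phi _).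
by elim: (pword s) => //= i u ->.
Qed.

Section TwistLevel.
Variables (A : nilcdga k) (xi : bas A -> U) (m : seq U -> U).
Hypotheses (exi : even xi) (mm : multilinear m).
Local Notation op := (@opar k A).

Lemma evA_ml n l t b : multilinear (fun xs => evA xi n (fun us => inss t us m (map (tau b) xs)) l).
Proof.
move=> s1 s2 a x y; rewrite -evA_lin; apply: eq_evA => // us _ _.
exact: (ml_map (tau b) (inss_ml t us mm)).
Qed.

Lemma twistA_Sym xs l : gsymmetric m -> twistA Sym m xi xs l = \sum_(0 <= i < (nilbound A).+1)
  i`!%:R^-1 *: (sg (op l) *: evA xi i (fun us => inss Sym us m (map (tau (op l)) xs)) l).
Proof.
move=> gm; apply: eq_bigr => n _; rewrite extA_Sym //; congr (_ *: (_ *: _)).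
have m1 : multilinear (fun xs => evA xi n (fun us => m (map snd us ++ xs)) l).
  by move=> s1 s2 a x y; rewrite -evA_lin; apply: eq_evA => // us _ _; rewrite !catA mm.
apply: (ml_ext m1 (@evA_ml n l Sym (op l))) => ys hys.
transitivity (evA xi n (fun us => sg (tpar (map fst ys) && op l) *: (sg (tpar (map fst ys) && tpar (map fst us)) *: m (map snd us ++ map snd ys))) l).
  by rewrite evAZ evA_sign scalerA -signr_addb addbb scale1r.
apply: eq_evA => // us hus _; rewrite inss_taus // inss_Sym // andbC.
by rewrite [in RHS](andbC (tpar (map fst us))).
Qed.

(** The A-infinity twisting has no factorials, but iterated insertion runs through all i! orders of
    the copies of xi. By [evA_psum] these agree, which brings in 1/i! and gives the same expression
    as in the symmetric case. *)
Lemma twistA_Tens xs l : twistA Tens m xi xs l = \sum_(0 <= i < (nilbound A).+1)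
  i`!%:R^-1 *: (sg (op l) *: evA xi i (fun us => inss Tens us m (map (tau (op l)) xs)) l).
Proof.
apply: eq_bigr => n _.
have := @extA_Tens k A U U xi exi true m (n + size xs) n xs l mm erefl; rewrite /bsum => ->.
rewrite hsumZ scalerA mulrC -scalerA; congr (_ *: _).
rewrite (ml_hsum xs (@evA_ml n l Tens (op l))) -hsumZ; apply: eq_hsum => ys hys sys.
transitivity (n`!%:R^-1 *: evA xi n (fun us => sg (tpar (map fst ys) && op l) *: (sg (tpar (map fst ys) && tpar (map fst us)) *: 
   psum us (fun us => shf us ys m))) l); last first.
  congr (_ *: _); apply: eq_evA => // us hus _; rewrite inss_taus // inss_psum // andbC.
  by rewrite [in RHS](andbC (tpar (map fst us))).
rewrite evAZ evA_sign [X in _ *: X]scalerA -signr_addb addbb scale1r evA_psum // scalerA mulVf ?scale1r.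
  by apply: eq_evA => // us _ sus; rewrite /shf sus sys.
by case: (n`!) (fact_gt0 n) => // q _; exact: natr_neq0.
Qed.

End TwistLevel.
End Uniform.

(** * The explicit formulas for f_r *)

Section Formulas.
Variables (k : fieldType) (V : superspace k).

Lemma Hoch_ml (m : seq (Pi V) -> Pi V) (ws : seq (Pi V)) : multilinear m -> multilinear (Hoch_formula m ws).
Proof.
move=> mm s1 s2 a x y; rewrite /Hoch_formula.
have sE z : size (s1 ++ z :: s2) = (size s1 + (size s2).+1)%N by rewrite size_cat.
rewrite scaler_sumr -big_split; apply: eq_bigr => s _ /=.
rewrite !sE scaler_sumr -big_split; apply: eq_bigr => b /eqP cb /=.
have p := perm_hoch s (size_tuple b) cb.
by rewrite !catA (kact_slot mm p) // size_cat addnA.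
Qed.

Lemma Hoch_homog (m : seq (Pi V) -> Pi V) (hs ys : seq (bool * Pi V)) :
  multilinear m -> hh hs -> hh ys ->
  Hoch_formula m (map snd hs) (map snd ys) = psum hs (fun us => shf us ys m).
Proof.
move=> mm hhs hys; rewrite /Hoch_formula -psum_pword -!map_cat.
move: (size (map snd ys)) (size_map snd ys) => n ->.
move: (size (map snd hs)) (size_map snd hs) => r ->; apply: eq_bigr => s _.
have sp : all (fun i => (i < size hs)%N) (pword s).
  by apply/allP => i; rewrite (perm_mem (perm_pword s)) mem_iota => /andP [].
have := @bsum_words k (Pi V) _ (hs ++ ys) (size hs + size ys) (pword s) (size hs) (size ys) m sp.
rewrite size_pword => /(_ erefl); rewrite map_cat ksign_cat ?size_map // -map_cat.
have -> : [seq nth (false, 0) (hs ++ ys) i | i <- iota (size hs) (size ys)] = ys.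
  apply: (@eq_from_nth _ (false, 0)); rewrite size_map size_iota // => j js.
  by rewrite (nth_map 0%N) ?size_iota // nth_iota // nth_cat ltnNge leq_addr /= addKn.
have -> : [seq nth (false, 0) (hs ++ ys) i | i <- pword s] = [seq nth (false, 0) hs i | i <- pword s].
  by apply/eq_in_map => i ip; rewrite nth_cat (allP sp i ip).
rewrite /shf size_map size_pword => <-; apply: eq_bigr => b /eqP cb.
have p := perm_hoch s (size_tuple b) cb.
by rewrite (kact_homog mm p) ?size_cat //; apply/hh_cat.
Qed.

Lemma CE_inss (m : seq (Pi V) -> Pi V) (hs : seq (bool * Pi V)) (xs : seq (Pi V)) :
  multilinear m -> gsymmetric m -> hh hs ->
  CE_formula m (map snd hs) xs = inss Sym hs m (map (tau (tpar (map fst hs))) xs).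
Proof.
move=> mm gm hhs.
have H := @ml_ext k (Pi V) (Pi V) (CE_formula m (map snd hs)) (fun xs => inss Sym hs m (map (tau (tpar (map fst hs))) xs)).
apply: H => [|| ys hys].
- by move=> s1 s2 a x y; rewrite /CE_formula !catA mm.
- exact: (ml_map (tau (tpar (map fst hs))) (inss_ml Sym hs mm)).
by rewrite inss_taus // inss_Sym // scalerA -signr_addb addbb scale1r.
Qed.

(** On homogeneous words both sides are the sum over the orders of the w's and their shuffles with
    the x's. Insertion brings the w's in from the right of the x's, and the twist of the x's
    compensates for this. *)
Lemma Hoch_inss (m : seq (Pi V) -> Pi V) (hs : seq (bool * Pi V)) (xs : seq (Pi V)) :
  multilinear m -> hh hs ->
  Hoch_formula m (map snd hs) xs = inss Tens hs m (map (tau (tpar (map fst hs))) xs).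
Proof.
move=> mm hhs.
have H := @ml_ext k (Pi V) (Pi V) (Hoch_formula m (map snd hs)) (fun xs => inss Tens hs m (map (tau (tpar (map fst hs))) xs)).
apply: H => [|| ys hys].
- exact: Hoch_ml.
- exact: (ml_map (tau (tpar (map fst hs))) (inss_ml Tens hs mm)).
by rewrite inss_taus // inss_psum // Hoch_homog // scalerA -signr_addb addbb scale1r.
Qed.

End Formulas.

(** * Cyclic invariance under insertion *)

Section Cyclic.
Variables (k : fieldType) (V : superspace k) (e : bool) (B : V -> V -> k^o).
Hypothesis ipB : inner_product e B.
Local Notation U := (Pi V).
Implicit Types (x y w : U) (xs : seq U) (c : seq U -> U) (b d p q : bool).

Lemma Pi_form_lin (a : k) x z y : Pi_form B (a *: x + z) y = a * Pi_form B x y + Pi_form B z y.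
Proof.
rewrite /Pi_form mulr_sumr -big_split; apply: eq_bigr => p _ /=.
by rewrite linearP (ip_linearl ipB); ring.
Qed.

Lemma Pi_form0 y : Pi_form B 0 y = 0.
Proof.
have := Pi_form_lin (-1) 0 0 y; rewrite scaler0 addr0 => ->.
by rewrite mulN1r addNr.
Qed.

Lemma Pi_formZ (a : k) x y : Pi_form B (a *: x) y = a * Pi_form B x y.
Proof. by have := Pi_form_lin a x 0 y; rewrite !addr0 Pi_form0 addr0. Qed.

Lemma Pi_formD x z y : Pi_form B (x + z) y = Pi_form B x y + Pi_form B z y.
Proof. by have := Pi_form_lin 1 x z y; rewrite scale1r mul1r. Qed.

Lemma Pi_form_sum (I : Type) (r : seq I) (F : I -> U) y :
  Pi_form B (\sum_(i <- r) F i) y = \sum_(i <- r) Pi_form B (F i) y.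
Proof.
elim: r => [|i r IH]; first by rewrite !big_nil Pi_form0.
by rewrite !big_cons Pi_formD IH.
Qed.

(* Cyclic invariance for the insertion of vectors of total parity [b]. *)
Definition cyc b c := forall p q x y (hs : seq (bool * U)), homog p x -> hh hs -> homog q y ->
  Pi_form B (c (x :: map snd hs)) y =
    sg ((p && (tpar (map fst hs) (+) q)) (+) (b && (p (+) q))) * Pi_form B (c (rcons (map snd hs) y)) x.

Lemma cyc_cyclic c : cyc false c <-> cyclic_maps B c.
Proof.
split=> [h p q ps x y xs hx hxs hy|h p q x y hs hx hhs hy].
  by have [hs [hhs -> ->]] := homogsP hxs; rewrite (h p q) // addbF.
by rewrite (h p q _ _ _ _ hx hhs hy) addbF.
Qed.

Lemma tpar_rcons (hs : seq (bool * U)) q y :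
  tpar (map fst (rcons hs (q, y))) = tpar (map fst hs) (+) q.
Proof. by rewrite -cats1 map_cat tpar_cat /= addbF. Qed.

Lemma ml_taus_rcons (R : lmodType k) (c : seq U -> R) p q (hs : seq (bool * U)) s1 y :
  multilinear c -> hh hs -> homog q y ->
  c (s1 ++ map (tau p) (rcons (map snd hs) y)) =
    sg (p && (tpar (map fst hs) (+) q)) *: c (s1 ++ rcons (map snd hs) y).
Proof.
move=> m hhs hy; have hh2 : hh (rcons hs (q, y)) by rewrite -cats1; apply/hh_cat; split=> //; apply/hh_cons.
have := ml_taus p s1 m hh2; rewrite (tpar_rcons hs) [map snd _]map_rcons => H; exact: H.
Qed.

Lemma ins_Tens_rcons d w c xs y : ins Tens d w c (rcons xs y) =
  ins Tens d w (fun vs => c (rcons vs (tau d y))) xs + c (rcons (rcons xs y) w).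
Proof.
rewrite -[LHS]/(\sum_(i < (size (rcons xs y)).+1) c (take i (rcons xs y) ++ w :: map (tau d) (drop i (rcons xs y)))).
rewrite size_rcons big_ord_recr /=.
have -> : take (size xs).+1 (rcons xs y) = rcons xs y by rewrite -(size_rcons xs y) take_size.
have -> : drop (size xs).+1 (rcons xs y) = [::] by rewrite -(size_rcons xs y) drop_size.
rewrite cats1; congr (_ + _).
apply: eq_bigr => i _; have le : (i <= size xs)%N by rewrite -ltnS.
rewrite -{1 2}cats1 takel_cat // drop_cat; case: ltnP => [lt|ge].
  by rewrite map_cat -cats1 -catA /= cats1.
have -> : (i : nat) = size xs by apply/eqP; rewrite eqn_leq le.
by rewrite subnn drop0 drop_size /= -cats1 -catA.
Qed.

(** In the tensor case the insertions of [w] between [x] and [y] correspond to each other under one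
    rotation. The insertion in front of [x] corresponds to the one behind [y] under two rotations,
    [w] being the vector paired with the output in between. In the symmetric case [w] is first moved
    behind [x]. *)
Lemma cyc_ins t b d w c : multilinear c -> (t = Sym -> gsymmetric c) -> homog d w -> cyc b c ->
  cyc (b (+) d) (ins t d w c).
Proof.
move=> m g hw cc p q x y hs hx hhs hy; have hhx : hh ((p, x) :: hs) by apply/hh_cons.
have T1 := ml_taus d [:: w] m hhx; rewrite /= in T1.
have hhw : hh ((d, w) :: hs) by apply/hh_cons.
case: t g => g.
  have T2 := ml_taus_rcons d [:: w] m hhs hy; rewrite /= in T2.
  rewrite -[ins Sym d w c (x :: _)]/(c [:: w, tau d x & map (tau d) (map snd hs)]) T1.
  rewrite -[ins Sym d w c (rcons _ _)]/(c (w :: map (tau d) (rcons (map snd hs) y))) T2.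
  have := g erefl [::] (map snd hs) _ _ _ _ hw hx => /= ->.
  rewrite scalerA !Pi_formZ (cc p q x y ((d, w) :: hs) hx hhw hy) /= !mulrA -!signr_addb.
  by congr (sg _ * _); case: (p); case: (q); case: (d); case: (b); case: (tpar _).
rewrite ins_Tens_cons ins_Tens_rcons !Pi_formD mulrDr addrC; congr (_ + _).
  rewrite -[ins Tens d w (fun ys => c (x :: ys)) _]/(\sum_(i < (size (map snd hs)).+1)
    c (x :: (take i (map snd hs) ++ w :: map (tau d) (drop i (map snd hs))))).
  rewrite -[ins Tens d w _ _]/(\sum_(i < (size (map snd hs)).+1)
    c (rcons (take i (map snd hs) ++ w :: map (tau d) (drop i (map snd hs))) (tau d y))).
  rewrite !Pi_form_sum mulr_sumr; apply: eq_bigr => i _.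
  pose zs := take i hs ++ (d, w) :: [seq (h.1, tau d h.2) | h <- drop i hs].
  have hz : hh zs.
    have := hhs; rewrite -{1}(cat_take_drop i hs) => /hh_cat [h1 h2].
    by apply/hh_cat; split=> //; apply/hh_cons; split=> //; exact: hh_taus.
  have ez : take i (map snd hs) ++ w :: map (tau d) (drop i (map snd hs)) = map snd zs.
    by rewrite map_cat /= -map_take -map_drop -!map_comp.
  have tz : tpar (map fst zs) = d (+) tpar (map fst hs).
    rewrite map_cat tpar_cat /= -map_comp addbCA -[in RHS](cat_take_drop i hs) map_cat tpar_cat.
    by congr (_ (+) (_ (+) tpar _)); apply: eq_map.
  rewrite ez (cc p q x y zs hx hz hy) (tau_homog d hy) -!cats1 (mlZ _ [::]) // Pi_formZ mulrA -signr_addb tz.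
  by congr (sg _ * _); case: (p); case: (q); case: (d); case: (b); case: (tpar _).
rewrite T1 Pi_formZ (cc d q w y ((p, x) :: hs) hw hhx hy) [rcons _ _]/=.
have hhy : hh (rcons hs (q, y)) by rewrite -cats1; apply/hh_cat; split=> //; apply/hh_cons.
have := cc p d x w (rcons hs (q, y)) hx hhy hw; rewrite tpar_rcons [map snd _]map_rcons => ->.
rewrite /= !mulrA -!signr_addb.
by congr (sg _ * _); case: (p); case: (q); case: (d); case: (b); case: (tpar _).
Qed.

Lemma inss_gsym hs c : multilinear c -> gsymmetric c -> gsymmetric (inss Sym hs c).
Proof.
by move=> m g; elim: hs => //= h hs IH; apply: ins_gsym => //; exact: inss_ml.
Qed.

Lemma cyc_inss t hs c : multilinear c -> (t = Sym -> gsymmetric c) -> hh hs -> cyc false c ->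
  cyc (tpar (map fst hs)) (inss t hs c).
Proof.
move=> m g + cc; elim: hs => [//|[p w] hs IH] /hh_cons [hw hhs].
rewrite /= addbC; apply: cyc_ins => //; [exact: inss_ml | | exact: IH].
by move=> et; move: (g et); rewrite et; exact: inss_gsym.
Qed.

(** The twist of the arguments produces exactly the sign by which [cyc b] differs from plain cyclic
    invariance. *)
Lemma cyc_taus b c : multilinear c -> cyc b c -> cyc false (fun xs => c (map (tau b) xs)).
Proof.
move=> m cc p q x y hs hx hhs hy; have hhx : hh ((p, x) :: hs) by apply/hh_cons.
have := ml_taus b [::] m hhx => /= ->; have := ml_taus_rcons b [::] m hhs hy => /= ->.
rewrite !Pi_formZ (cc p q) // !mulrA -!signr_addb.
by congr (sg _ * _); case: (p); case: (q); case: (b); case: (tpar _).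
Qed.

Lemma cyclic_opclosed t : opclosed t (cyclic_Der0 t B).
Proof.
split=> [b|b a D E [dD [c sc cc]] [dE [c' sc' cc']]|b D E [dD [c sc cc]] DE].
- split; first exact: Der0_zero.
  exists (fun=> 0); last by move=> *; rewrite !Pi_form0 mulr0.
  by split=> // [|q psi _ xs]; [exact: ml_zero | rewrite linear0 mulr0].
- split; first exact: Der0_lin.
  exists (fun xs => a *: c xs + c' xs).
    split=> [||q psi hq xs]; first exact: ml_linear (sm_multilinear sc) (sm_multilinear sc').
      by rewrite (sm_no_constant sc) (sm_no_constant sc') scaler0 addr0.
    by rewrite (sm_dual sc hq) (sm_dual sc' hq) linearP scale_regE; ring.
  move=> p q ps x y xs hx hxs hy; rewrite !Pi_form_lin (cc p q ps) // (cc' p q ps) //.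
  by ring.
- split; first exact: Der0_eq dD DE.
  exists c => //; split=> [||q psi hq xs]; [exact: sm_multilinear sc | exact: sm_no_constant sc|].
  by rewrite -DE; [exact: (sm_dual sc hq) | exact: gen_Fhat].
Qed.

Lemma Der0_opclosed (U' : superspace k) t : opclosed t (Der0 (U := U') t).
Proof. by split=> [b|b a D1 D2|b D1 D2]; [exact: Der0_zero | exact: Der0_lin | exact: Der0_eq]. Qed.

End Cyclic.

(** * Parities of structure maps and functionals *)

Section Parities.
Variables (k : fieldType) (U : superspace k).
Implicit Types (hs ys us : seq (bool * U)) (xs ws : seq U) (psi : {linear U -> k^o}).

Lemma hfun_homog q r psi (x : U) : hfun q psi -> homog r x -> r != q -> psi x = 0.
Proof. by move=> hq hx ne; apply: hq; case: (q) (r) ne hx => [] []. Qed.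

Lemma inss_dual t hs (a : k) psi (c : seq U -> U) :
  inss t hs (fun xs => a * psi (c xs) : k^o) = (fun xs => a * psi (inss t hs c xs)).
Proof.
elim: hs => //= h hs ->; apply/funext => xs.
have H : @ins k U t h.1 h.2 k^o (fun xs => a * psi (inss t hs c xs)) xs =
    a * @ins k U t h.1 h.2 k^o (fun xs => psi (inss t hs c xs)) xs.
  exact: (insZ t h.1 h.2 a (fun xs => psi (inss t hs c xs) : k^o) xs).
apply: (etrans H); congr (_ * _); exact: (ins_comp (R := U) (S := k^o) psi).
Qed.

Lemma ins_homog t p w (c : seq U -> U) (r : bool) : homog p w ->
  (forall hs, hh hs -> homog (r (+) tpar (map fst hs)) (c (map snd hs))) ->
  forall hs, hh hs -> homog (r (+) p (+) tpar (map fst hs)) (ins t p w c (map snd hs)).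
Proof.
move=> hw hc hs hhs.
have X h1 h2 : hs = h1 ++ h2 -> homog (r (+) p (+) tpar (map fst hs)) (c (map snd h1 ++ w :: map (tau p) (map snd h2))).
  move=> e; move: hhs; rewrite e => /hh_cat [hh1 hh2].
  have hz : hh (h1 ++ (p, w) :: [seq (h.1, tau p h.2) | h <- h2]).
    by apply/hh_cat; split=> //; apply/hh_cons; split=> //; exact: hh_taus.
  have := hc _ hz; rewrite !map_cat /= -!map_comp !tpar_cat /=.
  have -> : [seq (fst \o (fun h => (h.1, tau p h.2))) i | i <- h2] = map fst h2 by apply: eq_map.
  by rewrite -addbA (addbCA p).
case: t; first exact: (X [::] hs).
apply: homog_sum => i _; have := X (take i hs) (drop i hs).
by rewrite cat_take_drop map_take map_drop; apply.
Qed.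

(* A functional of parity [q] only sees the words whose parity makes the two
   signs agree. *)
Lemma dual_sign b q psi (G : seq U -> U) xs : hfun q psi -> multilinear G ->
  (forall ys, hh ys -> homog (~~ (b (+) tpar (map fst ys))) (G (map snd ys))) ->
  sg q * psi (G xs) = sg (~~ b && q) * psi (G (map (tau b) xs)).
Proof.
move=> hq mG hG.
have m1 : multilinear (fun xs => sg q * psi (G xs) : k^o).
  exact: (ml_scale (sg q) (ml_comp (R := U) (S := k^o) psi mG)).
have m2 : multilinear (fun xs => sg (~~ b && q) * psi (G (map (tau b) xs)) : k^o).
  exact: (ml_scale (sg (~~ b && q)) (ml_comp (R := U) (S := k^o) psi (ml_map (tau b) mG))).
apply: (ml_ext m1 m2) => ys hys.
have := ml_taus b [::] mG hys => /= ->; rewrite linearZ /= mulrA -signr_addb.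
have [<-|ne] := eqVneq (~~ (b (+) tpar (map fst ys))) q.
  by congr (sg _ * _); case: (b); case: (tpar _).
by rewrite (hfun_homog hq (hG ys hys)) // !mulr0.
Qed.

Lemma tau0 (xs : seq U) : map (tau false) xs = xs.
Proof.
elim: xs => //= x xs ->; congr (_ :: _); rewrite /tau expr0 scale1r.
exact: hcomp_sum.
Qed.

End Parities.

Section Structure.
Variables (k : fieldType) (V : superspace k).
Local Notation U := (Pi V).
Implicit Types (hs ys us : seq (bool * U)) (xs ws : seq U) (psi : {linear U -> k^o}).

(** The component of the wrong parity is detected by functionals of that parity, on which the parity
    of [D] forces the value 0. *)
Lemma inf_homog t D (m : seq U -> U) hs : infinity_structure t D m -> hh hs ->
  homog (~~ tpar (map fst hs)) (m (map snd hs)).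
Proof.
move=> iD hhs; set r := tpar _; set v := m _.
have Z : hcomp U r v = 0.
  apply: (@eq_by_functionals k U) => q psi hq; rewrite linear0.
  have [e|ne] := eqVneq r q; last by rewrite (hfun_homog hq (homog_hcomp r v)).
  have P := der_parity (proj1 (inf_der iD)) (gen_Fhat t psi) (gen_fparity hq).
  have := sm_dual (inf_maps iD) hq (map snd hs).
  rewrite (P (map fst hs)) //; last by rewrite -/r e; case: (q).
  move/eqP; rewrite eq_sym mulf_eq0 signr_eq0 /= => /eqP H.
  transitivity (psi v); last exact: H.
  have O : psi (hcomp U (~~ r) v) = 0.
    by apply: (hfun_homog hq (homog_hcomp (~~ r) v)); rewrite e; case: (q).
  have S := sum_hcomp v; rewrite big_bool in S; rewrite -[in RHS]S linearD.
  by case: (r) O => /= O; rewrite O ?addr0 ?add0r.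
by rewrite /homog -[RHS](sum_hcomp v) big_bool /=; case: (r) Z => /= ->; rewrite ?addr0 ?add0r.
Qed.

(** When the parities of functional and word do not match both sides vanish, so the sign can be
    expressed through the word alone. *)
Lemma inf_gen t D (m : seq U -> U) hs q psi : infinity_structure t D m -> hh hs -> hfun q psi ->
  D (gen psi) (map snd hs) = sg (~~ tpar (map fst hs)) * psi (m (map snd hs)).
Proof.
move=> iD hhs hq; rewrite (sm_dual (inf_maps iD) hq).
have [<-//|ne] := eqVneq (~~ tpar (map fst hs)) q.
by rewrite (hfun_homog hq (inf_homog iD hhs)) // !mulr0.
Qed.

Lemma inss_homog t D (m : seq U -> U) us ys : infinity_structure t D m -> hh us -> hh ys ->
  homog (~~ (tpar (map fst us) (+) tpar (map fst ys))) (inss t us m (map snd ys)).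
Proof.
move=> iD; elim: us ys => [|[p w] us IH] ys; first by move=> _ hy; exact: (inf_homog iD hy).
move=> /hh_cons [hw hus] hys.
have := @ins_homog k U t p w (inss t us m) (~~ tpar (map fst us)) hw.
have H zs : hh zs -> homog (~~ tpar (map fst us) (+) tpar (map fst zs)) (inss t us m (map snd zs)).
  by move=> hz; rewrite addNb; exact: IH.
move=> /(_ H ys hys).
by have -> : ~~ tpar (map fst us) (+) p (+) tpar (map fst ys) = ~~ (p (+) tpar (map fst us) (+) tpar (map fst ys));
  first by case: (p); case: (tpar _); case: (tpar _).
Qed.

End Structure.

(** * Compatibility with the transition maps of a formal cdga *)

Section Naturality.
Variables (k : fieldType) (U : superspace k) (R : lmodType k) (A : formal_cdga k) (i j : fidx A).
Hypothesis ij : fle i j.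
Variables (xi : forall i, bas (flev A i) -> U).
Hypothesis exi : forall i, even (@xi i).
Hypothesis xi_compat : forall l, @xi i l = \sum_a ftr a l *: @xi j a.
Local Notation Ai := (flev A i).
Local Notation Aj := (flev A j).

Definition oftr (a : option (bas Aj)) (l : option (bas Ai)) : k :=
  match a, l with None, None => 1 | Some a, Some l => ftr a l | _, _ => 0 end.

Lemma oftr_parity a l : oftr a l != 0 -> opar l = opar a.
Proof. by case: a l => [a|] [l|] //=; rewrite ?eqxx //; exact: ftr_parity. Qed.

Lemma oftr_mul (a b : option (bas Aj)) l : \sum_x umul (@bmul k Aj) a b x * oftr x l =
  \sum_s \sum_t oftr a s * oftr b t * umul (@bmul k Ai) s t l.
Proof.
have d1 (T : finType) (y : T) (F : T -> k) : \sum_x (y == x)%:R * F x = F y.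
  by rewrite -[RHS](sum_delta y F); apply: eq_bigr => x _; rewrite eq_sym.
have d2 (T : finType) (y : T) (F : T -> k) : \sum_x F x * (x == y)%:R = F y.
  by rewrite -[RHS](sum_delta y F); apply: eq_bigr => x _; rewrite mulrC.
case: a => [a|].
  case: b => [b|]; last first.
    under eq_bigr => x _ do rewrite um1r.
    rewrite d1 [RHS]big_option /= [X in _ = X + _]big1 ?add0r => [|t _]; last by rewrite !mul0r.
    under [RHS]eq_bigr => s _.
      rewrite big_option /= [X in _ + X]big1 ?addr0 => [|t _]; last by rewrite mulr0 mul0r.
      rewrite mulr1 um1r; over.
    case: l => [l|]; last by rewrite big1 // => s _; rewrite mulr0.
    by rewrite -[LHS](d2 _ l (fun s => ftr a s)).
  rewrite big_option um_None mul0r add0r [RHS]big_option /= [X in _ = X + _]big1 ?add0r => [|t _]; last by rewrite !mul0r.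
  under [RHS]eq_bigr => s _ do rewrite big_option /= mulr0 mul0r add0r.
  case: l => [l|]; first exact: ftr_mul.
  rewrite !big1 // => [s _|s _]; last by rewrite mulr0.
  by apply: big1 => t _; rewrite um_None mulr0.
under eq_bigr => x _ do rewrite um1l.
rewrite d1 [RHS]big_option /= [X in _ = _ + X]big1 ?addr0 => [|s _]; last first.
  by apply: big1 => t _; rewrite !mul0r.
by rewrite -[LHS](d2 _ l (fun t => oftr b t)); apply: eq_bigr => t _; rewrite mul1r um1l.
Qed.

(** Induction on n: the transition maps are multiplicative on the unital algebras ([oftr_mul]) and
    preserve parities. *)
Lemma evA_natural n (c : seq U -> R) l : multilinear c ->
  evA (@xi i) n (fun hs => c (map snd hs)) l =
    \sum_a oftr a l *: evA (@xi j) n (fun hs => c (map snd hs)) a.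
Proof.
elim: n c l => [|n IH] c l mc.
  rewrite big_option [X in _ + X]big1 ?addr0 => [|a _]; last by rewrite evA_0 scale0r scaler0.
  by rewrite !evA_0 eqxx scale1r; case: l => [l|]; rewrite ?scale0r ?scale1r.
transitivity (\sum_(a : bas Aj) \sum_b (\sum_s \sum_t oftr (Some a) s * oftr b t * umul (@bmul k Ai) s t l * sg (bpar a && opar b)) *:
    evA (@xi j) n (fun hs => c (@xi j a :: map snd hs)) b).
  rewrite evA_S.
  transitivity (\sum_(s : bas Ai) \sum_t \sum_(a : bas Aj) \sum_b (oftr (Some a) (Some s) * oftr b t *
      umul (@bmul k Ai) (Some s) t l * sg (bpar a && opar b)) *: evA (@xi j) n (fun hs => c (@xi j a :: map snd hs)) b).
    apply: eq_bigr => s _; apply: eq_bigr => t _.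
    rewrite (IH (fun ws => c (@xi i s :: ws))); last exact: ml_cons.
    rewrite [RHS]exchange_big scaler_sumr; apply: eq_bigr => b _.
    have -> : evA (@xi j) n (fun hs => c (@xi i s :: map snd hs)) b =
       \sum_(a : bas Aj) ftr a s *: evA (@xi j) n (fun hs => c (@xi j a :: map snd hs)) b.
      under [RHS]eq_bigr => a _ do rewrite -evAZ.
      rewrite -(evA_sum (@exi j)); apply: (eq_evA _ (@exi j)) => hs _ _.
      rewrite xi_compat (ml_sum [::] (map snd hs)) //; apply: eq_bigr => a _.
      by rewrite (mlZ [::]).
    rewrite !scaler_sumr; apply: eq_bigr => a _; rewrite !scalerA; congr (_ *: _).
    rewrite -[oftr (Some a) (Some s)]/(ftr a s).
    have [z|nz] := eqVneq (ftr a s) 0; first by rewrite z !(mul0r, mulr0).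
    have [z|nz2] := eqVneq (oftr b t) 0; first by rewrite z !(mul0r, mulr0).
    by rewrite (ftr_parity ij nz) (oftr_parity nz2) /=; ring.
  rewrite exchange_big /=.
  transitivity (\sum_(a : bas Aj) \sum_b \sum_(s : bas Ai) \sum_t (oftr (Some a) (Some s) * oftr b t *
      umul (@bmul k Ai) (Some s) t l * sg (bpar a && opar b)) *: evA (@xi j) n (fun hs => c (@xi j a :: map snd hs)) b).
    under eq_bigr => t _ do rewrite exchange_big.
    rewrite exchange_big; apply: eq_bigr => a _.
    under eq_bigr => t _ do rewrite exchange_big.
    rewrite exchange_big; apply: eq_bigr => b _.
    exact: exchange_big.
  apply: eq_bigr => a _; apply: eq_bigr => b _; rewrite big_option /= [X in (X + _) *: _]big1 ?add0r => [|t _]; last by rewrite !mul0r.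
  rewrite scaler_suml; apply: eq_bigr => s _; by rewrite scaler_suml.
under [RHS]eq_bigr => x _ do rewrite evA_S scaler_sumr.
rewrite [RHS]exchange_big; apply: eq_bigr => a _.
under [RHS]eq_bigr => x _ do rewrite scaler_sumr.
rewrite [RHS]exchange_big; apply: eq_bigr => b _ /=.
have -> : \sum_s \sum_t oftr (Some a) s * oftr b t * umul (@bmul k Ai) s t l * sg (bpar a && opar b) =
    (\sum_x umul (@bmul k Aj) (Some a) b x * oftr x l) * sg (bpar a && opar b).
  by rewrite oftr_mul mulr_suml; apply: eq_bigr => s _; rewrite mulr_suml.
rewrite mulr_suml scaler_suml; apply: eq_bigr => x _.
by rewrite scalerA; congr (_ *: _); ring.
Qed.

End Naturality.

Section PushNatural.
Variables (k : fieldType) (U : superspace k) (A : formal_cdga k) (i j : fidx A).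
Hypothesis ij : fle i j.
Variables (xi : forall i, bas (flev A i) -> U).
Hypothesis exi : forall i, even (@xi i).
Hypothesis xi_compat : forall l, @xi i l = \sum_a ftr a l *: @xi j a.
Local Notation Ai := (flev A i).
Local Notation Aj := (flev A j).

Lemma push_natural (f : seq U -> operator U) t l phi xs :
  (forall phi xs, Fhat t phi -> multilinear (R := k^o) (fun ws => f ws phi xs)) -> Fhat t phi ->
  pushA f (@xi i) l phi xs = \sum_a ftr a l * pushA f (@xi j) a phi xs.
Proof.
(* The two levels may have different nilpotency bounds; both sums are extended by zero terms to the
   larger one. *)
move=> mf hp; pose N := maxn (nilbound Ai) (nilbound Aj).
have ext h (a : bas (flev A h)) : (nilbound (flev A h) <= N)%N -> pushA f (@xi h) a phi xs =
    \sum_(1 <= r < N.+1) r`!%:R^-1 * evA (@xi h) r (fun hs => f (map snd hs) phi xs : k^o) (Some a).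
  move=> le; rewrite (pushA_ev (@exi h) _ _ mf hp) [RHS](big_cat_nat (n := (nilbound (flev A h)).+1)) //=.
  rewrite [X in _ + X]big_nat [X in _ + X]big1 ?addr0 // => r /andP [lr _].
  by rewrite evA_nil // mulr0.
rewrite ext ?leq_maxl //; under [RHS]eq_bigr => a _ do rewrite ext ?leq_maxr // mulr_sumr.
rewrite [RHS]exchange_big; apply: eq_bigr => r _.
rewrite (evA_natural (R := k^o) ij exi xi_compat r (Some l) (mf phi xs hp)) big_option scale0r add0r mulr_sumr.
by apply: eq_bigr => a _; exact: mulrCA.
Qed.

End PushNatural.

Section Single.
Variables (k : fieldType) (A : nilcdga k).
Let delta (a l : bas A) : k := (a == l)%:R.

Fact delta_suml a (F : bas A -> k) : \sum_s delta a s * F s = F a.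
Proof. by rewrite -[RHS](sum_delta a F); apply: eq_bigr => s _; rewrite /delta eq_sym. Qed.

Fact delta_sumr l (F : bas A -> k) : \sum_s F s * delta s l = F l.
Proof. by rewrite -[RHS](sum_delta l F); apply: eq_bigr => s _; rewrite mulrC. Qed.

Fact delta_comp a l : delta a l = \sum_s delta a s * delta s l.
Proof. by rewrite delta_suml. Qed.

Fact delta_parity a l : delta a l != 0 -> bpar l = bpar a.
Proof. by rewrite /delta; have [->|] := eqVneq a l; rewrite ?eqxx. Qed.

Fact delta_mul a b l : \sum_s bmul a b s * delta s l = \sum_s \sum_t delta a s * delta b t * bmul s t l.
Proof.
rewrite delta_sumr -[LHS](delta_suml a (fun s => bmul s b l)); apply: eq_bigr => s _.
rewrite -[in LHS](delta_suml b (fun t => bmul s t l)) mulr_sumr; apply: eq_bigr => t _.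
exact: mulrA.
Qed.

Fact delta_diff a l : \sum_s bdiff a s * delta s l = \sum_s delta a s * bdiff s l.
Proof. by rewrite delta_sumr delta_suml. Qed.

(** The constant system. It lets the uniqueness argument, which needs arbitrary finite-dimensional
    nilpotent algebras, use a property stated for formal ones. *)
Definition single : formal_cdga k := @FormalCdga k unit (fun _ _ => True) (fun=> A) (fun _ _ => delta)
  (fun _ => I) (fun _ _ _ _ _ => I) (inhabits tt) (fun _ _ => ex_intro2 _ _ tt I I)
  (fun _ _ _ => erefl) (fun _ _ _ _ _ => delta_comp) (fun _ _ _ => delta_parity)
  (fun _ _ _ => delta_mul) (fun _ _ _ => delta_diff).

End Single.

(** * Existence, twisting property and uniqueness for all cases at once *)

Section Assembly.
Variables (k : fieldType) (char0 : [pchar k] =i pred0) (V : superspace k).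
Local Notation U := (Pi V).
(** [F] is the explicit formula and [W] the target. The four cases differ only in how the hypotheses
    hold: the formula and the L-infinity operations are iterated insertions into [m], the two
    Maurer-Cartan equations agree, and f takes values in [W]. *)
Variables (t : ftype) (D DV : operator U) (m mbar : seq U -> U).
Variable F : seq U -> seq U -> U.
Variable W : bool -> operator U -> Prop.
Hypotheses (iD : infinity_structure t D m) (iDV : infinity_structure Sym DV mbar).
Hypothesis msym : t = Sym -> gsymmetric m.
Hypothesis mbarE : forall hs : seq (bool * U), hh hs -> mbar (map snd hs) = inss t hs m [::].
Hypothesis FE : forall (hs : seq (bool * U)) xs, hh hs ->
  F (map snd hs) xs = inss t hs m (map (tau (tpar (map fst hs))) xs).
Hypothesis MCE : forall (A : nilcdga k) (xi : bas A -> U) l, even xi ->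
  MC_left t m xi l = MC_left Sym mbar xi l.
Hypotheses (Wc : opclosed t W) (WD : forall b E, W b E -> Der0 t b E).
Implicit Types (hs ys us : seq (bool * U)) (xs ws : seq U) (psi : {linear U -> k^o}).

Local Notation f := (twf t D mbar).
Hypothesis Wf : forall hs, hh hs -> W (~~ tpar (map fst hs)) (f (map snd hs)).

Let mm : multilinear m := sm_multilinear (inf_maps iD).
Let mbm : multilinear mbar := sm_multilinear (inf_maps iDV).
Let dD : Der0 t true D := inf_der iD.
Let dDV : Der0 Sym true DV := inf_der iDV.

Let DD phi : Fhat t phi -> D (D phi) = fun=> 0.
Proof. by move=> hp; apply/funext => xs; exact: (inf_square iD). Qed.

Let DDV phi : Fhat Sym phi -> DV (DV phi) = fun=> 0.
Proof. by move=> hp; apply/funext => xs; exact: (inf_square iDV). Qed.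

Let mbar_homog hs : hh hs -> homog (~~ tpar (map fst hs)) (mbar (map snd hs)).
Proof. exact: (inf_homog iDV). Qed.

Let DV_mbar hs q psi : hh hs -> hfun q psi ->
  DV (gen psi) (map snd hs) = sg (~~ tpar (map fst hs)) * psi (mbar (map snd hs)).
Proof. exact: (inf_gen iDV). Qed.

Lemma D_genE q psi : hfun q psi -> D (gen psi) = fun xs => sg q * psi (m xs).
Proof. by move=> hq; apply/funext => xs; rewrite (sm_dual (inf_maps iD) hq). Qed.

Lemma inss_gen hs q psi : hfun q psi ->
  inss t hs (D (gen psi)) = fun xs => sg q * psi (inss t hs m xs).
Proof. by move=> hq; rewrite (D_genE hq) inss_dual. Qed.

Let D_mbar hs q psi : hh hs -> hfun q psi ->
  inss t hs (D (gen psi)) [::] = sg (~~ tpar (map fst hs)) * psi (mbar (map snd hs)).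
Proof.
move=> hhs hq; rewrite (inss_gen hs hq) -(mbarE hhs).
have [<-//|ne] := eqVneq (~~ tpar (map fst hs)) q.
by rewrite (hfun_homog hq (mbar_homog hhs)) // !mulr0.
Qed.

(** On a generator the constant field removed in [tder] is visible on the empty word only, so on
    other words f is the pure iterated insertion. *)
Lemma twf_gen hs q psi xs : hh hs -> hs != [::] -> xs != [::] -> hfun q psi ->
  f (map snd hs) (gen psi) xs = sg q * psi (inss t hs m xs).
Proof.
move=> hhs nhs nxs hq; rewrite (twfE dD mbm hhs (gen_Fhat t psi)).
case: hs nhs hhs => [//|h hs] _ hhs; rewrite /twh /tder ins_gen.
rewrite (adins_gen _ (proj1 dD) hhs) (inss_gen _ hq).
by case: xs nxs => [//|x xs] _; rewrite /= mulr0 mulr0 add0r.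
Qed.

Lemma twf_in_Der0 hs : hh hs -> Der0 t (~~ tpar (map fst hs)) (f (map snd hs)).
Proof. exact: (twf_Der0 dD mbm mbar_homog D_mbar). Qed.

Lemma twf_given_by : given_by F f.
Proof.
move=> ps ws hws nws; have [hs [hhs -> ews]] := homogsP hws; rewrite ews in nws *.
have nhs : hs != [::] by case: (hs) nws.
have mF : multilinear (fun xs => inss t hs m (map (tau (tpar (map fst hs))) xs)).
  exact: (ml_map (tau (tpar (map fst hs))) (inss_ml t hs mm)).
split=> // [s1 s2 a x y|q psi hq xs].
  have C z : (if s1 ++ z :: s2 is [::] then 0 else F (map snd hs) (s1 ++ z :: s2)) =
      inss t hs m (map (tau (tpar (map fst hs))) (s1 ++ z :: s2)) by rewrite -FE //; case: (s1).
  by rewrite !C; exact: mF.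
case: xs => [|x xs].
  by rewrite linear0 mulr0; exact: (Der0_nil char0 (twf_in_Der0 hhs) (gen_Fhat t psi)).
rewrite (twf_gen hhs nhs _ hq) // FE //.
apply: (@dual_sign k U (tpar (map fst hs)) q psi (inss t hs m) _ hq (inss_ml t hs mm)) => ys hys; exact: (inss_homog iD hhs hys).
Qed.

Lemma twf_Linfty : Linfty_map DV t D W f.
Proof.
split=> [phi xs hp|phi xs hp|//|ps ws hws|ps ws phi xs hws hp].
- exact: twf_ml.
- exact: (twf_sym char0 dD (proj1 dDV) mbm DV_mbar).
- by have [hs [hhs -> ->]] := homogsP hws; exact: Wf.
- have [hs [hhs -> ->]] := homogsP hws.
  rewrite -[RHS](twf_eq char0 dD DD (proj1 dDV) mbm mbar_homog DV_mbar D_mbar xs hhs hp).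
  by rewrite size_map.
Qed.

Lemma twistAE (A : nilcdga k) (xi : bas A -> U) xs l : even xi ->
  twistA t m xi xs l = \sum_(0 <= i < (nilbound A).+1)
    i`!%:R^-1 *: (sg (opar l) *: evA xi i (fun us => inss t us m (map (tau (opar l)) xs)) l).
Proof.
by case: (t) msym mm => g mm' exi; [apply: twistA_Sym => //; exact: g | exact: twistA_Tens].
Qed.

Section Level.
Variables (A : nilcdga k) (xi : bas A -> U).
Hypothesis exi : even xi.

(** The sum starts at 1: the term without xi has coefficients only at the unit of A. *)
Definition tw_maps (l : bas A) xs : U := \sum_(1 <= i < (nilbound A).+1)
  i`!%:R^-1 *: evA xi i (fun us => inss t us m xs) (Some l).

Lemma tw_maps_ml l : multilinear (tw_maps l).
Proof.
apply: ml_bigsum => i _; apply: ml_scale => s1 s2 a x y.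
rewrite -evA_lin; apply: (eq_evA _ exi) => us _ _; exact: (inss_ml t us mm).
Qed.

Lemma tw_maps_homog l ys : hh ys -> homog (~~ (bpar l (+) tpar (map fst ys))) (tw_maps l (map snd ys)).
Proof.
move=> hys; apply: homog_sum => i _; apply: homogZ; rewrite evA_prodc; apply: homog_sum => s _.
have [z|nz] := eqVneq (prodc (@bmul k A) (map Some s) (Some l)) 0.
  by rewrite z mul0r scale0r; exact: homog0.
have hs : hh [seq (bpar (n := A) a, xi a) | a <- s].
  by elim: (val s) => //= a s' IH; apply/hh_cons.
apply: homogZ; have := inss_homog iD hs hys; have := prodc_parity nz => /= ->.
by rewrite -!map_comp.
Qed.

Lemma pushA_gen l q psi xs : xs != [::] -> hfun q psi ->
  pushA f xi l (gen psi) xs = sg q * psi (tw_maps l xs).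
Proof.
move=> nxs hq; rewrite (pushA_ev exi _ _ (fun phi xs => @twf_ml _ _ _ _ _ dD mbm phi xs) (gen_Fhat t psi)).
rewrite linear_sum mulr_sumr; apply: eq_big_nat => r /andP [r0 _].
rewrite linearZ (evA_morph (S := k^o) psi) /= scale_regE mulrCA; congr (_ * _).
have H := @evAZ k A U k^o xi r (sg q) (fun hs => psi (inss t hs m xs) : k^o) (Some l).
apply: (etrans _ H); apply: (eq_evA _ exi) => us hus sus; apply: twf_gen => //.
by rewrite -size_eq0 sus -lt0n.
Qed.

(** The term i = 0 of the twisting is [constA], which has no component at e_l. The sign (-1)^|e_l|
    cancels the one in [twistAE], and [dual_sign] matches the remaining twist of the arguments with
    the sign of duality. *)
Lemma pushA_maps l : structure_maps (~~ bpar l) (pushA f xi l)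
  (fun xs => if xs is [::] then 0 else sg (bpar l) *: (twistA t m xi xs (Some l) - constA m xs (Some l))).
Proof.
have E xs : (if xs is [::] then 0 else sg (bpar l) *: (twistA t m xi xs (Some l) - constA m xs (Some l))) =
    if xs is [::] then 0 else tw_maps l (map (tau (bpar l)) xs).
  case: xs => // x xs; rewrite /constA extA_consts // scale0r subr0 twistAE //.
  rewrite big_nat_recl // evA_0 scale0r !scaler0 add0r scaler_sumr /tw_maps big_add1.
  apply: eq_bigr => i _; rewrite !scalerA; congr (_ *: _).
  by rewrite mulrAC -signr_addb addbb mul1r.
have mG := ml_map (tau (bpar l)) (@tw_maps_ml l).
have dP : Der0 t (~~ bpar l) (pushA f xi l).
  apply: (WD (pushA_closed exi l Wc _ Wf)) => phi xs hp; exact: twf_ml.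
split=> // [s1 s2 a x y|q psi hq xs].
  have C z : (if s1 ++ z :: s2 is [::] then 0 else
      sg (bpar l) *: (twistA t m xi (s1 ++ z :: s2) (Some l) - constA m (s1 ++ z :: s2) (Some l))) =
      tw_maps l (map (tau (bpar l)) (s1 ++ z :: s2)) by rewrite E; case: (s1).
  by rewrite !C; exact: mG.
rewrite E; case: xs => [|x xs].
  by rewrite linear0 mulr0; exact: (Der0_nil char0 dP (gen_Fhat t psi)).
rewrite (pushA_gen l _ hq) //; apply: (@dual_sign k U (bpar l) q psi (tw_maps l) _ hq (@tw_maps_ml l)) => ys; exact: tw_maps_homog.
Qed.

Lemma twist_None xs : twistA t m xi xs None - constA (A := A) m xs None = 0.
Proof.
rewrite /constA extA_consts // scale1r twistAE // big_nat_recl // big1 ?addr0 => [|i _]; last first.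
  by rewrite evA_None !scaler0.
rewrite evA_0 fact0 invr1 !scale1r.
by apply/eqP; rewrite subr_eq0; apply/eqP; congr m; exact: (@tau0 k U xs).
Qed.

End Level.

Lemma twf_twists : twists t D m W f.
Proof.
move=> A xi [cx ex mx]; have mf phi xs : Fhat t phi -> multilinear (R := k^o) (fun ws => f ws phi xs).
  by move=> hp; exact: twf_ml.
split; last by move=> i l; split; [exact: pushA_maps | move=> xs _; exact: twist_None].
split=> [i j ij l phi xs hp|i l|i l phi xs hp].
- by apply: (@push_natural k U A i j ij xi ex _ f t l phi xs mf hp) => l'; exact: cx.
- exact: (pushA_closed (ex i) l Wc mf Wf).
- apply: (pushA_MC char0 dD DD mbm (ex i)) => // l'; by rewrite -MCE //; exact: mx.
Qed.

(** The images of a Maurer-Cartan element under [g] and f have the same structure maps, so they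
    agree by density of polynomials. The difference of [g] and f thus vanishes on all Maurer-Cartan
    elements, and [MCzero_eq0] applies. *)
Lemma twf_unique g : Linfty_map DV t D W g -> twists t D m W g ->
  forall ws phi xs, Fhat t phi -> g ws phi xs = f ws phi xs.
Proof.
move=> Lg Tg ws phi xs hp.
have mg phi' xs' : Fhat t phi' -> multilinear (R := k^o) (fun ws => g ws phi' xs').
  exact: (Lm_multilinear Lg xs').
have mf phi' xs' : Fhat t phi' -> multilinear (R := k^o) (fun ws => f ws phi' xs').
  by move=> hp'; exact: twf_ml.
pose h ws : k^o := -1 *: (f ws phi xs : k^o) + g ws phi xs.
suff : h ws = 0 by rewrite /h scaleN1r addrC => /eqP; rewrite subr_eq0 => /eqP.
have gf := twf_sym char0 dD (proj1 dDV) mbm DV_mbar xs hp.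
apply: (MCzero_eq0 char0 dDV DDV mbm mbar_homog DV_mbar) => [||A xi exi MCxi l].
- exact: ml_linear (mf phi xs hp) (mg phi xs hp).
- move=> s1 s2 p q x y hx hy; rewrite /h (gf s1 s2 p q x y hx hy) (Lm_symmetric Lg xs hp s1 s2 hx hy).
  by rewrite scalerDr !scalerA mulrC.
have MCt : MC t m (A := single A) (fun _ => xi).
  split=> [i j _ l'|i l'|i l']; [|exact: exi|by rewrite MCE //; exact: MCxi].
  rewrite (bigD1 l') //= eqxx scale1r big1 ?addr0 // => a /negPf ->; exact: scale0r.
have [[_ og _] mapg] := Tg _ _ MCt; have [[_ of_ _] mapf] := twf_twists MCt.
have E (a : bas A) phi' : Fhat t phi' -> pushA g xi a phi' = pushA f xi a phi'.
  apply: (derivation_ext char0 (proj1 (WD (og tt a))) (proj1 (WD (of_ tt a)))) => q psi hq.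
  apply/funext => ys.
  by rewrite (sm_dual (proj1 (mapg tt a)) hq) (sm_dual (proj1 (mapf tt a)) hq).
rewrite big_nat_recl // evA_0; case: l => [l|]; last first.
  rewrite big1 ?addr0 => [|r _]; last by rewrite evA_None mulr0.
  by rewrite /h (Lm_positive Lg xs hp) addr0 !scaler0 mulr0.
rewrite scale0r mulr0 add0r.
transitivity (pushA g xi l phi xs - pushA f xi l phi xs); last by rewrite E // subrr.
rewrite (pushA_ev exi _ _ mg hp) (pushA_ev exi _ _ mf hp) -sumrB big_add1.
apply: eq_bigr => r _; rewrite -mulrBr; congr (_ * _).
have := @evA_lin k A U k^o xi r.+1 (-1) (fun hs => f (map snd hs) phi xs : k^o)
  (fun hs => g (map snd hs) phi xs : k^o) (Some l).
by rewrite scaleN1r addrC => <-.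
Qed.

Lemma twf_twisting_map : twisting_map DV t D m W f.
Proof. by split; [exact: twf_Linfty | exact: twf_twists | exact: twf_unique]. Qed.

End Assembly.

(** * Values of f in the cyclic derivations *)

Section CyclicTwist.
Variables (k : fieldType) (char0 : [pchar k] =i pred0) (V : superspace k).
Local Notation U := (Pi V).
Variables (t : ftype) (D DV : operator U) (m mbar : seq U -> U) (F : seq U -> seq U -> U).
Hypotheses (iD : infinity_structure t D m) (iDV : infinity_structure Sym DV mbar).
Hypothesis msym : t = Sym -> gsymmetric m.
Hypothesis mbarE : forall hs : seq (bool * U), hh hs -> mbar (map snd hs) = inss t hs m [::].
Hypothesis FE : forall (hs : seq (bool * U)) xs, hh hs ->
  F (map snd hs) xs = inss t hs m (map (tau (tpar (map fst hs))) xs).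

(** The structure maps of f(w_1, ..., w_r) are iterated insertions into [m]. These are cyclic up to
    the parity of the w's by [cyc_inss], and [cyc_taus] removes that sign. *)
Lemma twf_cyclic e (B : V -> V -> k^o) (hs : seq (bool * U)) : inner_product e B -> cyclic_maps B m -> hh hs ->
  cyclic_Der0 t B (~~ tpar (map fst hs)) (twf t D mbar (map snd hs)).
Proof.
move=> ipB cB; have mm : multilinear m := sm_multilinear (inf_maps iD).
case: hs => [_|h hs hhs]; first exact: (opc_zero (cyclic_opclosed ipB t)).
split; first exact: (twf_in_Der0 iD iDV mbarE hhs).
exists (fun xs => if xs is [::] then 0 else F (map snd (h :: hs)) xs).
  exact: (twf_given_by char0 iD iDV mbarE FE hhs).
have G := cyc_inss ipB mm msym hhs (proj2 (cyc_cyclic B m) cB).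
have /(proj1 (cyc_cyclic B _)) C := cyc_taus ipB (inss_ml t (h :: hs) mm) G.
move=> p q ps x y xs hx hxs hy.
have := C p q ps x y xs hx hxs hy; rewrite -(FE _ hhs) -(FE _ hhs) => ->.
by case: xs {hxs}.
Qed.

End CyclicTwist.

(** * Verification of the hypotheses in the four cases *)

Section Discharge.
Variables (k : fieldType) (char0 : [pchar k] =i pred0) (V : superspace k).
Local Notation U := (Pi V).

Lemma Linf_gsym D (m : seq U -> U) : infinity_structure Sym D m -> gsymmetric m.
Proof.
move=> iD; apply: (mu_sym (proj1 (inf_der iD)) (sm_multilinear (inf_maps iD))) => hs q psi.
exact: (inf_gen iD).
Qed.

Lemma Linf_inss D (m : seq U -> U) (hs : seq (bool * U)) : infinity_structure Sym D m -> hh hs ->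
  m (map snd hs) = inss Sym hs m [::].
Proof.
move=> iD hhs; have := inss_Sym (hs2 := [::]) (sm_multilinear (inf_maps iD)) (Linf_gsym iD) hhs I.
by rewrite andbF scale1r cats0 => <-.
Qed.

Section Associated.
Variables (D Dbar : operator U) (m mbar : seq U -> U).
Hypotheses (iD : infinity_structure Tens D m) (aD : associated_Linfty D Dbar).
Hypothesis iDbar : infinity_structure Sym Dbar mbar.

(** The projection from the tensor to the symmetric algebra sums over all permutations, and so does
    iterated insertion into the empty word. *)
Lemma associated_inss (hs : seq (bool * U)) : hh hs -> mbar (map snd hs) = inss Tens hs m [::].
Proof.
move=> hhs; apply: (@eq_by_functionals k U) => q psi hq.
have := proj2 aD psi (map snd hs).
rewrite (sm_dual (inf_maps iDbar) hq) projTS_inss //; last first.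
  exact: (Fhat_ml (der_stable (proj1 (inf_der iD)) (gen_Fhat Tens psi))).
rewrite (inss_gen iD hs hq) => H; by apply: mulfI H; rewrite signr_eq0.
Qed.

(** The commutator operations sum over n! orders of copies of the even xi, which cancels the 1/n! of
    the L-infinity equation. *)
Lemma associated_MC (A : nilcdga k) (xi : bas A -> U) l : even xi ->
  MC_left Tens m xi l = MC_left Sym mbar xi l.
Proof.
have mm := sm_multilinear (inf_maps iD); have mbm := sm_multilinear (inf_maps iDbar).
move=> exi; congr (_ + _); apply: eq_bigr => n _.
rewrite !extA_evA // scale1r scalerA mulrC -scalerA; congr (_ *: _).
transitivity (n`!%:R^-1 *: (n`!%:R *: evA xi n (fun us => m (map snd us)) (Some l))).
  rewrite scalerA mulVf ?scale1r //.
  by case: (n`!) (fact_gt0 n) => // r _; exact: natr_neq0.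
rewrite -(evA_psum exi); congr (_ *: _); apply: (eq_evA _ exi) => us hus _.
by rewrite associated_inss // inss_psum_nil.
Qed.

End Associated.
End Discharge.

Theorem theorem3p1 (k : fieldType) (char0 : [pchar k] =i pred0) (V : superspace k) :
  [/\ forall (D : operator (Pi V)) (m : seq (Pi V) -> Pi V),
        infinity_structure Sym D m ->
        exists f : seq (Pi V) -> operator (Pi V),
          [/\ given_by (CE_formula m) f,
              (forall ps ws, homogs ps ws -> Der0 Sym (~~ tpar ps) (f ws)) &
              twisting_map D Sym D m (Der0 Sym) f],
      forall (e : bool) (B : V -> V -> k^o) (D : operator (Pi V)) (m : seq (Pi V) -> Pi V),
        inner_product e B -> infinity_structure Sym D m -> cyclic_maps B m ->
        exists f : seq (Pi V) -> operator (Pi V),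
          [/\ given_by (CE_formula m) f,
              (forall ps ws, homogs ps ws -> cyclic_Der0 Sym B (~~ tpar ps) (f ws)) &
              twisting_map D Sym D m (cyclic_Der0 Sym B) f],
      forall (D Dbar : operator (Pi V)) (m mbar : seq (Pi V) -> Pi V),
        infinity_structure Tens D m -> associated_Linfty D Dbar ->
        infinity_structure Sym Dbar mbar ->
        exists f : seq (Pi V) -> operator (Pi V),
          [/\ given_by (Hoch_formula m) f,
              (forall ps ws, homogs ps ws -> Der0 Tens (~~ tpar ps) (f ws)) &
              twisting_map Dbar Tens D m (Der0 Tens) f] &
      forall (e : bool) (B : V -> V -> k^o) (D Dbar : operator (Pi V))
             (m mbar : seq (Pi V) -> Pi V),
        inner_product e B -> infinity_structure Tens D m -> cyclic_maps B m ->
        associated_Linfty D Dbar -> infinity_structure Sym Dbar mbar ->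
        exists f : seq (Pi V) -> operator (Pi V),
          [/\ given_by (Hoch_formula m) f,
              (forall ps ws, homogs ps ws -> cyclic_Der0 Tens B (~~ tpar ps) (f ws)) &
              twisting_map Dbar Tens D m (cyclic_Der0 Tens B) f]].
Proof.
split=> [D m iD|e B D m ipB iD cB|D Dbar m mbar iD aD iDb|e B D Dbar m mbar ipB iD cB aD iDb];
  have mm := sm_multilinear (inf_maps iD).
(* For an L-infinity algebra the structure on the source and the one being twisted coincide, so [DV]
   is [D] and [mbar] is [m]. *)
- have gm := Linf_gsym iD; have bE hs hhs := @Linf_inss k V D m hs iD hhs.
  have FE hs xs hhs := @CE_inss k V m hs xs mm gm hhs.
  have fD hs hhs := @twf_in_Der0 k V Sym D D m m iD iD bE hs hhs.
  exists (twf Sym D m); split; first exact: (twf_given_by char0 iD iD bE FE).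
    by move=> ps ws /homogsP [hs [hhs -> ->]]; exact: fD.
  exact: (twf_twisting_map char0 iD iD (fun _ => gm) bE (fun _ _ _ _ => erefl)
    (Der0_opclosed (Pi V) Sym) (fun _ _ h => h) fD).
- have gm := Linf_gsym iD; have bE hs hhs := @Linf_inss k V D m hs iD hhs.
  have FE hs xs hhs := @CE_inss k V m hs xs mm gm hhs.
  have fD hs hhs := @twf_cyclic k char0 V Sym D D m m _ iD iD (fun _ => gm) bE FE e B hs ipB cB hhs.
  exists (twf Sym D m); split; first exact: (twf_given_by char0 iD iD bE FE).
    by move=> ps ws /homogsP [hs [hhs -> ->]]; exact: fD.
  exact: (twf_twisting_map char0 iD iD (fun _ => gm) bE (fun _ _ _ _ => erefl)
    (cyclic_opclosed ipB Sym) (fun _ _ h => proj1 h) fD).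
- have bE := @associated_inss k V D Dbar m mbar iD aD iDb.
  have FE hs xs hhs := @Hoch_inss k V m hs xs mm hhs.
  have fD hs hhs := @twf_in_Der0 k V Tens D Dbar m mbar iD iDb bE hs hhs.
  have ME := associated_MC char0 iD aD iDb.
  have nS : Tens = Sym -> gsymmetric m by [].
  exists (twf Tens D mbar); split; first exact: (twf_given_by char0 iD iDb bE FE).
    by move=> ps ws /homogsP [hs [hhs -> ->]]; exact: fD.
  exact: (twf_twisting_map char0 iD iDb nS bE ME (Der0_opclosed (Pi V) Tens) (fun _ _ h => h) fD).
- have bE := @associated_inss k V D Dbar m mbar iD aD iDb.
  have FE hs xs hhs := @Hoch_inss k V m hs xs mm hhs.
  have nS : Tens = Sym -> gsymmetric m by [].
  have fD hs hhs := @twf_cyclic k char0 V Tens D Dbar m mbar _ iD iDb nS bE FE e B hs ipB cB hhs.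
  have ME := associated_MC char0 iD aD iDb.
  exists (twf Tens D mbar); split; first exact: (twf_given_by char0 iD iDb bE FE).
    by move=> ps ws /homogsP [hs [hhs -> ->]]; exact: fD.
  exact: (twf_twisting_map char0 iD iDb nS bE ME (cyclic_opclosed ipB Tens) (fun _ _ h => proj1 h) fD).
Qed.
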